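(* Let $1\le m\le n$. The map $\Phi:\mathrm{Orb}(i)\to T^*_{1,0}\mathrm{Gr}_{\mathbb{C}}$ restricts to real symplectomorphisms $$(\mathcal{D}_{\mathbb{R}},\mathrm{Im}\,\Omega_{\mathrm{KKS}})\cong(T^*\mathrm{Gr}_{\mathbb{R}},\omega_{\mathrm{can}}),\qquad(\mathcal{D}_{\mathbb{C}}^{\mathrm{ortho}},\omega_{\mathrm K})\cong(iT^*\mathrm{Gr}_{\mathbb{R}},\omega_{\mathrm{can}}),$$ $$(\mathcal{D}_{\mathbb{H}},\mathrm{Im}\,\Omega_{\mathrm{KKS}})\cong(T^*\mathrm{Gr}_{\mathbb{H}},\omega_{\mathrm{can}}),\qquad(\mathcal{D}_{\mathbb{C}}^{\mathrm{symp}},\omega_{\mathrm K})\cong(iT^*\mathrm{Gr}_{\mathbb{H}},\omega_{\mathrm{can}}),$$ $$(\mathcal{D}_{\mathbb{C}}^{\mathrm{unit}},\mathrm{Re}\,\Omega_{\mathrm{KKS}})\cong(\mathcal{X},\omega_{\mathrm C}),$$ where those involving $\mathbb{H}$ or $\mathrm{symp}$ are for $m,n$ even.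
   Context: $\mathrm{Orb}(i)=\{\xi=QP\mid Q\in\mathbb{C}^{n\times m},P\in\mathbb{C}^{m\times n},PQ=i\,\mathrm{Id}_m\}\subset\mathfrak{gl}_n\mathbb{C}^*\cong\mathfrak{gl}_n\mathbb{C}$ (trace form), with $\Omega_{\mathrm{KKS}}([\xi,X],[\xi,Y])=\mathrm{Tr}(\xi[X,Y])$. It is identified with the set of decompositions $\mathbb{C}^n=\Sigma\oplus\Lambda$, $\dim\Sigma=m$, by $\Sigma=\mathrm{Im}\,\xi$, $\Lambda=\ker\xi$. $\mathrm{Gr}_{\mathbb{C}}$ is the Grassmannian of $m$-dimensional subspaces of $\mathbb{C}^n$; covectors to $\Pi$ are linear maps $\eta:\mathbb{C}^n/\Pi\to\Pi$, equivalently $n\times n$ matrices with $\eta(\Pi)=0$, $\mathrm{Im}\,\eta\subset\Pi$, paired with $T_\Pi\mathrm{Gr}_{\mathbb{C}}=\mathrm{Hom}(\Pi,\mathbb{C}^n/\Pi)$ by trace. $\Phi(\xi)=(\Pi,\eta)$ is the diffeomorphism given by $\Pi=\{x+\sqrt{\xi^\dagger\xi}(x)\mid x\in\mathrm{Im}\,\xi\}$ and $\eta=\frac12(\sqrt{\xi^\dagger\xi}-\sqrt{\xi\xi^\dagger}-i\xi-i\xi^\dagger)$. Fix a real symmetric $\Theta$ with $\Theta^2=\mathrm{Id}_n$ and, for $n$ even, a real skew-symmetric $\mathcal{J}$ with $\mathcal{J}^2=-\mathrm{Id}_n$, $\mathbb{J}(x)=\mathcal{J}\overline x$. Subsets of $\mathrm{Orb}(i)$: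 $\mathcal{D}_{\mathbb{R}}$ ($\Sigma,\Lambda$ invariant under complex conjugation); $\mathcal{D}_{\mathbb{H}}$ ($\Sigma,\Lambda$ invariant under $\mathbb{J}$); $\mathcal{D}_{\mathbb{C}}^{\mathrm{unit}}$ ($\Sigma,\Lambda$ orthogonal for $x^\dagger\Theta y$); $\mathcal{D}_{\mathbb{C}}^{\mathrm{ortho}}$ (orthogonal for $x^{\mathsf T}y$); $\mathcal{D}_{\mathbb{C}}^{\mathrm{symp}}$ (orthogonal for $x^{\mathsf T}\mathcal{J}y$). Subsets of $T^*_{1,0}\mathrm{Gr}_{\mathbb{C}}$: $T^*\mathrm{Gr}_{\mathbb{R}}$ and $iT^*\mathrm{Gr}_{\mathbb{R}}$ consist of $(\Pi,\eta)$ with $\overline\Pi=\Pi$ and $\overline\eta=\eta$, respectively $\overline\eta=-\eta$; $T^*\mathrm{Gr}_{\mathbb{H}}$ and $iT^*\mathrm{Gr}_{\mathbb{H}}$ consist of $(\Pi,\eta)$ with $\mathbb{J}\Pi=\Pi$ and $\eta\mathbb{J}=\mathbb{J}\eta$, respectively $\eta\mathbb{J}=-\mathbb{J}\eta$. These are canonically the real cotangent bundles of $\mathrm{Gr}_{\mathbb{R}}=\{\overline\Pi=\Pi\}$ and $\mathrm{Gr}_{\mathbb{H}}=\{\mathbb{J}\Pi=\Pi\}$, respectively the bundles of imaginary-valued covectors $i\eta'$ on them (identified with the cotangent bundle by $i\eta'\leftrightarrow\eta'$); $\omega_{\mathrm{can}}$ is the canonical real symplectic form (minus the differential of the canonical one-form).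 Let $E_\pm$ be the $\pm1$-eigenspaces of $\Theta$. $\mathcal{X}$ consists of $(\Pi,\eta)$ with $\Pi=\Pi_+\oplus\Pi_-$, $\Pi_\pm\subset E_\pm$, and, writing $\Pi^\perp=\Pi_+^\perp\oplus\Pi_-^\perp$ with $\Pi^\perp_\pm\subset E_\pm$ (standard Hermitian form) and viewing $\eta:\Pi^\perp\to\Pi$, such that $\eta(\Pi_+^\perp)\subset\Pi_-$, $\eta(\Pi_-^\perp)\subset\Pi_+$. Kähler forms: on quaternionic $n\times m$ matrices $A=Q+jP^\dagger$ let $I,J,K$ be left multiplication by $i,j,k$ and $g(A,B)=\frac12\mathrm{Tr}(AB^\dagger+BA^\dagger)$. $U(m)$ acts by $(Q,P)\mapsto(Qh^{-1},hP)$ with hyperkähler momentum maps $\mu_1=\frac i2(Q^\dagger Q-PP^\dagger)$, $\mu_2+i\mu_3=PQ$ ($\mu_k\in\mathfrak u(m)$). Let $\tilde M$ be the hyperkähler quotient $(\mu_1^{-1}(i\,\mathrm{Id}_m)\cap\mu_2^{-1}(0)\cap\mu_3^{-1}(0))/U(m)$ of the open set where $Q$ has rank $m$. The map $[Q,P]\mapsto(\mathrm{Im}\,Q,QP)$ is a biholomorphism $(\tilde M,I)\to T^*_{1,0}\mathrm{Gr}_{\mathbb{C}}$, and $[Q,P]\mapsto UV$ with $U=\frac{Q-P^\dagger}{\sqrt2}$, $V=\frac{i(Q^\dagger+P)}{\sqrt2}$ is a biholomorphism $(\tilde M,K)\to\mathrm{Orb}(i)$. $\omega_{\mathrm C}$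 on $T^*_{1,0}\mathrm{Gr}_{\mathbb{C}}$ and $\omega_{\mathrm K}$ on $\mathrm{Orb}(i)$ are the Kähler forms corresponding to $g(I\cdot,\cdot)$ and $g(K\cdot,\cdot)$ on $\tilde M$ respectively. *)

(* Defs.v *)
From HB Require Import structures.
From mathcomp Require Import all_boot all_order all_algebra.
From mathcomp Require Import all_classical all_reals all_analysis.
From mathcomp Require Import complex.

Import Order.TTheory GRing.Theory Num.Theory numFieldNormedType.Exports.

Local Open Scope classical_set_scope.
Local Open Scope ring_scope.
Local Open Scope sesquilinear_scope.

(** * Submanifolds of real normed spaces

    A space is a set [S : set X] together with a map [e : X -> E] into a
    finite-dimensional real normed space, injective on [S]; topology and smooth
    structure are those of the image [e @` S], as a subset of [E].  Tangent
    vectors are elements of [E].  *)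

Section Smooth.
Context {R : realType}.

(* In finite dimension: f is C^k on the open set U iff all its iterated
   directional derivatives up to order k exist and are continuous on U. *)
Fixpoint Ck {E F : normedModType R} (k : nat) (U : set E) (f : E -> F) : Prop :=
  (forall x, U x -> {for x, continuous f}) /\
  (if k is k'.+1 then
     forall v, (forall x, U x -> derivable f x v) /\ Ck k' U (fun x => 'D_v f x)
   else True).

Definition smooth_on {E F : normedModType R} (U : set E) (f : E -> F) : Prop :=
  forall k, Ck k U f.

Section Space.
Context {E : normedModType R} {X : Type}.
Variables (S : set X) (e : X -> E).

(* A map is smooth if in the ambient spaces it extends, locally, to a smooth
   map on an open set. *)
Definition smooth_map {F : normedModType R} {Y : Type} (eY : Y -> F)
    (f : X -> Y) : Prop :=
  forall x, S x -> exists (U : set E) (g : E -> F),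
    [/\ open_nbhs (e x) U, smooth_on U g &
        forall y, S y -> U (e y) -> eY (f y) = g (e y)].

(* smooth k-parameter families of points of S, defined near the origin *)
Definition family {k : nat} (s : 'rV[R]_k -> X) : Prop :=
  exists U : set 'rV[R]_k,
    [/\ open_nbhs (0 : 'rV[R]_k) U, smooth_on U (e \o s) &
        forall u, U u -> S (s u)].

Definition dirv {k : nat} (i : 'I_k) : 'rV[R]_k := delta_mx 0 i.

Definition pd {k : nat} (i : 'I_k) (s : 'rV[R]_k -> X) (u : 'rV[R]_k) : E :=
  'D_(dirv i) (e \o s) u.

Definition curve_through (x : X) (c : 'rV[R]_1 -> X) : Prop :=
  family c /\ c 0 = x.

Definition velocity (c : 'rV[R]_1 -> X) : E := pd 0 c 0.

Definition tangent (x : X) (v : E) : Prop :=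
  exists c, curve_through x c /\ velocity c = v.

(** ** Differential forms; only their values on tangent vectors matter *)

Definition form1 := X -> E -> R.
Definition form2 := X -> E -> E -> R.

Definition smooth_form2 (w : form2) : Prop :=
  forall x, S x -> exists (U : set E) (b : E -> E -> E -> R),
    [/\ open_nbhs (e x) U,
        forall a a', smooth_on U (fun y => b y a a' : R^o),
        forall y a, scalar (b y a) /\ scalar (b y ^~ a) &
        forall y a a', S y -> U (e y) -> tangent y a -> tangent y a' ->
          w y a a' = b (e y) a a'].

Definition alternating (w : form2) : Prop :=
  forall x v, S x -> tangent x v -> w x v v = 0.

Definition nondegenerate (w : form2) : Prop :=
  forall x v, S x -> tangent x v ->
    (forall v', tangent x v' -> w x v v' = 0) -> v = 0.

(* dw = 0, evaluated on the coordinate fields of 3-parameter families; the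
   indices i + 1 and i + 2 are taken modulo 3 in 'I_3. *)
Definition closed_form2 (w : form2) : Prop :=
  forall s : 'rV[R]_3 -> X, family s ->
    \sum_(i < 3) 'D_(dirv i)
      (fun u => w (s u) (pd (i + 1) s u) (pd (i + 1 + 1) s u) : R^o) 0 = 0.

(* d theta (v, v') = d_0 (theta (d_1 s)) - d_1 (theta (d_0 s)) for any
   2-parameter family s with partial derivatives v, v' at s 0 = x. *)
Definition ext_d (theta : form1) : form2 := fun x v v' =>
  xget 0 [set r : R | exists s : 'rV[R]_2 -> X,
    [/\ family s, s 0 = x, pd 0 s 0 = v, pd 1 s 0 = v' &
        r = 'D_(dirv 0) (fun u => theta (s u) (pd 1 s u) : R^o) 0
          - 'D_(dirv 1) (fun u => theta (s u) (pd 0 s u) : R^o) 0]].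

End Space.

Definition diffeo {E F : normedModType R} {X Y : Type}
    (S : set X) (eX : X -> E) (T : set Y) (eY : Y -> F) (f : X -> Y) : Prop :=
  [/\ set_bij S T f, smooth_map S eX eY f &
      exists g : Y -> X,
        (forall x, S x -> g (f x) = x) /\ smooth_map T eY eX g].

Definition submanifold {E : normedModType R} {X : Type} (d : nat)
    (S : set X) (e : X -> E) : Prop :=
  forall x, S x -> exists (U : set E) (V : set 'rV[R]_d) (c : X -> 'rV[R]_d),
    [/\ open_nbhs (e x) U, open V &
        diffeo (S `&` e @^-1` U) e V id c].

Definition symplectic_manifold {E : normedModType R} {X : Type}
    (S : set X) (e : X -> E) (w : form2) : Prop :=
  [/\ exists d, submanifold d S e, smooth_form2 S e w, alternating S e w,
      closed_form2 S e w & nondegenerate S e w].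

Definition symplectomorphism {E F : normedModType R} {X Y : Type}
    (S : set X) (eX : X -> E) (wX : form2)
    (T : set Y) (eY : Y -> F) (wY : form2) (f : X -> Y) : Prop :=
  [/\ symplectic_manifold S eX wX, symplectic_manifold T eY wY,
      diffeo S eX T eY f &
      forall x c c', S x -> curve_through S eX x c -> curve_through S eX x c' ->
        wY (f x) (velocity eY (f \o c)) (velocity eY (f \o c'))
        = wX x (velocity eX c) (velocity eX c')].

End Smooth.

(** * Complex matrices *)

Section ComplexMatrices.
Context {R : realType}.
Local Notation C := R[i].
Local Notation i := ('i%C : C).

Definition conjmx {p q} (A : 'M[C]_(p, q)) : 'M[C]_(p, q) := map_mx Num.conj A.

Definition ofreal {p q} (A : 'M[R]_(p, q)) : 'M[C]_(p, q) :=
  map_mx (real_complex R) A.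

Definition rmx (p q : nat) : normedModType R :=
  ('M[R]_(p, q) * 'M[R]_(p, q))%type.

Definition reim {p q} (A : 'M[C]_(p, q)) : rmx p q :=
  (map_mx (@complex.Re R) A, map_mx (@complex.Im R) A).

Definition ofreim {p q} (v : rmx p q) : 'M[C]_(p, q) :=
  ofreal v.1 + i *: ofreal v.2.

Definition endo {p q} (A : 'M[C]_(p, q)) : 'Hom('cV[C]_q, 'cV[C]_p) :=
  linfun (mulmx A : 'cV[C]_q -> 'cV[C]_p).

Definition im {p q} (A : 'M[C]_(p, q)) : {vspace 'cV[C]_p} := limg (endo A).

Definition ker {p q} (A : 'M[C]_(p, q)) : {vspace 'cV[C]_q} := lker (endo A).

Definition psd {n} (A : 'M[C]_n) : Prop :=
  A ^t* = A /\ forall x : 'cV[C]_n, 0 <= (x ^t* *m A *m x) 0 0.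

Definition sqrtmx {n} (A : 'M[C]_n) : 'M[C]_n :=
  xget 0 [set B | psd B /\ B *m B = A].

Definition orthoproj {n} (V : {vspace 'cV[C]_n}) : 'M[C]_n :=
  xget 0 [set B | [/\ B *m B = B, B ^t* = B & im B = V]].

Definition invariant {n} (f : 'cV[C]_n -> 'cV[C]_n) (V : {vspace 'cV[C]_n}) :
  Prop := f @` [set x | x \in V] = [set x | x \in V].

Definition orthogonal_for {n} (b : 'cV[C]_n -> 'cV[C]_n -> 'M[C]_1)
    (V W : {vspace 'cV[C]_n}) : Prop :=
  forall x y, x \in V -> y \in W -> b x y = 0.

Definition bracket {n} (A B : 'M[C]_n) : 'M[C]_n := A *m B - B *m A.

(** * The orbit and the cotangent bundle of the Grassmannian *)

Definition Orb (m n : nat) : set 'M[C]_n :=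
  [set xi | exists (Q : 'M[C]_(n, m)) (P : 'M[C]_(m, n)),
     xi = Q *m P /\ P *m Q = i%:M].

(* independent of the choice of X and Y when v and w are tangent to the orbit *)
Definition OmegaKKS {n} (xi v w : 'M[C]_n) : C :=
  xget 0 [set c | exists X Y : 'M[C]_n,
    [/\ v = bracket xi X, w = bracket xi Y & c = \tr (xi *m bracket X Y)]].

Definition ReOmegaKKS {n} : form2 (X := 'M[C]_n) (E := rmx n n) := fun xi v w =>
  complex.Re (OmegaKKS xi (ofreim v) (ofreim w)).

Definition ImOmegaKKS {n} : form2 (X := 'M[C]_n) (E := rmx n n) := fun xi v w =>
  complex.Im (OmegaKKS xi (ofreim v) (ofreim w)).

Definition covect (n : nat) : Type := ({vspace 'cV[C]_n} * 'M[C]_n)%type.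

Definition TGr (m n : nat) : set (covect n) :=
  [set z | [/\ \dim z.1 = m, (forall x, x \in z.1 -> z.2 *m x = 0) &
               forall x : 'cV[C]_n, z.2 *m x \in z.1]].

Definition rcovect (n : nat) : normedModType R := (rmx n n * rmx n n)%type.

(* The Grassmannian is embedded in the Hermitian matrices by the orthogonal
   projectors onto the subspaces. *)
Definition embT {n} (z : covect n) : rcovect n :=
  (reim (orthoproj z.1), reim z.2).

Definition Phi {n} (xi : 'M[C]_n) : covect n :=
  let s := sqrtmx (xi ^t* *m xi) in
  let t := sqrtmx (xi *m xi ^t*) in
  ((endo (1%:M + s) @: im xi)%VS,
   2^-1 *: (s - t - i *: xi - i *: xi ^t*)).

(* Let dP be the derivative of the orthogonal projector P onto Pi.  The
   corresponding element of Hom(Pi, C^n / Pi) is x |-> dP x mod Pi (differentiate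
   P x = x).  As eta vanishes on Pi and has its image in Pi, the trace over Pi of
   its composite with eta is the trace over C^n of eta dP. *)
Definition canonical_form1 {n} : form1 (X := covect n) (E := rcovect n) :=
  fun z v => complex.Re (\tr (z.2 *m ofreim v.1)).

(* the canonical one-form for bundles of imaginary covectors i eta', identified
   with eta' *)
Definition canonical_form1_imag {n} : form1 (X := covect n) (E := rcovect n) :=
  fun z v => canonical_form1 (z.1, - i *: z.2) v.

Definition omega_can {n} (T : set (covect n)) : form2 (X := covect n) (E := rcovect n) :=
  fun z v w => - ext_d T embT canonical_form1 z v w.

Definition omega_can_imag {n} (T : set (covect n)) : form2 (X := covect n) (E := rcovect n) :=
  fun z v w => - ext_d T embT canonical_form1_imag z v w.

(** * The subsets *)

Definition jmap {n} (J : 'M[R]_n) (x : 'cV[C]_n) : 'cV[C]_n :=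
  ofreal J *m conjmx x.

Definition D_R (m n : nat) : set 'M[C]_n :=
  [set xi | [/\ Orb m n xi, invariant conjmx (im xi) &
                invariant conjmx (ker xi)]].

Definition D_H (m n : nat) (J : 'M[R]_n) : set 'M[C]_n :=
  [set xi | [/\ Orb m n xi, invariant (jmap J) (im xi) &
                invariant (jmap J) (ker xi)]].

Definition D_C_unit (m n : nat) (Theta : 'M[R]_n) : set 'M[C]_n :=
  [set xi | Orb m n xi /\
     orthogonal_for (fun x y => x ^t* *m ofreal Theta *m y) (im xi) (ker xi)].

Definition D_C_ortho (m n : nat) : set 'M[C]_n :=
  [set xi | Orb m n xi /\
     orthogonal_for (fun x y => x^T *m y) (im xi) (ker xi)].

Definition D_C_symp (m n : nat) (J : 'M[R]_n) : set 'M[C]_n :=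
  [set xi | Orb m n xi /\
     orthogonal_for (fun x y => x^T *m ofreal J *m y) (im xi) (ker xi)].

Definition TGr_R (m n : nat) : set (covect n) :=
  [set z | [/\ TGr m n z, invariant conjmx z.1 & conjmx z.2 = z.2]].

Definition iTGr_R (m n : nat) : set (covect n) :=
  [set z | [/\ TGr m n z, invariant conjmx z.1 & conjmx z.2 = - z.2]].

Definition TGr_H (m n : nat) (J : 'M[R]_n) : set (covect n) :=
  [set z | [/\ TGr m n z, invariant (jmap J) z.1 &
               forall x, z.2 *m jmap J x = jmap J (z.2 *m x)]].

Definition iTGr_H (m n : nat) (J : 'M[R]_n) : set (covect n) :=
  [set z | [/\ TGr m n z, invariant (jmap J) z.1 &
               forall x, z.2 *m jmap J x = - jmap J (z.2 *m x)]].

Definition eigsp {n} (Theta : 'M[R]_n) (a : C) : {vspace 'cV[C]_n} :=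
  ker (ofreal Theta - a%:M).

Definition graded {n} (Theta : 'M[R]_n) (V Vp Vm : {vspace 'cV[C]_n}) : Prop :=
  [/\ (Vp <= eigsp Theta 1)%VS, (Vm <= eigsp Theta (-1))%VS,
      (Vp + Vm)%VS = V & directv (Vp + Vm)].

Definition is_orthocompl {n} (V W : {vspace 'cV[C]_n}) : Prop :=
  forall x, x \in W <-> forall y, y \in V -> y ^t* *m x = 0.

Definition X_Theta (m n : nat) (Theta : 'M[R]_n) : set (covect n) :=
  [set z | TGr m n z /\
     exists Pp Pm W Wp Wm : {vspace 'cV[C]_n},
       [/\ graded Theta z.1 Pp Pm, is_orthocompl z.1 W, graded Theta W Wp Wm,
           (forall x, x \in Wp -> z.2 *m x \in Pm) &
           (forall x, x \in Wm -> z.2 *m x \in Pp)]].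

(** * Quaternionic matrices and the hyperkähler quotient

    The pair (X, Y) stands for X + j Y; the product uses j z = z^* j. *)

Definition hmx (p q : nat) : Type := ('M[C]_(p, q) * 'M[C]_(p, q))%type.

Definition hmul {p q r} (A : hmx p q) (B : hmx q r) : hmx p r :=
  (A.1 *m B.1 - conjmx A.2 *m B.2, A.2 *m B.1 + conjmx A.1 *m B.2).

Definition hadj {p q} (A : hmx p q) : hmx q p := (A.1 ^t*, - A.2^T).

Definition hi {p} : hmx p p := (i%:M, 0).
Definition hj {p} : hmx p p := (0, 1%:M).
Definition hk {p} : hmx p p := hmul hi hj.

(* The quaternion Tr (A B^* + B A^* ) is real: its j-component vanishes and its
   complex component is real. *)
Definition hmetric {p q} (A B : hmx p q) : R :=
  complex.Re (\tr (hmul A (hadj B)).1 + \tr (hmul B (hadj A)).1) / 2.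

Section Quotient.
Context {m n : nat}.

Definition QP : Type := ('M[C]_(n, m) * 'M[C]_(m, n))%type.

Definition toH (a : QP) : hmx n m := (a.1, a.2 ^t*).

Definition embQP (a : QP) : (rmx n m * rmx m n)%type := (reim a.1, reim a.2).

Definition mu1 (a : QP) : 'M[C]_m :=
  (i / 2) *: (a.1 ^t* *m a.1 - a.2 *m a.2 ^t*).

(* mu2 + i mu3 = P Q with mu2 and mu3 skew-Hermitian *)
Definition mu2 (a : QP) : 'M[C]_m :=
  2^-1 *: (a.2 *m a.1 - (a.2 *m a.1) ^t*).
Definition mu3 (a : QP) : 'M[C]_m :=
  (2 * i)^-1 *: (a.2 *m a.1 + (a.2 *m a.1) ^t*).

Definition level : set QP :=
  [set a | [/\ \rank a.1 = m, mu1 a = i%:M, mu2 a = 0 & mu3 a = 0]].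

(* derivative at t = 0 of exp(t X) . a, for X in u(m) *)
Definition vertical (a : QP) (X : 'M[C]_m) : QP := (- a.1 *m X, X *m a.2).

(* Let psi identify the quotient level / U(m) with a manifold Y embedded by eY.
   Then b is the lift at a, horizontal for the metric, of the tangent vector
   v of Y at psi a. *)
Definition horizontal_lift {F : normedModType R} {Y : Type}
    (psi : QP -> Y) (eY : Y -> F) (a : QP) (v : F) (b : QP) : Prop :=
  (exists c, [/\ curve_through level embQP a c, velocity embQP c = embQP b &
                 velocity eY (psi \o c) = v]) /\
  (forall X, X ^t* = - X -> hmetric (toH b) (toH (vertical a X)) = 0).

(* The form g(L -, -) of the quotient, transported to Y, where L is left
   multiplication by the quaternion l; quotient metric and complex structures
   are computed on horizontal lifts. *)
Definition quotient_form {F : normedModType R} {Y : Type}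
    (psi : QP -> Y) (eY : Y -> F) (l : hmx n n) : form2 (X := Y) (E := F) :=
  fun y v w => xget 0 [set r : R | exists a b b' : QP,
    [/\ level a, psi a = y, horizontal_lift psi eY a v b,
        horizontal_lift psi eY a w b' &
        r = hmetric (hmul l (toH b)) (toH b')]].

Definition toTGr (a : QP) : covect n := (im a.1, a.1 *m a.2).

Definition toOrb (a : QP) : 'M[C]_n :=
  let s := (Num.sqrt (2 : R))^-1%:C%C in
  (s *: (a.1 - a.2 ^t*)) *m ((s * i) *: (a.1 ^t* + a.2)).

End Quotient.

Definition omega_C (m n : nat) : form2 (X := covect n) (E := rcovect n) :=
  quotient_form (@toTGr m n) embT hi.

Definition omega_K (m n : nat) : form2 (X := 'M[C]_n) (E := rmx n n) :=
  quotient_form (@toOrb m n) reim hk.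

End ComplexMatrices.

Arguments D_R : clear implicits.
Arguments D_C_ortho : clear implicits.
Arguments TGr_R : clear implicits.
Arguments iTGr_R : clear implicits.
Arguments omega_C : clear implicits.
Arguments omega_K : clear implicits.

(* Main.v *)
(** Write a point of Orb(i) as [i E] with [E] idempotent, and put [Z = E - E^*],
    [A = E + E^* - 1], [D = sqrt (1 - Z^2)].  Then [A D^-1] is a Hermitian involution,
    [Pi = (1 + A D^-1) / 2] is an orthogonal projector, [eta = Pi Z], and
    [Phi (i E) = (im Pi, eta)], with inverse [E = (1 + (2 Pi - 1) D + Z) / 2].  Both maps
    are smooth in the ambient matrix spaces, since the square root is taken of matrices
    bounded below by 1, and both commute with every *-automorphism [tau] of the matrices.
    Each subset of the orbit is [tau E = E] or [tau E = E^*], and corresponds to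
    [tau eta = eta], respectively [tau eta = - eta], for [tau] complex conjugation,
    conjugation by J, or conjugation by Theta.

    The sets [tau E = E] (with [Im Omega]) and [tau E = E^*] (with [Re Omega], for Theta)
    are shown to be symplectic with Cayley charts centred at the involution [2 E - 1];
    [d Omega = 0] because tangent vectors anticommute with that involution.  The other
    symplectic structures are transported, by [Phi], by [eta |-> i eta], and by [Phi^-1].

    The forms are compared on the level set of the momentum map, where both
    [Phi (toOrb a) = toTGr a] and, for tangent vectors [(q, p)],
    [Omega = g (I -, -) + i Re (- d lambda)], [g (K -, -) = Im (- d lambda)], with
    [lambda = tr (P dQ) = tr (eta dPi)].  Curves of the orbit lift smoothly to the level
    set by [Q = H F (F^* H F)^(-1/2)], [H = Pi (1 + D)], and lifts are made horizontal by
    solving a Sylvester equation in u(m) and acting with a Cayley curve in U(m). *)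

From HB Require Import structures.
Require Import Defs.
From mathcomp Require Import all_boot all_order all_algebra.
From mathcomp Require Import all_classical all_reals all_analysis.
From mathcomp Require Import complex ring lra.

Set Implicit Arguments.
Unset Strict Implicit.
Unset Printing Implicit Defensive.

Import Order.TTheory GRing.Theory Num.Theory numFieldNormedType.Exports.
Import Defs.

Local Open Scope classical_set_scope.
Local Open Scope ring_scope.
Local Open Scope sesquilinear_scope.

(** * Smooth maps *)

(** The obstacle is that [sqrtmx], [orthoproj], [ext_d], [OmegaKKS] and [quotient_form] are
    specified by choice, and that smoothness is phrased by iterated directional derivatives, a class
    that is awkward to compose. Maps between ambient spaces are therefore handled in a Frechet
    class, stable under composition and differentiation; the given class is only composed with such
    maps on the left, or with affine maps on the right. The formulas for [Phi] and its inverse make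
    sense for every matrix, because 1 + Z Z^* is at least 1 whatever Z is, so both maps are
    restrictions of globally smooth ones, and charts, forms and families are pushed along them. The
    values of the chosen forms are pinned down by showing that all admissible choices give one
    number and that a choice exists; this is why two-parameter families with prescribed velocities
    and horizontal lifts have to be constructed. Closedness and nondegeneracy are proved by hand for
    the Kirillov form only, whose value on tangent vectors is a trace polynomial in the ambient
    matrices. *)

Section FrechetSmooth.
Context {R : realType}.
Implicit Types E F G H : normedModType R.

(** Frechet class C^k, defined through the tangent map (x, v) -> d f_x v on U x E. Iterating the
    tangent map avoids norms on spaces of linear maps and turns the chain rule into a composition of
    tangent maps. *)
Fixpoint Sm (k : nat) E F (U : set E) (f : E -> F) : Prop :=
  if k is k'.+1 then
    (forall x, U x -> differentiable f x) /\
    @Sm k' (E * E)%type F [set p | U p.1] (fun p => 'd f (p.1) (p.2))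
  else forall x, U x -> {for x, continuous f}.

Lemma Sm_cont k E F (U : set E) (f : E -> F) x :
  Sm k U f -> U x -> {for x, continuous f}.
Proof.
case: k => [|k] /= Uf Ux; first exact: Uf.
by apply: differentiable_continuous; apply: Uf.1.
Qed.

Lemma Sm_pred k E F (U : set E) (f : E -> F) : Sm k.+1 U f -> Sm k U f.
Proof.
elim: k E F U f => [|k IHk] E F U f /= [df dSm].
  by move=> x Ux; apply: differentiable_continuous; apply: df.
by split => //; apply: IHk.
Qed.

Lemma Sm_sub k E F (U V : set E) (f : E -> F) : V `<=` U -> Sm k U f -> Sm k V f.
Proof.
elim: k E F U V f => [|k IHk] E F U V f VU /=; first by move=> h x /VU; apply: h.
move=> [df dSm]; split; first by move=> x /VU; apply: df.
by apply: IHk dSm => p /=; apply: VU.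
Qed.

Lemma near_eq_is_diff E F (f g : E -> F) x df :
  (\near x, f x = g x) -> is_diff x f df -> is_diff x g df.
Proof.
move=> fg [dfx dfE].
have cdf : continuous ('d f x) by apply: diff_continuous.
have gx : g \o shift x = cst (g x) + 'd f x +o_ 0 id.
  apply/eqaddoP => e e0.
  have /eqaddoP/(_ e e0) := diff_locally dfx.
  rewrite -(nbhs_singleton fg) => fe.
  have fgs : \forall y \near 0, f (y + x) = g (y + x).
    by have := near_shift 0 x (fun y => f y = g y); rewrite /= subr0 => <-.
  apply: filter_app fe; near=> y.
  have fgy : f (y + x) = g (y + x) by near: y.
  rewrite -[(f \o shift x - _) y]/(f (y + x) - (f x + 'd f x y)).
  by rewrite -[(g \o shift x - _) y]/(g (y + x) - (f x + 'd f x y)) fgy.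
have dgE := diff_unique cdf gx.
split; last by rewrite dgE.
by apply/diff_locallyP; rewrite dgE.
Unshelve. all: by end_near. Qed.

Lemma open_fst E F (U : set E) : open U -> open [set p : E * F | U p.1].
Proof. by move=> oU; apply: open_comp => // p _; apply: cvg_fst. Qed.

Lemma open_near E (U : set E) x : open U -> U x -> \forall y \near x, U y.
Proof. by move=> oU Ux; apply: open_nbhs_nbhs. Qed.

Lemma Sm_ext k E F (U : set E) (f g : E -> F) :
  open U -> (forall x, U x -> f x = g x) -> Sm k U f -> Sm k U g.
Proof.
elim: k E F U f g => [|k IHk] E F U f g oU fg /=.
  move=> cf x Ux; have nU := open_near oU Ux.
  change (g @ x --> g x); rewrite -(fg x Ux).
  by apply: (cvg_trans _ (cf x Ux)); apply: near_eq_cvg; near=> y; apply: fg; near: y.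
move=> [df dSm].
have dfg x : U x -> is_diff x g ('d f x).
  move=> Ux; apply: near_eq_is_diff; last exact/differentiableP/df.
  by have nU := open_near oU Ux; near=> y; apply: fg; near: y.
split; first by move=> x Ux; have [] := dfg x Ux.
apply: IHk dSm; first exact: open_fst.
move=> p Up; have [_ dE] := dfg p.1 Up.
exact: (congr1 (fun h => h p.2) (esym dE)).
Unshelve. all: by end_near. Qed.

Lemma Sm_cst k E F (U : set E) (a : F) : Sm k U (fun _ : E => a).
Proof.
elim: k E F U a => [|k IHk] E F U a /=; first by move=> x _; apply: cst_continuous.
split; first by move=> x _; apply: differentiable_cst.
have -> : (fun p : E * E => 'd (fun _ : E => a) (p.1) (p.2)) = fun _ => 0.
  by apply/funext => p; rewrite diff_cst.
exact: IHk.
Qed.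

Lemma Sm_linear k E F (U : set E) (L : {linear E -> F}) :
  continuous L -> Sm k U L.
Proof.
elim: k E F U L => [|k IHk] E F U L cL /=; first by move=> x _; apply: cL.
split; first by move=> x _; apply: linear_differentiable.
have -> : (fun p : E * E => 'd L (p.1) (p.2)) = L \o snd.
  by apply/funext => p /=; rewrite diff_lin.
have -> : L \o snd = (L \o snd : {linear (E * E)%type -> F}) by [].
by apply: IHk => p; apply: continuous_comp; [exact: cvg_snd|exact: cL].
Qed.

Lemma Sm_lin k E F (U : set E) (f : E -> F) : linear f -> continuous f -> Sm k U f.
Proof.
move=> lf cf.
pose fL := GRing.isLinear.Build _ _ _ _ _ lf.
pose L : {linear _ -> _} := HB.pack f fL.
exact: (@Sm_linear k E F U L).
Qed.

Lemma Sm_pair k E F G (U : set E) (f : E -> F) (g : E -> G) : open U ->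
  Sm k U f -> Sm k U g -> Sm k U (fun x => (f x, g x)).
Proof.
elim: k E F G U f g => [|k IHk] E F G U f g oU /=.
  by move=> cf cg x Ux; apply: cvg_pair; [apply: cf|apply: cg].
move=> [df Df] [dg Dg].
split; first by move=> x Ux; apply: differentiable_pair; [apply: df|apply: dg].
apply: Sm_ext (IHk _ _ _ _ _ _ _ Df Dg); try exact: open_fst.
by move=> p Up; rewrite (diff_pair (df p.1 Up) (dg p.1 Up)).
Qed.

Lemma Sm_fst k E F (U : set (E * F)) : Sm k U (fst : (E * F)%type -> E).
Proof. by apply: Sm_lin => // p; apply: cvg_fst. Qed.

Lemma Sm_snd k E F (U : set (E * F)) : Sm k U (snd : (E * F)%type -> F).
Proof. by apply: Sm_lin => // p; apply: cvg_snd. Qed.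

(** The tangent map of g o f is the tangent map of g after [h], the tangent map of f. The induction
    hypothesis applies to these two; the first component of [h] needs f itself in class C^k, whence
    [Sm_pred]. *)
Lemma Sm_comp k E F G (U : set E) (V : set F) (f : E -> F) (g : F -> G) :
  open U -> open V -> (forall x, U x -> V (f x)) ->
  Sm k V g -> Sm k U f -> Sm k U (g \o f).
Proof.
elim: k E F G U V f g => [|k IHk] E F G U V f g oU oV UV.
  by move=> cg cf x Ux; apply: continuous_comp; [apply: cf|apply: cg; apply: UV].
move=> [dg Dg] /[dup] /Sm_pred Sf [df Df].
split; first by move=> x Ux; apply: differentiable_comp; [apply: df|apply/dg/UV].
have oU2 : open [set p : (E * E)%type | U p.1] by apply: open_fst.
have oV2 : open [set p : (F * F)%type | V p.1] by apply: open_fst.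
pose h (p : (E * E)%type) : (F * F)%type := (f p.1, 'd f (p.1) p.2).
have Sh : Sm k [set p | U p.1] h.
  apply: Sm_pair => //.
  by apply: (IHk _ _ _ _ _ fst f _ _ _ Sf) => //; apply: Sm_fst.
have := IHk _ _ _ _ _ h _ oU2 oV2 _ Dg Sh.
have UVh x : [set p | U p.1] x -> [set p | V p.1] (h x) by move=> /UV.
move=> /(_ UVh); apply: Sm_ext => // p /= Up.
by rewrite (diff_comp (df p.1 Up) (dg _ (UV _ Up))).
Qed.

Lemma SmD k E F (U : set E) (f g : E -> F) : open U ->
  Sm k U f -> Sm k U g -> Sm k U (fun x => f x + g x).
Proof.
move=> oU Sf Sg.
have Sa : Sm k setT (fun p : (F * F)%type => p.1 + p.2).
  apply: Sm_lin; first by move=> a p q /=; rewrite scalerDr addrACA.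
  by move=> p; apply: cvgD; [apply: cvg_fst|apply: cvg_snd].
by apply: (@Sm_comp k _ _ _ _ _ _ _ oU openT _ Sa (Sm_pair oU Sf Sg)).
Qed.

(** The tangent map of a bilinear B is B(x, w) + B(v, y): the same B composed with linear
    projections, so the induction closes on B itself. *)
Lemma Sm_bil k E F G (B : E -> F -> G) :
  (forall x, linear (B x)) -> (forall y, linear (B ^~ y)) ->
  continuous (fun p : E * F => B p.1 p.2) ->
  Sm k setT (fun p : (E * F)%type => B p.1 p.2).
Proof.
move=> lB1 lB2 cB.
have lB : bilinear_for *:%R *:%R (B : E -> F -> G).
  by split=> [y|x]; [apply: lB2|apply: lB1].
pose fB := @bilinear_isBilinear.Build R E F G *:%R *:%R B lB.
pose BB : {bilinear E -> F -> G} := HB.pack B fB.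
elim: k => [|k IHk]; first by move=> x _; apply: cB.
split; first by move=> x _; apply: (@differentiable_bilin _ _ _ _ BB).
have -> : (fun p : (E * F) * (E * F) =>
    'd (fun q : (E * F)%type => B q.1 q.2) (p.1) p.2) =
    (fun p => B p.1.1 p.2.2 + B p.2.1 p.1.2).
  by apply/funext => p; rewrite (@diff_bilin _ _ _ _ BB).
have oT2 : open [set p : ((E * F) * (E * F))%type | [set: (E * F)%type] p.1].
  exact: open_fst openT.
apply: SmD => //.
  pose h (p : ((E * F) * (E * F))%type) := (p.1.1, p.2.2).
  apply: (@Sm_comp _ _ _ _ _ _ h _ oT2 openT _ IHk) => //.
  apply: (@Sm_lin _ _ _ _ h) => // p; apply: cvg_pair => //=.
    by apply: cvg_comp; [apply: cvg_fst|apply: cvg_fst].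
  by apply: cvg_comp; [apply: cvg_snd|apply: cvg_snd].
pose h (p : ((E * F) * (E * F))%type) := (p.2.1, p.1.2).
apply: (@Sm_comp _ _ _ _ _ _ h _ oT2 openT _ IHk) => //.
apply: (@Sm_lin _ _ _ _ h) => // p; apply: cvg_pair => //=.
  by apply: cvg_comp; [apply: cvg_snd|apply: cvg_fst].
by apply: cvg_comp; [apply: cvg_fst|apply: cvg_snd].
Qed.

End FrechetSmooth.

(** * Directional derivatives and their comparison with the Frechet class *)

Section Directional.
Context {R : realType}.
Implicit Types E F G H : normedModType R.

(** In one real variable derivability and differentiability coincide, so passing to the line through
    x lets Frechet calculus act on maps that are only derivable along v. *)
Lemma is_derive_line E F (f : E -> F) x v df :
  is_derive x v f df <-> is_derive (0 : R) 1 (fun h => f (h *: v + x)) df.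
Proof.
have DE : 'D_v f x = 'D_1 (fun h : R => f (h *: v + x)) (0 : R).
  rewrite /derive; set g1 := fun h => h^-1 *: _; set g2 := fun h => h^-1 *: _.
  suff -> : g1 = g2 by [].
  by apply/funext => h; rewrite /g1 /g2 /= addr0 scale0r add0r [_%:A]mulr1.
split=> -[dv <-].
  by split; [exact: (derivable1P _ _ _).1|rewrite DE].
by split; [exact: (derivable1P _ _ _).2|rewrite DE].
Qed.

Lemma is_derive_chain E F G (f : E -> F) (g : F -> G) x v df :
  is_derive x v f df -> differentiable g (f x) ->
  is_derive x v (g \o f) ('d g (f x) df).
Proof.
move=> /is_derive_line [dl dfE] dg; apply/is_derive_line.
have dl' := dl; move/derivable1_diffP : dl' => dl'.
have l0 : f (0 *: v + x) = f x by rewrite scale0r add0r.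
have dc : differentiable (g \o (fun h : R => f (h *: v + x))) (0 : R).
  by apply: differentiable_comp => //; rewrite l0.
split; first by apply/derivable1_diffP.
have dg0 : differentiable g ((fun h : R => f (h *: v + x)) 0) by rewrite l0.
rewrite deriveE // (diff_comp dl' dg0) /= -(deriveE (1 : R) dl') dfE.
by rewrite l0.
Qed.

Lemma is_derive_pair E F G (f : E -> F) (g : E -> G) x v df dg :
  is_derive x v f df -> is_derive x v g dg ->
  is_derive x v (fun y => (f y, g y)) (df, dg).
Proof.
move=> /is_derive_line [/derivable1_diffP dl <-] /is_derive_line [/derivable1_diffP dm <-].
apply/is_derive_line; split.
  by apply/derivable1_diffP; apply: differentiable_pair.
rewrite deriveE; last exact: differentiable_pair.
by rewrite diff_pair // -!deriveE.
Qed.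

Lemma Ck_cont k E F (U : set E) (f : E -> F) x : Ck k U f -> U x -> {for x, continuous f}.
Proof. by case: k => [|k] [cf _] Ux; apply: cf. Qed.

Lemma Ck_pred k E F (U : set E) (f : E -> F) : Ck k.+1 U f -> Ck k U f.
Proof.
elim: k E F U f => [|k IHk] E F U f [cf df]; first by split.
by split=> // v; have [d1 /IHk d2] := df v.
Qed.

Lemma Ck_sub k E F (U V : set E) (f : E -> F) : V `<=` U -> Ck k U f -> Ck k V f.
Proof.
elim: k E F U V f => [|k IHk] E F U V f VU [cf df].
  by split => // x /VU; apply: cf.
split; first by move=> x /VU; apply: cf.
by move=> v; have [d1 d2] := df v; split; [move=> x /VU; apply: d1|apply: IHk d2].
Qed.

Lemma smooth_on_sub E F (U V : set E) (f : E -> F) :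
  V `<=` U -> smooth_on U f -> smooth_on V f.
Proof. by move=> VU sf k; apply: Ck_sub (sf k). Qed.

Lemma Ck_ext k E F (U : set E) (f g : E -> F) :
  open U -> (forall x, U x -> f x = g x) -> Ck k U f -> Ck k U g.
Proof.
elim: k E F U f g => [|k IHk] E F U f g oU fg [cf df].
  by split => // x Ux; apply: (@Sm_ext _ 0 _ _ U f g oU fg cf).
have nfg x : U x -> \near x, f x = g x.
  by move=> Ux; have nU := open_near oU Ux; near=> y; apply: fg; near: y.
split; first by move=> x Ux; apply: (@Sm_ext _ 0 _ _ U f g oU fg cf).
move=> v; have [d1 d2] := df v; split.
  by move=> x Ux; apply: near_eq_derivable (nfg x Ux) _; exact: d1.
by apply: IHk d2 => // x Ux; apply: near_eq_derive; apply: nfg.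
Unshelve. all: by end_near. Qed.

Lemma Ck_pair k E F G (U : set E) (f : E -> F) (g : E -> G) : open U ->
  Ck k U f -> Ck k U g -> Ck k U (fun x => (f x, g x)).
Proof.
elim: k E F G U f g => [|k IHk] E F G U f g oU [cf df] [cg dg].
  by split=> // x Ux; apply: cvg_pair; [apply: cf|apply: cg].
split; first by move=> x Ux; apply: cvg_pair; [apply: cf|apply: cg].
move=> v; have [df1 df2] := df v; have [dg1 dg2] := dg v.
have dd x : U x -> is_derive x v (fun x => (f x, g x)) ('D_v f x, 'D_v g x).
  by move=> Ux; apply: is_derive_pair; apply: derivableP; [apply: df1|apply: dg1].
split; first by move=> x /dd [].
by apply: Ck_ext (IHk _ _ _ _ _ _ oU df2 dg2) => // x /dd [].
Qed.

(** The derivative of g o f along v is the tangent map of g applied to (f, D_v f), again a composite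
    of a Frechet map with a pair known only through directional derivatives; hence the asymmetry
    between the two factors. *)
Lemma Ck_comp_Sm k E F G (U : set E) (V : set F) (f : E -> F) (g : F -> G) :
  open U -> open V -> (forall x, U x -> V (f x)) ->
  Sm k V g -> Ck k U f -> Ck k U (g \o f).
Proof.
elim: k E F G U V f g => [|k IHk] E F G U V f g oU oV UV.
  by move=> cg [cf _]; split=> // x Ux; apply: continuous_comp; [apply: cf|apply/cg/UV].
move=> [dg Dg] /[dup] /Ck_pred Cf [cf df].
split.
  move=> x Ux; apply: continuous_comp; [exact: cf|].
  by apply: differentiable_continuous; apply/dg/UV.
move=> v; have [df1 df2] := df v.
have dd x : U x -> is_derive x v (g \o f) ('d g (f x) ('D_v f x)).
  move=> Ux; apply: is_derive_chain; first exact/derivableP/df1.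
  exact/dg/UV.
split; first by move=> x /dd [].
have oV2 : open [set p : (F * F)%type | V p.1] by apply: open_fst.
have Ch := Ck_pair oU Cf df2.
apply: Ck_ext (IHk _ _ _ _ _ _ _ oU oV2 _ Dg Ch) => //= x /dd [//].
Qed.

(** A derivative in a fixed direction v is the tangent map restricted to the slice x -> (x, v). *)
Lemma Sm_Ck k E F (U : set E) (f : E -> F) : open U -> Sm k U f -> Ck k U f.
Proof.
move=> oU Sf.
elim: k E F U f oU Sf => [|k IHk] E F U f oU; first by [].
move=> [df Df]; split; first by move=> x Ux; apply/differentiable_continuous/df.
move=> v; split; first by move=> x Ux; apply/diff_derivable/df.
have oU2 : open [set p : (E * E)%type | U p.1] by apply: open_fst.
pose h (x : E) : (E * E)%type := (x, v).
have Sh : Sm k U h.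
  apply: Sm_pair => //; last exact: Sm_cst.
  by apply: Sm_lin => // x; apply: cvg_id.
have UVh x : U x -> [set p : (E * E)%type | U p.1] (h x) by [].
have := IHk _ _ _ _ oU (Sm_comp oU oU2 UVh Df Sh).
by apply: Ck_ext => // x Ux /=; rewrite deriveE //; apply: df.
Qed.

Definition smooth E F (U : set E) (f : E -> F) := forall k, Sm k U f.

Lemma smooth_smooth_on E F (U : set E) (f : E -> F) : open U -> smooth U f -> smooth_on U f.
Proof. by move=> oU Sf k; apply: Sm_Ck. Qed.

Lemma smooth_on_comp E F G (U : set E) (V : set F) (f : E -> F) (g : F -> G) :
  open U -> open V -> (forall x, U x -> V (f x)) ->
  smooth V g -> smooth_on U f -> smooth_on U (g \o f).
Proof. by move=> oU oV UV Sg Cf k; apply: Ck_comp_Sm (Sg k) (Cf k). Qed.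

(** A factorization of the increment with a factor K continuous at x suffices for differentiability:
    the remainder is B (K y - K x) (y - x), which is o(y - x) because a continuous bilinear map is
    bounded. It serves for inversion and for the square root, whose increments are known exactly. *)
Lemma hadamard E F G (phi : E -> F) (K : E -> G) (B : G -> E -> F) (x : E) :
  (forall y, linear (B y)) -> (forall y, linear (B ^~ y)) ->
  continuous (fun p : G * E => B p.1 p.2) ->
  {for x, continuous K} ->
  (\forall y \near x, phi y - phi x = B (K y) (y - x)) ->
  is_diff x phi (B (K x)).
Proof.
move=> lB1 lB2 cB cK phiE.
have lB : bilinear_for *:%R *:%R (B : G -> E -> F).
  by split=> [y|y]; [apply: lB2|apply: lB1].
pose fB := @bilinear_isBilinear.Build R G E F *:%R *:%R B lB.
pose BB : {bilinear G -> E -> F} := HB.pack B fB.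
have [M M0 BM] := @bilinear_schwarz _ _ _ _ BB cB.
pose fL := GRing.isLinear.Build _ _ _ _ _ (lB1 (K x)).
pose L : {linear E -> F} := HB.pack (B (K x)) fL.
have cL : continuous L.
  move=> y; apply: (@continuous_comp _ _ _ (fun z => (K x, z)) (fun p : G * E => B p.1 p.2)).
    by apply: cvg_pair => //; apply: cvg_cst.
  exact: cB.
have dx : phi \o shift x = cst (phi x) + L +o_ 0 id.
  apply/eqaddoP => e e0.
  have K1 : \forall y \near x, `|K y - K x| < e / M.
    have /cvgr_distC_lt := cK; apply; exact: divr_gt0.
  have K0 : \forall y \near 0, `|K (y + x) - K x| < e / M.
    by have := near_shift 0 x (fun y => `|K y - K x| < e / M); rewrite /= subr0 => <-.
  have P0 : \forall y \near 0, phi (y + x) - phi x = B (K (y + x)) y.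
    have := near_shift 0 x (fun y => phi y - phi x = B (K y) (y - x)).
    by rewrite /= subr0 => P; move: phiE; rewrite P; apply: filterS => y /=; rewrite addrK.
  near=> y.
  rewrite -[(phi \o shift x - _) y]/(phi (y + x) - (phi x + B (K x) y)).
  have -> : phi (y + x) - (phi x + B (K x) y) = B (K (y + x) - K x) y.
    rewrite opprD addrA (near P0 y) //.
    have -> : K (y + x) - K x = (-1) *: K x + K (y + x) by rewrite scaleN1r addrC.
    by rewrite lB2 scaleN1r addrC.
  rewrite (le_trans (BM _ _)) // ler_wpM2r //.
  by rewrite mulrC -ler_pdivlMr // ltW //; near: y.
have dE := diff_unique cL dx.
by split; [apply/diff_locallyP; rewrite dE|rewrite dE].
Unshelve. all: by end_near. Qed.

(* bootstrap: a solution of [d phi = Psi (phi, -)] inherits the smoothness of [Psi] *)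
Lemma Sm_ode k E F (U : set E) (W : set (F * E)) (phi : E -> F) (Psi : F * E -> F) :
  open U -> open W -> (forall j, Sm j W Psi) ->
  (forall x v, U x -> W (phi x, v)) ->
  (forall x, U x -> is_diff x phi (fun v => Psi (phi x, v))) ->
  Sm k U phi.
Proof.
move=> oU oW SP UW dphi.
have Sphi j : Sm j U phi.
  elim: j => [|j IHj].
    by move=> x Ux; apply: differentiable_continuous; have [] := dphi x Ux.
  split; first by move=> x Ux; have [] := dphi x Ux.
  have oU2 : open [set p : (E * E)%type | U p.1] by apply: open_fst.
  pose h (p : (E * E)%type) : (F * E)%type := (phi p.1, p.2).
  have Sh : Sm j [set p | U p.1] h.
    apply: Sm_pair => //; last exact: Sm_snd.
    by apply: (@Sm_comp _ _ _ _ _ _ _ fst phi oU2 oU) => //; apply: Sm_fst.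
  have UWh p : [set p | U p.1] p -> W (h p) by move=> Up; apply: UW.
  apply: Sm_ext (Sm_comp oU2 oW UWh (SP j) Sh) => // p Up.
  by have [_ dE] := dphi p.1 Up; exact: (congr1 (fun h => h p.2) (esym dE)).
exact: Sphi.
Qed.

End Directional.

(** * Finite-dimensional spaces *)

Section FiniteDim.
Context {R : realType}.
Implicit Types E F G H : normedModType R.

(** Continuity of the coordinate functionals is part of the data, so that every linear map out of
    the space is continuous without comparing norms. *)
Definition findim E := exists n (b : 'I_n -> E) (c : 'I_n -> E -> R),
  [/\ forall i, continuous (c i), forall i, scalar (c i) &
      forall x, x = \sum_i c i x *: b i].

Lemma findim_mx p q : findim 'M[R]_(p, q).
Proof.
exists #|{: 'I_p * 'I_q}|, (fun i => delta_mx (enum_val i).1 (enum_val i).2),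
  (fun i (A : 'M[R]_(p, q)) => A (enum_val i).1 (enum_val i).2); split.
- by move=> i A; apply: coord_continuous.
- by move=> i a A B; rewrite !mxE.
- move=> A; rewrite {1}[A]matrix_sum_delta pair_bigA /=.
  by rewrite (reindex (@enum_val _ {: 'I_p * 'I_q})) //=; apply: onW_bij; apply: enum_val_bij.
Qed.

Lemma findim_prod E F : findim E -> findim F -> findim (E * F)%type.
Proof.
move=> [n [b [c [cc lc Ec]]]] [n' [b' [c' [cc' lc' Ec']]]].
pose B i := match fintype.split i with inl j => (b j, 0 : F) | inr j => (0 : E, b' j) end.
pose C i (x : (E * F)%type) :=
  match @fintype.split n n' i with inl j => c j x.1 | inr j => c' j x.2 end.
exists (n + n')%N, B, C; split.
- move=> i x; rewrite /C; case: fintype.split => j.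
    by apply: continuous_comp; [apply: cvg_fst|apply: cc].
  by apply: continuous_comp; [apply: cvg_snd|apply: cc'].
- by move=> i a x y; rewrite /C; case: fintype.split => j /=; rewrite ?lc ?lc'.
- move=> [x y]; rewrite big_split_ord /=.
  rewrite (eq_bigr (fun i => (c i x *: b i, 0 : F))); last first.
    move=> i _; rewrite /C /B.
    by rewrite (unsplitK (inl i)) /=; congr pair; rewrite scaler0.
  rewrite [X in _ + X](eq_bigr (fun i => (0 : E, c' i y *: b' i))); last first.
    move=> i _; rewrite /C /B (unsplitK (inr i)) /=.
    by congr pair; rewrite scaler0.
  have fstE (I : Type) (r : seq I) (f : I -> (E * F)%type) :
      \sum_(i <- r) f i = (\sum_(i <- r) (f i).1, \sum_(i <- r) (f i).2).
    by elim: r => [|i r IH]; rewrite ?big_nil // !big_cons IH.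
  rewrite !fstE /= [X in _ + (X, _)]big1 // [X in (_, X) + _]big1 //.
  rewrite -(Ec x) -(Ec' y) -[LHS]/((x, y) : E * F).
  by rewrite -[RHS]/((x + 0, 0 + y) : E * F) addr0 add0r.
Qed.

Lemma continuous_bigsum E F n (f : 'I_n -> E -> F) :
  (forall i, continuous (f i)) -> continuous (fun x => \sum_i f i x).
Proof.
move=> cf; elim: n f cf => [|n IHn] f cf.
  under eq_fun do rewrite big_ord0.
  exact: cst_continuous.
under eq_fun do rewrite big_ord_recl.
by move=> x; apply: cvgD; [apply: cf|apply: IHn => i; apply: cf].
Qed.

Lemma linear_sum_fun E F (f : E -> F) n (a : 'I_n -> R) (b : 'I_n -> E) :
  linear f -> f (\sum_i a i *: b i) = \sum_i a i *: f (b i).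
Proof.
move=> lf.
have f0 : f 0 = 0.
  by have := lf (-1) 0 0; rewrite scaler0 add0r scaleN1r addNr.
elim: n a b => [|n IHn] a b; first by rewrite !big_ord0.
by rewrite !big_ord_recl lf IHn.
Qed.

Lemma findim_linear E F (f : E -> F) : findim E -> linear f -> continuous f.
Proof.
move=> [n [b [c [cc _ Ec]]]] lf.
have -> : f = fun x => \sum_i c i x *: f (b i).
  by apply/funext => x; rewrite {1}(Ec x) linear_sum_fun.
apply: continuous_bigsum => i x.
by apply: cvgZr_tmp; apply: cc.
Qed.

Lemma findim_bilinear E F G (B : E -> F -> G) : findim E -> findim F ->
  (forall x, linear (B x)) -> (forall y, linear (B ^~ y)) ->
  continuous (fun p : E * F => B p.1 p.2).
Proof.
move=> fE [n [b [c [cc _ Ec]]]] lB1 lB2.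
have -> : (fun p : E * F => B p.1 p.2) = fun p => \sum_i c i p.2 *: B p.1 (b i).
  by apply/funext => p; rewrite {1}(Ec p.2) linear_sum_fun.
apply: continuous_bigsum => i p.
apply: cvgZ.
  by apply: (@continuous_comp _ _ _ snd (c i)); [apply: cvg_snd|apply: cc].
apply: (@continuous_comp _ _ _ fst (B ^~ (b i))); first by apply: cvg_fst.
exact: findim_linear.
Qed.

Lemma smooth_linear E F (U : set E) (f : E -> F) : findim E -> linear f -> smooth U f.
Proof. by move=> fE lf k; apply: Sm_lin => //; apply: findim_linear. Qed.

Lemma smooth_bilinear E F G H (U : set E) (B : F -> G -> H) (f : E -> F) (g : E -> G) :
  findim F -> findim G ->
  (forall x, linear (B x)) -> (forall y, linear (B ^~ y)) -> open U ->
  smooth U f -> smooth U g -> smooth U (fun x => B (f x) (g x)).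
Proof.
move=> fF fG lB1 lB2 oU sf sg k.
have SB := Sm_bil k lB1 lB2 (findim_bilinear fF fG lB1 lB2).
exact: (Sm_comp (f := fun x => (f x, g x)) oU openT _ SB (Sm_pair oU (sf k) (sg k))).
Qed.

Lemma is_derive_linear E F G (L : F -> G) (f : E -> F) x v df :
  findim F -> linear L -> is_derive x v f df -> is_derive x v (L \o f) (L df).
Proof.
move=> fF lL df'.
pose fL := GRing.isLinear.Build _ _ _ _ _ lL.
pose LL : {linear F -> G} := HB.pack L fL.
have cL : continuous LL by apply: findim_linear.
have := @is_derive_chain _ _ _ _ _ LL _ _ _ df' (linear_differentiable (f x) cL).
by rewrite diff_lin.
Qed.

Lemma is_derive_bilinear E F G H (B : F -> G -> H) (f : E -> F) (g : E -> G) x v df dg :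
  findim F -> findim G ->
  (forall x, linear (B x)) -> (forall y, linear (B ^~ y)) ->
  is_derive x v f df -> is_derive x v g dg ->
  is_derive x v (fun x => B (f x) (g x)) (B (f x) dg + B df (g x)).
Proof.
move=> fF fG lB1 lB2 df' dg'.
have lB : bilinear_for *:%R *:%R (B : F -> G -> H).
  by split=> [y|y]; [apply: lB2|apply: lB1].
pose fB := @bilinear_isBilinear.Build R F G H *:%R *:%R B lB.
pose BB : {bilinear F -> G -> H} := HB.pack B fB.
have cB : continuous (fun p : F * G => BB p.1 p.2) by apply: findim_bilinear.
have := is_derive_chain (is_derive_pair df' dg') (@differentiable_bilin _ _ _ _ BB _ cB).
by rewrite diff_bilin.
Qed.

End FiniteDim.

(** * Symmetry of second derivatives *)

Section Schwarz.
Context {R : realType} {V : normedModType R}.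

Lemma MVT_line (f : V -> R^o) x v (h : R) : 0 < h ->
  (forall t, 0 <= t <= h -> derivable f (x + t *: v) v) ->
  exists2 c, 0 <= c <= h & f (x + h *: v) - f x = h * 'D_v f (x + c *: v).
Proof.
move=> h0 df.
pose l (t : R) : R := f (x + t *: v).
pose dl (t : R) : R := 'D_v f (x + t *: v).
have dd t : 0 <= t <= h -> is_derive t 1 l (dl t).
  move=> th; have := derivableP (df t th).
  move=> /is_derive_line /(iffLR (is_derive_line _ _ _ _)) H.
  apply/is_derive_line.
  have -> : (fun s : R => l (s *: 1 + t)) = (fun s : R => f (s *: v + (x + t *: v))).
    by apply/funext => s; rewrite /l [s *: 1]mulr1 scalerDl addrCA addrA.
  by have := derivableP (df t th); rewrite is_derive_line.
have [||c] := @MVT R l dl 0 h h0.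
- by move=> t; rewrite in_itv /= => /andP[a b]; apply: dd; rewrite !ltW.
- apply: derivable_within_continuous => t; rewrite in_itv /= => tt.
  by have [] := dd t tt.
rewrite in_itv /= => /andP[c0 ch]; rewrite subr0 /l scale0r addr0 => ->.
by exists c; rewrite ?ltW // mulrC.
Qed.

(** The mean value theorem is applied twice: along u to the increment [g] of f in the direction v,
    then along v to D_u f. The hypothesis on h and d keeps the whole parallelogram inside U. *)
Lemma second_difference (f : V -> R^o) (U : set V) x u v (h d : R) :
  (forall y, `|x - y| < d -> U y) ->
  (forall y, U y -> derivable f y u) ->
  (forall y, U y -> derivable ('D_u f) y v) ->
  0 < h -> h * `|u| + h * `|v| < d ->
  exists c e, [/\ 0 <= c <= h, 0 <= e <= h &
    f (x + h *: u + h *: v) - f (x + h *: u) - f (x + h *: v) + f x =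
    h * (h * 'D_v ('D_u f) (x + c *: u + e *: v))].
Proof.
move=> dU df ddf h0 hd.
have inU t s : 0 <= t <= h -> 0 <= s <= h -> U (x + t *: u + s *: v).
  move=> /andP[t0 th] /andP[s0 sh]; apply: dU; rewrite -addrA opprD addNKr normrN.
  apply: le_lt_trans hd; apply: (le_trans (ler_normD _ _)).
  by rewrite !normrZ !ger0_norm // lerD // ler_wpM2r.
have hh : 0 <= h <= h by rewrite lexx ltW.
have h00 : 0 <= (0 : R) <= h by rewrite lexx ltW.
pose g y : R^o := f (y + h *: v) - f y.
have dg t : 0 <= t <= h ->
    is_derive (x + t *: u) u g
      ('D_u f (x + t *: u + h *: v) - 'D_u f (x + t *: u)).
  move=> th.
  have D1 : is_derive (x + t *: u) u (fun y => f (y + h *: v)) ('D_u f (x + t *: u + h *: v)).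
    have := derivableP (df _ (inU t h th hh)).
    move=> /is_derive_line H; apply/is_derive_line; move: H.
    by congr (is_derive _ _ _ _); apply/funext => s; rewrite addrA.
  have D2 : is_derive (x + t *: u) u f ('D_u f (x + t *: u)).
    by apply: derivableP; have := inU t 0 th h00; rewrite scale0r addr0; apply: df.
  exact: is_deriveB.
have [t th|c ch gE] := @MVT_line g x u h h0; first by have [] := dg t th.
have [_ gD] := dg c ch.
have [s sh|e eh kE] := @MVT_line ('D_u f) (x + c *: u) v h h0.
  by apply: ddf; apply: inU.
exists c, e; split=> //; rewrite -kE -gD -gE /g.
by rewrite opprB [f x - _]addrC addrA.
Qed.

Lemma near_ball2 (U : set V) (p q : V -> R^o) x (e : R) : open U -> U x ->
  {for x, continuous p} -> {for x, continuous q} -> 0 < e ->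
  exists2 d : R, 0 < d & forall y, `|x - y| < d ->
    [/\ U y, `|p x - p y| < e & `|q x - q y| < e].
Proof.
move=> oU Ux cp cq e0.
have nU := open_near oU Ux.
have /cvgrPdist_lt /(_ _ e0) H1 := cp.
have /cvgrPdist_lt /(_ _ e0) H2 := cq.
have H : nbhs x [set y | U y /\ (`|p x - p y| < e /\ `|q x - q y| < e)].
  exact: filterI nU (filterI H1 H2).
have /nbhs_ballP [d /= d0 dP] := H; exists d => // y xy.
by have [|? [? ?]] := dP y; first by rewrite -ball_normE.
Qed.

Lemma mulfI2 (h a b : R) : h != 0 -> h * (h * a) = h * (h * b) -> a = b.
Proof. by move=> h0 /(mulfI h0) /(mulfI h0). Qed.

(** The second difference is symmetric in u and v, so p and q take a common value at points
    arbitrarily close to x, and continuity carries this to x. *)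
Lemma second_difference_eq (f p q : V -> R) (U : set V) x u v : open U -> U x ->
  {for x, continuous (p : V -> R^o)} -> {for x, continuous (q : V -> R^o)} ->
  (forall h d : R, (forall y, `|x - y| < d -> U y) ->
    0 < h -> h * `|u| + h * `|v| < d -> exists c e, [/\ 0 <= c <= h, 0 <= e <= h &
    f (x + h *: u + h *: v) - f (x + h *: u) - f (x + h *: v) + f x =
    h * (h * p (x + c *: u + e *: v))]) ->
  (forall h d : R, (forall y, `|x - y| < d -> U y) ->
    0 < h -> h * `|v| + h * `|u| < d -> exists c e, [/\ 0 <= c <= h, 0 <= e <= h &
    f (x + h *: v + h *: u) - f (x + h *: v) - f (x + h *: u) + f x =
    h * (h * q (x + c *: v + e *: u))]) ->
  p x = q x.
Proof.
move=> oU Ux cp cq Hp Hq.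
apply/eqP; rewrite -subr_eq0 -normr_le0; apply/ler_addgt0Pl => e e0.
rewrite addr0.
have e2 : 0 < e / 2 by rewrite divr_gt0.
have [d d0 dP] := near_ball2 oU Ux cp cq e2.
pose M := `|u| + `|v| + 1.
have M0 : 0 < M by rewrite ltr_wpDl // addr_ge0.
(* Here h M = d / 2; the summand 1 in [M] keeps it positive when u and v both vanish. *)
pose h := d / 2 / M.
have h0 : 0 < h by rewrite !divr_gt0.
have hd : h * `|u| + h * `|v| < d.
  rewrite -mulrDr (@le_lt_trans _ _ (h * M)) //; first by rewrite ler_wpM2l ?ltW // ltrDl.
  by rewrite /h divfK ?gt_eqF // ltr_pdivrMr // mulr_natr mulr2n ltrDl.
have dU y : `|x - y| < d -> U y by move=> /dP [].
have hd' : h * `|v| + h * `|u| < d by rewrite addrC.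
have [c [k [/andP[c0 ch] /andP[k0 kh] E1]]] := Hp _ _ dU h0 hd.
have [c' [k' [/andP[c'0 c'h] /andP[k'0 k'h] E2]]] := Hq _ _ dU h0 hd'.
have E : p (x + c *: u + k *: v) = q (x + c' *: v + k' *: u).
  apply: (@mulfI2 h); first by rewrite gt_eqF.
  rewrite -E1 -E2 [x + h *: v + h *: u]addrAC.
  by rewrite -!addrA; congr (_ + _); rewrite addrCA.
have [|_ A1 _] := dP (x + c *: u + k *: v).
  rewrite -addrA opprD addNKr normrN.
  apply: le_lt_trans hd; apply: (le_trans (ler_normD _ _)).
  by rewrite !normrZ !ger0_norm // lerD // ler_wpM2r.
have [|_ _ A2] := dP (x + c' *: v + k' *: u).
  rewrite -addrA opprD addNKr normrN.
  apply: le_lt_trans hd'; apply: (le_trans (ler_normD _ _)).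
  by rewrite !normrZ !ger0_norm // lerD // ler_wpM2r.
move: A1 A2; rewrite E => A1 A2.
rewrite [e]splitr ltW // -(subrKA (q (x + c' *: v + k' *: u))).
by apply: (le_lt_trans (ler_normD _ _)); rewrite addrC ltrD // distrC.
Qed.

Lemma schwarz_real (f : V -> R^o) (U : set V) x u v : open U -> U x ->
  Ck 2 U f -> 'D_v ('D_u f) x = 'D_u ('D_v f) x.
Proof.
move=> oU Ux [_ df].
have [du [_ /(_ v) [duv [cuv _]]]] := df u.
have [dv [_ /(_ u) [dvu [cvu _]]]] := df v.
apply: (@second_difference_eq f _ _ U x u v oU Ux (cuv x Ux) (cvu x Ux)) => h d dU.
  exact: second_difference dU du duv.
exact: second_difference dU dv dvu.
Qed.

Lemma Ck_linear k (E F : normedModType R) (U : set V) (L : E -> F) (f : V -> E) : open U ->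
  findim E -> linear L -> Ck k U f -> Ck k U (L \o f).
Proof.
move=> oU fE lL; apply: (Ck_comp_Sm oU openT) => //.
exact: smooth_linear.
Qed.

(** The coordinate functionals separate points and commute with derivatives, which reduces the claim
    to real values. *)
Lemma schwarz (E : normedModType R) (f : V -> E) (U : set V) x u v :
  findim E -> open U -> U x ->
  Ck 2 U f -> 'D_v ('D_u f) x = 'D_u ('D_v f) x.
Proof.
move=> fE oU Ux Cf; have [n [b [c [cc lc Ec]]]] := fE.
have sep a b' : (forall i, c i a = c i b') -> a = b'.
  by move=> H; rewrite (Ec a) (Ec b'); apply: eq_bigr => i _; rewrite H.
apply: sep => i.
pose ci : E -> R^o := c i.
have lci : linear ci by move=> a y z; apply: lc.
have Cg : Ck 2 U (ci \o f) by apply: Ck_linear.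
have [_ df] := Cf.
have D1 (w : V) y : U y -> is_derive y w (ci \o f) (ci ('D_w f y)).
  by move=> Uy; apply: is_derive_linear => //; apply: derivableP; apply: (df w).1.
have D2 (w z : V) y : U y -> 'D_z ('D_w (ci \o f)) y = ci ('D_z ('D_w f) y).
  move=> Uy.
  have -> : 'D_z ('D_w (ci \o f)) y = 'D_z (ci \o 'D_w f) y.
    apply: near_eq_derive; have nU := open_near oU Uy.
    by near=> t; have [_ ->] : is_derive t w (ci \o f) (ci ('D_w f t)) by apply: D1; near: t.
  have [_ /(_ z) [dd _]] := (df w).2.
  have dd' : is_derive y z ('D_w f) ('D_z ('D_w f) y) by apply/derivableP/dd.
  by have [_ ->] := is_derive_linear fE lci dd'.
by have := schwarz_real u v oU Ux Cg; rewrite !D2.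
Unshelve. all: by end_near. Qed.

End Schwarz.

(** * Calculus of complex matrix-valued maps *)

Section Entries.
Context {K : pzRingType} {p q : nat}.
Implicit Types A B : 'M[K]_(p, q).
Lemma mxE_add A B i j : (A + B) i j = A i j + B i j. Proof. by rewrite mxE. Qed.
Lemma mxE_opp A i j : (- A) i j = - A i j. Proof. by rewrite mxE. Qed.
Lemma mxE_scale a A i j : (a *: A) i j = a * A i j. Proof. by rewrite mxE. Qed.
Lemma mxE_0 i j : (0 : 'M[K]_(p, q)) i j = 0. Proof. by rewrite mxE. Qed.
End Entries.

(** Sums, opposites and scalings are expanded entrywise while products and the identity matrix stay
    opaque, so an identity that is linear in its products becomes a goal for [ring]. *)
Ltac mx_entries :=
  let i := fresh "i" in let j := fresh "j" in
  apply/matrixP => i j;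
  rewrite ?(@mxE_add, @mxE_opp, @mxE_scale, @mxE_0).

Section ComplexCalculus.
Context {R : realType}.
Local Notation C := R[i].
Local Notation rmx := (@Defs.rmx R).
Local Notation rcovect := (@Defs.rcovect R).
Implicit Types E F G H : normedModType R.

Lemma reimK p q : cancel (@reim R p q) ofreim.
Proof.
move=> A; apply/matrixP => i j; rewrite !mxE.
by case: (A i j) => a b; simpc.
Qed.

Lemma ofreimK p q : cancel (@ofreim R p q) reim.
Proof.
move=> [A B]; congr pair; apply/matrixP => i j; rewrite !mxE /=; simpc => //=.
Qed.

Lemma ofreim_linear p q (k : R) (u v : rmx p q) :
  ofreim (k *: u + v) = k%:C%C *: ofreim u + ofreim v.
Proof.
apply/matrixP => i j; rewrite !mxE /=.
by simpc; congr Complex; rewrite ?mulrDr; ring.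
Qed.

Lemma reim_linear p q (k : R) (A B : 'M[C]_(p, q)) :
  reim (k%:C%C *: A + B) = k *: reim A + reim B.
Proof. by apply: (can_inj (@ofreimK p q)); rewrite reimK ofreim_linear !reimK. Qed.

Lemma reim0 p q : reim (0 : 'M[C]_(p, q)) = 0.
Proof. by congr pair; apply/matrixP => i j; rewrite !mxE. Qed.

Lemma ofreim0 p q : ofreim (0 : rmx p q) = 0 :> 'M[C]_(p, q).
Proof. by rewrite -reim0 reimK. Qed.

Lemma reimD p q (A B : 'M[C]_(p, q)) : reim (A + B) = reim A + reim B.
Proof. by have := reim_linear 1 A B; rewrite !scale1r. Qed.

Lemma ofreimD p q (u v : rmx p q) : ofreim (u + v) = ofreim u + ofreim v.
Proof. by have := ofreim_linear 1 u v; rewrite !scale1r. Qed.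

Lemma ofreimZ p q (k : R) (u : rmx p q) : ofreim (k *: u) = k%:C%C *: ofreim u.
Proof. by have := ofreim_linear k u 0; rewrite ofreim0 !addr0. Qed.

Lemma ofreimN p q (u : rmx p q) : ofreim (- u) = - ofreim u.
Proof. by rewrite -scaleN1r ofreimZ rmorphN rmorph1 scaleN1r. Qed.

Lemma ofreimB p q (u v : rmx p q) : ofreim (u - v) = ofreim u - ofreim v.
Proof. by rewrite ofreimD ofreimN. Qed.

Lemma reim_inj p q : injective (@reim R p q).
Proof. exact: can_inj (@reimK p q). Qed.

Lemma ofreim_inj p q : injective (@ofreim R p q).
Proof. exact: can_inj (@ofreimK p q). Qed.

Lemma findim_rmx p q : findim (rmx p q : normedModType R).
Proof. by apply: findim_prod; apply: findim_mx. Qed.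

Lemma findim_rcovect n : findim (rcovect n : normedModType R).
Proof. by apply: findim_prod; apply: findim_rmx. Qed.

(** Linearity over the reals only, so that conjugation and the adjoint are included. *)
Definition rlinear p q r s (L : 'M[C]_(p, q) -> 'M[C]_(r, s)) :=
  forall (k : R) A B, L (k%:C%C *: A + B) = k%:C%C *: L A + L B.

Lemma rlinear_linear p q r s (L : 'M[C]_(p, q) -> 'M[C]_(r, s)) :
  rlinear L -> linear (fun v : rmx p q => reim (L (ofreim v))).
Proof. by move=> lL k u v; rewrite ofreim_linear lL reim_linear. Qed.

Definition csmooth E p q (U : set E) (f : E -> 'M[C]_(p, q)) :=
  smooth U (fun x => reim (f x)).

Lemma csmooth_sub E p q (U V : set E) (f : E -> 'M[C]_(p, q)) :
  V `<=` U -> csmooth U f -> csmooth V f.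
Proof. by move=> VU sf k; apply: Sm_sub (sf k). Qed.

Lemma csmooth_ext E p q (U : set E) (f g : E -> 'M[C]_(p, q)) : open U ->
  (forall x, U x -> f x = g x) -> csmooth U f -> csmooth U g.
Proof. by move=> oU fg sf k; apply: Sm_ext (sf k) => // x /fg ->. Qed.

Lemma csmooth_cst E p q (U : set E) (A : 'M[C]_(p, q)) : csmooth U (fun=> A).
Proof. by move=> k; apply: Sm_cst. Qed.

Lemma csmooth_lin E p q (U : set E) (f : E -> rmx p q) :
  smooth U f -> csmooth U (fun x => ofreim (f x)).
Proof. by move=> sf; rewrite /csmooth; under eq_fun do rewrite ofreimK. Qed.

Lemma csmooth_id p q (U : set (rmx p q)) : csmooth U (@ofreim R p q).
Proof. by apply: csmooth_lin; apply: smooth_linear => //; apply: findim_rmx. Qed.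

Lemma csmooth_comp E F p q (U : set E) (V : set F) (f : E -> F) (g : F -> 'M[C]_(p, q)) :
  open U -> open V -> (forall x, U x -> V (f x)) ->
  csmooth V g -> smooth U f -> csmooth U (fun x => g (f x)).
Proof. by move=> oU oV UV sg sf k; apply: (Sm_comp oU oV UV (sg k) (sf k)). Qed.

Lemma csmooth_rlinear E p q r s (U : set E) (L : 'M[C]_(p, q) -> 'M[C]_(r, s))
    (f : E -> 'M[C]_(p, q)) : open U ->
  rlinear L -> csmooth U f -> csmooth U (fun x => L (f x)).
Proof.
move=> oU lL sf k.
have SL := @smooth_linear _ _ _ setT _ (findim_rmx p q) (rlinear_linear lL) k.
by apply: Sm_ext (Sm_comp oU openT _ SL (sf k)) => // x _ /=; rewrite reimK.
Qed.

Definition cbilinear p q r s t w (B : 'M[C]_(p, q) -> 'M[C]_(r, s) -> 'M[C]_(t, w)) :=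
  (forall X, rlinear (B X)) /\ (forall Y, rlinear (B ^~ Y)).

Lemma csmooth_cbilinear E p q r s t w (U : set E)
    (B : 'M[C]_(p, q) -> 'M[C]_(r, s) -> 'M[C]_(t, w)) f g : open U ->
  cbilinear B -> csmooth U f -> csmooth U g -> csmooth U (fun x => B (f x) (g x)).
Proof.
move=> oU [lB1 lB2] sf sg.
have H := @smooth_bilinear R E _ _ _ U
  (fun (u : rmx p q) (v : rmx r s) => reim (B (ofreim u) (ofreim v)) : rmx t w)
  _ _ (findim_rmx p q) (findim_rmx r s) _ _ oU sf sg.
move=> k; have := H _ _ k; rewrite /= => {}H.
apply: Sm_ext (H _ _) => // [x _|u|v]; first by rewrite !reimK.
  exact: (rlinear_linear (lB1 _)).
exact: (rlinear_linear (lB2 _)).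
Qed.

Lemma cbilinear_mulmx p q r : cbilinear (@mulmx C p q r).
Proof.
split=> X k A B; first by rewrite mulmxDr scalemxAr.
by rewrite mulmxDl scalemxAl.
Qed.

Lemma csmoothM E p q r (U : set E) (f : E -> 'M[C]_(p, q)) (g : E -> 'M[C]_(q, r)) :
  open U -> csmooth U f -> csmooth U g -> csmooth U (fun x => f x *m g x).
Proof. by move=> oU; apply: csmooth_cbilinear => //; apply: cbilinear_mulmx. Qed.

Lemma csmoothD E p q (U : set E) (f g : E -> 'M[C]_(p, q)) :
  open U -> csmooth U f -> csmooth U g -> csmooth U (fun x => f x + g x).
Proof.
by move=> oU sf sg k; apply: Sm_ext (SmD oU (sf k) (sg k)) => // x _; rewrite reimD.
Qed.

Lemma rlinear_scale p q (a : C) : rlinear (fun A : 'M[C]_(p, q) => a *: A).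
Proof. by move=> k A B; rewrite scalerDr !scalerA mulrC. Qed.

Lemma csmoothZ E p q (U : set E) a (f : E -> 'M[C]_(p, q)) :
  open U -> csmooth U f -> csmooth U (fun x => a *: f x).
Proof. by move=> oU; apply: csmooth_rlinear => //; apply: rlinear_scale. Qed.

Lemma csmoothN E p q (U : set E) (f : E -> 'M[C]_(p, q)) :
  open U -> csmooth U f -> csmooth U (fun x => - f x).
Proof.
move=> oU sf; apply: csmooth_ext (csmoothZ (-1) oU sf) => // x _.
by rewrite scaleN1r.
Qed.

Lemma csmoothB E p q (U : set E) (f g : E -> 'M[C]_(p, q)) :
  open U -> csmooth U f -> csmooth U g -> csmooth U (fun x => f x - g x).
Proof. by move=> oU sf sg; apply: csmoothD => //; apply: csmoothN. Qed.

Lemma conjmxZ p q (k : C) (A : 'M[C]_(p, q)) : conjmx (k *: A) = (k^*)%C *: conjmx A.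
Proof. by apply/matrixP => i j; rewrite !mxE rmorphM. Qed.

Lemma conjmxD p q (A B : 'M[C]_(p, q)) : conjmx (A + B) = conjmx A + conjmx B.
Proof. exact: map_mxD. Qed.

Lemma rlinear_conj p q : rlinear (@conjmx R p q).
Proof. by move=> k A B; rewrite conjmxD conjmxZ conjc_real. Qed.

Lemma trCZ p q (k : C) (A : 'M[C]_(p, q)) : (k *: A) ^t* = (k^*)%C *: A ^t*.
Proof. by apply/matrixP => i j; rewrite !mxE rmorphM. Qed.

Lemma trCD p q (A B : 'M[C]_(p, q)) : (A + B) ^t* = A ^t* + B ^t*.
Proof. by rewrite linearD /= map_mxD. Qed.

Lemma trCN p q (A : 'M[C]_(p, q)) : (- A) ^t* = - A ^t*.
Proof. by rewrite linearN /= map_mxN. Qed.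

Lemma trCB p q (A B : 'M[C]_(p, q)) : (A - B) ^t* = A ^t* - B ^t*.
Proof. by rewrite trCD trCN. Qed.

Lemma trCM p q r (A : 'M[C]_(p, q)) (B : 'M[C]_(q, r)) : (A *m B) ^t* = B ^t* *m A ^t*.
Proof. by rewrite trmx_mul map_mxM. Qed.

Lemma trC1 n : (1%:M : 'M[C]_n) ^t* = 1%:M.
Proof. by rewrite trmx1 map_mx1. Qed.

Lemma trC0 p q : (0 : 'M[C]_(p, q)) ^t* = 0.
Proof. by rewrite trmx0 map_mx0. Qed.

Lemma rlinear_trC p q : rlinear (fun A : 'M[C]_(p, q) => A ^t*).
Proof. by move=> k A B; rewrite trCD trCZ conjc_real. Qed.

Lemma csmooth_trC E p q (U : set E) (f : E -> 'M[C]_(p, q)) :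
  open U -> csmooth U f -> csmooth U (fun x => (f x) ^t*).
Proof. by move=> oU; apply: (csmooth_rlinear oU (@rlinear_trC p q)). Qed.

Definition cderive E p q (x v : E) (f : E -> 'M[C]_(p, q)) (df : 'M[C]_(p, q)) :=
  is_derive x v (fun y => reim (f y) : rmx p q) (reim df).

Lemma cderive_rlinear E p q r s (x v : E) (L : 'M[C]_(p, q) -> 'M[C]_(r, s)) f df :
  rlinear L -> cderive x v f df -> cderive x v (fun y => L (f y)) (L df).
Proof.
move=> lL df'.
have := is_derive_linear (findim_rmx p q) (rlinear_linear lL) df'.
rewrite /cderive reimK; congr (is_derive _ _ _ _).
by apply/funext => y /=; rewrite reimK.
Qed.

Lemma cderive_cbilinear E p q r s t w (x v : E)
    (B : 'M[C]_(p, q) -> 'M[C]_(r, s) -> 'M[C]_(t, w)) f g df dg :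
  cbilinear B -> cderive x v f df -> cderive x v g dg ->
  cderive x v (fun y => B (f y) (g y)) (B (f x) dg + B df (g x)).
Proof.
move=> [lB1 lB2] df' dg'.
have := @is_derive_bilinear R E _ _ _
  (fun (u : rmx p q) (v : rmx r s) => reim (B (ofreim u) (ofreim v)) : rmx t w)
  _ _ x v _ _ (findim_rmx p q) (findim_rmx r s) _ _ df' dg'.
rewrite /cderive reimD /= !reimK => H.
have -> : (fun y => reim (B (f y) (g y))) =
    (fun y => reim (B (ofreim (reim (f y))) (ofreim (reim (g y))))).
  by apply/funext => y; rewrite !reimK.
apply: H => [u|u].
  exact: (rlinear_linear (lB1 _)).
exact: (rlinear_linear (lB2 _)).
Qed.

Lemma cderive_cst E p q (x v : E) (A : 'M[C]_(p, q)) : cderive x v (fun=> A) 0.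
Proof. by rewrite /cderive reim0; apply: is_derive_cst. Qed.

Lemma cderive_eq E p q (x v : E) (f : E -> 'M[C]_(p, q)) a b :
  cderive x v f a -> a = b -> cderive x v f b.
Proof. by move=> h <-. Qed.

Lemma cderive_unique E p q (x v : E) (f : E -> 'M[C]_(p, q)) a b :
  cderive x v f a -> cderive x v f b -> a = b.
Proof. by move=> [_ da] [_ db]; apply: (@reim_inj p q); rewrite -da -db. Qed.

Lemma cderive_near E p q (x v : E) (f g : E -> 'M[C]_(p, q)) a :
  (\near x, f x = g x) -> cderive x v f a -> cderive x v g a.
Proof. by move=> fg; apply: near_eq_is_derive; apply: filterS fg => y ->. Qed.

Lemma cderiveM E p q r (x v : E) (f : E -> 'M[C]_(p, q)) (g : E -> 'M[C]_(q, r)) df dg :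
  cderive x v f df -> cderive x v g dg ->
  cderive x v (fun y => f y *m g y) (f x *m dg + df *m g x).
Proof. exact/cderive_cbilinear/cbilinear_mulmx. Qed.

Lemma cderiveD E p q (x v : E) (f g : E -> 'M[C]_(p, q)) df dg :
  cderive x v f df -> cderive x v g dg -> cderive x v (fun y => f y + g y) (df + dg).
Proof.
move=> df' dg'; rewrite /cderive reimD.
have -> : (fun y => reim (f y + g y)) = (fun y => reim (f y)) + (fun y => reim (g y)).
  by apply/funext => y; rewrite reimD.
exact: is_deriveD.
Qed.

Lemma cderiveZ E p q (x v : E) a (f : E -> 'M[C]_(p, q)) df :
  cderive x v f df -> cderive x v (fun y => a *: f y) (a *: df).
Proof. exact/cderive_rlinear/rlinear_scale. Qed.

Lemma cderiveN E p q (x v : E) (f : E -> 'M[C]_(p, q)) df :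
  cderive x v f df -> cderive x v (fun y => - f y) (- df).
Proof.
move=> df'; rewrite -scaleN1r; have := cderiveZ (-1) df'.
by rewrite /cderive; under eq_fun do rewrite scaleN1r.
Qed.

Lemma cderiveB E p q (x v : E) (f g : E -> 'M[C]_(p, q)) df dg :
  cderive x v f df -> cderive x v g dg -> cderive x v (fun y => f y - g y) (df - dg).
Proof. by move=> ? ?; apply: cderiveD => //; apply: cderiveN. Qed.

Lemma cderive_trC E p q (x v : E) (f : E -> 'M[C]_(p, q)) df :
  cderive x v f df -> cderive x v (fun y => (f y) ^t*) (df ^t*).
Proof. exact: (cderive_rlinear (@rlinear_trC p q)). Qed.

End ComplexCalculus.

(** * Positive matrices, square roots and Sylvester equations *)

Section Hermitian.
Context {R : realType}.
Local Notation C := R[i].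

Lemma trCK p q (A : 'M[C]_(p, q)) : A ^t* ^t* = A.
Proof. exact: trmxCK. Qed.

Lemma mxtraceC n (A : 'M[C]_n) : \tr (A ^t*) = (\tr A)^*%C.
Proof. by rewrite /mxtrace rmorph_sum; apply: eq_bigr => i _; rewrite !mxE. Qed.

Lemma gram_diagE p q (X : 'M[C]_(p, q)) j : (X ^t* *m X) j j = \sum_i `|X i j| ^+ 2.
Proof. by rewrite mxE; apply: eq_bigr => i _; rewrite !mxE mulrC -normCK. Qed.

Lemma gram_diag_ge0 p q (X : 'M[C]_(p, q)) j : 0 <= (X ^t* *m X) j j.
Proof. by rewrite gram_diagE sumr_ge0 // => i _; rewrite exprn_ge0. Qed.

Lemma gram_tr_ge0 p q (X : 'M[C]_(p, q)) : 0 <= \tr (X ^t* *m X).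
Proof. by rewrite sumr_ge0 // => j _; apply: gram_diag_ge0. Qed.

Lemma gram_tr_eq0 p q (X : 'M[C]_(p, q)) : \tr (X ^t* *m X) = 0 -> X = 0.
Proof.
move=> /eqP; rewrite psumr_eq0; last by move=> j _; apply: gram_diag_ge0.
move=> /allP X0; apply/matrixP => i j; rewrite mxE.
have := X0 j (mem_index_enum _); rewrite gram_diagE psumr_eq0; last first.
  by move=> k _; rewrite exprn_ge0.
move=> /allP /(_ i (mem_index_enum _)) /=.
by rewrite sqrf_eq0 normr_eq0 => /eqP.
Qed.

Lemma gram_eq0 p q (X : 'M[C]_(p, q)) : X ^t* *m X = 0 -> X = 0.
Proof. by move=> X0; apply: gram_tr_eq0; rewrite X0 mxtrace0. Qed.

Lemma gram_tr_entry p q (X : 'M[C]_(p, q)) i j : `|X i j| ^+ 2 <= \tr (X ^t* *m X).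
Proof.
apply: (@le_trans _ _ ((X ^t* *m X) j j)).
  by rewrite gram_diagE (bigD1 i) //= lerDl sumr_ge0.
rewrite /mxtrace (bigD1 j) //= lerDl sumr_ge0 // => k _.
exact: gram_diag_ge0.
Qed.

(* [A - c 1] is positive semidefinite *)
Definition pdef n (c : C) (A : 'M[C]_n) :=
  A ^t* = A /\ forall x : 'cV[C]_n, c * (x ^t* *m x) 0 0 <= (x ^t* *m A *m x) 0 0.

Lemma pdef_psd n (c : C) (A : 'M[C]_n) : 0 <= c -> pdef c A -> psd A.
Proof.
move=> c0 [Ah Ac]; split=> // x; apply: le_trans (Ac x).
by rewrite mulr_ge0 // gram_diag_ge0.
Qed.

Lemma psd_pdef n (A : 'M[C]_n) : psd A -> pdef 0 A.
Proof. by move=> [Ah Ac]; split=> // x; rewrite mul0r. Qed.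

Lemma mulmx_diagE p q (X : 'M[C]_(p, q)) (A : 'M[C]_p) j :
  (X ^t* *m A *m X) j j = ((col j X) ^t* *m A *m col j X) 0 0.
Proof.
rewrite !mxE; apply: eq_bigr => k _; rewrite !mxE; congr (_ * _).
by apply: eq_bigr => l _; rewrite !mxE.
Qed.

Lemma pdef_tr n p (c : C) (A : 'M[C]_n) (X : 'M[C]_(n, p)) : pdef c A ->
  c * \tr (X ^t* *m X) <= \tr (X ^t* *m A *m X).
Proof.
move=> [_ Ac]; rewrite /mxtrace mulr_sumr; apply: ler_sum => j _.
have H : (X ^t* *m X) j j = ((col j X) ^t* *m col j X) 0 0.
  by have := mulmx_diagE X 1%:M j; rewrite !mulmx1.
by rewrite mulmx_diagE H; apply: Ac.
Qed.

Lemma psd_tr n p (A : 'M[C]_n) (X : 'M[C]_(n, p)) : psd A -> 0 <= \tr (X ^t* *m A *m X).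
Proof. by move=> /psd_pdef /(pdef_tr X); rewrite mul0r. Qed.

Lemma psd_gram n p (X : 'M[C]_(p, n)) : psd (X ^t* *m X).
Proof.
split; first by rewrite trCM trCK.
by move=> x; rewrite mulmxA -trCM -mulmxA; apply: gram_diag_ge0.
Qed.

Lemma herm_conj n p (A : 'M[C]_n) (X : 'M[C]_(n, p)) : A ^t* = A ->
  (X ^t* *m A *m X) ^t* = X ^t* *m A *m X.
Proof. by move=> Ah; rewrite !trCM trCK Ah mulmxA. Qed.

Lemma psd_conj n p (A : 'M[C]_n) (X : 'M[C]_(n, p)) : psd A -> psd (X ^t* *m A *m X).
Proof.
move=> [Ah Ac]; split; first exact: herm_conj.
move=> x; have := Ac (X *m x); rewrite trCM !mulmxA; apply.
Qed.

Lemma pdef_inj n p (c : C) (A : 'M[C]_n) (X : 'M[C]_(n, p)) : 0 < c -> pdef c A ->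
  A *m X = 0 -> X = 0.
Proof.
move=> c0 /(pdef_tr X) cA AX; apply: gram_tr_eq0; apply/eqP.
rewrite -mulmxA AX mulmx0 mxtrace0 pmulr_rle0 // in cA.
by rewrite eq_le cA gram_tr_ge0.
Qed.

Lemma unitmx_inj n (A : 'M[C]_n) :
  (forall X : 'M[C]_n, A *m X = 0 -> X = 0) -> A \in unitmx.
Proof.
by move=> Ai; rewrite -row_full_unit -cokermx_eq0; apply/eqP/Ai/mulmx_coker.
Qed.

Lemma pdef_unitmx n (c : C) (A : 'M[C]_n) : 0 < c -> pdef c A -> A \in unitmx.
Proof. by move=> c0 cA; apply: unitmx_inj => X; apply: pdef_inj cA. Qed.

Lemma spectral_hermitian n (A : 'M[C]_n) : A ^t* = A ->
  exists (P : 'M[C]_n) (d : 'rV[C]_n), [/\ P *m P ^t* = 1%:M, P ^t* *m P = 1%:M &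
    A = P ^t* *m diag_mx d *m P].
Proof.
move=> Ah.
have Asym : A \is hermitianmx n false Num.conj.
  by apply/is_hermitianmxP; rewrite expr0 scale1r Ah.
have /orthomx_spectralP AE := hermitian_normalmx Asym.
have Pu := spectral_unitarymx A.
have P1 : spectralmx A *m (spectralmx A) ^t* = 1%:M by apply/unitarymxP.
exists (spectralmx A), (spectral_diag A); split=> //; first exact: mulmx1C.
by rewrite {1}AE invmx_unitary.
Qed.

Lemma diag_formE n (d : 'rV[C]_n) (x : 'cV[C]_n) :
  (x ^t* *m diag_mx d *m x) 0 0 = \sum_i d 0 i * `|x i 0| ^+ 2.
Proof.
rewrite mul_mx_diag !mxE; apply: eq_bigr => i _; rewrite !mxE normCK.
by ring.
Qed.

Lemma sandwich_mul n (A S B : 'M[C]_n) : B *m A = 1%:M ->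
  A *m S *m B *m (A *m S *m B) = A *m (S *m S) *m B.
Proof. by move=> BA; rewrite !mulmxA -(mulmxA _ B A) BA mulmx1. Qed.

(** The square roots of the eigenvalues are taken in an orthonormal eigenbasis; the eigenvalues are
    at least c, and monotonicity of the root gives the bound sqrt c. Keeping a quantitative lower
    bound, rather than mere positivity, is what later yields estimates. *)
Lemma pdef_sqrt n (c : C) (A : 'M[C]_n) : 0 <= c -> pdef c A ->
  exists B : 'M[C]_n, pdef (sqrtC c) B /\ B *m B = A.
Proof.
move=> c0 [Ah Ac]; have [P [d [P1 P1' AE]]] := spectral_hermitian Ah.
have nE (x : 'cV[C]_n) : x ^t* *m x = (P *m x) ^t* *m (P *m x).
  by rewrite trCM mulmxA -(mulmxA _ (P ^t*)) P1' mulmx1.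
have fE e (x : 'cV[C]_n) :
    x ^t* *m (P ^t* *m diag_mx e *m P) *m x = (P *m x) ^t* *m diag_mx e *m (P *m x).
  by rewrite trCM !mulmxA.
(* The bound on the form is tested on the i-th eigenvector, the image of the i-th basis vector under
   P^*. *)
have dc i : c <= d 0 i.
  have Pe (e : 'cV[C]_n) : P *m (P ^t* *m e) = e by rewrite mulmxA P1 mul1mx.
  have := Ac (P ^t* *m delta_mx i 0); rewrite AE nE fE Pe.
  have sE (F : 'I_n -> C) : \sum_k F k * `|(delta_mx i 0 : 'cV[C]_n) k 0| ^+ 2 = F i.
    rewrite (bigD1 i) //= big1 ?addr0 => [|k /negbTE ki]; last first.
      by rewrite mxE ki normr0 expr0n mulr0.
    by rewrite mxE !eqxx normr1 expr1n mulr1.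
  by rewrite gram_diagE diag_formE sE mulr_sumr (sE (fun=> c)).
pose s : 'rV[C]_n := \row_i sqrtC (d 0 i).
have d0 i : 0 <= d 0 i by apply: le_trans (dc i).
exists (P ^t* *m diag_mx s *m P); split; last first.
  rewrite AE.
  have -> : diag_mx d = diag_mx s *m diag_mx s.
    rewrite mulmx_diag; congr diag_mx; apply/rowP => i.
    by rewrite !mxE -expr2 sqrtCK.
  exact: sandwich_mul.
have sh : (diag_mx s) ^t* = diag_mx s.
  apply/matrixP => i j; rewrite !mxE eq_sym; case: eqP => [->|_]; last first.
    by rewrite !mulr0n rmorph0.
  by rewrite !mulr1n; apply: CrealP; rewrite ger0_real // sqrtC_ge0.
split; first exact: herm_conj sh.
move=> x.
rewrite nE fE.
rewrite gram_diagE diag_formE mulr_sumr; apply: ler_sum => i _.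
by rewrite ler_wpM2r ?exprn_ge0 // mxE ler_sqrtC ?nnegrE.
Qed.

Lemma psd_gramP n (A : 'M[C]_n) : psd A -> exists W : 'M[C]_n, A = W ^t* *m W.
Proof.
move=> /psd_pdef pA; have [B [[Bh _] <-]] := pdef_sqrt (lexx 0) pA.
by exists B; rewrite Bh.
Qed.

(** With A = W^* W the hypothesis says that the squared norm of W X vanishes. *)
Lemma psd_ker n p (A : 'M[C]_n) (X : 'M[C]_(n, p)) :
  psd A -> \tr (X ^t* *m A *m X) = 0 -> A *m X = 0.
Proof.
move=> /psd_gramP [W ->]; rewrite mulmxA -trCM -mulmxA => /gram_tr_eq0 WX.
by rewrite -mulmxA WX mulmx0.
Qed.

(** For X = A - B, equality of the squares gives (A + B) X = - X (A + B), hence tr (X (A + B) X) =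
    0. Both summands are nonnegative, so A X = B X = 0 and X^2 = 0. *)
Lemma psd_sqrt_unique n (A B : 'M[C]_n) : psd A -> psd B -> A *m A = B *m B -> A = B.
Proof.
move=> pA pB AB; pose X := A - B.
have Xh : X ^t* = X by rewrite trCB pA.1 pB.1.
have XAB : (A + B) *m X = - (X *m (A + B)).
  rewrite /X !(mulmxDl, mulmxDr, mulmxN, mulNmx) AB.
  by mx_entries; ring.
have trX : \tr (X *m (A + B) *m X) = 0.
  have H : \tr (X *m (A + B) *m X) = - \tr (X *m (A + B) *m X).
    by rewrite -{1}mulmxA XAB mulmxN raddfN /= mxtrace_mulC.
  by apply/eqP; move/eqP: H; rewrite -addr_eq0 -mulr2n mulrn_eq0.
have trA := psd_tr X pA; have trB := psd_tr X pB.
rewrite Xh in trA trB; rewrite (mulmxDr X A B) (mulmxDl (X *m A)) mxtraceD in trX.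
have tA : \tr (X ^t* *m A *m X) = 0.
  rewrite Xh; apply: le_anti; rewrite trA andbT -[leRHS]trX lerDl; exact: trB.
have tB : \tr (X ^t* *m B *m X) = 0.
  rewrite Xh; apply: le_anti; rewrite trB andbT -[leRHS]trX lerDr; exact: trA.
apply/eqP; rewrite -subr_eq0; apply/eqP/gram_eq0.
by rewrite Xh {1}/X mulmxBl (psd_ker pA tA) (psd_ker pB tB) subr0.
Qed.

Lemma sqrtmx_unique n (A B : 'M[C]_n) : psd B -> B *m B = A -> sqrtmx A = B.
Proof.
move=> pB BA; apply: xget_unique => // B' [pB' BA'].
by apply: psd_sqrt_unique; rewrite // BA.
Qed.

Lemma sqrtmx_pdef n (c : C) (A : 'M[C]_n) : 0 <= c -> pdef c A ->
  pdef (sqrtC c) (sqrtmx A) /\ sqrtmx A *m sqrtmx A = A.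
Proof.
move=> c0 cA; have [B [cB BA]] := pdef_sqrt c0 cA.
have s0 : 0 <= sqrtC c by rewrite sqrtC_ge0; exact: c0.
rewrite (sqrtmx_unique (pdef_psd s0 cB) BA); exact: conj cB BA.
Qed.

(** Pairing A X + X B with X produces tr (X^* A X), bounded below by c, and a nonnegative term: the
    Sylvester operator is coercive as soon as one of its coefficients is. *)
Lemma sylvester_ge n p (c : C) (A : 'M[C]_n) (B : 'M[C]_p) (X : 'M[C]_(n, p)) :
  pdef c A -> psd B -> c * \tr (X ^t* *m X) <= \tr (X ^t* *m (A *m X + X *m B)).
Proof.
move=> cA pB; rewrite mulmxDr mxtraceD !mulmxA.
have H : \tr (X ^t* *m X *m B) = \tr (X ^t* ^t* *m B *m X ^t*).
  by rewrite trCK mxtrace_mulC mulmxA mxtrace_mulC mulmxA.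
rewrite H -[leLHS]addr0; apply: lerD; first exact: pdef_tr.
exact: psd_tr.
Qed.

Lemma sylvester_inj n p (c : C) (A : 'M[C]_n) (B : 'M[C]_p) (X : 'M[C]_(n, p)) :
  0 < c -> pdef c A -> psd B -> A *m X + X *m B = 0 -> X = 0.
Proof.
move=> c0 cA pB AX; apply: gram_tr_eq0; apply/eqP.
have := sylvester_ge X cA pB; rewrite AX mulmx0 mxtrace0 pmulr_rle0 // => H.
by rewrite eq_le H gram_tr_ge0.
Qed.

(** The commutator Y of M and A solves A Y + Y A = 0, because M commutes with A^2. *)
Lemma pdef_comm n (c : C) (A M : 'M[C]_n) : 0 < c -> pdef c A ->
  M *m (A *m A) = A *m A *m M -> M *m A = A *m M.
Proof.
move=> c0 cA MA; apply/eqP; rewrite -subr_eq0; apply/eqP.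
apply: (sylvester_inj c0 cA (pdef_psd (ltW c0) cA)).
rewrite mulmxBr mulmxBl !mulmxA in MA *; rewrite MA.
by mx_entries; ring.
Qed.

End Hermitian.

(** * Smoothness of matrix inversion *)

Section InverseSqrt.
Context {R : realType}.
Local Notation C := R[i].
Local Notation rmx := (@Defs.rmx R).
Implicit Types E F G H : normedModType R.

Lemma ReD (a b : C) : complex.Re (a + b) = complex.Re a + complex.Re b.
Proof. by case: a => ? ?; case: b. Qed.

Lemma Re_realM (k : R) (a : C) : complex.Re (k%:C%C * a) = k * complex.Re a.
Proof. by case: a => x y /=; rewrite mul0r subr0. Qed.

Lemma trRe_linear p q (B : 'M[C]_(q, p)) :
  scalar (fun v : rmx p q => complex.Re (\tr (ofreim v *m B))).
Proof.
move=> k u v; rewrite ofreim_linear mulmxDl -scalemxAl mxtraceD mxtraceZ.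
by rewrite ReD Re_realM.
Qed.

Lemma retr_continuous E n (f : E -> 'M[C]_n) x :
  {for x, continuous (fun x => reim (f x))} ->
  {for x, continuous (fun x => complex.Re (\tr (f x)) : R^o)}.
Proof.
move=> cf.
have cL : continuous (fun v : rmx n n => complex.Re (\tr (ofreim v *m 1%:M)) : R^o).
  by apply: findim_linear; [exact: findim_rmx|exact: trRe_linear].
have -> : (fun x => complex.Re (\tr (f x)) : R^o) =
    (fun v : rmx n n => complex.Re (\tr (ofreim v *m 1%:M)) : R^o) \o (fun x => reim (f x)).
  by apply/funext => y /=; rewrite reimK mulmx1.
by apply: continuous_comp; [exact: cf|exact: cL].
Qed.

Lemma gram_tr_real p q (X : 'M[C]_(p, q)) :
  \tr (X ^t* *m X) = (complex.Re (\tr (X ^t* *m X)))%:C%C.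
Proof. by rewrite RRe_real // ger0_real // gram_tr_ge0. Qed.

(** The ambient normed space carries the maximum norm of the real and imaginary entries, whereas the
    estimates on positive matrices come in the Hilbert-Schmidt norm; this bounds the former by the
    latter. *)
Lemma norm_le_gram p q (u : rmx p q) (r : R) : 0 <= r ->
  complex.Re (\tr ((ofreim u) ^t* *m ofreim u)) <= r ^+ 2 -> `|u| <= r.
Proof.
move=> r0 ur.
have E i j : u.1 i j ^+ 2 + u.2 i j ^+ 2 <= r ^+ 2.
  apply: le_trans ur; rewrite -lecR -gram_tr_real.
  apply: le_trans (gram_tr_entry (ofreim u) i j).
  rewrite -add_Re2_Im2 lecR !mxE /=; simpc => /=.
  exact: lexx.
have B (A : 'M[R]_(p, q)) : (forall i j, A i j ^+ 2 <= r ^+ 2) -> `|A| <= r.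
  move=> Ar; rewrite /Num.Def.normr /= mx_normrE bigmax_le // => -[i j] _ /=.
  by rewrite -(ler_pXn2r (n := 2)) ?nnegrE // real_normK ?num_real.
rewrite /Num.Def.normr /= ge_max !B // => i j.
  by apply: le_trans (E i j); rewrite lerDr sqr_ge0.
by apply: le_trans (E i j); rewrite lerDl sqr_ge0.
Qed.

Lemma mulmx_bounded p q r : exists2 M : R, 0 < M &
  forall (A : 'M[C]_(p, q)) (B : 'M[C]_(q, r)), `|reim (A *m B)| <= M * `|reim A| * `|reim B|.
Proof.
pose B (u : rmx p q) (v : rmx q r) : rmx p r := reim (ofreim u *m ofreim v).
have [l1 l2] := @cbilinear_mulmx R p q r.
have lB1 u : linear (B u) by apply: (rlinear_linear (l1 _)).
have lB2 v : linear (B ^~ v) by apply: (rlinear_linear (l2 _)).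
have lB : bilinear_for *:%R *:%R B by split=> y; [apply: lB2|apply: lB1].
pose fB := @bilinear_isBilinear.Build R _ _ _ *:%R *:%R B lB.
pose BB : {bilinear rmx p q -> rmx q r -> rmx p r} := HB.pack B fB.
have cB : continuous (fun p => BB p.1 p.2).
  by apply: findim_bilinear => //; apply: findim_rmx.
have [M M0 BM] := bilinear_schwarz cB.
by exists M => // X Y; have := BM (reim X) (reim Y); rewrite /= /B !reimK.
Qed.

Lemma invmx_sub n (A B : 'M[C]_n) : A \in unitmx -> B \in unitmx ->
  invmx B - invmx A = - (invmx B *m (B - A) *m invmx A).
Proof.
by move=> Au Bu; rewrite mulmxBr mulVmx // mulmxBl mul1mx mulmxK // opprB.
Qed.

Lemma reimN p q (A : 'M[C]_(p, q)) : reim (- A) = - reim A.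
Proof. by apply: (can_inj (@ofreimK R p q)); rewrite ofreimN !reimK. Qed.

Lemma reimB p q (A B : 'M[C]_(p, q)) : reim (A - B) = reim A - reim B.
Proof. by rewrite reimD reimN. Qed.

Lemma le_half_add (a b : R) : a <= b + 2^-1 * a -> a <= 2 * b.
Proof. by lra. Qed.

Lemma le_half_le0 (a : R) : a <= 2^-1 * a -> a <= 0.
Proof. by lra. Qed.

Lemma mulr_regroup (M a b c : R) : M * a * (M * b * c) = M * M * a * b * c.
Proof. by ring. Qed.

Lemma mulr_regroup' (M a b c : R) : M * a * (M * b * c) = M * M * a * c * b.
Proof. by ring. Qed.

Definition units n : set (rmx n n) := [set v | ofreim v \in unitmx].

(** Near v the map X -> X h v^{-1}, with h = w - v, has norm at most 1/2. This excludes a left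
    kernel of w and, through the resolvent identity, bounds the inverse of w by twice that of v; the
    Lipschitz estimate follows. *)
Lemma units_near n (v : rmx n n) : units v ->
  exists2 M : R, 0 < M & \forall w \near v, units w /\
    `|reim (invmx (ofreim w)) - reim (invmx (ofreim v))| <= M * `|w - v|.
Proof.
move=> vU; have [M M0 BM] := mulmx_bounded n n n.
pose y := invmx (ofreim v); rewrite -/y.
(* [K] times the norm of h bounds X -> X h y; [M] enters twice, once for each of the two
   products. *)
pose K := M * M * `|reim y|.
have K0 : 0 <= K by rewrite !mulr_ge0 // ltW.
pose L := K * (2 * `|reim y|) + 1.
have L0 : 0 < L by apply: ltr_wpDl ltr01; apply: mulr_ge0 K0 _; apply: mulr_ge0.
exists L => //.
have e0 : 0 < (2 * (K + 1))^-1 by rewrite invr_gt0 mulr_gt0 // ltr_wpDl.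
have nb : \forall w \near v, `|v - w| < (2 * (K + 1))^-1.
  by apply/nbhs_ballP; exists (2 * (K + 1))^-1 => //= w; rewrite -ball_normE.
apply: filterS nb => w vw.
have Kw : K * `|w - v| <= 2^-1.
  rewrite distrC in vw; apply: (@le_trans _ _ ((K + 1) * (2 * (K + 1))^-1)).
    by apply: ler_pM => //; [rewrite lerDl|exact: ltW].
  by rewrite invfM mulrCA mulfV ?mulr1 // gt_eqF // ltr_wpDl.
pose h := ofreim w - ofreim v.
have hE : reim h = w - v by rewrite /h -ofreimB ofreimK.
have bd (X : 'M[C]_n) : `|reim (X *m h *m y)| <= 2^-1 * `|reim X|.
  apply: le_trans (BM _ _) _; rewrite mulrAC.
  apply: (@le_trans _ _ (M * `|reim y| * (M * `|reim X| * `|reim h|))).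
    by apply: ler_wpM2l (BM _ _); rewrite mulr_ge0 // ltW.
  by rewrite hE mulr_regroup'; apply: ler_wpM2r.
have wU : ofreim w \in unitmx.
  rewrite -row_free_unit -kermx_eq0; apply/eqP.
  (* A left kernel X of w satisfies X = - X h y, so its norm is at most half of itself. *)
  set X := kermx _; have Xw : X *m ofreim w = 0 by apply: mulmx_ker.
  have XE : X = - (X *m h *m y).
    by rewrite /h mulmxBr Xw sub0r mulNmx opprK mulmxK.
  have : `|reim X| <= 2^-1 * `|reim X|.
    by rewrite {1}XE reimN normrN; apply: bd.
  move=> /le_half_le0; rewrite normr_le0 => H.
  by apply: (@reim_inj R n n); rewrite (eqP H) reim0.
split=> //.
pose y' := invmx (ofreim w); rewrite -/y'.
have dE : reim y' - reim y = - reim (y' *m h *m y).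
  by rewrite -reimB (invmx_sub vU wU) reimN.
have y'2 : `|reim y'| <= 2 * `|reim y|.
  have : `|reim y'| <= `|reim y| + 2^-1 * `|reim y'|.
    rewrite -[X in `|X| <= _](subrK (reim y)) dE addrC.
    apply: (le_trans (ler_normD _ _)); rewrite lerD2l normrN; exact: bd.
  exact: le_half_add.
rewrite dE normrN; apply: (@le_trans _ _ (K * `|reim y'| * `|w - v|)).
  have <- : M * `|reim y| * (M * `|reim y'| * `|reim h|) = K * `|reim y'| * `|w - v|.
    by rewrite -hE; apply: mulr_regroup.
  apply: le_trans (BM _ _) _; rewrite mulrAC.
  by apply: ler_wpM2l (BM _ _); rewrite mulr_ge0 // ltW.
apply: ler_wpM2r => //; rewrite /L.
apply: (@le_trans _ _ (K * (2 * `|reim y|))); last by rewrite lerDl.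
exact: ler_wpM2l.
Qed.

Lemma open_units n : open (@units n).
Proof.
rewrite openE => v vU; have [M M0 H] := units_near vU.
by apply: filterS H => w [].
Qed.

Lemma inv_continuous n (v : rmx n n) : units v ->
  {for v, continuous (fun w : rmx n n => reim (invmx (ofreim w)))}.
Proof.
move=> vU; have [M M0 H] := units_near vU.
apply/cvgrPdist_lt => e e0.
have nb : \forall w \near v, `|v - w| < e / M.
  apply/nbhs_ballP; exists (e / M); first exact: divr_gt0.
  by move=> w; rewrite -ball_normE.
apply: filterS2 H nb => w [_ wM] we; rewrite distrC.
by apply: (le_lt_trans wM); rewrite mulrC -ltr_pdivlMr // distrC.
Qed.

(** The resolvent identity is a Hadamard factorization of the increment, and the resulting equation
    d phi (v) = - phi v phi is polynomial in phi, so [Sm_ode] applies. *)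
Lemma csmooth_inv_units n : csmooth (@units n) (fun w => invmx (ofreim w)).
Proof.
pose phi (w : rmx n n) : rmx n n := reim (invmx (ofreim w)).
pose Psi (p : (rmx n n * rmx n n)%type) : rmx n n :=
  reim (- (ofreim p.1 *m ofreim p.2 *m ofreim p.1)).
have SPsi j : Sm j setT Psi.
  have S1 : csmooth setT (fun p : (rmx n n * rmx n n)%type => ofreim p.1).
    by apply: csmooth_lin => k; apply: Sm_fst.
  have S2 : csmooth setT (fun p : (rmx n n * rmx n n)%type => ofreim p.2).
    by apply: csmooth_lin => k; apply: Sm_snd.
  have oT := @openT (rmx n n * rmx n n)%type.
  exact: (csmoothN oT (csmoothM oT (csmoothM oT S1 S2) S1) j).
move=> k; apply: (@Sm_ode R k _ _ (@units n) setT phi Psi (@open_units n) openT) => // x xU.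
pose B (u v : rmx n n) : rmx n n := reim (- (ofreim u *m ofreim v *m invmx (ofreim x))).
have lB1 u : linear (B u).
  apply: (@rlinear_linear R n n n n (fun v => - (ofreim u *m v *m invmx (ofreim x)))).
  by move=> a X Y; rewrite mulmxDr mulmxDl opprD -scalemxAr -scalemxAl scalerN.
have lB2 v : linear (B ^~ v).
  apply: (@rlinear_linear R n n n n (fun u => - (u *m ofreim v *m invmx (ofreim x)))).
  by move=> a X Y; rewrite !mulmxDl opprD -!scalemxAl scalerN.
have cB : continuous (fun p : rmx n n * rmx n n => B p.1 p.2).
  by apply: findim_bilinear => //; apply: findim_rmx.
have phiE : \forall y \near x, phi y - phi x = B (phi y) (y - x).
  apply: filterS (open_near (@open_units n) xU) => y yU.
  by rewrite /B /phi reimK ofreimB -reimB (invmx_sub xU yU).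
have -> : (fun v => Psi (phi x, v)) = B (phi x).
  by apply/funext => v; rewrite /Psi /B /phi reimK.
exact: (@hadamard R _ _ _ phi phi B x lB1 lB2 cB (inv_continuous xU) phiE).
Qed.

Lemma csmooth_inv E n (U : set E) (f : E -> 'M[C]_n) : open U ->
  (forall x, U x -> f x \in unitmx) -> csmooth U f -> csmooth U (fun x => invmx (f x)).
Proof.
move=> oU fU sf.
have H : csmooth U (fun x => invmx (ofreim (reim (f x)))).
  apply: (csmooth_comp oU (@open_units n) _ (@csmooth_inv_units n) sf) => x Ux.
  by rewrite /units /= reimK; apply: fU.
by apply: csmooth_ext H => // x _; rewrite reimK.
Qed.

End InverseSqrt.

(** * Smoothness of the positive square root *)

Section Sqrt.
Context {R : realType}.
Local Notation C := R[i].
Local Notation rmx := (@Defs.rmx R).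
Implicit Types E F G H : normedModType R.

(** Every eigenvalue is bounded in modulus by the Hilbert-Schmidt norm. *)
Lemma diag_herm_bound n (B : 'M[C]_n) (d : C) : 0 <= d -> B ^t* = B ->
  \tr (B ^t* *m B) <= d ^+ 2 -> pdef (- d) B.
Proof.
move=> d0 Bh; have [P [e [P1 P1' BE]]] := spectral_hermitian Bh.
move=> trB; split=> // x.
have eh : (diag_mx e) ^t* = diag_mx e.
  have : P *m B *m P ^t* = diag_mx e.
    by rewrite BE !mulmxA P1 mul1mx -mulmxA P1 mulmx1.
  by move=> <-; rewrite !trCM trCK Bh mulmxA.
have eb i : - d <= e 0 i.
  have er : e 0 i \is Num.real.
    apply/CrealP; have := congr1 (fun M : 'M[C]_n => M i i) eh.
    by rewrite !mxE eqxx !mulr1n.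
  suff : `|e 0 i| <= d by rewrite real_ler_norml // => /andP[].
  have nd : `|e 0 i| \is Num.nneg by rewrite nnegrE.
  have dn : d \is Num.nneg by rewrite nnegrE.
  rewrite -(ler_pXn2r (n := 2)) //.
  apply: le_trans trB.
  have -> : \tr (B ^t* *m B) = \tr ((diag_mx e) ^t* *m diag_mx e).
    by rewrite Bh BE (sandwich_mul _ P1) mxtrace_mulC (mulmxA P) P1 mul1mx eh.
  have := gram_tr_entry (diag_mx e) i i.
  by rewrite {1}mxE eqxx mulr1n.
have -> : x ^t* *m x = (P *m x) ^t* *m (P *m x).
  by rewrite trCM mulmxA -(mulmxA _ (P ^t*)) P1' mulmx1.
rewrite {1}BE; have -> : x ^t* *m (P ^t* *m diag_mx e *m P) *m x =
    (P *m x) ^t* *m diag_mx e *m (P *m x) by rewrite trCM !mulmxA.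
rewrite gram_diagE diag_formE mulr_sumr; apply: ler_sum => i _.
by apply: ler_wpM2r => //; apply: exprn_ge0.
Qed.

Lemma pdefD n (c d : C) (A B : 'M[C]_n) : pdef c A -> pdef d B -> pdef (c + d) (A + B).
Proof.
move=> [Ah Ac] [Bh Bd]; split; first by rewrite trCD Ah Bh.
move=> x; rewrite mulmxDr mulmxDl mulrDl [X in _ <= X]mxE.
by apply: lerD; [apply: Ac|apply: Bd].
Qed.

Lemma gram_quadE (K : comNzRingType) (s a b c : K) :
  c - s ^+ 2 * a = (s * (s * a - b) - (s * b - c)) + 2 * (s * b - s * (s * a)).
Proof. by ring. Qed.

Lemma mxtraceB (K : pzRingType) n (A B : 'M[K]_n) : \tr (A - B) = \tr A - \tr B.
Proof. exact: raddfB. Qed.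

Lemma mxtrace_quadE (K : comPzRingType) n (s : K) (A B D E : 'M[K]_n) :
  \tr (s *: (s *: A - B) - (s *: D - E)) = s * (s * \tr A - \tr B) - (s * \tr D - \tr E).
Proof. by rewrite mxtraceB mxtraceZ mxtraceB mxtraceZ mxtraceB mxtraceZ. Qed.

(** The inverse of the Sylvester operator has Hilbert-Schmidt norm at most 1/s. This is
    [sylvester_ge] followed by Cauchy-Schwarz, the latter obtained by expanding the squared norm of
    s X - h. *)
Lemma sylvester_bound n p (s : C) (A : 'M[C]_n) (B : 'M[C]_p) (X : 'M[C]_(n, p)) :
  0 < s -> pdef s A -> psd B ->
  s ^+ 2 * \tr (X ^t* *m X) <= \tr ((A *m X + X *m B) ^t* *m (A *m X + X *m B)).
Proof.
move=> s0 sA pB; set h := A *m X + X *m B.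
have H := sylvester_ge X sA pB; rewrite -/h in H.
have sr : (s^*)%C = s by apply/CrealP; apply: gtr0_real.
have tr1 : \tr (h ^t* *m X) = \tr (X ^t* *m h).
  have -> : \tr (h ^t* *m X) = (\tr (X ^t* *m h))^*%C by rewrite -mxtraceC trCM trCK.
  apply/CrealP; rewrite ger0_real //; apply: le_trans H.
  by apply: mulr_ge0; [exact: ltW|exact: gram_tr_ge0].
have := gram_tr_ge0 (s *: X - h).
have -> : (s *: X - h) ^t* *m (s *: X - h) =
    s *: (s *: (X ^t* *m X) - X ^t* *m h) - (s *: (h ^t* *m X) - h ^t* *m h).
  rewrite trCB trCZ sr mulmxBl (mulmxBr (s *: _)) (mulmxBr (h ^t*)).
  by rewrite -(scalemxAl s) -(scalemxAl s _ h) -scalemxAr -(scalemxAr _ (h ^t*)) -scalerBr.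
rewrite mxtrace_quadE tr1.
move=> K; have K2 := ler_wpM2l (ltW s0) H.
rewrite -subr_ge0; set a := \tr (X ^t* *m X) in K K2 *.
set b := \tr (X ^t* *m h) in K K2 *; set c := \tr (h ^t* *m h) in K *.
have K3 : 0 <= 2 * (s * b - s * (s * a)).
  by apply: mulr_ge0; [exact: ler0n|rewrite subr_ge0].
by rewrite (gram_quadE s a b c); apply: addr_ge0 K K3.
Qed.

(** The Hermitian part. Composing the square root with it gives a map on an open set of all
    matrices, on which differentiability makes sense; Hermitian matrices alone have empty interior
    in positive size. *)
Definition herm n (A : 'M[C]_n) : 'M[C]_n := 2^-1 *: (A + A ^t*).

Lemma rlinear_herm n : rlinear (@herm n).
Proof.
move=> k A B; rewrite /herm trCD trCZ conjc_real addrACA -scalerDr.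
by rewrite (scalerDr 2^-1) !scalerA [k%:C%C * _]mulrC.
Qed.

Lemma hermB n (A B : 'M[C]_n) : herm (A - B) = herm A - herm B.
Proof. by rewrite /herm trCB addrACA -opprD scalerBr. Qed.

Lemma half_real : conjc (2^-1 : C) = 2^-1.
Proof. by rewrite conjc_inv conjc_nat. Qed.

Lemma half_twice (V : lmodType C) (v : V) : (2^-1 : C) *: (v + v) = v.
Proof.
have h2 : (2^-1 + 2^-1 : C) = 1 by rewrite -[2^-1]mulr1 -mulrDr -[1 + 1]/(2%:R) mulVf // pnatr_eq0.
by rewrite scalerDr -scalerDl h2 scale1r.
Qed.

Lemma herm_trC n (A : 'M[C]_n) : (herm A) ^t* = herm A.
Proof. by rewrite /herm trCZ half_real trCD trCK addrC. Qed.

Lemma herm_id n (A : 'M[C]_n) : A ^t* = A -> herm A = A.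
Proof. by move=> Ah; rewrite /herm Ah half_twice. Qed.

Definition pdset n : set (rmx n n) :=
  [set v | exists2 c : R, 0 < c & pdef c%:C%C (herm (ofreim v))].

Lemma near_lt E (f : E -> R^o) x (e : R) : {for x, continuous f} -> f x = 0 ->
  0 < e -> \forall y \near x, f y < e.
Proof.
move=> cf f0 e0; have /cvgrPdist_lt /(_ _ e0) := cf; rewrite f0.
by apply: filterS => y; rewrite sub0r normrN; apply: le_lt_trans (ler_norm _).
Qed.

Lemma gram_small n (v : rmx n n) (e : R) : 0 < e ->
  \forall w \near v, \tr ((herm (ofreim (w - v))) ^t* *m herm (ofreim (w - v))) <= (e%:C%C) ^+ 2.
Proof.
move=> e0.
pose f (w : rmx n n) := (herm (ofreim (w - v))) ^t* *m herm (ofreim (w - v)).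
have cf : {for v, continuous (fun w => reim (f w))}.
  have S0 : csmooth setT (fun w => herm (ofreim (w - v))).
    apply: (csmooth_rlinear openT (@rlinear_herm n)).
    apply: (@csmooth_ext _ _ _ _ _ (fun w => ofreim w - ofreim v) _ openT).
      by move=> x _; rewrite ofreimB.
    by apply: (csmoothB openT); [exact: csmooth_id|exact: csmooth_cst].
  have S1 := csmoothM openT (csmooth_trC openT S0) S0.
  exact: (Sm_cont (S1 0%N)).
have c1 := retr_continuous cf.
have f0 : complex.Re (\tr (f v)) = 0.
  by rewrite /f subrr ofreim0 /herm trC0 addr0 scaler0 trC0 mul0mx mxtrace0.
have e2 : 0 < e ^+ 2 by apply: exprn_gt0.
apply: filterS (near_lt c1 f0 e2) => w H.
by rewrite gram_tr_real -rmorphXn lecR ltW.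
Qed.

(** A Hermitian perturbation of Hilbert-Schmidt norm at most c/2 lowers the bound c by at most
    c/2. *)
Lemma open_pdset n : open (@pdset n).
Proof.
rewrite openE => v [c c0 cA].
have c2 : 0 < c / 2 by apply: divr_gt0.
have := gram_small v c2; apply: filterS => w wv.
exists (c / 2); first exact: c2.
have c2' : 0 <= (c / 2)%:C%C by rewrite ler0c ltW.
have pB := diag_herm_bound c2' (herm_trC _) wv.
have -> : (c / 2)%:C%C = c%:C%C + - (c / 2)%:C%C.
  by rewrite -rmorphB; congr (_%:C)%C; lra.
have -> : herm (ofreim w) = herm (ofreim v) + herm (ofreim (w - v)).
  by rewrite ofreimB hermB addrC subrK.
exact: pdefD.
Qed.

Lemma ltr0c (c : R) : (0 < c%:C%C) = (0 < c).
Proof. exact: (ltcR 0 c). Qed.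

Definition hsqrt n (v : rmx n n) : rmx n n := reim (sqrtmx (herm (ofreim v))).

Lemma hsqrtP n (v : rmx n n) : pdset v -> exists2 s : R, 0 < s &
  pdef s%:C%C (ofreim (hsqrt v)) /\ ofreim (hsqrt v) *m ofreim (hsqrt v) = herm (ofreim v).
Proof.
move=> [c c0 cA]; have c0' : 0 < c%:C%C by rewrite ltr0c.
have s0 : 0 < sqrtC c%:C%C by rewrite sqrtC_gt0.
have sE : (complex.Re (sqrtC c%:C%C))%:C%C = sqrtC c%:C%C.
  by rewrite RRe_real // gtr0_real.
exists (complex.Re (sqrtC c%:C%C)); first by rewrite -ltr0c sE.
by rewrite sE /hsqrt reimK; apply: sqrtmx_pdef (ltW c0') cA.
Qed.

Lemma mulmx_sqrB n (A B : 'M[C]_n) :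
  B *m B - A *m A = A *m (B - A) + (B - A) *m B.
Proof. by rewrite mulmxBl mulmxBr [RHS]addrC addrA subrK. Qed.

(** The increment of the root solves a Sylvester equation whose right-hand side is linear in the
    increment of the argument, with one coefficient at each end point. *)
Lemma hsqrt_diff n (v w : rmx n n) : pdset v -> pdset w ->
  herm (ofreim (w - v)) =
  ofreim (hsqrt v) *m (ofreim (hsqrt w) - ofreim (hsqrt v)) +
  (ofreim (hsqrt w) - ofreim (hsqrt v)) *m ofreim (hsqrt w).
Proof.
move=> /hsqrtP [s _ [_ vE]] /hsqrtP [t _ [_ wE]].
rewrite ofreimB hermB -vE -wE; exact: mulmx_sqrB.
Qed.

(** In [sylvester_bound] only the root at the base point v needs a positive lower bound s, so the
    estimate is uniform in w. *)
Lemma hsqrt_continuous n (v : rmx n n) : pdset v -> {for v, continuous (@hsqrt n)}.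
Proof.
move=> vP; have [s s0 [sv vE]] := hsqrtP vP.
have s0' : 0 < s%:C%C by rewrite ltr0c.
apply/cvgrPdist_lt => e e0.
have es : 0 < e / 2 * s by apply: mulr_gt0 => //; apply: divr_gt0.
apply: filterS2 (gram_small v es) (open_near (@open_pdset n) vP) => w wv wP.
have e2 : 0 <= e / 2 by apply: ltW; apply: divr_gt0.
rewrite distrC; apply: (@le_lt_trans _ _ (e / 2)); last first.
  by rewrite ltr_pdivrMr // mulr_natr mulr2n ltrDl.
apply: norm_le_gram e2 _.
have [t t0 [tw _]] := hsqrtP wP; rewrite -ltr0c in t0.
have := @sylvester_bound n n s%:C%C _ _ (ofreim (hsqrt w) - ofreim (hsqrt v)) s0' sv (pdef_psd (ltW t0) tw).
rewrite -hsqrt_diff // -ofreimB => /le_trans /(_ wv).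
rewrite gram_tr_real -!rmorphXn -rmorphM lecR exprMn mulrC.
by rewrite ler_pM2r // exprn_gt0.
Qed.

(** The operator X -> A X + X B as a matrix acting on vectorized matrices, so that smooth dependence
    of its inverse reduces to matrix inversion. *)
Definition sylv n (A B : 'M[C]_n) : 'M[C]_(n * n) := lin_mulmx A + lin_mulmxr B.

Lemma sylvE n (A B X : 'M[C]_n) : mxvec X *m sylv A B = mxvec (A *m X + X *m B).
Proof. by rewrite mulmxDr !mul_vec_lin /= linearD. Qed.

Lemma sylv_unit n (s : R) (A B : 'M[C]_n) : 0 < s -> pdef s%:C%C A -> psd B ->
  sylv A B \in unitmx.
Proof.
rewrite -ltr0c => s0 sA pB; rewrite -row_free_unit -kermx_eq0; apply/eqP/row_matrixP => i.
rewrite row0; have : row i (kermx (sylv A B)) *m sylv A B = 0.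
  by rewrite -row_mul mulmx_ker row0.
rewrite -[row i _]vec_mxK sylvE => /eqP; rewrite mxvec_eq0 => /eqP.
by move=> /(sylvester_inj s0 sA pB) ->; rewrite linear0.
Qed.

Definition sylv_inv n (A B Y : 'M[C]_n) : 'M[C]_n := vec_mx (mxvec Y *m invmx (sylv A B)).

Lemma sylv_invP n (A B X : 'M[C]_n) : sylv A B \in unitmx ->
  sylv_inv A B (A *m X + X *m B) = X.
Proof. by move=> u; rewrite /sylv_inv -sylvE mulmxK // mxvecK. Qed.

Lemma sylv_invK n (A B Y : 'M[C]_n) : sylv A B \in unitmx ->
  A *m sylv_inv A B Y + sylv_inv A B Y *m B = Y.
Proof.
move=> u; apply: (can_inj mxvecK); rewrite -sylvE /sylv_inv vec_mxK.
by rewrite mulmxKV.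
Qed.

Lemma csmooth_sylv E n (U : set E) (f g : E -> 'M[C]_n) : open U ->
  csmooth U f -> csmooth U g -> csmooth U (fun x => sylv (f x) (g x)).
Proof.
move=> oU sf sg; apply: csmoothD => //.
  apply: (csmooth_rlinear oU (L := @lin_mulmx C n n n)) => // k A B.
  by rewrite linearP.
apply: (csmooth_rlinear oU (L := @lin_mulmxr C n n n)) => // k A B.
by rewrite linearP.
Qed.

Lemma cbilinear_vec n : cbilinear (fun (Y : 'M[C]_n) (K : 'M[C]_(n * n)) => vec_mx (mxvec Y *m K)).
Proof.
split=> [Y|K] k A B; first by rewrite mulmxDr -scalemxAr linearP.
by rewrite linearP mulmxDl -scalemxAl linearP.
Qed.

(** The derivative of the root at a matrix with root S is the inverse of X -> S X + X S, which
    depends smoothly on S. The Hadamard factor [K] at w is the inverse of the Sylvester operator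
    with coefficients the roots of v and of w. *)
Lemma csmooth_hsqrt n : csmooth (@pdset n) (fun v => sqrtmx (herm (ofreim v))).
Proof.
pose W : set (rmx n n * rmx n n)%type := [set p | sylv (ofreim p.1) (ofreim p.1) \in unitmx].
pose Psi (p : (rmx n n * rmx n n)%type) : rmx n n :=
  reim (sylv_inv (ofreim p.1) (ofreim p.1) (herm (ofreim p.2))).
have oT := @openT (rmx n n * rmx n n)%type.
have S1 : csmooth setT (fun p : (rmx n n * rmx n n)%type => ofreim p.1).
  by apply: csmooth_lin => k; apply: Sm_fst.
have S2 : csmooth setT (fun p : (rmx n n * rmx n n)%type => ofreim p.2).
  by apply: csmooth_lin => k; apply: Sm_snd.
have SS := csmooth_sylv oT S1 S1.
have oW : open W.
  have -> : W = (fun p : (rmx n n * rmx n n)%type =>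
      reim (sylv (ofreim p.1) (ofreim p.1))) @^-1` (@units R (n * n)).
    by apply/seteqP; split=> p; rewrite /W /units /= reimK.
  apply: open_comp; last exact: open_units.
  by move=> p _; apply: (Sm_cont (SS 0%N)).
have SPsi j : Sm j W Psi.
  have SW : csmooth W (fun p => invmx (sylv (ofreim p.1) (ofreim p.1))).
    by apply: csmooth_inv => //; apply: csmooth_sub SS.
  have Sh : csmooth W (fun p => herm (ofreim p.2)).
    apply: (csmooth_rlinear oW (@rlinear_herm n)); exact: csmooth_sub S2.
  exact: (csmooth_cbilinear oW (@cbilinear_vec n) Sh SW j).
have pP v : pdset v -> sylv (ofreim (hsqrt v)) (ofreim (hsqrt v)) \in unitmx.
  by move=> /hsqrtP [s s0 [sv _]]; apply: (sylv_unit s0 sv); apply: pdef_psd sv; rewrite ler0c ltW.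
move=> k; apply: (@Sm_ode R k _ _ (@pdset n) W (@hsqrt n) Psi (@open_pdset n) oW SPsi) => [v w vP|v vP].
  exact: pP.
have [s s0 [sv _]] := hsqrtP vP.
pose K (w : rmx n n) : rmx (n * n) (n * n) :=
  reim (invmx (sylv (ofreim (hsqrt v)) (ofreim (hsqrt w)))).
pose B (k : rmx (n * n) (n * n)) (h : rmx n n) : rmx n n :=
  reim (vec_mx (mxvec (herm (ofreim h)) *m ofreim k)).
have lB1 u : linear (B u).
  move=> a x y; rewrite /B; have [_ l2] := @cbilinear_vec n.
  by rewrite ofreim_linear rlinear_herm (l2 (ofreim u)) reim_linear.
have lB2 h : linear (B ^~ h).
  by have [l1 _] := @cbilinear_vec n; apply: (rlinear_linear (l1 _)).
have cB : continuous (fun p : rmx (n * n) (n * n) * rmx n n => B p.1 p.2).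
  by apply: findim_bilinear => //; apply: findim_rmx.
have uw w : pdset w -> sylv (ofreim (hsqrt v)) (ofreim (hsqrt w)) \in unitmx.
  by move=> /hsqrtP [t t0 [tw _]]; apply: (sylv_unit s0 sv); apply: pdef_psd tw; rewrite ler0c ltW.
have cK : {for v, continuous K}.
  pose U : set (rmx n n) := [set y | sylv (ofreim (hsqrt v)) (ofreim y) \in unitmx].
  have S3 : csmooth setT (fun y => sylv (ofreim (hsqrt v)) (ofreim y)).
    by apply: csmooth_sylv; [exact: openT|exact: csmooth_cst|exact: csmooth_id].
  have oU : open U.
    have -> : U = (fun y : rmx n n =>
        reim (sylv (ofreim (hsqrt v)) (ofreim y))) @^-1` (@units R (n * n)).
      by apply/seteqP; split=> p; rewrite /U /units /= reimK.
    apply: open_comp; last exact: open_units.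
    by move=> p _; apply: (Sm_cont (S3 0%N)).
  have S4 : csmooth U (fun y => invmx (sylv (ofreim (hsqrt v)) (ofreim y))).
    by apply: csmooth_inv => //; apply: csmooth_sub S3.
  pose g (y : rmx n n) : rmx (n * n) (n * n) :=
    reim (invmx (sylv (ofreim (hsqrt v)) (ofreim y))).
  apply: (@continuous_comp _ _ _ (@hsqrt n) g); first exact: hsqrt_continuous.
  apply: (Sm_cont (S4 0%N)); exact: uw.
have phiE : \forall y \near v, hsqrt y - hsqrt v = B (K y) (y - v).
  apply: filterS (open_near (@open_pdset n) vP) => y yP.
  rewrite /B /K reimK (hsqrt_diff vP yP) -/(sylv_inv _ _ _) sylv_invP; last exact: uw.
  by move: (hsqrt y) (hsqrt v) => a b; rewrite -ofreimB ofreimK.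
have -> : (fun w => Psi (hsqrt v, w)) = B (K v).
  by apply/funext => h; rewrite /Psi /B /K reimK.
exact: (@hadamard R _ _ _ _ K B v lB1 lB2 cB cK phiE).
Qed.

Lemma csmooth_sqrt E n (U : set E) (f : E -> 'M[C]_n) : open U ->
  (forall x, U x -> exists2 c : R, 0 < c & pdef c%:C%C (herm (f x))) ->
  csmooth U f -> csmooth U (fun x => sqrtmx (herm (f x))).
Proof.
move=> oU fU sf.
have H : csmooth U (fun x => sqrtmx (herm (ofreim (reim (f x))))).
  apply: (csmooth_comp oU (@open_pdset n) _ (@csmooth_hsqrt n) sf) => x Ux.
  by rewrite /pdset /= reimK; apply: fU.
have fE : (fun x => sqrtmx (herm (f x))) = (fun x => sqrtmx (herm (ofreim (reim (f x))))).
  by apply/funext => x; rewrite reimK.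
by rewrite fE; exact: H.
Qed.

End Sqrt.

Ltac mx_ring := mx_entries; ring.

(** * The algebra of Phi *)

Section PolarAlgebra.
Context {R : realType} {n : nat}.
Local Notation C := R[i].
Local Notation M := 'M[C]_n.
Implicit Types E Z P eta : M.

(** For anti-Hermitian Z this is sqrt (1 - Z^2). Written with Z Z^* the argument is at least 1 for
    every matrix, so the formula is defined and smooth everywhere; [herm] acts trivially on it. *)
Definition Dmx Z : M := sqrtmx (herm (1%:M + Z *m Z ^t*)).

Lemma pdef1 : pdef 1 (1%:M : M).
Proof. by split; [rewrite trC1|move=> x; rewrite mulmx1 mul1r]. Qed.

Lemma pdef_one_gram Z : pdef 1 (1%:M + Z *m Z ^t*).
Proof.
have := pdefD pdef1 (psd_pdef (psd_gram (Z ^t*))).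
by rewrite addr0 trCK.
Qed.

Lemma herm_one_gram Z : herm (1%:M + Z *m Z ^t*) = 1%:M + Z *m Z ^t*.
Proof. by apply: herm_id; have [] := pdef_one_gram Z. Qed.

Lemma Dmx_pdef Z : pdef 1 (Dmx Z).
Proof.
rewrite /Dmx herm_one_gram; have [+ _] := sqrtmx_pdef ler01 (pdef_one_gram Z).
by rewrite sqrtC1.
Qed.

Lemma Dmx_sqr Z : Dmx Z *m Dmx Z = 1%:M + Z *m Z ^t*.
Proof. by rewrite /Dmx herm_one_gram; have [] := sqrtmx_pdef ler01 (pdef_one_gram Z). Qed.

Lemma Dmx_herm Z : (Dmx Z) ^t* = Dmx Z.
Proof. by have [] := Dmx_pdef Z. Qed.

Lemma Dmx_unit Z : Dmx Z \in unitmx.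
Proof. exact: pdef_unitmx ltr01 (Dmx_pdef Z). Qed.

Lemma Dmx_comm Z X : X *m (Z *m Z ^t*) = Z *m Z ^t* *m X -> X *m Dmx Z = Dmx Z *m X.
Proof.
move=> XZ; apply: (pdef_comm ltr01 (Dmx_pdef Z)).
by rewrite Dmx_sqr mulmxDr mulmxDl mulmx1 mul1mx XZ.
Qed.

Lemma mulmxN1_comm (A D : M) : D \in unitmx -> A *m D = D *m A ->
  A *m invmx D = invmx D *m A.
Proof.
move=> Du AD; apply: (can_inj (mulKmx Du)).
by rewrite mulKVmx // mulmxA -AD mulmxK.
Qed.

(* For an idempotent [E], the anti-Hermitian part [E - E^*] of the involution [2E - 1]
   and its Hermitian part [E + E^* - 1], whose sign is [2 Pi - 1]. *)
Definition PiE E : M := 2^-1 *: (1%:M + (E + E ^t* - 1%:M) *m invmx (Dmx (E - E ^t*))).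
Definition etaE E : M := PiE E *m (E - E ^t*).

Definition Eof P eta : M :=
  2^-1 *: (1%:M + (P + P - 1%:M) *m Dmx (eta - eta ^t*) + (eta - eta ^t*)).

(** A + Z is the involution 2 E - 1 split into its Hermitian and anti-Hermitian parts, and A = e D
    is the polar decomposition of A. Listing the relations lets later computations treat e, D and Z
    as abstract symbols. *)
Record polar E Z A D e : Prop := Polar {
  pZ : Z = E - E ^t*; pA : A = E + E ^t* - 1%:M;
  pE : E + E = 1%:M + A + Z;
  pD : D = Dmx Z;
  pZh : Z ^t* = - Z; peh : e ^t* = e; pDh : D ^t* = D; pDu : D \in unitmx;
  pAe : A = e *m D;
  pee : e *m e = 1%:M; peZ : Z *m e = - (e *m Z);
  pDe : D *m e = e *m D; pDZ : Z *m D = D *m Z; pDD : D *m D = 1%:M - Z *m Z;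
  pPi : PiE E = 2^-1 *: (1%:M + e) }.

Lemma trC_anti E : (E - E ^t*) ^t* = - (E - E ^t*).
Proof. by rewrite trCB trCK opprB. Qed.

Lemma invmx_trC (D : M) : D ^t* = D -> (invmx D) ^t* = invmx D.
Proof. by move=> Dh; rewrite trmx_inv map_invmx Dh. Qed.

(** Both A + Z and its adjoint A - Z square to 1, hence A^2 + Z^2 = 1 and A Z + Z A = 0. Then Z^2
    commutes with A and with Z, and so does the root D. *)
Lemma idem_polar E : E *m E = E -> exists Z A D e, polar E Z A D e.
Proof.
move=> EE.
have [Z ZE] : exists Z, Z = E - E ^t* by exists (E - E ^t*).
have [A AE] : exists A, A = E + E ^t* - 1%:M by exists (E + E ^t* - 1%:M).
have [D DE] : exists D, D = Dmx Z by exists (Dmx Z).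
have EE' : E ^t* *m E ^t* = E ^t* by rewrite -trCM EE.
have Zh : Z ^t* = - Z by rewrite ZE; exact: trC_anti.
have Ah : A ^t* = A by rewrite AE trCB trCD trCK trC1 [E ^t* + E]addrC.
have AZ : Z *m A = - (A *m Z).
  rewrite AE ZE !(mulmxDl, mulmxDr, mulmxN, mulNmx, mulmx1, mul1mx) EE EE'.
  mx_ring.
have AA : A *m A = 1%:M - Z *m Z.
  rewrite AE ZE !(mulmxDl, mulmxDr, mulmxN, mulNmx, mulmx1, mul1mx) EE EE'.
  mx_ring.
have Dh : D ^t* = D by rewrite DE Dmx_herm.
have Du : D \in unitmx by rewrite DE Dmx_unit.
have DD : D *m D = 1%:M - Z *m Z by rewrite DE Dmx_sqr Zh mulmxN.
have DC X : X *m (Z *m Z) = Z *m Z *m X -> X *m D = D *m X.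
  by move=> XZ; rewrite DE; apply: Dmx_comm; rewrite Zh !(mulmxN, mulNmx) XZ.
have DA : A *m D = D *m A.
  by apply: DC; rewrite mulmxA -(mulmxA Z Z) AZ mulmxN mulmxA AZ mulNmx opprK.
have DZ : Z *m D = D *m Z by apply: DC; rewrite mulmxA.
have iA := mulmxN1_comm Du DA; have iZ := mulmxN1_comm Du DZ.
have eh : (A *m invmx D) ^t* = A *m invmx D by rewrite trCM Ah (invmx_trC Dh) iA.
have ee : A *m invmx D *m (A *m invmx D) = 1%:M.
  by rewrite {1}iA -mulmxA (mulmxA A A) AA -DD mulmxK // mulVmx.
have eZ : Z *m (A *m invmx D) = - (A *m invmx D *m Z).
  by rewrite mulmxA AZ mulNmx -!mulmxA iZ.
have De : D *m (A *m invmx D) = A *m invmx D *m D.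
  by rewrite mulmxA -DA mulmxK // mulmxKV.
have EA : E + E = 1%:M + A + Z by rewrite AE ZE; mx_ring.
have Pe : PiE E = 2^-1 *: (1%:M + A *m invmx D) by rewrite /PiE -ZE -AE -DE.
have Ae : A = A *m invmx D *m D by rewrite mulmxKV.
exists Z, A, D, (A *m invmx D).
exact: (Polar ZE AE EA DE Zh eh Dh Du Ae ee eZ De DZ DD Pe).
Qed.

Lemma PiE_double E Z A D e : polar E Z A D e -> PiE E + PiE E = 1%:M + e.
Proof. by move=> p; rewrite (pPi p) -scalerDr half_twice. Qed.

Lemma PiE_herm E : E *m E = E -> (PiE E) ^t* = PiE E.
Proof.
by move=> /idem_polar [Z [A [D [e p]]]]; rewrite (pPi p) trCZ half_real trCD trC1 (peh p).
Qed.

Lemma mulmx_half (A B : M) : (2^-1 *: A) *m (2^-1 *: B) = 2^-1 *: (2^-1 *: (A *m B)).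
Proof. by rewrite -scalemxAl -scalemxAr. Qed.

Lemma PiE_idem E : E *m E = E -> PiE E *m PiE E = PiE E.
Proof.
move=> /idem_polar [Z [A [D [e p]]]]; rewrite (pPi p) mulmx_half.
rewrite mulmxDl !mulmxDr !mul1mx mulmx1 (pee p).
by rewrite [e + _]addrC half_twice.
Qed.

(** Z anticommutes with 2 Pi - 1, so it is off-diagonal for Pi; one block is eta and the other is -
    eta^*. *)
Lemma PiE_anti E : E *m E = E ->
  PiE E *m (E - E ^t*) + (E - E ^t*) *m PiE E = E - E ^t*.
Proof.
move=> /idem_polar [Z [A [D [e p]]]]; rewrite (pPi p) -(pZ p).
rewrite -scalemxAl -scalemxAr -scalerDr mulmxDl mulmxDr mul1mx mulmx1 (peZ p).
by rewrite addrACA subrr addr0 half_twice.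
Qed.

Lemma etaE_anti E : E *m E = E -> etaE E - (etaE E) ^t* = E - E ^t*.
Proof.
move=> EE; rewrite /etaE trCM trC_anti (PiE_herm EE) mulNmx opprK.
exact: PiE_anti.
Qed.

Lemma etaE_l E : E *m E = E -> PiE E *m etaE E = etaE E.
Proof. by move=> EE; rewrite /etaE mulmxA (PiE_idem EE). Qed.

Lemma etaE_r E : E *m E = E -> etaE E *m PiE E = 0.
Proof.
move=> EE; have := congr1 (mulmx (PiE E)) (PiE_anti EE).
rewrite mulmxDr mulmxA (PiE_idem EE) mulmxA => /eqP.
by rewrite -subr_eq0 addrAC subrr add0r => /eqP.
Qed.

Lemma Eof_PiE E : E *m E = E -> Eof (PiE E) (etaE E) = E.
Proof.
move=> EE; rewrite /Eof (etaE_anti EE).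
have [Z [A [D [e p]]]] := idem_polar EE.
rewrite (PiE_double p) -(pZ p) -(pD p) [1%:M + e]addrC addrK -(pAe p) -(pE p).
exact: half_twice.
Qed.

Section Inverse.
Variables P eta : M.
Hypotheses (PP : P *m P = P) (Ph : P ^t* = P) (Pe : P *m eta = eta) (eP : eta *m P = 0).

Let Z := eta - eta ^t*.
Let D := Dmx Z.
Let e : M := P + P - 1%:M.

Lemma eof_anti : Z *m e = - (e *m Z).
Proof.
have Peh : P *m eta ^t* = 0 by rewrite -Ph -trCM eP trC0.
have ePh : eta ^t* *m P = eta ^t* by rewrite -{1}Ph -trCM Pe.
rewrite /Z /e !(mulmxDl, mulmxDr, mulmxN, mulNmx, mulmx1, mul1mx) Pe eP Peh ePh.
mx_ring.
Qed.

Lemma eof_sqr : e *m e = 1%:M.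
Proof. by rewrite /e !(mulmxDl, mulmxDr, mulmxN, mulNmx, mulmx1, mul1mx) PP; mx_ring. Qed.

Lemma eof_comm : e *m D = D *m e.
Proof.
apply: Dmx_comm; rewrite trC_anti !(mulmxN, mulNmx); congr (- _).
by rewrite mulmxA -(mulmxA Z Z) eof_anti mulmxN mulmxA eof_anti mulNmx opprK.
Qed.

Lemma eof_herm : e ^t* = e.
Proof. by rewrite /e trCB trCD Ph trC1. Qed.

Lemma Eof_sub : Eof P eta - (Eof P eta) ^t* = Z.
Proof.
have Zh : Z ^t* = - Z := trC_anti eta.
rewrite /Eof -/Z -/D -/e trCZ half_real -scalerBr (trCD _ Z) (trCD 1%:M) trC1 trCM Dmx_herm.
rewrite eof_herm -/D -eof_comm Zh.
have -> : 1%:M + e *m D + Z - (1%:M + e *m D - Z) = Z + Z by mx_ring.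
exact: half_twice.
Qed.

Lemma Eof_add : Eof P eta + (Eof P eta) ^t* - 1%:M = e *m D.
Proof.
have Zh : Z ^t* = - Z := trC_anti eta.
rewrite /Eof -/Z -/D -/e trCZ half_real -scalerDr (trCD _ Z) (trCD 1%:M) trC1 trCM Dmx_herm.
rewrite eof_herm -/D -eof_comm Zh.
have -> : 1%:M + e *m D + Z + (1%:M + e *m D - Z) = (1%:M + e *m D) + (1%:M + e *m D).
  by mx_ring.
by rewrite half_twice addrC addKr.
Qed.

(** For S = e D the relations S^2 = 1 - Z^2 and S Z = - Z S make S + Z an involution, of which [Eof]
    is the associated idempotent. *)
Lemma Eof_idem : Eof P eta *m Eof P eta = Eof P eta.
Proof.
have DZ : Z *m D = D *m Z.
  by apply: Dmx_comm; rewrite trC_anti !(mulmxN, mulNmx) mulmxA.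
rewrite /Eof mulmx_half; congr (_ *: _); rewrite -/Z -/D -/e.
have eDeD : e *m D *m (e *m D) = 1%:M - Z *m Z.
  rewrite mulmxA -(mulmxA e) -eof_comm mulmxA eof_sqr mul1mx Dmx_sqr.
  by rewrite trC_anti mulmxN.
have ZeD : Z *m (e *m D) = - (e *m D *m Z).
  by rewrite mulmxA eof_anti mulNmx -!mulmxA DZ.
rewrite -[RHS]half_twice; congr (_ *: _).
move: (e *m D) (Z) eDeD ZeD => S Y SS ZS.
rewrite !(mulmxDl, mulmxDr, mulmxN, mulNmx, mulmx1, mul1mx) SS ZS.
mx_ring.
Qed.

Lemma PiE_Eof : PiE (Eof P eta) = P.
Proof.
rewrite /PiE Eof_sub Eof_add mulmxK; last exact: Dmx_unit.
by rewrite /e addrC subrK half_twice.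
Qed.

Lemma etaE_Eof : etaE (Eof P eta) = eta.
Proof.
rewrite /etaE PiE_Eof Eof_sub /Z mulmxBr Pe -Ph -trCM eP trC0 subr0 //.
Qed.

End Inverse.

Section Modulus.
Variables E Z A D e : M.
Hypothesis p : polar E Z A D e.

(** [s] and [t] are twice the moduli of E and of its adjoint. *)
Let s : M := D + e + e *m Z.
Let t : M := D + e - e *m Z.

Lemma invD_psd : psd (invmx D).
Proof.
have pDp : psd D by rewrite (pD p); apply: pdef_psd (Dmx_pdef Z); apply: ler01.
have := psd_conj (invmx D) pDp.
by rewrite (invmx_trC (pDh p)) -mulmxA mulmxV ?mulmx1 // (pDu p).
Qed.

Lemma psd_scale (a : C) (X : M) : 0 <= a -> psd X -> psd (a *: X).
Proof.
move=> a0 [Xh Xp]; have ar : conjc a = a by apply/CrealP; rewrite ger0_real.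
split; first by rewrite trCZ ar Xh.
by move=> x; rewrite -scalemxAr -scalemxAl mxE; apply: mulr_ge0.
Qed.

(** The hypotheses give X D^{-1} X = 2 X, which exhibits X as congruent to a positive matrix. *)
Lemma half_psd (X : M) : X ^t* = X -> X *m D = D *m X ->
  X *m X = 2 *: (D *m X) -> psd (2^-1 *: X).
Proof.
move=> Xh XD XX.
have E1 : X *m invmx D *m X = 2 *: X.
  rewrite (mulmxN1_comm (pDu p) XD) -mulmxA XX -scalemxAr; congr (_ *: _).
  exact: mulKmx (pDu p) X.
have := psd_conj X invD_psd; rewrite Xh E1.
have h0 : 0 <= (2^-1 * 2^-1 : C) by apply: mulr_ge0; rewrite invr_ge0 ler0n.
move=> /(psd_scale h0); rewrite scalerA -mulrA mulVf ?mulr1 // pnatr_eq0 //.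
Qed.

Let De : D *m e = e *m D := pDe p.
Let ZD : Z *m D = D *m Z := pDZ p.
Let Ze : Z *m e = - (e *m Z) := peZ p.
Let ee : e *m e = 1%:M := pee p.

Let DeX (X : M) : D *m (e *m X) = e *m (D *m X).
Proof. by rewrite !mulmxA De. Qed.
Let ZDX (X : M) : Z *m (D *m X) = D *m (Z *m X).
Proof. by rewrite !mulmxA ZD. Qed.
Let ZeX (X : M) : Z *m (e *m X) = - (e *m (Z *m X)).
Proof. by rewrite !mulmxA Ze mulNmx. Qed.
Let eeX (X : M) : e *m (e *m X) = X.
Proof. by rewrite mulmxA ee mul1mx. Qed.
Let DD : D *m D = 1%:M - Z *m Z := pDD p.

Let DDX (X : M) : D *m (D *m X) = X - Z *m (Z *m X).
Proof. by rewrite mulmxA DD mulmxBl mul1mx mulmxA. Qed.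

(** Rewriting to a normal form in which each word reads e, then D, then Z, with e^2 = 1 and D^2 = 1
    - Z^2. *)
Let normE := (mulmxDl, mulmxDr, mulmxN, mulNmx, mulmx1, mul1mx, =^~ mulmxA,
  DeX, ZDX, ZeX, eeX, De, ZD, Ze, ee, DDX, DD).

Lemma sD : s *m D = D *m s.
Proof. by rewrite /s !normE; mx_ring. Qed.

Lemma tD : t *m D = D *m t.
Proof. by rewrite /t !normE; mx_ring. Qed.

Lemma ss : s *m s = 2 *: (D *m s).
Proof. by rewrite /s !normE; mx_ring. Qed.

Lemma tt : t *m t = 2 *: (D *m t).
Proof. by rewrite /t !normE; mx_ring. Qed.

Lemma eZh : (e *m Z) ^t* = e *m Z.
Proof. by rewrite trCM (pZh p) (peh p) mulNmx Ze opprK. Qed.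

Lemma sh : s ^t* = s.
Proof. by rewrite /s !trCD eZh (pDh p) (peh p). Qed.

Lemma th : t ^t* = t.
Proof. by rewrite /t trCB trCD eZh (pDh p) (peh p). Qed.

Let E2 : E = 2^-1 *: (1%:M + e *m D + Z).
Proof. by rewrite -(pAe p) -(pE p) half_twice. Qed.

Let E2h : E ^t* = 2^-1 *: (1%:M + e *m D - Z).
Proof.
by rewrite E2 trCZ half_real !trCD trC1 trCM (pDh p) (peh p) (pZh p) De.
Qed.

Lemma modulus_r : (2^-1 *: s) *m (2^-1 *: s) = E ^t* *m E.
Proof.
rewrite {2}E2 E2h !mulmx_half; do 2 congr (_ *: _).
by rewrite /s !normE; mx_ring.
Qed.

Lemma modulus_l : (2^-1 *: t) *m (2^-1 *: t) = E *m E ^t*.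
Proof.
rewrite E2h {1}E2 !mulmx_half; do 2 congr (_ *: _).
by rewrite /t !normE; mx_ring.
Qed.

Lemma sqrt_EhE : sqrtmx (E ^t* *m E) = 2^-1 *: s.
Proof. by apply: sqrtmx_unique modulus_r; apply: half_psd; [exact: sh|exact: sD|exact: ss]. Qed.

Lemma sqrt_EEh : sqrtmx (E *m E ^t*) = 2^-1 *: t.
Proof. by apply: sqrtmx_unique modulus_l; apply: half_psd; [exact: th|exact: tD|exact: tt]. Qed.

(** With |E| = s / 2, this and the next identity express (1 + |E|) E and Pi as right multiples of
    each other. They have the same image, which is why the subspace in [Phi] is that of Pi. *)
Lemma sqrt_shift : (1%:M + 2^-1 *: s) *m E = PiE E *m (1%:M + D + Z).
Proof.
have -> : 1%:M + 2^-1 *: s = 2^-1 *: (1%:M + 1%:M + s).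
  by rewrite (scalerDr _ (1%:M + 1%:M) s) half_twice.
rewrite E2 mulmx_half -E2 (pPi p) -scalemxAl; congr (_ *: _).
rewrite -[RHS]half_twice; congr (_ *: _).
by rewrite /s !normE; mx_ring.
Qed.

(** Multiplying the previous identity by Pi on the right kills the Z term, as Pi Z Pi = 0, and
    leaves Pi (1 + D), where 1 + D is invertible and commutes with Pi. *)
Lemma sqrt_shift_Pi : (1%:M + 2^-1 *: s) *m E *m (PiE E *m invmx (1%:M + D)) = PiE E.
Proof.
have EEi : E *m E = E.
  rewrite E2 mulmx_half; congr (_ *: _); rewrite -[RHS]half_twice; congr (_ *: _).
  by rewrite !normE; mx_ring.
have PZP : PiE E *m Z *m PiE E = 0 by rewrite (pZ p) -/(etaE E) (etaE_r EEi).
have PD : D *m PiE E = PiE E *m D.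
  by rewrite (pPi p) -scalemxAl -scalemxAr mulmxDl mulmxDr De mulmx1 mul1mx.
have D1u : 1%:M + D \in unitmx.
  have c : pdef (1 + 1) (1%:M + D).
    by apply: pdefD; [exact: pdef1|rewrite (pD p); exact: Dmx_pdef].
  by apply: pdef_unitmx c; apply: addr_gt0; apply: ltr01.
rewrite sqrt_shift !mulmxA mulmxDr mulmxDl PZP addr0 mulmxDr mulmx1 mulmxDl.
rewrite -(mulmxA (PiE E) D) PD !mulmxA (PiE_idem EEi).
by rewrite -[X in (X + _) *m _]mulmx1 -mulmxDr mulmxK.
Qed.

End Modulus.

End PolarAlgebra.

(** * Subspaces, projectors and the bijectivity of Phi *)

Section Subspaces.
Context {R : realType}.
Local Notation C := R[i].
Local Notation i := ('i%C : C).

Lemma endoE p q (A : 'M[C]_(p, q)) x : endo A x = A *m x.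
Proof. by rewrite lfunE. Qed.

Lemma imP p q (A : 'M[C]_(p, q)) x : reflect (exists y, x = A *m y) (x \in im A).
Proof.
apply: (iffP memv_imgP) => [[y _ ->]|[y ->]]; first by exists y; rewrite endoE.
by exists y; rewrite ?memvf // endoE.
Qed.

Lemma kerP p q (A : 'M[C]_(p, q)) x : reflect (A *m x = 0) (x \in ker A).
Proof. by rewrite memv_ker endoE; apply: eqP. Qed.

Lemma im_mulmx p q r (A : 'M[C]_(p, q)) (B : 'M[C]_(q, r)) : (endo A @: im B)%VS = im (A *m B).
Proof.
apply/vspaceP => x; apply/memv_imgP/imP.
  by move=> [y /imP [z ->] ->]; exists z; rewrite endoE mulmxA.
by move=> [z ->]; exists (B *m z); [apply/imP; exists z|rewrite endoE mulmxA].
Qed.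

Lemma mulmx_cV_eq p q (A B : 'M[C]_(p, q)) : (forall x : 'cV_q, A *m x = B *m x) -> A = B.
Proof.
move=> AB; apply/matrixP => j k; have := AB (delta_mx k 0).
by rewrite -!colE => /matrixP /(_ j 0); rewrite !mxE.
Qed.

Lemma im_subP p q r (A : 'M[C]_(p, q)) (B : 'M[C]_(p, r)) :
  (im A <= im B)%VS <-> exists X, A = B *m X.
Proof.
split=> [/subvP AB|[X ->]]; last first.
  by apply/subvP => x /imP [y ->]; apply/imP; exists (X *m y); rewrite mulmxA.
have H k : exists y : 'cV_r, col k A = B *m y.
  by apply/imP/AB/imP; exists (delta_mx k 0); rewrite colE.
pose X := \matrix_(j < r, k < q) sval (cid (H k)) j 0.
exists X; apply/matrixP => j k.
have := svalP (cid (H k)) => /matrixP /(_ j 0); rewrite !mxE => ->.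
by apply: eq_bigr => l _; rewrite !mxE.
Qed.

Lemma idem_imP n (E : 'M[C]_n) (x : 'cV[C]_n) : E *m E = E ->
  reflect (E *m x = x) (x \in im E).
Proof.
move=> EE; apply: (iffP (imP E x)) => [[y ->]|Ex]; first by rewrite mulmxA EE.
by exists x.
Qed.

Lemma idem_im_eq n (E F : 'M[C]_n) : E *m E = E -> F *m F = F ->
  im E = im F <-> E *m F = F /\ F *m E = E.
Proof.
move=> EE FF; split=> [EF|[EF FE]].
  split; apply: mulmx_cV_eq => x; rewrite -mulmxA.
    by apply/(idem_imP _ EE); rewrite EF; apply/imP; exists x.
  by apply/(idem_imP _ FF); rewrite -EF; apply/imP; exists x.
apply/eqP; rewrite eqEsubv; apply/andP; split; apply/im_subP.
  by exists E; rewrite FE.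
by exists F; rewrite EF.
Qed.

Lemma im_scale p q (a : C) (A : 'M[C]_(p, q)) : a != 0 -> im (a *: A) = im A.
Proof.
move=> a0; apply/vspaceP => x; apply/imP/imP => -[y ->].
  by exists (a *: y); rewrite -scalemxAl scalemxAr.
by exists (a^-1 *: y); rewrite -scalemxAl -scalemxAr scalerA mulfV // scale1r.
Qed.

Lemma ker_scale p q (a : C) (A : 'M[C]_(p, q)) : a != 0 -> ker (a *: A) = ker A.
Proof.
move=> a0; apply/vspaceP => x; apply/kerP/kerP; rewrite -scalemxAl => H.
  by move/eqP: H; rewrite scaler_eq0 (negbTE a0) => /eqP.
by rewrite H scaler0.
Qed.

Lemma dim_im_inj p q r (A : 'M[C]_(p, q)) (B : 'M[C]_(q, r)) :
  (forall x : 'cV_q, A *m x = 0 -> x = 0) -> \dim (im (A *m B)) = \dim (im B).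
Proof.
move=> Ai; rewrite -im_mulmx limg_dim_eq //.
have -> : lker (endo A) = 0%VS.
  apply/vspaceP => x; rewrite memv0; apply/kerP/eqP => [/Ai //|->].
  by rewrite mulmx0.
by rewrite capv0.
Qed.

Lemma dim_im_linv n m (Q : 'M[C]_(n, m)) (P : 'M[C]_(m, n)) : P *m Q = 1%:M ->
  \dim (im Q) = m.
Proof.
move=> PQ; rewrite -{1}[Q]mulmx1 dim_im_inj.
  have -> : im (1%:M : 'M[C]_m) = fullv.
    by apply/vspaceP => x; rewrite memvf; apply/imP; exists x; rewrite mul1mx.
  by rewrite dimvf /dim /= muln1.
by move=> x Qx; rewrite -[x]mul1mx -PQ -mulmxA Qx mulmx0.
Qed.

Lemma frame_exists n (V : {vspace 'cV[C]_n}) m : \dim V = m ->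
  exists2 F : 'M[C]_(n, m), im F = V & forall X : 'cV_m, F *m X = 0 -> X = 0.
Proof.
move=> <-; pose b := vbasis V.
pose F : 'M[C]_(n, \dim V) := \matrix_(j, k) (b`_k : 'cV_n) j 0.
have FE (x : 'cV_(\dim V)) : F *m x = \sum_k x k 0 *: b`_k.
  apply/matrixP => j l; rewrite ord1 summxE mxE; apply: eq_bigr => k _.
  by rewrite !mxE mulrC.
exists F => [|x].
  apply/vspaceP => x; apply/imP/idP => [[y ->]|xV].
    rewrite FE; apply: rpred_sum => k _; apply: rpredZ.
    by apply: vbasis_mem; apply: mem_nth; rewrite size_tuple.
  exists (\col_k coord b k x); rewrite FE {1}(coord_vbasis xV).
  by apply: eq_bigr => k _; rewrite mxE.
rewrite FE => x0.
have /freeP fb := basis_free (vbasisP V).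
by apply/matrixP => k l; rewrite ord1 mxE; apply: (fb (fun k => x k 0)).
Qed.

Lemma gram_unit n m (F : 'M[C]_(n, m)) : (forall X : 'cV_m, F *m X = 0 -> X = 0) ->
  F ^t* *m F \in unitmx.
Proof.
move=> Fi; apply: unitmx_inj => X FX.
have FX0 : F *m X = 0.
  by apply: gram_eq0; rewrite trCM -mulmxA (mulmxA (F ^t*)) FX mulmx0.
apply: mulmx_cV_eq => x; rewrite mul0mx; apply: Fi.
by rewrite mulmxA FX0 mul0mx.
Qed.

Lemma orthoproj_exists n (V : {vspace 'cV[C]_n}) :
  exists P : 'M[C]_n, [/\ P *m P = P, P ^t* = P & im P = V].
Proof.
have [F FV Fi] := @frame_exists n V _ erefl; rewrite -[V]FV.
have Gu := gram_unit Fi.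
have GG : (F ^t* *m F) ^t* = F ^t* *m F by rewrite trCM trCK.
have Gi : (invmx (F ^t* *m F)) ^t* = invmx (F ^t* *m F) by rewrite invmx_trC.
exists (F *m invmx (F ^t* *m F) *m F ^t*); split.
- by rewrite !mulmxA -(mulmxA _ (F ^t*) F) mulmxKV.
- by rewrite !trCM trCK Gi mulmxA.
- apply/eqP; rewrite eqEsubv; apply/andP; split; apply/im_subP.
    by exists (invmx (F ^t* *m F) *m F ^t*); rewrite mulmxA.
  by exists F; rewrite -!mulmxA mulVmx // mulmx1.
Qed.

Lemma orthoproj_unique n (P Q : 'M[C]_n) : P *m P = P -> P ^t* = P ->
  Q *m Q = Q -> Q ^t* = Q -> im P = im Q -> P = Q.
Proof.
move=> PP Ph QQ Qh /(idem_im_eq PP QQ) [PQ QP].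
by rewrite -QP -Qh -[in LHS]Ph -trCM PQ Qh.
Qed.

Lemma orthoprojP n (V : {vspace 'cV[C]_n}) :
  [/\ orthoproj V *m orthoproj V = orthoproj V, (orthoproj V) ^t* = orthoproj V &
      im (orthoproj V) = V].
Proof.
have [P PV] := orthoproj_exists V.
by rewrite /orthoproj; case: xgetP => [Q _ //|] /(_ P).
Qed.

Lemma orthoproj_im n (P : 'M[C]_n) : P *m P = P -> P ^t* = P -> orthoproj (im P) = P.
Proof.
move=> PP Ph; have [QQ Qh QV] := orthoprojP (im P).
exact: orthoproj_unique.
Qed.

Definition idem n m (E : 'M[C]_n) := E *m E = E /\ \dim (im E) = m.

Lemma i_neq0 : i != 0.
Proof. by rewrite eq_complex /= oner_eq0 andbF. Qed.

Lemma mulii : i * i = -1.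
Proof. by rewrite -expr2 sqr_i. Qed.

Lemma conji : conjc i = - i.
Proof. by apply/eqP; rewrite eq_complex /= oppr0 !eqxx. Qed.

(** If P Q = i then E = - i Q P is idempotent with the image of Q. Conversely a frame F of the image
    of E gives a factorization E = F P with P F = 1, and i is put on the second factor. *)
Lemma OrbP m n (xi : 'M[C]_n) : Orb m n xi <-> exists2 E, xi = i *: E & idem m E.
Proof.
split=> [[Q [P [-> PQ]]]|[E -> [EE dE]]].
  exists (- i *: (Q *m P)); first by rewrite scalerA mulrN mulii opprK scale1r.
  have ii : (- i) * (- i) * i = - i by rewrite mulrNN mulii mulN1r.
  split.
    rewrite -scalemxAl -scalemxAr scalerA -mulmxA (mulmxA P) PQ mul_scalar_mx -scalemxAr.
    by rewrite scalerA ii.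
  rewrite im_scale ?oppr_eq0 ?i_neq0 //.
  have PQ1 : (- i *: P) *m Q = 1%:M.
    by rewrite -scalemxAl PQ scale_scalar_mx mulNr mulii opprK.
  have -> : im (Q *m P) = im Q.
    apply/eqP; rewrite eqEsubv; apply/andP; split; apply/im_subP; first by exists P.
    exists (- i *: Q); rewrite -scalemxAr -mulmxA PQ mul_mx_scalar scalerA mulNr mulii.
    by rewrite opprK scale1r.
  exact: dim_im_linv PQ1.
have [F FE Fi] := frame_exists dE.
have [P EP] : exists P, E = F *m P by apply/im_subP; rewrite FE.
have EF : E *m F = F.
  apply: mulmx_cV_eq => x; rewrite -mulmxA; apply/(idem_imP _ EE).
  by rewrite -FE; apply/imP; exists x.
have PF : P *m F = 1%:M.
  apply: mulmx_cV_eq => x; apply/eqP; rewrite -subr_eq0; apply/eqP; apply: Fi.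
  by rewrite mulmxBr mul1mx !mulmxA -EP EF subrr.
by exists F, (i *: P); rewrite -scalemxAr -scalemxAl -EP PF scalemx1.
Qed.

Definition proj_covect n m (P eta : 'M[C]_n) :=
  [/\ P *m P = P, P ^t* = P, P *m eta = eta, eta *m P = 0 & \dim (im P) = m].

Lemma TGrP m n (z : covect n) : TGr m n z <-> proj_covect m (orthoproj z.1) z.2.
Proof.
have [PP Ph PV] := orthoprojP z.1.
have VE x : (x \in z.1) = (x \in im (orthoproj z.1)) by rewrite PV.
split.
  move=> [dz z0 zi]; split=> //; last by rewrite PV.
    apply: mulmx_cV_eq => x; rewrite -mulmxA; apply/(idem_imP _ PP).
    by rewrite PV; apply: zi.
  apply: mulmx_cV_eq => x; rewrite mul0mx -mulmxA; apply: z0.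
  by have /imP : exists y, orthoproj z.1 *m x = orthoproj z.1 *m y; [exists x|rewrite PV].
move=> [_ _ Pe eP dP]; split; first by rewrite -PV.
  by move=> x; rewrite VE => /(idem_imP _ PP) <-; rewrite mulmxA eP mul0mx.
by move=> x; rewrite VE; apply/(idem_imP _ PP); rewrite mulmxA Pe.
Qed.

(** 1 + |E| is bounded below by 1, hence injective, and carries the image of E onto that of Pi. *)
Lemma idem_Pi_dim n (E : 'M[C]_n) : E *m E = E -> \dim (im (PiE E)) = \dim (im E).
Proof.
move=> EE; have [Z [A [D [e p]]]] := idem_polar EE.
have H := sqrt_shift p; have H' := sqrt_shift_Pi p.
set s := 2^-1 *: _ in H H'.
have -> : im (PiE E) = im ((1%:M + s) *m E).
  apply/eqP; rewrite eqEsubv; apply/andP; split; apply/im_subP.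
    by exists (PiE E *m invmx (1%:M + D)).
  by exists (1%:M + D + Z).
apply: dim_im_inj => x.
have sp : psd s by apply: half_psd; [exact: p|exact: sh p|exact: sD p|exact: ss p].
have c : pdef 1 (1%:M + s) by have := pdefD pdef1 (psd_pdef sp); rewrite addr0.
exact: pdef_inj ltr01 c.
Qed.

(** For xi = i E the moduli are those of E, with difference e Z, and - i xi - i xi^* is Z; half of e
    Z + Z is Pi Z. *)
Lemma Phi_scale n (E : 'M[C]_n) : E *m E = E -> Phi (i *: E) = (im (PiE E), etaE E).
Proof.
move=> EE; have [Z [A [D [e p]]]] := idem_polar EE.
have H := sqrt_shift p; have H' := sqrt_shift_Pi p.
have iE : (i *: E) ^t* = - (i *: E ^t*) by rewrite trCZ conji scaleNr.
rewrite /Phi iE im_scale ?i_neq0 //.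
have -> : - (i *: E ^t*) *m (i *: E) = E ^t* *m E.
  by rewrite mulNmx -scalemxAl -scalemxAr scalerA mulii scaleN1r opprK.
have -> : i *: E *m - (i *: E ^t*) = E *m E ^t*.
  by rewrite mulmxN -scalemxAl -scalemxAr scalerA mulii scaleN1r opprK.
rewrite (sqrt_EhE p) (sqrt_EEh p) im_mulmx; congr pair.
  apply/eqP; rewrite eqEsubv; apply/andP; split; apply/im_subP.
    by exists (1%:M + D + Z).
  by exists (PiE E *m invmx (1%:M + D)).
rewrite scalerN opprK !scalerA mulii !scaleN1r opprK.
rewrite -scalerBr /etaE -(pZ p) (pPi p) -scalemxAl; congr (_ *: _).
have -> : D + e + e *m Z - (D + e - e *m Z) = e *m Z + e *m Z by mx_ring.
rewrite half_twice mulmxDl mul1mx (pZ p); mx_ring.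
Qed.

Definition PhiInv n (z : covect n) : 'M[C]_n := i *: Eof (orthoproj z.1) z.2.

Lemma orthoproj_PiE n (E : 'M[C]_n) : E *m E = E -> orthoproj (im (PiE E)) = PiE E.
Proof. by move=> EE; apply: orthoproj_im; [exact: PiE_idem|exact: PiE_herm]. Qed.

Lemma Phi_TGr n m (E : 'M[C]_n) : idem m E -> TGr m n (Phi (i *: E)).
Proof.
move=> [EE dE]; rewrite Phi_scale //; apply/TGrP => /=.
rewrite orthoproj_PiE //; split; [exact: PiE_idem|exact: PiE_herm|exact: etaE_l|exact: etaE_r|].
by rewrite idem_Pi_dim.
Qed.

Lemma PhiK n (E : 'M[C]_n) : E *m E = E -> PhiInv (Phi (i *: E)) = i *: E.
Proof. by move=> EE; rewrite Phi_scale // /PhiInv /= orthoproj_PiE // Eof_PiE. Qed.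

Lemma PhiInv_Orb n m (z : covect n) : TGr m n z -> idem m (Eof (orthoproj z.1) z.2).
Proof.
move=> /TGrP [PP Ph Pe eP dP]; have EE := Eof_idem PP Ph Pe eP.
by split=> //; rewrite -(idem_Pi_dim EE) PiE_Eof.
Qed.

Lemma PhiInvK n m (z : covect n) : TGr m n z -> Phi (PhiInv z) = z.
Proof.
move=> /[dup] /PhiInv_Orb [EE _] /TGrP [PP Ph Pe eP dP].
rewrite /PhiInv Phi_scale // PiE_Eof // etaE_Eof //.
by have [_ _ ->] := orthoprojP z.1; case: z {EE PP Ph Pe eP dP}.
Qed.

End Subspaces.

(** * Compatibility of Phi with star-automorphisms *)

Section Symmetries.
Context {R : realType} {n : nat}.
Local Notation C := R[i].
Local Notation i := ('i%C : C).
Local Notation M := 'M[C]_n.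

(** Only real linearity is required, so that both antilinear and complex linear involutions
    qualify. *)
Record staraut (tau : M -> M) : Prop := Staraut {
  tauL : rlinear tau;
  tauM : forall A B, tau (A *m B) = tau A *m tau B;
  tau1 : tau 1%:M = 1%:M;
  tauC : forall A, tau (A ^t*) = (tau A) ^t*;
  tauK : involutive tau }.

Section Naturality.
Variable tau : M -> M.
Hypothesis ht : staraut tau.

Lemma tauD A B : tau (A + B) = tau A + tau B.
Proof. by have := tauL ht 1 A B; rewrite !scale1r. Qed.

Lemma tau0 : tau 0 = 0.
Proof. by apply: (addrI (tau 0)); rewrite -tauD !addr0. Qed.

Lemma tauN A : tau (- A) = - tau A.
Proof. by apply: (addrI (tau A)); rewrite -tauD !subrr tau0. Qed.

Lemma tauB A B : tau (A - B) = tau A - tau B.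
Proof. by rewrite tauD tauN. Qed.

Lemma tau_half A : tau (2^-1 *: A) = 2^-1 *: tau A.
Proof. by rewrite -{2}(half_twice A) scalerDr tauD half_twice. Qed.

Lemma tauV A : A \in unitmx -> tau (invmx A) = invmx (tau A).
Proof.
move=> Au; have E : tau A *m tau (invmx A) = 1%:M by rewrite -(tauM ht) mulmxV // (tau1 ht).
have tu : tau A \in unitmx by have [] := mulmx1_unit E.
by rewrite -[LHS](mulKmx tu) E mulmx1.
Qed.

Lemma tau_psd A : psd A -> psd (tau A).
Proof. by move=> /psd_gramP [W ->]; rewrite (tauM ht) (tauC ht); apply: psd_gram. Qed.

(** The image of a positive square root is again positive, so uniqueness of the root applies. *)
Lemma tau_Dmx Z : tau (Dmx Z) = Dmx (tau Z).
Proof.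
rewrite [in RHS]/Dmx herm_one_gram; apply/esym/sqrtmx_unique.
  by apply: tau_psd; apply: pdef_psd (Dmx_pdef Z); apply: ler01.
by rewrite -(tauM ht) Dmx_sqr tauD (tau1 ht) (tauM ht) (tauC ht).
Qed.

Lemma tau_PiE E : tau (PiE E) = PiE (tau E).
Proof.
rewrite /PiE tau_half tauD (tau1 ht) (tauM ht) tauV; last exact: Dmx_unit.
by rewrite tau_Dmx !tauB tauD (tau1 ht) (tauC ht).
Qed.

Lemma tau_etaE E : tau (etaE E) = etaE (tau E).
Proof. by rewrite /etaE (tauM ht) tau_PiE tauB (tauC ht). Qed.

Lemma tau_Eof P eta : tau (Eof P eta) = Eof (tau P) (tau eta).
Proof.
rewrite /Eof tau_half (tauD _ (eta - _)) (tauD 1%:M) (tau1 ht) (tauM ht) tau_Dmx.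
by rewrite !tauB tauD (tau1 ht) (tauC ht).
Qed.

End Naturality.

Lemma Dmx_anti (E : M) : Dmx (E ^t* - E ^t* ^t*) = Dmx (E - E ^t*).
Proof. by rewrite /Dmx trCK -[E ^t* - E]opprB trCN mulNmx mulmxN opprK. Qed.

Lemma PiE_trC (E : M) : PiE (E ^t*) = PiE E.
Proof. by rewrite /PiE Dmx_anti trCK [E ^t* + E]addrC. Qed.

Lemma etaE_trC (E : M) : etaE (E ^t*) = - etaE E.
Proof. by rewrite /etaE PiE_trC trCK -opprB mulmxN. Qed.

(** The adjoint of an idempotent has the same Pi and the opposite eta; the claim follows by
    inverting this. *)
Lemma Eof_opp (P eta : M) : P *m P = P -> P ^t* = P -> P *m eta = eta -> eta *m P = 0 ->
  Eof P (- eta) = (Eof P eta) ^t*.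
Proof.
move=> PP Ph Pe eP; have EE := Eof_idem PP Ph Pe eP.
have EE' : (Eof P eta) ^t* *m (Eof P eta) ^t* = (Eof P eta) ^t* by rewrite -trCM EE.
by rewrite -[RHS](Eof_PiE EE') PiE_trC etaE_trC PiE_Eof // etaE_Eof.
Qed.

(** In the four sets [F] stands for fixed by tau and [A] for the twisted condition: tau gives the
    adjoint on the orbit, the opposite covector on the cotangent side. *)
Definition SF m (tau : M -> M) : set M := [set xi | exists2 E, xi = i *: E & idem m E /\ tau E = E].
Definition SA m (tau : M -> M) : set M := [set xi | exists2 E, xi = i *: E & idem m E /\ tau E = E ^t*].
Definition TF m (tau : M -> M) : set (covect n) :=
  [set z | [/\ TGr m n z, tau (orthoproj z.1) = orthoproj z.1 & tau z.2 = z.2]].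
Definition TA m (tau : M -> M) : set (covect n) :=
  [set z | [/\ TGr m n z, tau (orthoproj z.1) = orthoproj z.1 & tau z.2 = - z.2]].

Section PhiSets.
Variables (m : nat) (tau : M -> M).
Hypothesis ht : staraut tau.

Lemma orthoproj_Phi (E : M) : E *m E = E -> orthoproj (Phi (i *: E)).1 = PiE E.
Proof. by move=> EE; rewrite (Phi_scale EE); apply: orthoproj_PiE. Qed.

Lemma eta_Phi (E : M) : E *m E = E -> (Phi (i *: E)).2 = etaE E.
Proof. by move=> EE; rewrite (Phi_scale EE). Qed.

Lemma Phi_SF xi : SF m tau xi -> TF m tau (Phi xi).
Proof.
move=> [E -> [iE tE]]; have [EE dE] := iE.
apply: And3; first exact: Phi_TGr.
  by rewrite (orthoproj_Phi EE) (tau_PiE ht) tE.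
by rewrite (eta_Phi EE) (tau_etaE ht) tE.
Qed.

Lemma Phi_SA xi : SA m tau xi -> TA m tau (Phi xi).
Proof.
move=> [E -> [iE tE]]; have [EE dE] := iE.
apply: And3; first exact: Phi_TGr.
  by rewrite (orthoproj_Phi EE) (tau_PiE ht) tE PiE_trC.
by rewrite (eta_Phi EE) (tau_etaE ht) tE etaE_trC.
Qed.

Lemma PhiInv_TF z : TF m tau z -> SF m tau (PhiInv z).
Proof.
move=> [Tz tP te]; exists (Eof (orthoproj z.1) z.2); [exact: erefl|split; first exact: PhiInv_Orb].
by rewrite (tau_Eof ht) tP te.
Qed.

Lemma PhiInv_TA z : TA m tau z -> SA m tau (PhiInv z).
Proof.
move=> [Tz tP te]; exists (Eof (orthoproj z.1) z.2); [exact: erefl|split; first exact: PhiInv_Orb].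
have /TGrP [PP Ph Pe eP _] := Tz.
by rewrite (tau_Eof ht) tP te; apply: Eof_opp.
Qed.

Lemma SF_Orb (xi : M) : SF m tau xi -> Orb m n xi.
Proof. by move=> [E -> [iE _]]; apply/OrbP; exists E. Qed.

Lemma SA_Orb (xi : M) : SA m tau xi -> Orb m n xi.
Proof. by move=> [E -> [iE _]]; apply/OrbP; exists E. Qed.

Lemma Orb_PhiK (xi : M) : Orb m n xi -> PhiInv (Phi xi) = xi.
Proof. by move=> /OrbP [E -> [EE _]]; apply: PhiK. Qed.

End PhiSets.

Lemma idem_ker_eq (E F : M) : E *m E = E -> F *m F = F -> im E = im F -> ker E = ker F -> E = F.
Proof.
move=> EE FF /(idem_im_eq EE FF) [EF FE] kEF.
suff : E *m (1%:M - F) = 0 by rewrite mulmxBr mulmx1 EF => /eqP; rewrite subr_eq0 => /eqP.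
apply: mulmx_cV_eq => x; rewrite mul0mx -mulmxA; apply/kerP; rewrite kEF; apply/kerP.
by rewrite mulmxA mulmxBr mulmx1 FF subrr mul0mx.
Qed.

Definition vset (V : {vspace 'cV[C]_n}) : set 'cV[C]_n := [set x | x \in V].

Lemma vset_inj : injective vset.
Proof.
move=> V W VW; apply/vspaceP => x; apply/idP/idP => xV.
  have : vset V x by [].
  by rewrite VW.
have : vset W x by [].
by rewrite -VW.
Qed.

Lemma invariantE f (V : {vspace 'cV[C]_n}) : invariant f V = (f @` vset V = vset V).
Proof. by []. Qed.

Lemma image_invariant f (V W : {vspace 'cV[C]_n}) : f @` vset V = vset W ->
  invariant f V <-> W = V.
Proof.
by rewrite invariantE => ->; split=> [/vset_inj|->].
Qed.

Section Semilinear.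
Variables (f g : 'cV[C]_n -> 'cV[C]_n) (tau : M -> M).
Hypotheses (fg : cancel g f) (gf : cancel f g) (f0 : f 0 = 0)
  (ft : forall A x, f (A *m x) = tau A *m f x).

Lemma invariant_im A : invariant f (im A) <-> im (tau A) = im A.
Proof.
have E : f @` vset (im A) = vset (im (tau A)).
  apply/seteqP; split=> [_ [x /imP [y ->] <-]|x /imP [y ->]] /=.
    by rewrite ft; apply/imP; exists (f y).
  by exists (A *m g y); [apply/imP; exists (g y)|rewrite ft fg].
exact: image_invariant E.
Qed.

Lemma invariant_ker A : invariant f (ker A) <-> ker (tau A) = ker A.
Proof.
have E : f @` vset (ker A) = vset (ker (tau A)).
  apply/seteqP; split=> [_ [x /kerP Ax <-]|x /kerP Ax] /=.
    by apply/kerP; rewrite -ft Ax f0.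
  exists (g x); last by rewrite fg.
  by apply/kerP; apply: (can_inj gf); rewrite ft fg Ax f0.
exact: image_invariant E.
Qed.

Hypothesis ht : staraut tau.

(** The semilinear map f carries the image and kernel of E to those of tau E, and an idempotent is
    determined by the two. *)
Lemma invariant_idem (E : M) : E *m E = E ->
  invariant f (im (i *: E)) /\ invariant f (ker (i *: E)) <-> tau E = E.
Proof.
move=> EE; rewrite im_scale ?i_neq0 // ker_scale ?i_neq0 //.
have [a1 a2] := invariant_im E; have [k1 k2] := invariant_ker E.
split=> [[/a1 a /k1 b]|tE].
  have tEE : tau E *m tau E = tau E by rewrite -(tauM ht) EE.
  exact: idem_ker_eq tEE EE a b.
by split; [apply: a2|apply: k2]; rewrite tE.
Qed.

(** As tau respects adjoints, tau of the projector onto V is an orthogonal projector, with image f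
    V. *)
Lemma invariant_proj (V : {vspace 'cV[C]_n}) :
  invariant f V <-> tau (orthoproj V) = orthoproj V.
Proof.
have [PP Ph PV] := orthoprojP V; rewrite -{1}PV invariant_im.
split=> [H|-> //]; apply: orthoproj_unique => //.
  by rewrite -(tauM ht) PP.
by rewrite -(tauC ht) Ph.
Qed.

Lemma semilinear_eq (A B : M) : (forall x, A *m f x = B *m f x) <-> A = B.
Proof.
split=> [H|-> //]; apply: mulmx_cV_eq => x.
by have := H (g x); rewrite fg.
Qed.

End Semilinear.

End Symmetries.

(** * The three involutions and the subsets they define *)

Section Instances.
Context {R : realType} {n : nat}.
Local Notation C := R[i].
Local Notation i := ('i%C : C).
Local Notation M := 'M[C]_n.

Lemma conjmxM p q r (A : 'M[C]_(p, q)) (B : 'M[C]_(q, r)) : conjmx (A *m B) = conjmx A *m conjmx B.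
Proof. exact: map_mxM. Qed.

Lemma conjmxK p q : involutive (@conjmx R p q).
Proof. by move=> A; apply/matrixP => j k; rewrite !mxE conjCK. Qed.

Lemma conjmx0 p q : conjmx (0 : 'M[C]_(p, q)) = 0.
Proof. exact: map_mx0. Qed.

Lemma conjmxN p q (A : 'M[C]_(p, q)) : conjmx (- A) = - conjmx A.
Proof. exact: map_mxN. Qed.

Lemma trCE p q (A : 'M[C]_(p, q)) : A ^t* = conjmx A^T.
Proof. by []. Qed.

Lemma staraut_conj : staraut (@conjmx R n n).
Proof.
split.
- exact: rlinear_conj.
- exact: conjmxM.
- exact: map_mx1.
- by move=> A; apply/matrixP => j k; rewrite !mxE.
- exact: conjmxK.
Qed.

Lemma conjmx_real p q (A : 'M[R]_(p, q)) : conjmx (ofreal A) = ofreal A.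
Proof. by apply/matrixP => j k; rewrite !mxE; apply: conjc_real. Qed.

Lemma trC_real p q (A : 'M[R]_(p, q)) : (ofreal A) ^t* = ofreal A^T.
Proof. by apply/matrixP => j k; rewrite !mxE; apply: conjc_real. Qed.

Lemma ofrealM p q r (A : 'M[R]_(p, q)) (B : 'M[R]_(q, r)) :
  ofreal (A *m B) = ofreal A *m ofreal B.
Proof. exact: map_mxM. Qed.

Section Quaternionic.
Variable J : 'M[R]_n.
Hypotheses (JT : J^T = - J) (JJ : J *m J = - 1%:M).

Let Jc : M := ofreal J.

(** Conjugation of operators by the antilinear map [jmap]; the sign comes from its inverse being its
    opposite. *)
Definition tauJ (A : M) : M := - (Jc *m conjmx A *m Jc).

Lemma Jc_sqr : Jc *m Jc = - 1%:M.
Proof. by rewrite -ofrealM JJ /ofreal map_mxN map_mx1. Qed.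

Lemma Jc_trC : Jc ^t* = - Jc.
Proof. by rewrite trC_real JT /ofreal map_mxN. Qed.

Lemma staraut_J : staraut tauJ.
Proof.
have Jr : conjmx Jc = Jc by apply: conjmx_real.
split.
- move=> k A B; rewrite /tauJ rlinear_conj mulmxDr mulmxDl opprD.
  by rewrite -scalemxAr -scalemxAl scalerN.
- move=> A B; rewrite /tauJ conjmxM mulNmx mulmxN opprK !mulmxA.
  by rewrite -(mulmxA _ Jc Jc) Jc_sqr mulmxN mulmx1 mulNmx mulNmx.
- by rewrite /tauJ (tau1 staraut_conj) mulmx1 Jc_sqr opprK.
- move=> A; rewrite /tauJ trCN !trCM Jc_trC !(mulNmx, mulmxN) opprK !mulmxA.
  by rewrite (tauC staraut_conj).
- move=> A; rewrite /tauJ conjmxN !conjmxM Jr conjmxK mulmxN mulNmx opprK.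
  rewrite !mulmxA Jc_sqr !mulNmx mul1mx -mulmxA Jc_sqr mulmxN mulmx1 opprK //.
Qed.

Lemma jmapK : cancel (fun x => - jmap J x) (jmap J).
Proof.
move=> x; rewrite /jmap conjmxN conjmxM conjmx_real conjmxK mulmxN mulmxA.
by rewrite Jc_sqr mulNmx mul1mx opprK.
Qed.

Lemma jmapK' : cancel (jmap J) (fun x => - jmap J x).
Proof.
move=> x; rewrite /jmap conjmxM conjmx_real conjmxK mulmxA.
by rewrite Jc_sqr mulNmx mul1mx opprK.
Qed.

Lemma jmap_tau A x : jmap J (A *m x) = tauJ A *m jmap J x.
Proof.
rewrite /jmap /tauJ conjmxM mulNmx -!mulmxA (mulmxA Jc Jc) Jc_sqr.
by rewrite mulNmx mul1mx !mulmxN opprK.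
Qed.

Lemma jmap0 : jmap J (0 : 'cV[C]_n) = 0.
Proof. by rewrite /jmap conjmx0 mulmx0. Qed.

End Quaternionic.

Section Unitary.
Variable Theta : 'M[R]_n.
Hypotheses (ThT : Theta^T = Theta) (Th2 : Theta *m Theta = 1%:M).

Let Tc : M := ofreal Theta.

Definition tauT (A : M) : M := Tc *m A *m Tc.

Lemma Tc_sqr : Tc *m Tc = 1%:M.
Proof. by rewrite -ofrealM Th2 /ofreal map_mx1. Qed.

Lemma Tc_trC : Tc ^t* = Tc.
Proof. by rewrite trC_real ThT. Qed.

Lemma staraut_T : staraut tauT.
Proof.
split.
- move=> k A B; rewrite /tauT mulmxDr mulmxDl.
  by rewrite -scalemxAr -scalemxAl.
- by move=> A B; rewrite /tauT !mulmxA -(mulmxA _ Tc Tc) Tc_sqr mulmx1.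
- by rewrite /tauT mulmx1 Tc_sqr.
- by move=> A; rewrite /tauT !trCM Tc_trC mulmxA.
- by move=> A; rewrite /tauT !mulmxA Tc_sqr mul1mx -mulmxA Tc_sqr mulmx1.
Qed.

End Unitary.

Lemma set_iff (T : Type) (A B : set T) : (forall x, A x <-> B x) -> A = B.
Proof. by move=> AB; apply/seteqP; split=> x /AB. Qed.

(** The kernel of E is the image of 1 - E, which turns orthogonality of vectors into one matrix
    equation. *)
Lemma orthogonal_idemP (E K : M) : E *m E = E ->
  orthogonal_for (fun x y => x ^t* *m K *m y) (im (i *: E)) (ker (i *: E)) <->
  E ^t* *m K *m (1%:M - E) = 0.
Proof.
move=> EE; rewrite /orthogonal_for im_scale ?i_neq0 // ker_scale ?i_neq0 //; split.
  move=> H; apply/matrixP => j k; rewrite [RHS]mxE.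
  have E1 (u v : 'cV[C]_n) : (E *m u) ^t* *m K *m ((1%:M - E) *m v) = u ^t* *m (E ^t* *m K *m (1%:M - E)) *m v.
    by rewrite trCM !mulmxA.
  set N := E ^t* *m K *m (1%:M - E) in E1 *.
  pose u : 'cV[C]_n := delta_mx j 0; pose v : 'cV[C]_n := delta_mx k 0.
  have H' := H (E *m u) ((1%:M - E) *m v); rewrite E1 in H'.
  have dj : u ^t* = delta_mx 0 j.
    by rewrite trCE trmx_delta /conjmx map_delta_mx.
  have : u ^t* *m N *m v = 0.
    apply: H'; first by apply/imP; exists u.
    by apply/kerP; rewrite mulmxA mulmxBr mulmx1 EE subrr mul0mx.
  by rewrite dj -rowE -colE => /matrixP /(_ 0 0); rewrite !mxE.
move=> H x y /imP [z ->] /kerP Ey.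
have -> : y = (1%:M - E) *m y by rewrite mulmxBl mul1mx Ey subr0.
by rewrite trCM -!mulmxA (mulmxA K) (mulmxA (E ^t*)) (mulmxA (E ^t*)) H mul0mx mulmx0.
Qed.

Lemma orthogonal_idemP' (E K : M) : E *m E = E ->
  orthogonal_for (fun x y => x^T *m K *m y) (im (i *: E)) (ker (i *: E)) <->
  E^T *m K *m (1%:M - E) = 0.
Proof.
move=> EE; rewrite /orthogonal_for im_scale ?i_neq0 // ker_scale ?i_neq0 //; split.
  move=> H; apply/matrixP => j k; rewrite [RHS]mxE.
  have E1 (u v : 'cV[C]_n) : (E *m u)^T *m K *m ((1%:M - E) *m v) = u^T *m (E^T *m K *m (1%:M - E)) *m v.
    by rewrite trmx_mul !mulmxA.
  set N := E^T *m K *m (1%:M - E) in E1 *.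
  pose u : 'cV[C]_n := delta_mx j 0; pose v : 'cV[C]_n := delta_mx k 0.
  have H' := H (E *m u) ((1%:M - E) *m v); rewrite E1 in H'.
  have : u^T *m N *m v = 0.
    apply: H'; first by apply/imP; exists u.
    by apply/kerP; rewrite mulmxA mulmxBr mulmx1 EE subrr mul0mx.
  by rewrite trmx_delta -rowE -colE => /matrixP /(_ 0 0); rewrite !mxE.
move=> H x y /imP [z ->] /kerP Ey.
have -> : y = (1%:M - E) *m y by rewrite mulmxBl mul1mx Ey subr0.
by rewrite trmx_mul -!mulmxA (mulmxA K) (mulmxA E^T) (mulmxA E^T) H mul0mx mulmx0.
Qed.

Lemma Orb_setE m (P Q : M -> Prop) :
  (forall E : M, E *m E = E -> P (i *: E) <-> Q E) ->
  [set xi : M | Orb m n xi /\ P xi] = [set xi | exists2 E, xi = i *: E & idem m E /\ Q E].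
Proof.
move=> PQ; apply: set_iff => xi; split=> [[/OrbP [E -> iE]]|[E -> [iE qE]]] /=.
  by move/(PQ E iE.1) => qE; exists E.
by split; [apply/OrbP; exists E|apply/(PQ E iE.1)].
Qed.

Lemma D_RE m : D_R R m n = SF m (@conjmx R n n).
Proof.
rewrite /SF -(@Orb_setE m (fun xi => invariant conjmx (im xi) /\ invariant conjmx (ker xi))
  (fun E => conjmx E = E)).
  by apply: set_iff => xi; split=> [[a b c]|[a [b c]]].
move=> E EE; apply: (@invariant_idem _ _ conjmx conjmx) => //.
- exact: conjmxK.
- exact: conjmxK.
- exact: conjmx0.
- exact: conjmxM.
- exact: staraut_conj.
Qed.

Lemma D_HE m J : J^T = - J -> J *m J = - 1%:M -> D_H m n J = SF m (tauJ J).
Proof.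
move=> JT JJ.
rewrite /SF -(@Orb_setE m (fun xi => invariant (jmap J) (im xi) /\ invariant (jmap J) (ker xi))
  (fun E => tauJ J E = E)).
  by apply: set_iff => xi; split=> [[a b c]|[a [b c]]].
move=> E EE; apply: (@invariant_idem _ _ (jmap J) (fun x => - jmap J x)) => //.
- exact: jmapK.
- exact: jmapK'.
- exact: jmap0.
- exact: jmap_tau.
- exact: staraut_J.
Qed.

(** Orthogonality reads E^* Theta = E^* Theta E. The right side is Hermitian, hence so is the left:
    E^* Theta = Theta E. *)
Lemma D_C_unitE m Theta : Theta^T = Theta -> Theta *m Theta = 1%:M ->
  D_C_unit m n Theta = SA m (tauT Theta).
Proof.
move=> TT T2; apply: Orb_setE => E EE; have T2' := Tc_sqr T2; have TT' := Tc_trC TT.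
apply: iff_trans (orthogonal_idemP _ EE) _; rewrite /tauT.
rewrite mulmxBr mulmx1; split=> [/eqP|H].
  rewrite subr_eq0 => /eqP H.
  have H2 := congr1 (fun X : M => X ^t*) H; rewrite !trCM trCK TT' mulmxA -H in H2.
  by rewrite H2 -mulmxA T2' mulmx1.
have -> : E ^t* *m ofreal Theta = ofreal Theta *m E.
  by rewrite -H -(mulmxA (ofreal Theta *m E)) T2' mulmx1.
by rewrite -mulmxA EE subrr.
Qed.

(** Orthogonality reads E^T = E^T E, which is symmetric; so E^T = E, that is, conjugate and adjoint
    of E coincide. *)
Lemma D_C_orthoE m : D_C_ortho R m n = SA m (@conjmx R n n).
Proof.
have H (E : M) : E *m E = E ->
    orthogonal_for (fun x y => x^T *m y) (im (i *: E)) (ker (i *: E)) <-> conjmx E = E ^t*.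
  move=> EE; have := orthogonal_idemP' 1%:M EE; rewrite mulmx1 => K.
  apply: (@iff_trans _ (E^T *m (1%:M - E) = 0)).
    apply: iff_trans K; split=> O x y xE yE; have := O x y xE yE; by rewrite mulmx1.
  rewrite mulmxBr mulmx1; split=> [/eqP|cE].
    rewrite subr_eq0 => /eqP ET.
    have ET2 := congr1 trmx ET; rewrite trmx_mul !trmxK -ET in ET2.
    by rewrite trCE -ET2.
  have -> : E^T = E by rewrite -[LHS]conjmxK -trCE -cE conjmxK.
  by rewrite EE subrr.
exact: Orb_setE.
Qed.

(** Orthogonality reads E^T J = E^T J E. Transposition sends the left side to - J E and the right
    side to its opposite, so J E = E^T J. *)
Lemma D_C_sympE m J : J^T = - J -> J *m J = - 1%:M -> D_C_symp m n J = SA m (tauJ J).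
Proof.
move=> JT JJ; have J2 := Jc_sqr JJ.
have JcT : (ofreal J : M)^T = - ofreal J.
  have -> : (ofreal J)^T = ofreal J^T by apply/matrixP => j k; rewrite !mxE.
  by rewrite JT /ofreal map_mxN.
apply: Orb_setE => E EE; apply: iff_trans (orthogonal_idemP' _ EE) _.
have tE : tauJ J E = E ^t* <-> ofreal J *m E = E^T *m ofreal J.
  have tE' : tauJ J E = conjmx (- (ofreal J *m E *m ofreal J)).
    by rewrite conjmxN !conjmxM conjmx_real.
  rewrite tE' trCE; split=> [/(can_inj (@conjmxK n n)) <-|H].
    by rewrite mulNmx -(mulmxA (ofreal J *m E)) J2 mulmxN mulmx1 opprK.
  by rewrite H -mulmxA J2 mulmxN mulmx1 opprK.
apply: iff_trans (iff_sym tE).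
rewrite mulmxBr mulmx1; split=> [/eqP|H].
  rewrite subr_eq0 => /eqP H.
  have H2 := congr1 trmx H; rewrite !trmx_mul !trmxK JcT mulNmx mulmxN mulmxA in H2.
  by move/oppr_inj: H2 => ->; rewrite -H.
by rewrite -H -mulmxA EE subrr.
Qed.

Lemma TGr_RE m : TGr_R R m n = TF m (@conjmx R n n).
Proof.
have H (V : {vspace 'cV[C]_n}) := @invariant_proj _ _ conjmx conjmx _ (@conjmxK n 1) (@conjmxM n n 1) staraut_conj V.
by apply: set_iff => z; split=> -[a b c]; apply: And3 => //; apply/H.
Qed.

Lemma iTGr_RE m : iTGr_R R m n = TA m (@conjmx R n n).
Proof.
have H (V : {vspace 'cV[C]_n}) := @invariant_proj _ _ conjmx conjmx _ (@conjmxK n 1) (@conjmxM n n 1) staraut_conj V.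
by apply: set_iff => z; split=> -[a b c]; apply: And3 => //; apply/H.
Qed.

Lemma TGr_HE m J : J^T = - J -> J *m J = - 1%:M -> TGr_H m n J = TF m (tauJ J).
Proof.
move=> JT JJ.
have H (V : {vspace 'cV[C]_n}) := invariant_proj (jmapK JJ) (jmap_tau JJ) (staraut_J JT JJ) V.
have K (A : M) : (forall x, A *m jmap J x = jmap J (A *m x)) <-> tauJ J A = A.
  have [s1 s2] := semilinear_eq (jmapK JJ) (tauJ J A) A.
  split=> [Ax|tA x]; last by rewrite (jmap_tau JJ) tA.
  by apply: s1 => x; rewrite Ax (jmap_tau JJ).
by apply: set_iff => z; split=> -[a b c]; apply: And3 => //; (apply/H || apply/K).
Qed.

Lemma iTGr_HE m J : J^T = - J -> J *m J = - 1%:M -> iTGr_H m n J = TA m (tauJ J).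
Proof.
move=> JT JJ.
have H (V : {vspace 'cV[C]_n}) := invariant_proj (jmapK JJ) (jmap_tau JJ) (staraut_J JT JJ) V.
have K (A : M) : (forall x, A *m jmap J x = - jmap J (A *m x)) <-> tauJ J A = - A.
  have [s1 s2] := semilinear_eq (jmapK JJ) (tauJ J A) (- A).
  split=> [Ax|tA x]; last by rewrite (jmap_tau JJ) tA (mulNmx A) opprK.
  by apply: s1 => x; rewrite (mulNmx A) Ax opprK (jmap_tau JJ).
by apply: set_iff => z; split=> -[a b c]; apply: And3 => //; (apply/H || apply/K).
Qed.

Section XTheta.
Variable Theta : 'M[R]_n.
Hypotheses (ThT : Theta^T = Theta) (Th2 : Theta *m Theta = 1%:M).
Let Tc : M := ofreal Theta.

Lemma eigspP a (x : 'cV[C]_n) : x \in eigsp Theta a <-> Tc *m x = a *: x.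
Proof.
split=> [/kerP|H]; last by apply/kerP; rewrite mulmxBl mul_scalar_mx H subrr.
by rewrite mulmxBl mul_scalar_mx => /eqP; rewrite subr_eq0 => /eqP.
Qed.

(** When Theta commutes with P, the projectors (1 + Theta) / 2 and (1 - Theta) / 2 preserve the
    image of P and split it. *)
Lemma graded_comm (P : M) : P *m P = P ->
  (Tc *m P = P *m Tc) -> exists Vp Vm, graded Theta (im P) Vp Vm /\
    (forall x, x \in Vp <-> P *m x = x /\ Tc *m x = x) /\
    (forall x, x \in Vm <-> P *m x = x /\ Tc *m x = - x).
Proof.
move=> PP TP; have T2 : Tc *m Tc = 1%:M by apply: Tc_sqr.
pose Vp := (im P :&: eigsp Theta 1)%VS; pose Vm := (im P :&: eigsp Theta (-1))%VS.
have Vpx x : x \in Vp <-> P *m x = x /\ Tc *m x = x.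
  rewrite memv_cap; split=> [/andP [/(idem_imP _ PP) a /eigspP b]|[a b]].
    by rewrite scale1r in b.
  by apply/andP; split; [apply/(idem_imP _ PP)|apply/eigspP; rewrite scale1r].
have Vmx x : x \in Vm <-> P *m x = x /\ Tc *m x = - x.
  rewrite memv_cap; split=> [/andP [/(idem_imP _ PP) a /eigspP b]|[a b]].
    by rewrite scaleN1r in b.
  by apply/andP; split; [apply/(idem_imP _ PP)|apply/eigspP; rewrite scaleN1r].
exists Vp, Vm; split; last by split.
split; rewrite ?capvSr //.
- apply/vspaceP => x; apply/memv_addP/(idem_imP _ PP).
    by move=> [u /Vpx [Pu _] [v /Vmx [Pv _] ->]]; rewrite mulmxDr Pu Pv.
  move=> Px.
  exists (2^-1 *: (x + Tc *m x)).
    apply/Vpx; rewrite -!scalemxAr !mulmxDr Px !mulmxA T2 mul1mx -TP -mulmxA Px.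
    split; [exact: erefl|by rewrite addrC].
  exists (2^-1 *: (x - Tc *m x)).
    apply/Vmx; rewrite -!scalemxAr !mulmxBr Px !mulmxA T2 mul1mx -TP -mulmxA Px.
    split; [exact: erefl|by rewrite -scalerN opprB].
  by rewrite -scalerDr addrACA subrr addr0 half_twice.
- apply/directv_addP/vspaceP => x; rewrite memv0.
  apply/idP/eqP => [|->]; last exact: mem0v.
  rewrite memv_cap => /andP [/Vpx [_ a] /Vmx [_ b]].
  by rewrite -[x]half_twice -{1}a b addNr scaler0.
Qed.

Lemma graded_stable V Vp Vm : graded Theta V Vp Vm -> forall x, x \in V -> Tc *m x \in V.
Proof.
move=> [/subvP sp /subvP sm <- _] x /memv_addP [u up [v vm ->]].
have /eigspP := sp _ up; have /eigspP := sm _ vm; rewrite mulmxDr => -> ->.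
by rewrite scale1r scaleN1r; apply: memv_add => //; rewrite memvN.
Qed.

(** A grading of Pi amounts to Theta commuting with its projector. Since eta vanishes on Pi,
    exchanging parities on the complement amounts to Theta eta = - eta Theta on the whole space. *)
Lemma X_ThetaE m : X_Theta m n Theta = TA m (tauT Theta).
Proof.
have T2 : Tc *m Tc = 1%:M by apply: Tc_sqr.
have Th : Tc ^t* = Tc by apply: Tc_trC.
apply: set_iff => z.
have [PP Ph PV] := orthoprojP z.1; set P := orthoproj z.1 in PP Ph PV *.
have PV' x : x \in z.1 <-> P *m x = x.
  by rewrite -PV; split=> /(idem_imP _ PP).
have PC (x : 'cV[C]_n) : (forall y, y \in z.1 -> y ^t* *m x = 0) <-> P *m x = 0.
  split=> [H|Px y /PV' <-]; last by rewrite trCM Ph -mulmxA Px mulmx0.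
  apply: gram_eq0; rewrite trCM Ph -mulmxA (mulmxA P) PP mulmxA -[X in X *m P]trCK.
  have := H (P *m x); rewrite trCM Ph trCK; apply.
  by apply/PV'; rewrite mulmxA PP.
have cT : Tc *m P = P *m Tc <-> tauT Theta P = P.
  rewrite /tauT -/Tc; split=> [->|H]; first by rewrite -mulmxA T2 mulmx1.
  by rewrite -[in RHS]H -(mulmxA (Tc *m P)) T2 mulmx1.
split=> [[Tz [Pp [Pm [W [Wp [Wm [g1 oW g2 ep em]]]]]]]|[Tz tP te]].
  have TP : Tc *m P = P *m Tc.
    have PTP : P *m Tc *m P = Tc *m P.
      apply: mulmx_cV_eq => x; rewrite -!mulmxA; apply/PV'; apply: (graded_stable g1).
      by apply/PV'; rewrite mulmxA PP.
    have := congr1 (fun X : M => X ^t*) PTP; rewrite !trCM Ph Th => PTP'.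
    by rewrite mulmxA PTP in PTP'.
  apply: And3 => //; first exact/cT.
  have /TGrP [_ _ _ eP _] := Tz; rewrite -/P in eP.
  have H : Tc *m z.2 = - (z.2 *m Tc).
    have g2' := g2; case: g2' => /subvP sp /subvP sm Ws _.
    have g1' := g1; case: g1' => /subvP sp1 /subvP sm1 _ _.
    have HW x : x \in W -> Tc *m (z.2 *m x) = - (z.2 *m (Tc *m x)).
      rewrite -Ws => /memv_addP [u up [v vm ->]].
      have /eigspP := sp _ up; have /eigspP := sm _ vm; rewrite !mulmxDr => -> ->.
      have /eigspP -> := sm1 _ (ep _ up); have /eigspP -> := sp1 _ (em _ vm).
      by rewrite !scale1r !scaleN1r mulmxN opprD opprK.
    apply: mulmx_cV_eq => x; rewrite mulNmx -!mulmxA.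
    have xW : x - P *m x \in W.
      apply/oW => y yz; have /PC : P *m (x - P *m x) = 0 by rewrite mulmxBr mulmxA PP subrr.
      by apply.
    have eE : z.2 *m x = z.2 *m (x - P *m x) by rewrite mulmxBr (mulmxA _ P) eP mul0mx subr0.
    have TE : z.2 *m (Tc *m x) = z.2 *m (Tc *m (x - P *m x)).
      by rewrite !mulmxBr (mulmxA Tc P) TP -(mulmxA P) (mulmxA z.2 P) eP mul0mx subr0.
    by rewrite eE TE HW.
  by rewrite /tauT -/Tc H mulNmx -mulmxA T2 mulmx1.
split=> //; have /TGrP [_ _ Pe eP _] := Tz; rewrite -/P in Pe eP.
have TP : Tc *m P = P *m Tc by apply/cT.
have Te : Tc *m z.2 = - (z.2 *m Tc).
  by rewrite -mulNmx -te /tauT -/Tc -(mulmxA (Tc *m z.2)) T2 mulmx1.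
have QQ : (1%:M - P) *m (1%:M - P) = 1%:M - P.
  by rewrite mulmxBr mulmx1 mulmxBl mul1mx PP subrr subr0.
have TQ : Tc *m (1%:M - P) = (1%:M - P) *m Tc.
  by rewrite mulmxBr mulmxBl mul1mx mulmx1 TP.
have [Pp [Pm [g1 [Ppx Pmx]]]] := graded_comm PP TP.
have [Wp [Wm [g2 [Wpx Wmx]]]] := graded_comm QQ TQ.
exists Pp, Pm, (im (1%:M - P)), Wp, Wm; split.
- by rewrite -PV.
- move=> x; split=> [/(idem_imP _ QQ) xQ y|/PC Px].
    by apply: (iffRL (PC x)); rewrite -xQ mulmxA mulmxBr mulmx1 PP subrr mul0mx.
  by apply/(idem_imP _ QQ); rewrite mulmxBl mul1mx Px subr0.
- exact: g2.
- move=> x /Wpx [_ Tx]; apply/Pmx; rewrite mulmxA Pe; split=> //.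
  by rewrite mulmxA Te mulNmx -mulmxA Tx.
- move=> x /Wmx [_ Tx]; apply/Ppx; rewrite mulmxA Pe; split=> //.
  by rewrite mulmxA Te mulNmx -mulmxA Tx mulmxN opprK.
Qed.

End XTheta.

End Instances.

(** * Transport of symplectic structures *)

Section Affine.
Context {R : realType}.
Implicit Types E F V W : normedModType R.

Lemma is_derive_affine V W F (f : W -> F) (L : {linear V -> W}) (a : W) (y v : V) df :
  is_derive (a + L y) (L v) f df -> is_derive y v (fun z => f (a + L z)) df.
Proof.
move=> /is_derive_line H; apply/is_derive_line; move: H.
congr (is_derive _ _ _ _); apply/funext => h.
by rewrite linearD linearZ addrCA.
Qed.

(** Right composition is harmless for affine maps: a fixed direction v is sent to the fixed
    direction L v at every point. *)
Lemma Ck_affine k V W F (U : set W) (f : W -> F) (L : {linear V -> W}) (a : W) :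
  continuous L -> Ck k U f -> Ck k [set y | U (a + L y)] (fun y => f (a + L y)).
Proof.
move=> cL; elim: k f => [|k IHk] f [cf df].
  split=> // x Ux; apply: (@continuous_comp _ _ _ (fun y => a + L y) f); last exact: cf.
  by apply: cvgD; [apply: cvg_cst|apply: cL].
split.
  move=> x Ux; apply: (@continuous_comp _ _ _ (fun y => a + L y) f); last exact: cf.
  by apply: cvgD; [apply: cvg_cst|apply: cL].
move=> v; have [d1 d2] := df (L v).
have D x : U (a + L x) -> is_derive x v (fun y => f (a + L y)) ('D_(L v) f (a + L x)).
  by move=> Ux; apply: is_derive_affine; apply: derivableP; apply: d1.
split; first by move=> x /D [].
have H := IHk _ d2.
suff -> : (fun x => 'D_v (fun y => f (a + L y)) x) = (fun y => 'D_(L v) f (a + L y)) by [].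
apply/funext => x; rewrite /derive; set p := fun h => h^-1 *: _; set q := fun h => h^-1 *: _.
suff -> : p = q by [].
have LE h : L (h *: v + x) = h *: L v + L x by rewrite linearP.
by apply/funext => h; rewrite /p /q /= LE addrCA.
Qed.

End Affine.

Section Transport.
Context {R : realType}.
Implicit Types E F : normedModType R.

Lemma open_affine (V W : normedModType R) (U : set W) (L : {linear V -> W}) (a : W) :
  continuous L -> open U -> open [set y | U (a + L y)].
Proof.
move=> cL oU; apply: (@open_comp _ _ (fun y => a + L y) U) => // x _.
by apply: cvgD; [apply: cvg_cst|apply: cL].
Qed.

Definition line_fun k (v : 'rV[R]_k) (t : 'rV[R]_1) : 'rV[R]_k := t 0 0 *: v.

Lemma line_fun_linear k (v : 'rV[R]_k) : linear (line_fun v).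
Proof. by move=> a x y; rewrite /line_fun !mxE scalerDl scalerA. Qed.

HB.instance Definition _ k v := GRing.isLinear.Build R _ _ _ (@line_fun k v) (line_fun_linear v).

Lemma line_fun_continuous k (v : 'rV[R]_k) : continuous (line_fun v).
Proof. by apply: findim_linear; [exact: findim_mx|exact: line_fun_linear]. Qed.

Section Space.
Context {E : normedModType R} {X : Type}.
Variables (S : set X) (e : X -> E).

Lemma pd_tangent k (s : 'rV[R]_k -> X) (U : set 'rV[R]_k) u (j : 'I_k) :
  open U -> smooth_on U (e \o s) -> (forall v, U v -> S (s v)) -> U u ->
  tangent S e (s u) (pd e j s u).
Proof.
move=> oU sU US Uu; pose L := line_fun (dirv j).
have L0 : L 0 = 0 by rewrite /L /line_fun mxE scale0r.
exists (fun t => s (u + L t)); split; [split|].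
- exists [set t | U (u + L t)]; split.
  + split; first exact: (open_affine u (line_fun_continuous (v := dirv j)) oU).
    by rewrite /= L0 addr0.
  + by move=> k'; apply: (Ck_affine u (line_fun_continuous (v := dirv j)) (sU k')).
  + by move=> t /US.
- by rewrite L0 addr0.
have [_ /(_ (dirv j)) [d1 _]] := sU 1%N.
have Ld : L (dirv 0) = dirv j by rewrite /L /line_fun !mxE eqxx scale1r.
have : is_derive (u + L 0) (L (dirv 0)) (e \o s) (pd e j s u).
  by rewrite L0 addr0 Ld; apply: derivableP; apply: d1.
by move=> /is_derive_affine [].
Qed.

End Space.

Section Push.
Context {E F : normedModType R} {X Y : Type}.
Variables (S : set X) (eX : X -> E) (T : set Y) (eY : Y -> F) (f : X -> Y) (G : E -> F).
Hypotheses (fST : forall x, S x -> T (f x)) (sG : smooth setT G)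
  (fG : forall x, S x -> eY (f x) = G (eX x)).

Lemma push_smooth k (s : 'rV[R]_k -> X) U : open U -> smooth_on U (eX \o s) ->
  (forall v, U v -> S (s v)) -> smooth_on U (eY \o (f \o s)).
Proof.
move=> oU sU US j.
have H := smooth_on_comp oU openT (fun x _ => I) sG sU j.
by apply: Ck_ext H => // x Ux /=; rewrite fG //; apply: US.
Qed.

Lemma push_family k (s : 'rV[R]_k -> X) : family S eX s -> family T eY (f \o s).
Proof.
move=> [U [[oU U0] sU US]]; exists U; split=> //; first exact: push_smooth.
by move=> u /US /fST.
Qed.

Lemma push_pd k (s : 'rV[R]_k -> X) U u (j : 'I_k) : open U -> smooth_on U (eX \o s) ->
  (forall v, U v -> S (s v)) -> U u ->
  is_derive u (dirv j) (eY \o (f \o s)) ('d G (eX (s u)) (pd eX j s u)).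
Proof.
move=> oU sU US Uu.
have [_ /(_ (dirv j)) [d1 _]] := sU 1%N.
have dG : differentiable G (eX (s u)) by have [d _] := sG 1%N; apply: d.
have H := is_derive_chain (derivableP (d1 u Uu)) dG.
apply: near_eq_is_derive H; apply: filterS (open_near oU Uu) => v Uv /=.
by rewrite fG //; apply: US.
Qed.

Lemma push_curve x c : curve_through S eX x c -> curve_through T eY (f x) (f \o c).
Proof. by move=> [fc <-]; split=> //; apply: push_family. Qed.

Lemma push_velocity x c : curve_through S eX x c ->
  velocity eY (f \o c) = 'd G (eX x) (velocity eX c).
Proof.
move=> [[U [[oU U0] sU US]] <-].
by have [_ ] := push_pd 0 oU sU US U0.
Qed.

Lemma push_tangent x v : tangent S eX x v -> tangent T eY (f x) ('d G (eX x) v).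
Proof.
move=> [c [cx <-]]; exists (f \o c); split; first exact: push_curve.
exact: push_velocity cx.
Qed.

End Push.

Lemma velocity_near E X (e : X -> E) (c c' : 'rV[R]_1 -> X) :
  (\forall t \near (0 : 'rV[R]_1), c t = c' t) -> velocity e c = velocity e c'.
Proof.
by move=> cc; apply: near_eq_derive; apply: filterS cc => t /= ->.
Qed.

Section Inverse.
Context {E F : normedModType R} {X Y : Type}.
Variables (S : set X) (eX : X -> E) (T : set Y) (eY : Y -> F)
  (f : X -> Y) (G : E -> F) (g : Y -> X) (Gi : F -> E).

(** Both directions are restrictions of maps smooth on the whole ambient spaces, so that no local
    extensions have to be chosen. *)
Record gdiffeo : Prop := Gdiffeo {
  gd_fST : forall x, S x -> T (f x);
  gd_gTS : forall y, T y -> S (g y);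
  gd_gf : forall x, S x -> g (f x) = x;
  gd_fg : forall y, T y -> f (g y) = y;
  gd_sG : smooth setT G;
  gd_sGi : smooth setT Gi;
  gd_fG : forall x, S x -> eY (f x) = G (eX x);
  gd_gG : forall y, T y -> eX (g y) = Gi (eY y) }.

Hypothesis gd : gdiffeo.

Lemma gdiffeo_diffeo : diffeo S eX T eY f.
Proof.
split.
- split; first exact: gd_fST.
    move=> x y /set_mem Sx /set_mem Sy fxy.
    by rewrite -(gd_gf gd Sx) -(gd_gf gd Sy) fxy.
  by move=> y Ty; exists (g y); [exact: gd_gTS|exact: gd_fg].
- move=> x Sx; exists setT, G; split; first by split=> //; exact: openT.
    exact: (smooth_smooth_on openT (gd_sG gd)).
  by move=> y Sy _; apply: gd_fG.
exists g; split; first exact: gd_gf.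
move=> y Ty; exists setT, Gi; split; first by split=> //; exact: openT.
  exact: (smooth_smooth_on openT (gd_sGi gd)).
by move=> z Tz _; apply: gd_gG.
Qed.

(** Off S the composite of Gi and G need not be the identity, so its derivative is computed on
    velocities of curves of S. *)
Lemma tangent_invl x v : S x -> tangent S eX x v -> 'd Gi (eY (f x)) ('d G (eX x) v) = v.
Proof.
move=> Sx [c [cx <-]].
rewrite -(push_velocity (gd_sG gd) (gd_fG gd) cx).
have cy := push_curve (gd_fST gd) (gd_sG gd) (gd_fG gd) cx.
rewrite -(push_velocity (gd_sGi gd) (gd_gG gd) cy).
apply: velocity_near; have [[U [oU sU US]] _] := cx.
by apply: filterS (open_near oU.1 oU.2) => t Ut /=; apply: gd_gf => //; apply: US.
Qed.

End Inverse.

Lemma gdiffeo_sym E F X Y (S : set X) (eX : X -> E) (T : set Y) (eY : Y -> F) f G g Gi :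
  gdiffeo S eX T eY f G g Gi -> gdiffeo T eY S eX g Gi f G.
Proof. by case. Qed.

(** A chart whose two directions are given by smooth maps of open sets of the ambient spaces; unlike
    the existential form in [submanifold], it composes directly with a [gdiffeo]. *)
Definition schart E X d (S : set X) (e : X -> E) (x : X) :=
  exists (U : set E) (V : set 'rV[R]_d) (c : X -> 'rV[R]_d) (h : 'rV[R]_d -> X)
    (K : E -> 'rV[R]_d) (H : 'rV[R]_d -> E),
    [/\ open_nbhs (e x) U, open V,
        (forall y, S y -> U (e y) -> V (c y) /\ h (c y) = y),
        (forall v, V v -> [/\ S (h v), U (e (h v)) & c (h v) = v]) &
        [/\ smooth U K, smooth V H, (forall y, S y -> U (e y) -> c y = K (e y)) &
            (forall v, V v -> e (h v) = H v)]].

Definition smanifold E X d (S : set X) (e : X -> E) := forall x, S x -> schart d S e x.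

Lemma smanifold_submanifold E X d (S : set X) (e : X -> E) :
  smanifold d S e -> submanifold d S e.
Proof.
move=> mS x Sx; have [U [V [c [h [K [H [[oU Ux] oV cV hV [sK sH cK hH]]]]]]]] := mS x Sx.
exists U, V, c; split=> //; split.
- split; first by move=> y [Sy Uy]; have [] := cV y Sy Uy.
    move=> y z /set_mem [Sy Uy] /set_mem [Sz Uz] cyz.
    by have [_ <-] := cV y Sy Uy; have [_ <-] := cV z Sz Uz; rewrite cyz.
  by move=> v Vv; exists (h v); have [] := hV v Vv.
- move=> y [Sy Uy]; exists U, K; split=> //; first exact: smooth_smooth_on.
  by move=> z [Sz _] Uz; apply: cK.
exists h; split; first by move=> y [Sy Uy]; have [] := cV y Sy Uy.
move=> v Vv; exists V, H; split=> //; first exact: smooth_smooth_on.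
by move=> w Vw _; apply: hH.
Qed.

(** Guarantees that [ext_d] is evaluated on an actual family and not at its default value. *)
Definition has2fam E X (S : set X) (e : X -> E) := forall x v w, S x ->
  tangent S e x v -> tangent S e x w ->
  exists s : 'rV[R]_2 -> X, [/\ family S e s, s 0 = x, pd e 0 s 0 = v & pd e 1 s 0 = w].

(** Joint smoothness in the point and the vectors is asked for, where [smooth_form2] fixes the
    vectors: this is the version that survives pullback by a map and its derivative. *)
Definition ambient_form E X (S : set X) (e : X -> E) (w : form2) (b : E -> E -> E -> R) :=
  [/\ smooth setT (fun p : (E * (E * E))%type => b p.1 p.2.1 p.2.2 : R^o),
      (forall y a, scalar (b y a) /\ scalar (b y ^~ a)) &
      (forall y a a', S y -> tangent S e y a -> tangent S e y a' -> w y a a' = b (e y) a a')].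

Record symp E X (S : set X) (e : X -> E) (w : form2) : Prop := Symp {
  sy_man : exists d, smanifold d S e;
  sy_fam : has2fam S e;
  sy_form : exists b, ambient_form S e w b;
  sy_alt : alternating S e w;
  sy_closed : closed_form2 S e w;
  sy_nondeg : nondegenerate S e w }.

Lemma symp_symplectic E X (S : set X) (e : X -> E) (w : form2) :
  symp S e w -> symplectic_manifold S e w.
Proof.
case=> [[d /smanifold_submanifold md] _ [b [sb lb wb]] wa wc wn].
split=> //; first by exists d.
move=> x Sx; exists setT, b; split=> //; first by split=> //; exact: openT.
  move=> a a' k; apply: Sm_Ck; first exact: openT.
  have oT := @openT E.
  have sh : Sm k setT (fun y : E => (y, (a, a')) : (E * (E * E))%type).
    by apply: Sm_pair => //; [apply: Sm_lin => // z; apply: cvg_id|apply: Sm_cst].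
  exact: (Sm_comp oT openT (fun x _ => I) (sb k) sh).
by move=> y a a' Sy _; apply: wb.
Qed.

Section TransportForm.
Context {E F : normedModType R} {X Y : Type}.
Variables (S : set X) (eX : X -> E) (T : set Y) (eY : Y -> F)
  (f : X -> Y) (G : E -> F) (g : Y -> X) (Gi : F -> E).
Hypothesis gd : gdiffeo S eX T eY f G g Gi.

Lemma smanifold_transport d : smanifold d S eX -> smanifold d T eY.
Proof.
move=> mS y Ty.
have [U [V [c [h [K [H [[oU Ux] oV cV hV [sK sH cK hH]]]]]]]] := mS _ (gd_gTS gd Ty).
have oT := @openT F.
exists (Gi @^-1` U), V, (c \o g), (f \o h), (K \o Gi), (G \o H).
have oU' : open (Gi @^-1` U).
  by apply: open_comp => // z _; apply: (Sm_cont (gd_sGi gd 0%N)).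
split=> //.
- by split=> //; rewrite /= -(gd_gG gd Ty).
- move=> z Tz /=; rewrite -(gd_gG gd Tz) => Uz.
  have [Vz hz] := cV _ (gd_gTS gd Tz) Uz.
  by split=> //; rewrite hz (gd_fg gd Tz).
- move=> v Vv /=; have [Sv Uv cv] := hV v Vv; split.
  + exact: gd_fST gd _ Sv.
  + by rewrite /= -(gd_gG gd (gd_fST gd Sv)) (gd_gf gd Sv).
  + by rewrite (gd_gf gd Sv).
split.
- move=> k; apply: (Sm_comp oU' oU _ (sK k)) => //.
  by apply: Sm_sub (gd_sGi gd k).
- by move=> k; apply: (Sm_comp oV openT _ (gd_sG gd k) (sH k)).
- by move=> z Tz /= ; rewrite -(gd_gG gd Tz) => Uz; apply: cK => //; apply: gd_gTS gd _ Tz.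
- by move=> v Vv /=; have [Sv Uv cv] := hV v Vv; rewrite (gd_fG gd Sv) (hH v Vv).
Qed.

Let pfam := push_family (gd_fST gd) (gd_sG gd) (gd_fG gd).
Let pvel := push_velocity (gd_sG gd) (gd_fG gd).
Let ptan := push_tangent (gd_fST gd) (gd_sG gd) (gd_fG gd).
Let gd' := gdiffeo_sym gd.
Let pfam' := push_family (gd_fST gd') (gd_sG gd') (gd_fG gd').
Let ptan' := push_tangent (gd_fST gd') (gd_sG gd') (gd_fG gd').

Lemma has2fam_transport : has2fam S eX -> has2fam T eY.
Proof.
move=> hS y v w Ty tv tw.
have [s [fs s0 sv sw]] := hS _ _ _ (gd_gTS gd Ty) (ptan' tv) (ptan' tw).
exists (f \o s); split; first exact: pfam.
- by rewrite /= s0 (gd_fg gd).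
- have [U [[oU U0] sU US]] := fs.
  have [_ D] := push_pd (gd_sG gd) (gd_fG gd) 0 oU sU US U0.
  rewrite /pd D s0 sv; have := tangent_invl gd' Ty tv.
  by rewrite (gd_gG gd Ty).
have [U [[oU U0] sU US]] := fs.
have [_ D] := push_pd (gd_sG gd) (gd_fG gd) 1 oU sU US U0.
rewrite /pd D s0 sw; have := tangent_invl gd' Ty tw.
by rewrite (gd_gG gd Ty).
Qed.

Variables (wS : @form2 R E X) (wT : @form2 R F Y).
Hypothesis pres : forall x c c', S x -> curve_through S eX x c -> curve_through S eX x c' ->
  wT (f x) (velocity eY (f \o c)) (velocity eY (f \o c')) = wS x (velocity eX c) (velocity eX c').

Lemma pres_tangent y v w : T y -> tangent T eY y v -> tangent T eY y w ->
  wT y v w = wS (g y) ('d Gi (eY y) v) ('d Gi (eY y) w).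
Proof.
move=> Ty tv tw; have Sy := gd_gTS gd Ty.
have [c [cc cv]] := ptan' tv; have [c' [cc' cw]] := ptan' tw.
have := pres Sy cc cc'.
rewrite (pvel cc) (pvel cc') cv cw (gd_fg gd Ty) (gd_gG gd Ty).
have := tangent_invl gd' Ty tv; rewrite (gd_gG gd Ty) => ->.
by have := tangent_invl gd' Ty tw; rewrite (gd_gG gd Ty) => ->.
Qed.

(** On tangent vectors wT is the pullback of wS by the inverse. Its ambient extension is smooth
    because the tangent map of Gi is, and closedness is checked on families pulled back to S. *)
Lemma symp_transport : symp S eX wS -> symp T eY wT.
Proof.
case=> [[d md] hf [b [sb lb wb]] wa wc wn]; split.
- by exists d; apply: smanifold_transport.
- exact: has2fam_transport.
- exists (fun y a a' => b (Gi y) ('d Gi y a) ('d Gi y a')); split.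
  + move=> k.
    have oT1 := @openT (F * (F * F))%type; have oT2 := @openT (E * (E * E))%type.
    have oT3 := @openT (F * F)%type.
    have sD : Sm k setT (fun p : (F * F)%type => 'd Gi (p.1) p.2).
      by have [_ H] := gd_sGi gd k.+1; apply: Sm_sub H.
    have S1 : Sm k setT (fun p : (F * (F * F))%type => p.1) by apply: Sm_fst.
    have S2 : Sm k setT (fun p : (F * (F * F))%type => p.2) by apply: Sm_snd.
    have S21 : Sm k setT (fun p : (F * (F * F))%type => p.2.1).
      exact: (Sm_comp oT1 oT3 (fun x _ => I) (Sm_fst k setT) S2).
    have S22 : Sm k setT (fun p : (F * (F * F))%type => p.2.2).
      exact: (Sm_comp oT1 oT3 (fun x _ => I) (Sm_snd k setT) S2).
    have D1 := Sm_comp oT1 oT3 (fun x _ => I) sD (Sm_pair oT1 S1 S21).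
    have D2 := Sm_comp oT1 oT3 (fun x _ => I) sD (Sm_pair oT1 S1 S22).
    have D0 := Sm_comp oT1 openT (fun x _ => I) (gd_sGi gd k) S1.
    exact: (Sm_comp oT1 oT2 (fun x _ => I) (sb k) (Sm_pair oT1 D0 (Sm_pair oT1 D1 D2))).
  + move=> y a; have [l1 l2] := lb (Gi y) ('d Gi y a).
    split=> r u v; rewrite linearP; first exact: l1.
    exact: l2.
  + move=> y a a' Ty ta ta'; rewrite pres_tangent // wb ?(gd_gG gd Ty) //.
    * exact: gd_gTS gd _ Ty.
    * exact: ptan' ta.
    * exact: ptan' ta'.
- move=> y v Ty tv; rewrite pres_tangent //; apply: wa; first exact: gd_gTS gd _ Ty.
  exact: ptan' tv.
- move=> s fs; have [U [[oU U0] sU US]] := fs.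
  rewrite -[RHS](wc (g \o s)); last exact: pfam'.
  apply: eq_bigr => i _; apply: near_eq_derive.
  apply: filterS (open_near oU U0) => u Uu.
  have tpd j : tangent T eY (s u) (pd eY j s u) by apply: (pd_tangent j oU sU US Uu).
  have pdE j : pd eX j (g \o s) u = 'd Gi (eY (s u)) (pd eY j s u).
    by have [_ ] := push_pd (gd_sG gd') (gd_fG gd') j oU sU US Uu.
  by rewrite !pdE pres_tangent //; apply: US.
move=> y v Ty tv vn.
have Sy := gd_gTS gd Ty.
have v0 : 'd Gi (eY y) v = 0.
  apply: (wn (g y)) => //; first exact: ptan' tv.
  move=> u tu; have tu' := ptan tu; rewrite (gd_fg gd Ty) in tu'.
  rewrite -[in RHS](vn _ tu') pres_tangent //.
  by have := tangent_invl gd Sy tu; rewrite (gd_fg gd Ty) => ->.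
have := tangent_invl gd' Ty tv.
by rewrite v0 linear0.
Qed.

Lemma symp_symplectomorphism : symp S eX wS -> symplectomorphism S eX wS T eY wT f.
Proof.
move=> sS; split; first exact: symp_symplectic.
- exact: symp_symplectic (symp_transport sS).
- exact: gdiffeo_diffeo gd.
- exact: pres.
Qed.

End TransportForm.

End Transport.

(** * The base manifolds *)

Section RealCoordinates.
Context {R : realType} {p q : nat}.
Local Notation rmx := (@Defs.rmx R p q).

Definition linpred (P : rmx -> Prop) := P 0 /\ forall (k : R) u v, P u -> P v -> P (k *: u + v).

Definition pred_space (V : vectType R) (P : V -> Prop) (U : {vspace V}) := forall u, u \in U <-> P u.

(** The subspace is grown one vector at a time, by induction on its codimension, using excluded
    middle to decide whether P is exhausted. *)
Lemma linpred_space (P : 'M[R]_(p, q) * 'M[R]_(p, q) -> Prop) : linpred P ->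
  exists U : {vspace 'M[R]_(p, q) * 'M[R]_(p, q)}, pred_space P U.
Proof.
move=> [P0 PL].
pose V := ('M[R]_(p, q) * 'M[R]_(p, q))%type.
have H n : forall U : {vspace V}, (forall u, u \in U -> P u) -> (\dim {:V} - \dim U <= n)%N ->
    exists U' : {vspace V}, pred_space P U'.
  elim: n => [|n IHn] U UP dU.
    have UT : U = fullv.
      by apply/eqP; rewrite eqEdim subvf /= -subn_eq0 -leqn0.
    by exists U => u; split=> [/UP //|_]; rewrite UT memvf.
  have [PU|/existsNP [u /not_implyP [Pu uU]]] := pselect (forall u, P u -> u \in U).
    by exists U => u; split; [apply: UP|apply: PU].
  apply: (IHn (U + <[u]>)%VS).
    move=> w /memv_addP [a aU [b /vlineP [k ->] ->]].
    by rewrite addrC; apply: PL => //; apply: UP.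
  have : (\dim U < \dim (U + <[u]>)%VS)%N.
    rewrite ltn_neqAle dimvS ?addvSl // andbT; apply/negP => /eqP dd.
    apply: uU; have : U = (U + <[u]>)%VS by apply/eqP; rewrite eqEdim addvSl dd leqnn.
    by move=> ->; apply: (subvP (addvSr U _)); apply: memv_line.
  by move=> lt; rewrite -ltnS; apply: leq_trans dU; apply: ltn_sub2l => //; apply: leq_trans lt (dimvS (subvf _)).
apply: (H (\dim {:V}) 0%VS); last by rewrite leq_subr.
by move=> u; rewrite memv0 => /eqP ->.
Qed.

Lemma space_coords (U : {vspace 'M[R]_(p, q) * 'M[R]_(p, q)}) :
  exists (h : 'rV[R]_(\dim U) -> rmx) (k : rmx -> 'rV[R]_(\dim U)),
  [/\ linear h, linear k, (forall v, h v \in U), (forall v, k (h v) = v) &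
      forall u, u \in U -> h (k u) = u].
Proof.
pose b := vbasis U.
pose h (v : 'rV[R]_(\dim U)) : 'M[R]_(p, q) * 'M[R]_(p, q) := \sum_j v 0 j *: b`_j.
pose k (u : 'M[R]_(p, q) * 'M[R]_(p, q)) : 'rV[R]_(\dim U) := \row_j coord b j (projv U u).
have fb : free b := basis_free (vbasisP U).
exists h, k; split.
- move=> a u v; rewrite /h scaler_sumr -big_split /=; apply: eq_bigr => j _.
  by rewrite !mxE scalerDl scalerA.
- by move=> a u v; apply/rowP => j; rewrite !mxE !linearP.
- move=> v; apply: rpred_sum => j _; apply: rpredZ.
  by apply: vbasis_mem; apply: mem_nth; rewrite size_tuple.
- move=> v; apply/rowP => j; rewrite mxE projv_id; last first.
    apply: rpred_sum => l _; apply: rpredZ.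
    by apply: vbasis_mem; apply: mem_nth; rewrite size_tuple.
  by rewrite /h coord_sum_free.
- move=> u uU; rewrite /h /k [RHS](coord_vbasis uU).
  by apply: eq_bigr => j _; rewrite mxE projv_id.
Qed.

End RealCoordinates.

Section Symmetric.
Context {R : realType} {n : nat}.
Local Notation C := R[i].
Local Notation i := ('i%C : C).
Local Notation M := 'M[C]_n.
Local Notation rmx := (@Defs.rmx R).

(** An antilinear involution, with [b] recording whether it reverses products. It is tau itself when
    tau is antilinear, and tau followed by the adjoint when tau is complex linear; in both cases the
    points of interest are its fixed idempotents. *)
Record antisym (b : bool) (sg : M -> M) : Prop := Antisym {
  sgL : rlinear sg;
  sgi : forall A, sg (i *: A) = - (i *: sg A);
  sgM : forall A B, sg (A *m B) = if b then sg B *m sg A else sg A *m sg B;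
  sg1 : sg 1%:M = 1%:M;
  sgC : forall A, sg (A ^t*) = (sg A) ^t*;
  sgK : involutive sg }.

Definition Dsym m (sg : M -> M) : set M :=
  [set xi | exists2 E, xi = i *: E & idem m E /\ sg E = E].

Variables (b : bool) (sg : M -> M).
Hypothesis hs : antisym b sg.

Lemma sgD A B : sg (A + B) = sg A + sg B.
Proof. by have := sgL hs 1 A B; rewrite !scale1r. Qed.
Lemma sg0 : sg 0 = 0.
Proof. by apply: (addrI (sg 0)); rewrite -sgD !addr0. Qed.
Lemma sgN A : sg (- A) = - sg A.
Proof. by apply: (addrI (sg A)); rewrite -sgD !subrr sg0. Qed.
Lemma sgB A B : sg (A - B) = sg A - sg B.
Proof. by rewrite sgD sgN. Qed.

Lemma sgV A : A \in unitmx -> sg (invmx A) = invmx (sg A).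
Proof.
move=> Au; have E1 : sg A *m sg (invmx A) = 1%:M.
  have := sgM hs A (invmx A); have := sgM hs (invmx A) A.
  by rewrite mulmxV // mulVmx // (sg1 hs); case: b => -> ->.
have tu : sg A \in unitmx by have [] := mulmx1_unit E1.
by rewrite -[LHS](mulKmx tu) E1 mulmx1.
Qed.

(** Reversing the order in (S - S0) (S + S0)^{-1} changes its sign, since the two factors
    anticommute. *)
Definition bsign (A : M) : M := if b then - A else A.

Lemma bsignK : involutive bsign.
Proof. by move=> A; rewrite /bsign; case: b; rewrite ?opprK. Qed.

(* the tangent space at [S0], in the coordinates [Y = (S - S0) (S + S0)^-1] *)
Definition oddmx (S0 Y : M) := S0 *m Y = - (Y *m S0).
Definition oddsym (S0 Y : M) := oddmx S0 Y /\ sg Y = bsign Y.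

Section Chart.
Variable S0 : M.
Hypotheses (S00 : S0 *m S0 = 1%:M) (sS0 : sg S0 = S0).

(** S - S0 and S + S0 anticommute because S and S0 have the same square. *)
Lemma chart_odd S : S *m S = 1%:M -> sg S = S -> S + S0 \in unitmx ->
  oddsym S0 ((S - S0) *m invmx (S + S0)).
Proof.
move=> SS sS Pu; set P := S + S0 in Pu *; set N := S - S0.
have NP : N *m P = - (P *m N).
  by rewrite /N /P !(mulmxDl, mulmxDr, mulmxN, mulNmx) SS S00; mx_ring.
have iN : invmx P *m N = - (N *m invmx P).
  apply: (can_inj (mulKmx Pu)); rewrite mulKVmx // mulmxN (mulmxA P) -[P *m N]opprK -NP.
  by rewrite mulNmx opprK mulmxK.
have S0N : S0 *m N = - (N *m S) by rewrite /N mulmxBr mulmxBl SS S00; mx_ring.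
have S0P : S0 *m P = P *m S by rewrite /P mulmxDr mulmxDl SS S00 addrC.
have iS : S *m invmx P = invmx P *m S0.
  apply: (can_inj (mulKmx Pu)); rewrite mulmxA -S0P mulmxK // mulKVmx //.
split; first by rewrite /oddmx mulmxA S0N mulNmx -!mulmxA iS.
have sN : sg N = N by rewrite sgB sS sS0.
have sP : sg (invmx P) = invmx P by rewrite sgV // sgD sS sS0.
rewrite (sgM hs) sP sN /bsign; case: b => //.
Qed.

(** With P = S + S0 one has 1 - Y = 2 S0 P^{-1} and 1 + Y = 2 S P^{-1}, so the Cayley transform of Y
    times S0 gives S back. *)
Lemma chart_unit S : S *m S = 1%:M -> S + S0 \in unitmx ->
  1%:M - (S - S0) *m invmx (S + S0) \in unitmx /\
  (1%:M + (S - S0) *m invmx (S + S0)) *m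
    invmx (1%:M - (S - S0) *m invmx (S + S0)) *m S0 = S.
Proof.
move=> SS Pu; set P := S + S0 in Pu *; set N := S - S0.
have E1 : 1%:M - N *m invmx P = (S0 + S0) *m invmx P.
  by rewrite -{1}(mulmxV Pu) -mulmxBl; congr (_ *m _); rewrite /P /N; mx_ring.
have E2 : 1%:M + N *m invmx P = (S + S) *m invmx P.
  by rewrite -{1}(mulmxV Pu) -mulmxDl; congr (_ *m _); rewrite /P /N; mx_ring.
have iE : ((S0 + S0) *m invmx P) *m (2^-1 *: (2^-1 *: (P *m (S0 + S0)))) = 1%:M.
  rewrite -!scalemxAr -mulmxA (mulmxA (invmx P)) mulVmx // mul1mx.
  by rewrite mulmxDr !mulmxDl S00 !half_twice.
have [u1 _] := mulmx1_unit iE.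
rewrite E1 E2; split=> //.
have -> : invmx ((S0 + S0) *m invmx P) = 2^-1 *: (2^-1 *: (P *m (S0 + S0))).
  by rewrite -[RHS](mulKmx u1) iE mulmx1.
rewrite -!scalemxAr -!scalemxAl -!mulmxA (mulmxA (invmx P)) mulVmx // mul1mx.
by rewrite (mulmxDl S0 S0) S00 mulmxDr mulmx1 !half_twice.
Qed.

Section Inverse.
Variable Y : M.
Hypotheses (oY : oddsym S0 Y) (Yu : 1%:M - Y \in unitmx).

Let S := (1%:M + Y) *m invmx (1%:M - Y) *m S0.

Lemma cay_swap : S0 *m (1%:M + Y) = (1%:M - Y) *m S0.
Proof. by rewrite mulmxDr mulmx1 oY.1 mulmxBl mul1mx. Qed.

Lemma cay_swap' : S0 *m (1%:M - Y) = (1%:M + Y) *m S0.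
Proof. by rewrite mulmxBr mulmx1 oY.1 opprK mulmxDl mul1mx. Qed.

Lemma cay_unit : 1%:M + Y \in unitmx.
Proof.
have -> : 1%:M + Y = S0 *m (1%:M - Y) *m S0 by rewrite cay_swap' -mulmxA S00 mulmx1.
have S0u : S0 \in unitmx by have [] := mulmx1_unit S00.
by rewrite !unitmx_mul S0u Yu.
Qed.

Lemma cay_comm : (1%:M + Y) *m invmx (1%:M - Y) = invmx (1%:M - Y) *m (1%:M + Y).
Proof.
apply: mulmxN1_comm => //.
by rewrite !(mulmxDl, mulmxDr, mulmxN, mulNmx, mulmx1, mul1mx); mx_ring.
Qed.

(** S0 exchanges 1 + Y and 1 - Y. In this form S is conjugate to S0, which shows that the rank of
    the idempotent is kept. *)
Lemma cay_conj : S = (1%:M + Y) *m S0 *m invmx (1%:M + Y).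
Proof.
rewrite /S -!mulmxA; congr (_ *m _); apply: (can_inj (mulKmx Yu)).
by rewrite mulKVmx // mulmxA -cay_swap mulmxK // cay_unit.
Qed.

Lemma cay_sg : sg S = S.
Proof.
have sY := oY.2; rewrite /bsign in sY.
rewrite /S !(sgM hs) sgV // !sgD sgN (sg1 hs) sY sS0.
case: b in sY *; last by [].
rewrite opprK.
have -> : S0 *m (invmx (1%:M + Y) *m (1%:M - Y)) = invmx (1%:M - Y) *m (1%:M + Y) *m S0.
  apply: (can_inj (mulKmx Yu)); rewrite -!mulmxA mulKVmx // (mulmxA (1%:M - Y)) -cay_swap.
  by rewrite -mulmxA mulKVmx ?cay_unit // cay_swap'.
by rewrite cay_comm.
Qed.

Lemma cay_sub : S + S0 = 2%:R *: (invmx (1%:M - Y) *m S0) /\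
  S - S0 = Y *m (2%:R *: (invmx (1%:M - Y) *m S0)).
Proof.
have : S0 = (1%:M - Y) *m (invmx (1%:M - Y) *m S0) by rewrite mulKVmx.
have : S = (1%:M + Y) *m (invmx (1%:M - Y) *m S0) by rewrite mulmxA.
move: (invmx (1%:M - Y) *m S0) => T -> ->.
rewrite -scalemxAr !scaler_nat !(mulmxDl, mulmxDr, mulmxN, mulNmx, mul1mx).
by split; mx_ring.
Qed.

Lemma cay_chart : S + S0 \in unitmx /\ (S - S0) *m invmx (S + S0) = Y.
Proof.
have [-> ->] := cay_sub.
have Pu : 2%:R *: (invmx (1%:M - Y) *m S0) \in unitmx.
  rewrite unitmxZ ?unitfE ?pnatr_eq0 // unitmx_mul unitmx_inv Yu.
  by have [] := mulmx1_unit S00.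
by rewrite mulmxK.
Qed.

End Inverse.
End Chart.
End Symmetric.

(** * Constancy of the dimension *)

Section Dimension.
Variable K : fieldType.
Implicit Types V W : vectType K.

Lemma dim_inj_le V W (f : V -> W) (U : {vspace V}) (U' : {vspace W}) : linear f ->
  (forall u, u \in U -> f u \in U') -> (forall u, u \in U -> f u = 0 -> u = 0) ->
  (\dim U <= \dim U')%N.
Proof.
move=> lf fU fi.
pose F : {linear V -> W} := HB.pack f (GRing.isLinear.Build K V W *:%R f lf).
have k0 : (U :&: lker (linfun F) = 0)%VS.
  apply/eqP; rewrite -subv0; apply/subvP => u; rewrite memv_cap memv_ker memv0 lfunE /=.
  by move=> /andP [uU /eqP f0]; rewrite (fi u uU f0).
rewrite -(limg_dim_eq k0); apply: dimvS; apply/subvP => w /memv_imgP [u uU ->].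
by rewrite lfunE; apply: fU.
Qed.

(** O is the direct sum of U and f U; the last hypothesis gives both directness and injectivity of f
    on U. *)
Lemma dim_double V (f : V -> V) (U O : {vspace V}) : linear f ->
  (forall u v, u \in U -> v \in U -> u + f v \in O) ->
  (forall w, w \in O -> exists u v, [/\ u \in U, v \in U & w = u + f v]) ->
  (forall u v, u \in U -> v \in U -> u + f v = 0 -> v = 0) ->
  \dim O = (\dim U + \dim U)%N.
Proof.
move=> lf UO OU fi.
pose F : {linear V -> V} := HB.pack f (GRing.isLinear.Build K V V *:%R f lf).
have FE x : linfun F x = f x by rewrite lfunE.
have k0 : (U :&: lker (linfun F) = 0)%VS.
  apply/eqP; rewrite -subv0; apply/subvP => u; rewrite memv_cap memv_ker memv0 FE.
  by move=> /andP [uU /eqP f0]; rewrite (fi 0 u) ?mem0v // add0r.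
rewrite -{2}(limg_dim_eq k0) -dimv_disjoint_sum; last first.
  apply/eqP; rewrite -subv0; apply/subvP => w; rewrite memv_cap memv0.
  move=> /andP [wU /memv_imgP [u uU]]; rewrite FE => wE.
  have u0 : - u = 0.
    apply: (fi w) => //; first by rewrite rpredN.
    by rewrite (linearN F u : f (- u) = - f u) wE subrr.
  by rewrite wE -[u]opprK u0 oppr0 -FE linear0.
congr (\dim _); apply/vspaceP => w; apply/idP/idP.
  move=> /OU [u [v [uU vU ->]]]; apply: memv_add => //.
  by rewrite -FE; apply: memv_img.
move=> /memv_addP [u uU [_ /memv_imgP [v vU ->] ->]].
by rewrite FE; apply: UO.
Qed.

End Dimension.

Section Conjugate.
Context {R : realType} {n : nat}.
Local Notation C := R[i].
Local Notation i := ('i%C : C).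
Implicit Types (m : nat) (E : 'M[C]_n).

Lemma idem_factor m E : idem m E ->
  exists (Q : 'M[C]_(n, m)) (P : 'M[C]_(m, n)), E = Q *m P /\ P *m Q = 1%:M.
Proof.
move=> hE.
have [Q [P [QP PQ]]] : Orb m n (i *: E) by apply/OrbP; exists E.
exists Q, (- i *: P); rewrite -scalemxAr -scalemxAl PQ -QP scalerA mulNr mulii opprK scale1r.
by rewrite scale_scalar_mx mulNr mulii opprK.
Qed.

Lemma factor_idem m (Q : 'M[C]_(n, m)) (P : 'M[C]_(m, n)) : P *m Q = 1%:M -> idem m (Q *m P).
Proof.
move=> PQ; split; first by rewrite mulmxA -(mulmxA Q) PQ mulmx1.
apply: etrans (dim_im_linv PQ); congr (\dim _).
apply/eqP; rewrite eqEsubv; apply/andP; split; apply/im_subP; first by exists P.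
by exists Q; rewrite -mulmxA PQ mulmx1.
Qed.

Lemma idem_conj m E (g : 'M[C]_n) : idem m E -> g \in unitmx -> idem m (g *m E *m invmx g).
Proof.
move=> /idem_factor [Q [P [-> PQ]]] gu.
have -> : g *m (Q *m P) *m invmx g = (g *m Q) *m (P *m invmx g) by rewrite !mulmxA.
by apply: factor_idem; rewrite mulmxA mulmxKV.
Qed.

Lemma idem_compl m E : idem m E -> idem (n - m)%N (1%:M - E).
Proof.
move=> [EE dE]; have FF : (1%:M - E) *m (1%:M - E) = 1%:M - E.
  by rewrite mulmxBl mul1mx mulmxBr mulmx1 EE subrr subr0.
split=> //; have -> : im (1%:M - E) = ker E.
  apply/vspaceP => x; apply/imP/kerP => [[y ->]|Ex].
    by rewrite mulmxA mulmxBr mulmx1 EE subrr mul0mx.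
  by exists x; rewrite mulmxBl mul1mx Ex subr0.
have := limg_ker_dim (endo E) fullv; rewrite capfv dimvf dE /= => /(congr1 (subn^~ m)).
by rewrite addnK /dim /= muln1.
Qed.

Lemma factor_orth p q (Q : 'M[C]_(n, p)) (P : 'M[C]_(p, n))
    (T : 'M[C]_(n, q)) (L : 'M[C]_(q, n)) :
  P *m Q = 1%:M -> L *m T = 1%:M -> (Q *m P) *m (T *m L) = 0 -> P *m T = 0.
Proof.
move=> PQ LT h; have : P *m ((Q *m P) *m (T *m L)) *m T = 0 by rewrite h mulmx0 mul0mx.
by rewrite !mulmxA PQ mul1mx -!mulmxA LT mulmx1.
Qed.

(** g matches frames of the images and frames of the complementary images: with E = Q P and 1 - E =
    T L, and likewise for F, it is Q' P + T' L. *)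
Lemma idem_similar m E F : idem m E -> idem m F ->
  exists2 g, g \in unitmx & g *m E = F *m g.
Proof.
move=> hE hF.
have [Q [P [QP PQ]]] := idem_factor hE; have [Q' [P' [QP' PQ']]] := idem_factor hF.
have [T [L [TL LT]]] := idem_factor (idem_compl hE).
have [T' [L' [TL' LT']]] := idem_factor (idem_compl hF).
have orth (A : 'M[C]_n) : A *m A = A -> A *m (1%:M - A) = 0 /\ (1%:M - A) *m A = 0.
  by move=> AA; rewrite mulmxBr mulmxBl mulmx1 mul1mx AA subrr.
have [EF FE] := orth _ hE.1; have [EF' FE'] := orth _ hF.1.
rewrite TL QP in EF FE; rewrite TL' QP' in EF' FE'.
have PT := factor_orth PQ LT EF; have LQ := factor_orth LT PQ FE.
have PT' := factor_orth PQ' LT' EF'; have LQ' := factor_orth LT' PQ' FE'.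
pose g := Q' *m P + T' *m L; pose h := Q *m P' + T *m L'.
have gh : g *m h = 1%:M.
  rewrite /g /h mulmxDl !mulmxDr.
  rewrite -(mulmxA Q') (mulmxA P) PQ mul1mx -(mulmxA Q') (mulmxA P T) PT mul0mx mulmx0 addr0.
  rewrite -(mulmxA T') (mulmxA L Q) LQ mul0mx mulmx0 add0r -(mulmxA T') (mulmxA L T) LT mul1mx.
  by rewrite -QP' -TL' addrC subrK.
exists g; first by have [] := mulmx1_unit gh.
have -> : g *m E = Q' *m P.
  rewrite QP /g mulmxDl -(mulmxA Q') (mulmxA P) PQ mul1mx.
  by rewrite -(mulmxA T') (mulmxA L) LQ mul0mx mulmx0 addr0.
rewrite QP' /g mulmxDr -(mulmxA Q') (mulmxA P') PQ' mul1mx.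
by rewrite -(mulmxA Q') (mulmxA P') PT' mul0mx mulmx0 addr0.
Qed.

End Conjugate.

Section OddDimension.
Context {R : realType} {n : nat}.
Local Notation C := R[i].
Local Notation i := ('i%C : C).
Local Notation M := 'M[C]_n.
Variables (b : bool) (sg : M -> M).
Hypothesis hs : antisym b sg.

Lemma half_split (Y Z : M) :
  2^-1 *: (Y + Z) + i *: (- i *: (2^-1 *: (Y - Z))) = Y.
Proof.
rewrite scalerA mulrN mulii opprK scale1r -scalerDr addrACA subrr addr0.
exact: half_twice.
Qed.

Lemma bsignZ (a : C) (A : M) : bsign b (a *: A) = a *: bsign b A.
Proof. by rewrite /bsign; case: b; rewrite ?scalerN. Qed.

Lemma bsignD (A B : M) : bsign b (A + B) = bsign b A + bsign b B.
Proof. by rewrite /bsign; case: b; rewrite ?opprD. Qed.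

Lemma sgbs A : sg (bsign b A) = bsign b (sg A).
Proof. by rewrite /bsign; case: (b) => //; apply: (sgN hs). Qed.

Lemma sgZr (k : R) A : sg (k%:C%C *: A) = k%:C%C *: sg A.
Proof. by have := sgL hs k A 0; rewrite (sg0 hs) !addr0. Qed.

Lemma sgNi A : sg (- i *: A) = i *: sg A.
Proof. by rewrite scaleNr (sgN hs) (sgi hs) opprK. Qed.

Lemma odd_lin (S0 : M) (k : R) A B : oddmx S0 A -> oddmx S0 B -> oddmx S0 (k%:C%C *: A + B).
Proof. by rewrite /oddmx mulmxDr mulmxDl -scalemxAr -scalemxAl => -> ->; rewrite opprD scalerN. Qed.

Lemma oddsym_lin (S0 : M) (k : R) A B : oddsym b sg S0 A -> oddsym b sg S0 B ->
  oddsym b sg S0 (k%:C%C *: A + B).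
Proof.
move=> [oA sA] [oB sB]; split; first exact: odd_lin.
by rewrite (sgL hs) sA sB bsignD bsignZ.
Qed.

Lemma odd_bsg S0 A : sg S0 = S0 -> oddmx S0 A -> oddmx S0 (bsign b (sg A)).
Proof.
move=> sS oA; have : oddmx S0 (sg A).
  have := congr1 sg oA; rewrite (sgN hs) !(sgM hs) sS /oddmx.
  by case: (b) => // ->; rewrite opprK.
by rewrite /oddmx /bsign; case: (b) => //; rewrite mulmxN mulNmx => ->.
Qed.

Lemma oddmx_conj (g Sa Sb Y : M) : g \in unitmx -> g *m Sa = Sb *m g ->
  oddmx Sa Y -> oddmx Sb (g *m Y *m invmx g).
Proof.
rewrite /oddmx => gu gS oY; have gS' : invmx g *m Sb = Sa *m invmx g.
  by apply: (can_inj (mulKmx gu)); rewrite mulKVmx // mulmxA gS mulmxK.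
by rewrite -(mulmxA _ (invmx g)) gS' !mulmxA -gS -(mulmxA g) oY mulmxN mulNmx !mulmxA.
Qed.

Lemma odd_space (S0 : M) : exists U : {vspace 'M[R]_n * 'M[R]_n},
  pred_space (fun u => oddmx S0 (ofreim u)) U.
Proof.
apply: linpred_space; split; first by rewrite ofreim0 /oddmx mulmx0 mul0mx oppr0.
by move=> k u v ou ov; rewrite ofreim_linear; apply: odd_lin.
Qed.

Lemma oddsym_space (S0 : M) : exists U : {vspace 'M[R]_n * 'M[R]_n},
  pred_space (fun u => oddsym b sg S0 (ofreim u)) U.
Proof.
apply: linpred_space; split.
  rewrite ofreim0 /oddsym /oddmx mulmx0 mul0mx oppr0 (sg0 hs); split=> //.
  by rewrite /bsign; case: (b); rewrite ?oppr0.
by move=> k u v ou ov; rewrite ofreim_linear; apply: oddsym_lin.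
Qed.

(** Y -> [bsign] ([sg] Y) is a real structure on the complex space of matrices odd for S0, and the
    tangent space is its real form. *)
Lemma oddsym_dim (S0 : M) (U O : {vspace 'M[R]_n * 'M[R]_n}) : sg S0 = S0 ->
  pred_space (fun u => oddsym b sg S0 (ofreim u)) U ->
  pred_space (fun u => oddmx S0 (ofreim u)) O -> \dim O = (\dim U + \dim U)%N.
Proof.
move=> sS hU hO.
pose J (u : 'M[R]_n * 'M[R]_n) : 'M[R]_n * 'M[R]_n := reim (i *: ofreim u).
have oJ u : ofreim (J u) = i *: ofreim u by rewrite reimK.
have ioddmx (a : C) A : oddmx S0 A -> oddmx S0 (a *: A).
  by rewrite /oddmx -scalemxAr -scalemxAl -scalerN => ->.
have addo A B : oddmx S0 A -> oddmx S0 B -> oddmx S0 (A + B).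
  by move=> oA oB; have := odd_lin 1 oA oB; rewrite scale1r.
have JE (w : 'M[R]_n * 'M[R]_n) (A B : M) : ofreim w = A + i *: B -> w = reim A + J (reim B).
  move=> h; apply: ofreim_inj; rewrite (ofreimD (reim A) (J (reim B))) oJ h.
  by rewrite (reimK A) (reimK B).
apply: (@dim_double R _ J).
- by move=> k u v; rewrite /J ofreim_linear scalerDr scalerA mulrC -scalerA reim_linear.
- move=> u v /hU [ou su] /hU [ov sv]; apply/hO.
  rewrite ofreimD oJ; exact: (addo _ _ ou (ioddmx i _ ov)).
- move=> w /hO; have [Y wY] : exists Y, ofreim w = Y by exists (ofreim w).
  rewrite wY => oY; have oZ := odd_bsg sS oY; set Z := bsign b (sg Y) in oZ.
  have sZ : sg Z = bsign b Y by rewrite sgbs (sgK hs).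
  have sY : sg Y = bsign b Z by rewrite bsignK.
  have hf (A : M) : sg (2^-1 *: A) = 2^-1 *: sg A.
    by rewrite -[2^-1](_ : (2^-1 : R)%:C%C = _) ?sgZr // fmorphV rmorph_nat.
  exists (reim (2^-1 *: (Y + Z))), (reim (- i *: (2^-1 *: (Y - Z)))); split.
  + apply/hU; rewrite reimK; split; first exact: (ioddmx _ _ (addo _ _ oY oZ)).
    by rewrite hf (sgD hs) sZ sY bsignZ bsignD addrC.
  + apply/hU; rewrite reimK; split.
      have oN := ioddmx (-1) _ oZ; rewrite scaleN1r in oN.
      exact: (ioddmx _ _ (ioddmx _ _ (addo _ _ oY oN))).
    rewrite sgNi hf (sgB hs) sZ sY !bsignZ bsignD scaleNr -!scalerN.
    have -> : bsign b (- Z) = - bsign b Z by rewrite /bsign; case: (b).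
    by rewrite opprD opprK addrC.
  + exact: (JE _ _ _ (etrans wY (esym (half_split Y Z)))).
- move=> u v /hU [ou su] /hU [ov sv] /(congr1 (@ofreim R n n)).
  rewrite ofreimD oJ ofreim0 => /eqP; rewrite addr_eq0 => /eqP uv.
  have := congr1 sg uv; rewrite su uv (sgN hs) (sgi hs) sv opprK.
  rewrite -scaleNr bsignZ => e; apply: (@ofreim_inj R n n); rewrite ofreim0.
  apply: (can_inj (bsignK b)); have : (i + i) *: bsign b (ofreim v) = 0.
    by rewrite scalerDl -{1}e -scalerDl addNr scale0r.
  rewrite -mulr2n => /eqP; rewrite scaler_eq0 mulrn_eq0 (negbTE i_neq0) /= => /eqP ->.
  by rewrite /bsign; case: (b); rewrite ?oppr0.
Qed.

(** Idempotents of equal rank are conjugate, but the conjugating matrix need not respect [sg]. The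
    comparison is therefore made between the complex odd spaces, and the dimension halved. *)
Lemma oddsym_dim_const m (E F : M) (U V : {vspace 'M[R]_n * 'M[R]_n}) :
  idem m E -> idem m F -> sg E = E -> sg F = F ->
  pred_space (fun u => oddsym b sg (E + E - 1%:M) (ofreim u)) U ->
  pred_space (fun u => oddsym b sg (F + F - 1%:M) (ofreim u)) V -> \dim U = \dim V.
Proof.
move=> hE hF sE sF hU hV.
have sS A : sg A = A -> sg (A + A - 1%:M) = A + A - 1%:M.
  by move=> sA; rewrite (sgB hs) (sgD hs) sA (sg1 hs).
have [W hW] := odd_space (E + E - 1%:M); have [W' hW'] := odd_space (F + F - 1%:M).
have dU := oddsym_dim (sS _ sE) hU hW; have dV := oddsym_dim (sS _ sF) hV hW'.
have le A B (OA OB : {vspace 'M[R]_n * 'M[R]_n}) : idem m A -> idem m B ->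
    pred_space (fun u => oddmx (A + A - 1%:M) (ofreim u)) OA ->
    pred_space (fun u => oddmx (B + B - 1%:M) (ofreim u)) OB -> (\dim OA <= \dim OB)%N.
  move=> hA hB hOA hOB; have [g gu gAB] := idem_similar hA hB.
  have gS : g *m (A + A - 1%:M) = (B + B - 1%:M) *m g.
    by rewrite mulmxBr mulmxBl mulmxDr mulmxDl gAB mulmx1 mul1mx.
  apply: (@dim_inj_le R _ _ (fun u => reim (g *m ofreim u *m invmx g))).
  - move=> k u v; rewrite ofreim_linear mulmxDr mulmxDl -scalemxAr -scalemxAl.
    by rewrite reim_linear.
  - move=> u /hOA ou; apply/hOB; rewrite reimK.
    exact: (oddmx_conj gu gS ou).
  - move=> u _ /(congr1 (@ofreim R n n)); rewrite reimK ofreim0 => e.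
    apply: (@ofreim_inj R n n); rewrite ofreim0.
    have := congr1 (fun T => invmx g *m T *m g) e.
    by rewrite mulmx0 mul0mx -!mulmxA mulVmx // mulmx1 mulKmx.
apply: double_inj; rewrite -!addnn -dU -dV.
by apply/eqP; rewrite eqn_leq (le E F) // (le F E).
Qed.

End OddDimension.

(** * Cayley charts on the sets of symmetric idempotents *)

Section SymmetricManifold.
Context {R : realType} {n : nat}.
Local Notation C := R[i].
Local Notation i := ('i%C : C).
Local Notation M := 'M[C]_n.
Local Notation rmx := (@Defs.rmx R).
Variables (b : bool) (sg : M -> M) (m : nat).
Hypothesis hs : antisym b sg.
Local Notation D := (Dsym m sg).

Lemma refl_sqr (E : M) : E *m E = E -> (E + E - 1%:M) *m (E + E - 1%:M) = 1%:M.
Proof.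
move=> EE; rewrite !(mulmxDl, mulmxDr, mulmxN, mulNmx, mulmx1, mul1mx) EE.
by mx_ring.
Qed.

Lemma refl_sg (E : M) : sg E = E -> sg (E + E - 1%:M) = E + E - 1%:M.
Proof. by move=> sE; rewrite (sgB hs) (sgD hs) sE (sg1 hs). Qed.

Definition cayE (S0 Y : M) : M := 2^-1 *: (1%:M + (1%:M + Y) *m invmx (1%:M - Y) *m S0).

Lemma cayE_refl S0 Y : cayE S0 Y + cayE S0 Y - 1%:M = (1%:M + Y) *m invmx (1%:M - Y) *m S0.
Proof. by rewrite /cayE -scalerDr half_twice addrC addKr. Qed.

Lemma sg_half (A : M) : sg (2^-1 *: A) = 2^-1 *: sg A.
Proof.
have hh : (2^-1 : R)%:C%C = 2^-1 :> C by rewrite fmorphV rmorph_nat.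
by rewrite -hh (sgZr hs).
Qed.

Lemma cayE_idem (E Y : M) : idem m E -> sg E = E -> oddsym b sg (E + E - 1%:M) Y ->
  1%:M - Y \in unitmx -> idem m (cayE (E + E - 1%:M) Y) /\
  sg (cayE (E + E - 1%:M) Y) = cayE (E + E - 1%:M) Y.
Proof.
move=> hE sE oY Yu; have S00 := refl_sqr hE.1; have sS := refl_sg sE.
have Yp := cay_unit S00 oY Yu.
split; last by rewrite /cayE sg_half (sgD hs) (sg1 hs) (cay_sg hs S00 sS oY Yu).
have -> : cayE (E + E - 1%:M) Y = (1%:M + Y) *m E *m invmx (1%:M + Y).
  rewrite /cayE (cay_conj S00 oY Yu) mulmxBr mulmxDr mulmx1 mulmxBl mulmxDl mulmxV //.
  by rewrite addrC subrK half_twice.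
exact: idem_conj.
Qed.

Lemma DsymE (E : M) : idem m E -> sg E = E -> D (i *: E).
Proof. by move=> hE sE; exists E. Qed.

Lemma unscale_i (E : M) : - i *: (i *: E) = E.
Proof. by rewrite scalerA mulNr mulii opprK scale1r. Qed.

Lemma scale_iN (E : M) : i *: (- i *: E) = E.
Proof. by rewrite scalerA mulrN mulii opprK scale1r. Qed.

Lemma DsymP (xi : M) : D xi <-> idem m (- i *: xi) /\ sg (- i *: xi) = - i *: xi.
Proof.
split=> [[E -> [hE sE]]|[hE sE]]; first by rewrite unscale_i.
by exists (- i *: xi); rewrite ?scale_iN.
Qed.

Lemma open_unit_preim (V : normedModType R) (f : V -> M) : csmooth setT f ->
  open [set x | f x \in unitmx].
Proof.
move=> sf; have -> : [set x | f x \in unitmx] = (fun x => reim (f x)) @^-1` (@units R n).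
  by apply/seteqP; split=> x; rewrite /units /= reimK.
apply: open_comp; last exact: open_units.
by move=> x _; exact: (Sm_cont (sf 0%N) I).
Qed.

Definition numE (v : rmx n n) : M := - i *: ofreim v.

Lemma csmooth_numE U : open U -> csmooth U numE.
Proof. by move=> oU; apply: csmoothZ => //; apply: csmooth_id. Qed.

Lemma csmooth_refl U : open U -> csmooth U (fun v => numE v + numE v - 1%:M).
Proof.
move=> oU; apply: csmoothB => //; last exact: csmooth_cst.
by apply: csmoothD => //; apply: csmooth_numE.
Qed.

Lemma csmooth_cayE (V : normedModType R) (U : set V) (S0 : M) (Y : V -> M) : open U ->
  (forall x, U x -> 1%:M - Y x \in unitmx) -> csmooth U Y -> csmooth U (fun x => cayE S0 (Y x)).
Proof.
move=> oU Yu sY; apply: csmoothZ => //; apply: csmoothD => //; first exact: csmooth_cst.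
apply: csmoothM => //; last exact: csmooth_cst.
apply: csmoothM => //; first by apply: csmoothD => //; apply: csmooth_cst.
apply: csmooth_inv => //; apply: csmoothB => //; exact: csmooth_cst.
Qed.

Lemma numE_reim (E : M) : numE (reim (i *: E)) = E.
Proof. by rewrite /numE reimK unscale_i. Qed.

Lemma Dsym_chart d (E : M) (h : 'rV[R]_d -> rmx n n) (k : rmx n n -> 'rV[R]_d) :
  idem m E -> sg E = E -> linear h -> linear k ->
  (forall v, oddsym b sg (E + E - 1%:M) (ofreim (h v))) -> (forall v, k (h v) = v) ->
  (forall u, oddsym b sg (E + E - 1%:M) (ofreim u) -> h (k u) = u) ->
  schart d D reim (i *: E).
Proof.
move=> hE sE lh lk ho kh hk; have S00 := refl_sqr hE.1; have sS := refl_sg sE.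
have cI Y := @cayE_idem E Y hE sE; have ES := erefl (E + E - 1%:M).
move: {2}(E + E - 1%:M) ES cI S00 sS ho hk => S0 ES; rewrite ES => cI S00 sS ho hk.
pose num (v : rmx n n) := numE v + numE v - 1%:M.
pose U := [set v | num v + S0 \in unitmx].
pose V := [set y | 1%:M - ofreim (h y) \in unitmx].
pose K (v : rmx n n) := k (reim ((num v - S0) *m invmx (num v + S0))).
pose H y := reim (i *: cayE S0 (ofreim (h y))) : rmx n n.
have oU : open U.
  apply: open_unit_preim; apply: csmoothD; [exact: openT| |exact: csmooth_cst].
  exact: csmooth_refl openT.
have sh W : smooth W h by apply: smooth_linear => //; apply: findim_mx.
have oV : open V.
  apply: open_unit_preim; apply: csmoothB; [exact: openT|exact: csmooth_cst|].
  exact: csmooth_lin (sh _).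
have numK A : num (reim (i *: A)) = A + A - 1%:M by rewrite /num numE_reim.
exists U, V, (K \o reim), (fun y => i *: cayE S0 (ofreim (h y))), K, H; split.
- split=> //; rewrite /U /= numK ES.
  have -> : S0 + S0 = 2%:R *: S0 by rewrite scaler_nat mulr2n.
  by rewrite unitmxZ ?unitfE ?pnatr_eq0 //; have [] := mulmx1_unit S00.
- exact: oV.
- move=> _ [F -> [hF sF]]; rewrite /U /V /K /= numK => Uy.
  have := chart_odd hs S00 sS (refl_sqr hF.1) (refl_sg sF) Uy.
  have := chart_unit S00 (refl_sqr hF.1) Uy.
  move: ((F + F - 1%:M - S0) *m invmx (F + F - 1%:M + S0)) => Y [Yu YE] oY.
  have hY : ofreim (h (k (reim Y))) = Y by rewrite hk reimK.
  by rewrite hY; split=> //; congr (_ *: _); rewrite /cayE YE addrC subrK half_twice.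
- move=> v Vv; have oY := ho v; rewrite /U /K /= numK cayE_refl.
  have [Su ->] := cay_chart S00 Vv.
  have [cI1 cI2] := cI _ oY Vv.
  by split; [exact: DsymE| |rewrite ofreimK kh].
split=> //.
- have sK : csmooth U (fun v => (num v - S0) *m invmx (num v + S0)).
    have sn := csmooth_refl oU.
    apply: csmoothM => //; first by apply: csmoothB => //; apply: csmooth_cst.
    by apply: csmooth_inv => //; apply: csmoothD => //; apply: csmooth_cst.
  move=> j; have sk := @smooth_linear R _ _ setT k (findim_rmx n n) lk j.
  exact: (Sm_comp oU openT (fun x _ => I) sk (sK j)).
have : csmooth V (fun y => i *: cayE S0 (ofreim (h y))).
  apply: csmoothZ => //; apply: csmooth_cayE => //; exact: csmooth_lin (sh _).
by [].
Qed.

Lemma Dsym_smanifold : exists d, smanifold d D reim.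
Proof.
(* One dimension must serve all charts: it is read at an arbitrary point, or set to 0 when the set
   is empty. *)
have [[_ [E0 _ [hE0 sE0]]]|D0] := pselect (exists xi, D xi); last first.
  by exists 0%N => xi Dx; case: D0; exists xi.
have [U0 hU0] := oddsym_space hs (E0 + E0 - 1%:M).
exists (\dim U0) => _ [E -> [hE sE]].
have [U hU] := oddsym_space hs (E + E - 1%:M).
have dU := oddsym_dim_const hs hE0 hE sE0 sE hU0 hU.
have [h [k [lh lk hU' kh hk]]] := space_coords U.
move: h k lh lk hU' kh hk; rewrite -dU => h k lh lk hU' kh hk.
apply: (@Dsym_chart _ E h k) => //.
- by move=> v; apply/hU.
- by move=> u ou; apply: hk; apply/hU.
Qed.

End SymmetricManifold.

(** * Tangent vectors and two-parameter families *)

Section SymmetricTangents.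
Context {R : realType} {n : nat}.
Local Notation C := R[i].
Local Notation i := ('i%C : C).
Local Notation M := 'M[C]_n.
Local Notation rmx := (@Defs.rmx R).
Variables (b : bool) (sg : M -> M) (m : nat).
Hypothesis hs : antisym b sg.
Local Notation D := (Dsym m sg).

(** The linearization at E of E E = E and [sg] E = E. *)
Definition tangD (E v : M) := E *m v + v *m E = v /\ sg v = v.

Lemma cderive_pd p q (X : normedModType R) k (s : 'rV[R]_k -> 'M[C]_(p, q)) (U : set 'rV[R]_k) u (j : 'I_k) :
  smooth_on U ((fun x => reim x : rmx p q) \o s) -> U u ->
  cderive u (dirv j) s (ofreim (pd (fun x => reim x : rmx p q) j s u)).
Proof.
move=> sU Uu; have [_ /(_ (dirv j)) [d1 _]] := sU 1%N.
by rewrite /cderive ofreimK; apply: derivableP; apply: d1.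
Qed.

Lemma Dsym_pd k (s : 'rV[R]_k -> M) (U : set 'rV[R]_k) u (j : 'I_k) :
  open U -> smooth_on U (reim \o s) -> (forall v, U v -> D (s v)) -> U u ->
  exists v, [/\ pd reim j s u = reim (i *: v), tangD (- i *: s u) v &
    cderive u (dirv j) s (i *: v)].
Proof.
move=> oU sU US Uu; have ds := cderive_pd (rmx n n) j sU Uu.
exists (- i *: ofreim (pd reim j s u)); rewrite scale_iN ofreimK; split=> //.
have dE := cderiveZ (- i) ds.
move: (ofreim (pd reim j s u)) ds dE => w ds dE.
split.
  apply: (cderive_unique (cderiveM dE dE)); apply: cderive_near dE.
  by apply: filterS (open_near oU Uu) => v /US /DsymP [[->]].
apply: (cderive_unique (cderive_rlinear (sgL hs) dE)); apply: cderive_near dE.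
by apply: filterS (open_near oU Uu) => v /US /DsymP [_ ->].
Qed.

Lemma tangD_anti E v : tangD E v -> (E + E - 1%:M) *m v = - (v *m (E + E - 1%:M)).
Proof.
move=> [tv _]; apply/eqP; rewrite -addr_eq0 !(mulmxBl, mulmxBr, mulmxDl, mulmxDr) mulmx1 mul1mx.
have -> : E *m v = v - v *m E by rewrite -{2}tv addrK.
by apply/eqP; mx_ring.
Qed.

Lemma tangD_odd E v : E *m E = E -> sg E = E -> tangD E v ->
  oddsym b sg (E + E - 1%:M) (v *m (E + E - 1%:M)).
Proof.
move=> EE sE tv; have S00 := refl_sqr EE; have sS := refl_sg hs sE.
have a := tangD_anti tv; have sv := tv.2.
move: (E + E - 1%:M) S00 sS a => S0 S00 sS a.
split; first by rewrite /oddmx mulmxA a mulNmx.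
by rewrite (sgM hs) sv sS /bsign; case: (b).
Qed.

Definition lin2 (A B : rmx n n) (u : 'rV[R]_2) : rmx n n := u 0 0 *: A + u 0 1 *: B.

Lemma lin2_linear A B : linear (lin2 A B).
Proof. by move=> a u v; rewrite /lin2 !mxE !scalerDl !scalerDr !scalerA addrACA. Qed.

Lemma lin2_dirv0 A B : lin2 A B (dirv 0) = A.
Proof. by rewrite /lin2 !mxE /= scale1r scale0r addr0. Qed.

Lemma lin2_dirv1 A B : lin2 A B (dirv 1) = B.
Proof. by rewrite /lin2 !mxE /= scale1r scale0r add0r. Qed.

Lemma lin2_0 A B : lin2 A B 0 = 0.
Proof. by rewrite /lin2 !mxE !scale0r addr0. Qed.

Lemma cderive_lin2 A B u v : cderive u v (fun x => ofreim (lin2 A B x)) (ofreim (lin2 A B v)).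
Proof.
have := @is_derive_linear R _ _ _ _ id u v v (findim_mx 1 2) (@lin2_linear A B) (is_derive_id u v).
rewrite /cderive ofreimK; congr (is_derive _ _ _ _).
by apply/funext => x /=; rewrite ofreimK.
Qed.

(** Differentiating S (1 + Y) = (1 + Y) S0 at Y = 0 gives 2 v + S0 w S0 = w, and S0 w S0 = - w. *)
Lemma cay_velocity (V : normedModType R) (x d : V) (Sf Yf : V -> M) (S0 v w : M) :
  Sf x = S0 -> Yf x = 0 -> cderive x d Sf (v + v) -> cderive x d Yf (w *m S0) ->
  (\near x, Sf x *m (1%:M + Yf x) = (1%:M + Yf x) *m S0) ->
  S0 *m S0 = 1%:M -> S0 *m w = - (w *m S0) -> v = w.
Proof.
move=> Sx Yx dS dY SY S00 aw; have d1 := cderiveD (cderive_cst x d 1%:M) dY.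
have e := cderive_unique (cderiveM d1 (cderive_cst x d S0)) (cderive_near SY (cderiveM dS d1)).
rewrite Sx Yx !add0r addr0 mulmx0 add0r !mulmx1 mulmxA aw mulNmx -(mulmxA w) S00 mulmx1 in e.
by rewrite -[v]half_twice -[v + v](addKr (- w)) -e opprK half_twice.
Qed.

(** The family is the image under the inverse Cayley chart of the plane spanned by v0 S0 and v1 S0,
    the chart coordinates of the two velocities. Every smooth-looking linearized vector is thereby a
    true tangent vector. *)
Lemma Dsym_family2 E v0 v1 : idem m E -> sg E = E -> tangD E v0 -> tangD E v1 ->
  exists s : 'rV[R]_2 -> M, [/\ family D reim s, s 0 = i *: E,
    pd reim 0 s 0 = reim (i *: v0) & pd reim 1 s 0 = reim (i *: v1)].
Proof.
move=> hE sE t0 t1; have S00 := refl_sqr hE.1; have sS := refl_sg hs sE.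
have o0 := tangD_odd hE.1 sE t0; have o1 := tangD_odd hE.1 sE t1.
have a0 := tangD_anti t0; have a1 := tangD_anti t1.
have cI Y := @cayE_idem _ _ _ _ m hs E Y hE sE; have ES := erefl (E + E - 1%:M).
move: {2}(E + E - 1%:M) ES cI S00 sS o0 o1 a0 a1 => S0 ES; rewrite ES => cI S00 sS o0 o1 a0 a1.
pose A := reim (v0 *m S0) : rmx n n; pose B := reim (v1 *m S0) : rmx n n.
pose Y u := ofreim (lin2 A B u).
have oY u : oddsym b sg S0 (Y u).
  rewrite /Y /lin2 ofreimD ofreimZ; apply: (oddsym_lin hs); first by rewrite reimK.
  rewrite ofreimZ -[X in oddsym _ _ _ X]addr0; apply: (oddsym_lin hs); first by rewrite reimK.
  have := oddsym_lin hs (-1) o0 o0; rewrite rmorphN rmorph1 scaleN1r addNr.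
  by [].
have sY U : csmooth U Y by apply: csmooth_lin; apply: smooth_linear; [exact: findim_mx|exact: lin2_linear].
pose U := [set u | 1%:M - Y u \in unitmx].
have oU : open U.
  by apply: open_unit_preim; apply: csmoothB; [exact: openT|exact: csmooth_cst|].
have Y0 : Y 0 = 0 by rewrite /Y lin2_0 ofreim0.
have U0 : U 0 by rewrite /U /= Y0 subr0 unitmx1.
pose s u := i *: cayE S0 (Y u).
have ss : smooth_on U (reim \o s).
  apply: smooth_smooth_on => //; have : csmooth U s; last by [].
  by apply: csmoothZ => //; apply: csmooth_cayE.
have US u : U u -> D (s u).
  by move=> Uu; have [h1 h2] := cI _ (oY u) Uu; apply: DsymE.
have s0 : s 0 = i *: E.
  by rewrite /s Y0 /cayE addr0 subr0 invmx1 !mul1mx -ES addrC subrK half_twice.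
have key j w v : Y (dirv j) = w *m S0 -> S0 *m w = - (w *m S0) ->
    cderive 0 (dirv j) s (i *: v) -> v = w.
  move=> Yj aw dv.
  have dE : cderive 0 (dirv j) (fun u => cayE S0 (Y u)) v.
    have := cderiveZ (- i) dv; rewrite unscale_i; apply: cderive_near.
    by apply: filterS (open_near oU U0) => x _; rewrite unscale_i.
  have dY : cderive 0 (dirv j) Y (w *m S0) by rewrite -Yj; exact: cderive_lin2.
  have dS := cderiveB (cderiveD dE dE) (cderive_cst 0 (dirv j) 1%:M).
  rewrite subr0 in dS; apply: (cay_velocity _ Y0 dS dY _ S00 aw).
    by rewrite cayE_refl Y0 addr0 subr0 invmx1 mul1mx mul1mx.
  apply: filterS (open_near oU U0) => x Ux.
  rewrite cayE_refl (cay_conj S00 (oY x) Ux) mulmxKV //.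
  by have := cay_unit S00 (oY x) Ux.
exists s; split=> //; first by exists U.
  have [v [-> _ dv]] := Dsym_pd 0 oU ss US U0; rewrite (key _ v0 v _ a0 dv) //.
  by rewrite /Y lin2_dirv0 reimK.
have [v [-> _ dv]] := Dsym_pd 1 oU ss US U0; rewrite (key _ v1 v _ a1 dv) //.
by rewrite /Y lin2_dirv1 reimK.
Qed.

Lemma Dsym_tangentP E v : idem m E -> sg E = E ->
  tangent D reim (i *: E) v <-> exists2 w, v = reim (i *: w) & tangD E w.
Proof.
move=> hE sE; split.
  move=> [c [[[U [[oU U0] sU US]] c0] <-]].
  have [w [wE tw _]] := Dsym_pd 0 oU sU US U0.
  by exists w => //; rewrite c0 unscale_i in tw.
move=> [w -> tw]; have [s [fs s0 sw _]] := Dsym_family2 hE sE tw tw.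
have [U [[oU U0] sU US]] := fs.
by rewrite -s0 -sw; apply: pd_tangent oU sU US U0.
Qed.

Lemma Dsym_has2fam : has2fam D reim.
Proof.
move=> _ v w [E -> [hE sE]] /(Dsym_tangentP _ hE sE) [v' -> tv] /(Dsym_tangentP _ hE sE) [w' -> tw].
exact: Dsym_family2.
Qed.

End SymmetricTangents.

(** * Trace forms and their derivatives *)

Section TraceForm.
Context {R : realType} {n : nat}.
Local Notation C := R[i].
Local Notation M := 'M[C]_n.
Local Notation rmx := (@Defs.rmx R).
Implicit Types V : normedModType R.

Lemma smooth_p1 V : smooth setT (fun p : (V * (V * V))%type => p.1).
Proof. by move=> k; apply: Sm_fst. Qed.

Lemma smooth_p2 V : smooth setT (fun p : (V * (V * V))%type => p.2.1).
Proof.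
have oT := @openT (V * (V * V))%type; have oT' := @openT (V * V)%type.
move=> k; exact: (Sm_comp oT oT' (fun x _ => I) (Sm_fst k setT) (Sm_snd k setT)).
Qed.

Lemma smooth_p3 V : smooth setT (fun p : (V * (V * V))%type => p.2.2).
Proof.
have oT := @openT (V * (V * V))%type; have oT' := @openT (V * V)%type.
move=> k; exact: (Sm_comp oT oT' (fun x _ => I) (Sm_snd k setT) (Sm_snd k setT)).
Qed.

Lemma cderive_ofreim V (g : V -> rmx n n) x v dg : is_derive x v g dg ->
  cderive x v (fun y => ofreim (g y)) (ofreim dg).
Proof.
rewrite /cderive ofreimK; congr (is_derive _ _ _ _).
by apply/funext => y; rewrite ofreimK.
Qed.

Lemma cderive_pd2 V (f : V -> rmx n n) (U : set V) u v x : Ck 2 U f -> U x ->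
  cderive x v (fun y => ofreim ('D_u f y)) (ofreim ('D_v ('D_u f) x)).
Proof.
move=> [_ /(_ u) [_ [_ /(_ v) [d1 _]]]] Ux.
exact: (cderive_ofreim (derivableP (d1 x Ux))).
Qed.

(** The factor k = 1 gives the real part of the trace and k = - i the imaginary part, so both kinds
    of form are treated at once. *)
Definition retr (k : C) (A : M) : R := complex.Re (k * \tr A).

Lemma retr_lin (k : C) (a : R) (A B : M) : retr k (a%:C%C *: A + B) = a * retr k A + retr k B.
Proof. by rewrite /retr mxtraceD mxtraceZ mulrDr mulrCA ReD Re_realM. Qed.

Lemma retrD k A B : retr k (A + B) = retr k A + retr k B.
Proof. by rewrite /retr mxtraceD mulrDr ReD. Qed.

Lemma retr_linear k : linear (fun u : rmx n n => retr k (ofreim u) : R^o).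
Proof. by move=> a u v; rewrite ofreim_linear retr_lin. Qed.

Lemma smooth_retr V k (U : set V) (f : V -> M) : open U -> csmooth U f ->
  smooth U (fun x => retr k (f x) : R^o).
Proof.
move=> oU sf j.
have sr := @smooth_linear R _ _ setT _ (findim_rmx n n) (@retr_linear k) j.
have := Sm_comp oU openT (fun x _ => I) sr (sf j).
by apply: Sm_ext => // x _ /=; rewrite reimK.
Qed.

Lemma is_derive_retr V k x v (f : V -> M) df : cderive x v f df ->
  is_derive x v (fun y => retr k (f y) : R^o) (retr k df).
Proof.
move=> df'; have := is_derive_linear (findim_rmx n n) (@retr_linear k) df'.
rewrite reimK; congr (is_derive _ _ _ _).
by apply/funext => y /=; rewrite reimK.
Qed.

Lemma bracket_leibniz (S P Q s p q : M) :
  S *m (P *m q + p *m Q - (Q *m p + q *m P)) + s *m (P *m Q - Q *m P) =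
  s *m bracket P Q + (S *m bracket p Q + S *m bracket P q).
Proof.
rewrite -mulmxDr [RHS]addrC /bracket; congr (S *m _ + _).
by rewrite [P *m q + _]addrC opprD addrACA.
Qed.

Lemma is_derive_bracket V k x v (S P Q : V -> M) s p q :
  cderive x v S s -> cderive x v P p -> cderive x v Q q ->
  is_derive x v (fun y => retr k (S y *m bracket (P y) (Q y)) : R^o)
    (retr k (s *m bracket (P x) (Q x)) + (retr k (S x *m bracket p (Q x)) +
     retr k (S x *m bracket (P x) q))).
Proof.
move=> ds dp dq.
have := is_derive_retr k (cderiveM ds (cderiveB (cderiveM dp dq) (cderiveM dq dp))).
by rewrite -!retrD -bracket_leibniz.
Qed.

Lemma retr_alt k (A B : M) : retr k (A *m bracket B B) = 0.
Proof. by rewrite /bracket subrr mulmx0 /retr mxtrace0 mulr0. Qed.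

Lemma retr_anti k (A B D : M) : retr k (A *m bracket B D) = - retr k (A *m bracket D B).
Proof.
by apply/eqP; rewrite -addr_eq0 -retrD -mulmxDr /bracket addrC addrA subrK subrr mulmx0 /retr mxtrace0 mulr0.
Qed.

(** Conjugation by S preserves the trace and changes the sign of a product of three odd matrices. *)
Lemma odd_product_trace (S a c d : M) : S *m S = 1%:M ->
  S *m a = - (a *m S) -> S *m c = - (c *m S) -> S *m d = - (d *m S) ->
  \tr (a *m c *m d) = 0.
Proof.
move=> SS Sa Sc Sd.
have e : S *m (a *m c *m d) *m S = - (a *m c *m d).
  rewrite !mulmxA Sa !mulNmx -(mulmxA a S c) Sc mulmxN !mulNmx opprK (mulmxA a c S).
  by rewrite -(mulmxA (a *m c) S d) Sd mulmxN mulNmx (mulmxA (a *m c)) -(mulmxA _ S S) SS mulmx1.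
have := congr1 mxtrace e; rewrite mxtrace_mulC (mulmxA S S) SS mul1mx raddfN /=.
move=> /eqP; rewrite -addr_eq0 -mulr2n mulrn_eq0 /= => /eqP //.
Qed.

Lemma retr_odd k (S a c d : M) : S *m S = 1%:M ->
  S *m a = - (a *m S) -> S *m c = - (c *m S) -> S *m d = - (d *m S) ->
  retr k (a *m bracket c d) = 0.
Proof.
move=> SS Sa Sc Sd; rewrite /retr /bracket mulmxBr !mulmxA mxtraceB.
by rewrite (odd_product_trace SS Sa Sc Sd) (odd_product_trace SS Sa Sd Sc) subrr mulr0.
Qed.

End TraceForm.

(** * The Kirillov form as a symplectic form *)

Section KKS.
Context {R : realType} {n : nat}.
Local Notation C := R[i].
Local Notation i := ('i%C : C).
Local Notation M := 'M[C]_n.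
Local Notation rmx := (@Defs.rmx R).
Variables (b : bool) (sg : M -> M) (m : nat).
Hypothesis hs : antisym b sg.
Local Notation D := (Dsym m sg).

Lemma tangD_mid (E v : M) : E *m E = E -> E *m v + v *m E = v -> E *m v *m E = 0.
Proof.
move=> EE tv; have := congr1 (mulmx E) tv; rewrite mulmxDr mulmxA EE mulmxA => /eqP.
by rewrite -subr_eq0 addrAC subrr add0r => /eqP.
Qed.

(** A tangent vector is off-diagonal for E, and bracketing with E is an involution on such matrices.
    It provides an explicit X with v = [E, X]. *)
Lemma tangD_bracket (E v : M) : E *m E = E -> E *m v + v *m E = v -> bracket E (bracket E v) = v.
Proof.
move=> EE tv; have m0 := tangD_mid EE tv.
by rewrite /bracket mulmxBr mulmxBl !mulmxA EE m0 -(mulmxA v) EE sub0r opprK subr0.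
Qed.

Lemma tr_bracket (A B D : M) : \tr (A *m bracket B D) = \tr (bracket A B *m D).
Proof.
rewrite /bracket mulmxBr mulmxBl !mxtraceB mulmxA; congr (_ - _).
by rewrite mulmxA mxtrace_mulC mulmxA.
Qed.

Lemma bracketC (A B : M) : bracket A B = - bracket B A.
Proof. by rewrite /bracket opprB. Qed.

Lemma tr_bracket' (A B D : M) : \tr (A *m bracket B D) = - \tr (B *m bracket A D).
Proof.
by rewrite tr_bracket bracketC mulNmx raddfN /= -tr_bracket.
Qed.

(** tr (xi [X, Y]) = tr ([xi, X] Y) depends on X only through v; by antisymmetry it depends on Y
    only through w. *)
Lemma OmegaKKS_eq (xi v w X Y : M) : v = bracket xi X -> w = bracket xi Y ->
  OmegaKKS xi v w = \tr (xi *m bracket X Y).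
Proof.
move=> vE wE; rewrite /OmegaKKS; apply: xget_subset1; first by exists X, Y.
move=> _ _ [X1 [Y1 [v1 w1 ->]]] [X2 [Y2 [v2 w2 ->]]].
by rewrite tr_bracket -v1 v2 -tr_bracket tr_bracket' -w1 w2 -tr_bracket'.
Qed.

Lemma bracket_ii (v w : M) : bracket (i *: v) (i *: w) = - bracket v w.
Proof. by rewrite /bracket -!scalemxAl -!scalemxAr !scalerA mulii !scaleN1r opprB opprK addrC. Qed.

Lemma tr_kks (E v N : M) : bracket E (bracket E v) = v ->
  \tr ((i *: E) *m bracket (i *: v) (i *: bracket E N)) = i * \tr (v *m N).
Proof.
move=> vE; rewrite bracket_ii mulmxN -scalemxAl -scalerN mxtraceZ; congr (_ * _).
by rewrite raddfN /= !tr_bracket (bracketC (bracket E v)) vE mulNmx raddfN opprK.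
Qed.

(** With X = [E, v] and Y = [E, w] as preimages, the form becomes the trace of xi against the
    bracket of the tangent vectors themselves, a polynomial in ambient coordinates. *)
Lemma OmegaKKS_tan (E v w : M) : E *m E = E -> E *m v + v *m E = v -> E *m w + w *m E = w ->
  OmegaKKS (i *: E) (i *: v) (i *: w) = \tr ((i *: E) *m bracket (i *: v) (i *: w)).
Proof.
move=> EE tv tw.
have bE u : E *m u + u *m E = u -> i *: u = bracket (i *: E) (bracket E u).
  by move=> tu; rewrite -{1}(tangD_bracket EE tu) /bracket scalerBr -scalemxAl -scalemxAr.
rewrite (OmegaKKS_eq (bE _ tv) (bE _ tw)) (tr_bracket (i *: E)) -(bE v tv).
rewrite bracket_ii -!scalemxAl mulmxN scalerN raddfN /= !mxtraceZ (tr_bracket' E) mulrN opprK.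
by [].
Qed.

Definition kappa : C := if b then 1 else - i.

Variable w : @form2 R (rmx n n) M.
Hypothesis wE : forall E u v, idem m E -> sg E = E -> tangD sg E u -> tangD sg E v ->
  w (i *: E) (reim (i *: u)) (reim (i *: v)) = retr kappa ((i *: E) *m bracket (i *: u) (i *: v)).

Definition kks_ambient (y a a' : rmx n n) : R := retr kappa (ofreim y *m bracket (ofreim a) (ofreim a')).

Lemma kks_ambientE xi a a' : D xi -> tangent D reim xi a -> tangent D reim xi a' ->
  w xi a a' = kks_ambient (reim xi) a a'.
Proof.
move=> [E -> [hE sE]] /(Dsym_tangentP hs _ hE sE) [u -> tu] /(Dsym_tangentP hs _ hE sE) [v -> tv].
by rewrite (wE hE sE tu tv) /kks_ambient (reimK (i *: E)) (reimK (i *: u)) (reimK (i *: v)).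
Qed.

Lemma bracket_linl (k : R) (A B F : M) :
  bracket (k%:C%C *: A + B) F = k%:C%C *: bracket A F + bracket B F.
Proof. by rewrite /bracket mulmxDl mulmxDr -scalemxAl -scalemxAr scalerBr opprD addrACA. Qed.

Lemma retr_bracketl (r : C) (k : R) (Y A B F : M) :
  retr r (Y *m bracket (k%:C%C *: A + B) F) = k * retr r (Y *m bracket A F) + retr r (Y *m bracket B F).
Proof. by rewrite bracket_linl mulmxDr -scalemxAr retr_lin. Qed.

Lemma retr_bracketr (r : C) (k : R) (Y A B F : M) :
  retr r (Y *m bracket F (k%:C%C *: A + B)) = k * retr r (Y *m bracket F A) + retr r (Y *m bracket F B).
Proof. by rewrite retr_anti retr_bracketl opprD -mulrN -!retr_anti. Qed.

Lemma kks_ambient_l y a k u v :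
  kks_ambient y (k *: u + v) a = k * kks_ambient y u a + kks_ambient y v a.
Proof. rewrite /kks_ambient. rewrite (ofreim_linear k u v). exact: retr_bracketl. Qed.

Lemma kks_ambient_r y a k u v :
  kks_ambient y a (k *: u + v) = k * kks_ambient y a u + kks_ambient y a v.
Proof. rewrite /kks_ambient. rewrite (ofreim_linear k u v). exact: retr_bracketr. Qed.

Lemma kks_form : ambient_form D reim w kks_ambient.
Proof.
split; last exact: kks_ambientE.
- have oT := @openT (rmx n n * (rmx n n * rmx n n))%type.
  have s1 := csmooth_lin (smooth_p1 (rmx n n)).
  have s2 := csmooth_lin (smooth_p2 (rmx n n)).
  have s3 := csmooth_lin (smooth_p3 (rmx n n)).
  exact: (smooth_retr kappa oT (csmoothM oT s1 (csmoothB oT (csmoothM oT s2 s3) (csmoothM oT s3 s2)))).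
- by move=> y a; split=> k u v; [exact: (kks_ambient_r y a k u v)|exact: (kks_ambient_l y a k u v)].
Qed.

Lemma kks_alt : alternating D reim w.
Proof. by move=> x v Dx tv; rewrite kks_ambientE // /kks_ambient retr_alt. Qed.

(** The test vector is [E, N] with N a multiple of v^*; the pairing is then, up to sign, the squared
    norm of v. *)
Lemma kks_nondeg : nondegenerate D reim w.
Proof.
move=> _ _ [E -> [hE sE]] /(Dsym_tangentP hs _ hE sE) [v -> tv] h.
have vE := tangD_bracket hE.1 tv.1.
(* If [sg] reverses products, [E, N] is fixed only when [sg] N = - N; by antilinearity the factor i
   achieves this. *)
pose l : C := if b then i else 1.
have sN : sg (l *: v ^t*) = bsign b (l *: v ^t*).
  rewrite /l /bsign; case: (b); last by rewrite !scale1r (sgC hs) tv.2.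
  by rewrite (sgi hs) (sgC hs) tv.2.
have [N NE] : exists N, N = l *: v ^t* by exists (l *: v ^t*).
rewrite -NE in sN.
have tw : tangD sg E (bracket E N).
  split; rewrite /bracket.
    by rewrite mulmxBr mulmxBl !mulmxA hE.1 -(mulmxA N) hE.1 addrA subrK.
  rewrite (sgB hs) !(sgM hs) sN sE /bsign; case: (b) => //.
  by rewrite mulNmx mulmxN opprK addrC.
have tt : tangent D reim (i *: E) (reim (i *: bracket E N)).
  by apply/(Dsym_tangentP hs _ hE sE); exists (bracket E N).
have := h _ tt; rewrite (wE hE sE tv tw) /retr (tr_kks _ vE) NE -scalemxAr mxtraceZ.
have -> : v *m v ^t* = (v ^t*) ^t* *m v ^t* by rewrite trCK.
rewrite gram_tr_real => h0; suff -> : v = 0 by rewrite scaler0 reim0.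
suff v0 : v ^t* = 0 by rewrite -[v]trCK v0 trC0.
apply: gram_tr_eq0; rewrite gram_tr_real.
move: (complex.Re (\tr _)) h0 => r; have -> : kappa * (i * (l * r%:C%C)) = (if b then - r else r)%:C%C.
  rewrite /kappa /l; case: (b); first by rewrite mul1r mulrA mulii mulN1r rmorphN.
  by rewrite mul1r mulrA mulNr mulii opprK mul1r.
by rewrite /=; case: (b) => [/eqP|->] //; rewrite oppr_eq0 => /eqP ->.
Qed.

Lemma cycle3_sum (F : 'I_3 -> R) : \sum_(j < 3) F j = F 0 + (F 1 + F (1 + 1)).
Proof.
rewrite big_ord_recl big_ord_recl big_ord_recl big_ord0 addr0.
by congr (F _ + (F _ + F _)); apply/val_inj.
Qed.

(** The second derivatives are symmetric in their indices and G is antisymmetric, so the six terms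
    cancel in pairs. *)
Lemma cycle3_cancel (G : M -> M -> R) (p : 'I_3 -> M) (q : 'I_3 -> 'I_3 -> M) :
  (forall A B, G A B = - G B A) -> (forall j l, q j l = q l j) ->
  \sum_(j < 3) (G (q j (j + 1)) (p (j + 1 + 1)) + G (p (j + 1)) (q j (j + 1 + 1))) = 0.
Proof.
move=> GC qC; rewrite cycle3_sum.
have -> : 1 + 1 + 1 = 0 :> 'I_3 by apply/val_inj.
have -> : 0 + 1 = 1 :> 'I_3 by apply/val_inj.
move: (0 : 'I_3) (1 : 'I_3) (1 + 1 : 'I_3) => x y z.
rewrite (qC y x) (qC z x) (qC z y) (GC (p x)) (GC (p y)) (GC (p z)).
move: (G _ _) (G _ _) (G _ _) => c d e; ring.
Qed.

(** By the Leibniz rule, differentiating the point gives traces of products of three odd matrices,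
    which vanish; differentiating the vectors gives second derivatives, which cancel by symmetry. *)
Lemma kks_closed : closed_form2 D reim w.
Proof.
move=> s [U [[oU U0] sU US]].
pose p j u := ofreim (pd reim j s u) : M.
pose q j l := ofreim ('D_(dirv j) ('D_(dirv l) (reim \o s)) 0) : M.
have qC j l : q j l = q l j.
  have e := @schwarz _ _ _ _ U 0 (dirv l) (dirv j) (findim_rmx n n) oU U0 (sU 2%N).
  exact: (congr1 (@ofreim R n n) e).
have dp j l : cderive 0 (dirv j) (p l) (q j l).
  have e := @cderive_pd2 _ n _ (reim \o s) U (dirv l) (dirv j) 0 (sU 2%N) U0.
  exact: e.
have GC := retr_anti kappa (s 0).
rewrite -[RHS](cycle3_cancel (p ^~ 0) GC qC); apply: eq_bigr => j _.
have wp : \forall u \near (0 : 'rV[R]_3), w (s u) (pd reim (j + 1) s u) (pd reim (j + 1 + 1) s u) =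
    retr kappa (s u *m bracket (p (j + 1) u) (p (j + 1 + 1) u)).
  apply: filterS (open_near oU U0) => u Uu; rewrite kks_ambientE; first 1 last.
  - exact: US.
  - exact: pd_tangent oU sU US Uu.
  - exact: pd_tangent oU sU US Uu.
  by rewrite /kks_ambient (reimK (s u)).
apply: etrans (near_eq_derive _ wp) _.
have ds := cderive_pd (rmx n n) j sU U0.
have [_ ->] := is_derive_bracket kappa ds (dp j (j + 1)) (dp j (j + 1 + 1)).
rewrite -[RHS]add0r; congr (_ + _).
have /DsymP [[EE _] _] := US 0 U0.
have anti l : (- i *: s 0 + - i *: s 0 - 1%:M) *m p l 0 = - (p l 0 *m (- i *: s 0 + - i *: s 0 - 1%:M)).
  have [v [pE tv _]] := Dsym_pd hs l oU sU US U0.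
  have -> : p l 0 = i *: v by rewrite /p pE reimK.
  by rewrite -scalemxAr -scalemxAl (tangD_anti tv) scalerN.
move: (- i *: s 0 + - i *: s 0 - 1%:M) (refl_sqr EE) anti => S SS anti.
exact: (retr_odd _ SS (anti _) (anti _) (anti _)).
Qed.

Lemma kks_symp : symp D reim w.
Proof.
split.
- exact: Dsym_smanifold hs.
- exact: Dsym_has2fam hs.
- by exists kks_ambient; exact: kks_form.
- exact: kks_alt.
- exact: kks_closed.
- exact: kks_nondeg.
Qed.

End KKS.

(** * Ambient extensions of Phi and of its inverse *)

Section PhiDiffeo.
Context {R : realType} {n : nat}.
Local Notation C := R[i].
Local Notation i := ('i%C : C).
Local Notation M := 'M[C]_n.
Local Notation rmx := (@Defs.rmx R).
Local Notation rcovect := (@Defs.rcovect R).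
Implicit Types V W : normedModType R.

Lemma csmooth_Dmx V (U : set V) (Z : V -> M) : open U -> csmooth U Z ->
  csmooth U (fun x => Dmx (Z x)).
Proof.
move=> oU sZ; apply: csmooth_sqrt => //.
  move=> x _; exists 1; first exact: ltr01.
  by rewrite herm_one_gram; exact: pdef_one_gram.
apply: (csmoothD oU (csmooth_cst U 1%:M)); apply: (csmoothM oU sZ).
exact: csmooth_trC oU sZ.
Qed.

Lemma csmooth_PiE V (U : set V) (E : V -> M) : open U -> csmooth U E ->
  csmooth U (fun x => PiE (E x)).
Proof.
move=> oU sE; have sE' := csmooth_trC oU sE.
have sZ := csmooth_Dmx oU (csmoothB oU sE sE').
have s1 := csmooth_cst U (1%:M : M).
have sI := csmooth_inv oU (fun x _ => Dmx_unit (E x - (E x) ^t*)) sZ.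
exact: (csmoothZ 2^-1 oU (csmoothD oU s1 (csmoothM oU (csmoothB oU (csmoothD oU sE sE') s1) sI))).
Qed.

Lemma csmooth_etaE V (U : set V) (E : V -> M) : open U -> csmooth U E ->
  csmooth U (fun x => etaE (E x)).
Proof.
move=> oU sE.
exact: (csmoothM oU (csmooth_PiE oU sE) (csmoothB oU sE (csmooth_trC oU sE))).
Qed.

Lemma csmooth_Eof V (U : set V) (P eta : V -> M) : open U -> csmooth U P -> csmooth U eta ->
  csmooth U (fun x => Eof (P x) (eta x)).
Proof.
move=> oU sP se; have s1 := csmooth_cst U (1%:M : M).
have sZ := csmoothB oU se (csmooth_trC oU se).
have sS := csmoothB oU (csmoothD oU sP sP) s1.
exact: (csmoothZ 2^-1 oU (csmoothD oU (csmoothD oU s1 (csmoothM oU sS (csmooth_Dmx oU sZ))) sZ)).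
Qed.

Definition GPhi (v : rmx n n) : rcovect n := (reim (PiE (numE v)), reim (etaE (numE v))).

Definition GPhiInv (u : rcovect n) : rmx n n := reim (i *: Eof (ofreim u.1) (ofreim u.2)).

Lemma smooth_GPhi : smooth setT GPhi.
Proof.
move=> k; have oT := @openT (rmx n n); have sE := csmooth_numE (n := n) oT.
exact: (Sm_pair oT (csmooth_PiE oT sE k) (csmooth_etaE oT sE k)).
Qed.

Lemma smooth_fst V W : smooth setT (fun p : (V * W)%type => p.1).
Proof. by move=> k; apply: Sm_fst. Qed.

Lemma smooth_snd V W : smooth setT (fun p : (V * W)%type => p.2).
Proof. by move=> k; apply: Sm_snd. Qed.

Lemma smooth_GPhiInv : smooth setT GPhiInv.
Proof.
have oT := @openT (rcovect n).
have s1 := csmooth_lin (smooth_fst (rmx n n) (rmx n n)).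
have s2 := csmooth_lin (smooth_snd (rmx n n) (rmx n n)).
exact: (csmoothZ i oT (csmooth_Eof oT s1 s2)).
Qed.

Lemma GPhi_embT m xi : Orb m n xi -> embT (Phi xi) = GPhi (reim xi).
Proof.
move=> /OrbP [E -> [EE _]]; rewrite /GPhi numE_reim /embT.
by rewrite orthoproj_Phi // eta_Phi.
Qed.

Lemma GPhiInv_reim (z : covect n) : reim (PhiInv z) = GPhiInv (embT z).
Proof. by rewrite /GPhiInv /embT /= reimK reimK. Qed.

Section Sets.
Variables (m : nat) (tau : M -> M).
Hypothesis ht : staraut tau.

Lemma Phi_gdiffeo_SF : gdiffeo (SF m tau) reim (TF m tau) embT Phi GPhi (@PhiInv R n) GPhiInv.
Proof.
split.
- exact: Phi_SF.
- exact: PhiInv_TF.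
- by move=> x /SF_Orb /Orb_PhiK.
- by move=> z [Tz _ _]; exact: PhiInvK Tz.
- exact: smooth_GPhi.
- exact: smooth_GPhiInv.
- by move=> x /SF_Orb; exact: GPhi_embT.
- by move=> z _; exact: GPhiInv_reim.
Qed.

Lemma Phi_gdiffeo_SA : gdiffeo (SA m tau) reim (TA m tau) embT Phi GPhi (@PhiInv R n) GPhiInv.
Proof.
split.
- exact: Phi_SA.
- exact: PhiInv_TA.
- by move=> x /SA_Orb /Orb_PhiK.
- by move=> z [Tz _ _]; exact: PhiInvK Tz.
- exact: smooth_GPhi.
- exact: smooth_GPhiInv.
- by move=> x /SA_Orb; exact: GPhi_embT.
- by move=> z _; exact: GPhiInv_reim.
Qed.

Hypothesis ti : forall A, tau (i *: A) = - (i *: tau A).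

Definition irot (a : C) (z : covect n) : covect n := (z.1, a *: z.2).

Definition Girot (a : C) (u : rcovect n) : rcovect n := (u.1, reim (a *: ofreim u.2)).

Lemma smooth_Girot a : smooth setT (Girot a).
Proof.
move=> k; have oT := @openT (rcovect n).
have s2 := csmooth_lin (smooth_snd (rmx n n) (rmx n n)).
exact: (Sm_pair oT (smooth_fst (rmx n n) (rmx n n) k) (csmoothZ a oT s2 k)).
Qed.

Lemma irot_embT a z : embT (irot a z) = Girot a (embT z).
Proof. by rewrite /Girot /embT /irot /= reimK. Qed.

Lemma TGr_irot a z : TGr m n z -> TGr m n (irot a z).
Proof.
move=> [dz z0 z1]; split=> //= x; first by move=> /z0; rewrite -scalemxAl => ->; rewrite scaler0.
by rewrite -scalemxAl; apply: memvZ.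
Qed.

(** As tau is antilinear, multiplying the covector by i exchanges tau eta = eta with tau eta = -
    eta. *)
Lemma irot_gdiffeo : gdiffeo (TF m tau) embT (TA m tau) embT (irot i) (Girot i)
  (irot (- i)) (Girot (- i)).
Proof.
split.
- by move=> z [Tz tP te]; split; [exact: TGr_irot|exact: tP|rewrite /= ti te].
- move=> z [Tz tP te]; split; [exact: TGr_irot|exact: tP|rewrite /= scaleNr (tauN ht) ti te].
  by rewrite opprK scalerN.
- by move=> [V e] _; rewrite /irot /= unscale_i.
- by move=> [V e] _; rewrite /irot /= scale_iN.
- exact: smooth_Girot.
- exact: smooth_Girot.
- by move=> z _; exact: irot_embT.
- by move=> z _; exact: irot_embT.
Qed.

End Sets.
End PhiDiffeo.

(** * The canonical two-form *)

Section CanonicalForm.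
Context {R : realType} {n : nat}.
Local Notation C := R[i].
Local Notation i := ('i%C : C).
Local Notation M := 'M[C]_n.
Local Notation rmx := (@Defs.rmx R).
Local Notation rcovect := (@Defs.rcovect R).
Implicit Types V W X : normedModType R.

Lemma retrB k (A B : M) : retr k (A - B) = retr k A - retr k B.
Proof. by rewrite /retr mxtraceB mulrBr raddfB. Qed.

Lemma is_derive_cov1 V (f : V -> rcovect n) x d df :
  is_derive x d f df -> is_derive x d (fun y => (f y).1 : rmx n n) df.1.
Proof.
move=> H; have l : linear (fun p : rcovect n => p.1 : rmx n n) by [].
exact: (is_derive_linear (findim_rcovect n) l H).
Qed.

Lemma is_derive_cov2 V (f : V -> rcovect n) x d df :
  is_derive x d f df -> is_derive x d (fun y => (f y).2 : rmx n n) df.2.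
Proof.
move=> H; have l : linear (fun p : rcovect n => p.2 : rmx n n) by [].
exact: (is_derive_linear (findim_rcovect n) l H).
Qed.

Lemma retr_cancel k (F X Y P Q : M) : X = Y ->
  retr k (F *m X + P) - retr k (F *m Y + Q) = retr k (P - Q).
Proof. by move=> ->; rewrite retrB (retrD k _ P) (retrD k _ Q) opprD addrACA subrr add0r. Qed.

(** The two terms containing second derivatives of Pi agree by symmetry and drop out, leaving first
    derivatives only. *)
Lemma ext_d_value V (k : C) (f : V -> rcovect n) (U : set V) x a b : open U -> U x -> Ck 2 U f ->
  'D_a (fun u => retr k (ofreim (f u).2 *m ofreim ('D_b f u).1) : R^o) x -
  'D_b (fun u => retr k (ofreim (f u).2 *m ofreim ('D_a f u).1) : R^o) x =
  retr k (ofreim ('D_a f x).2 *m ofreim ('D_b f x).1 - ofreim ('D_b f x).2 *m ofreim ('D_a f x).1).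
Proof.
move=> oU Ux f2; have fW := findim_rcovect (R := R) n.
have D1 c : is_derive x c f ('D_c f x).
  by apply: derivableP; have [_ /(_ c) [d1 _]] := f2; apply: d1.
have D2 c d : is_derive x d ('D_c f) ('D_d ('D_c f) x).
  by apply: derivableP; have [_ /(_ c) [_ [_ /(_ d) [d1 _]]]] := f2; apply: d1.
have key c d : is_derive x c (fun u => retr k (ofreim (f u).2 *m ofreim ('D_d f u).1) : R^o)
    (retr k (ofreim (f x).2 *m ofreim ('D_c ('D_d f) x).1 + ofreim ('D_c f x).2 *m ofreim ('D_d f x).1)).
  have c1 := cderive_ofreim (is_derive_cov2 (D1 c)).
  have c2 := cderive_ofreim (is_derive_cov1 (D2 d c)).
  exact: (is_derive_retr k (cderiveM c1 c2)).
have [_ e1] := key a b; have [_ e2] := key b a.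
have e3 := @schwarz _ _ _ _ U x b a fW oU Ux f2.
apply: (etrans (congr2 (fun p q : R => p - q) e1 e2)).
exact: (retr_cancel _ _ _ _ (congr1 (fun t : rcovect n => ofreim t.1) e3)).
Qed.

(** The set from which [ext_d] chooses is a singleton: [has2fam] provides an element, and its value
    involves only v and w. *)
Lemma ext_dE (T : set (covect n)) (theta : form1 (X := covect n) (E := rcovect n)) (k : C) z v w :
  (forall z v, theta z v = retr k (z.2 *m ofreim v.1)) -> has2fam T embT ->
  T z -> tangent T embT z v -> tangent T embT z w ->
  ext_d T embT theta z v w =
  retr k (ofreim v.2 *m ofreim w.1 - ofreim w.2 *m ofreim v.1).
Proof.
move=> tE hT Tz tv tw; set val := retr _ _.
have uniq r : (exists s : 'rV[R]_2 -> covect n,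
    [/\ family T embT s, s 0 = z, pd embT 0 s 0 = v, pd embT 1 s 0 = w &
        r = 'D_(dirv 0) (fun u => theta (s u) (pd embT 1 s u) : R^o) 0
          - 'D_(dirv 1) (fun u => theta (s u) (pd embT 0 s u) : R^o) 0]) -> r = val.
  move=> [s [[U [[oU U0] sU US]] s0 sv sw ->]].
  have := ext_d_value k (dirv 0) (dirv 1) oU U0 (sU 2%N).
  rewrite -/(pd embT 0 s 0) -/(pd embT 1 s 0) sv sw -/val => <-.
  have E (d : 'rV[R]_2) : (fun u => theta (s u) ('D_d (embT \o s) u)) =
      (fun u => retr k (ofreim ((embT \o s) u).2 *m ofreim ('D_d (embT \o s) u).1)).
    by apply/funext => u; rewrite tE /= reimK.
  have e1 := congr1 (fun g => 'D_(dirv 0) (g : _ -> R^o) 0) (E (dirv 1)).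
  have e2 := congr1 (fun g => 'D_(dirv 1) (g : _ -> R^o) 0) (E (dirv 0)).
  exact: (congr2 (fun p q : R => p - q) e1 e2).
have [s [fs s0 sv sw]] := hT z v w Tz tv tw.
rewrite /ext_d; set P := (X in xget _ X).
have [r Pr] : exists r, P r.
  by eexists; exists s; split; [exact: fs|exact: s0|exact: sv|exact: sw|reflexivity].
exact: uniq (xgetI 0 Pr).
Qed.

Lemma canonical_form1E (z : covect n) (v : rcovect n) : canonical_form1 z v = retr 1 (z.2 *m ofreim v.1).
Proof. by rewrite /retr mul1r. Qed.

Lemma canonical_form1_imagE (z : covect n) (v : rcovect n) :
  canonical_form1_imag z v = retr (- i) (z.2 *m ofreim v.1).
Proof. by rewrite /canonical_form1_imag /canonical_form1 /retr /= -scalemxAl mxtraceZ. Qed.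

(** Its trace is the exterior derivative of tr (eta dPi). *)
Definition cot_form (v w : rcovect n) : M := ofreim v.2 *m ofreim w.1 - ofreim w.2 *m ofreim v.1.

Lemma omega_canE (T : set (covect n)) z v w : has2fam T embT ->
  T z -> tangent T embT z v -> tangent T embT z w ->
  omega_can T z v w = - retr 1 (cot_form v w).
Proof. by move=> hT Tz tv tw; congr (- _); exact: (ext_dE canonical_form1E hT Tz tv tw). Qed.

Lemma omega_can_imagE (T : set (covect n)) z v w : has2fam T embT ->
  T z -> tangent T embT z v -> tangent T embT z w ->
  omega_can_imag T z v w = - retr (- i) (cot_form v w).
Proof. by move=> hT Tz tv tw; congr (- _); exact: (ext_dE canonical_form1_imagE hT Tz tv tw). Qed.

End CanonicalForm.

Lemma gram_anti (R : realType) n (e : 'M[R[i]]_n) : e *m e = 0 -> e ^t* *m e ^t* = 0 ->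
  (e - e ^t*) *m (e - e ^t*) ^t* = e *m e ^t* + e ^t* *m e.
Proof.
rewrite trCB trCK mulmxBr !mulmxBl; move: (e ^t*) => f -> ->.
by rewrite subr0 sub0r opprK.
Qed.

Lemma unit_sandwich (K : comUnitRingType) n m (X : 'M[K]_(n, m)) (Y : 'M[K]_(m, n)) (g : 'M[K]_m) :
  g \in unitmx ->
  X *m invmx g *m (g *m g - g) *m (invmx g *m Y) = X *m Y - X *m invmx g *m Y.
Proof.
move=> gu; rewrite mulmxBr mulmxBl; congr (_ - _).
  by rewrite !mulmxA mulmxKV // mulmxK.
by rewrite !mulmxA mulmxKV.
Qed.

(** * The level set of the momentum map *)

Section LevelSet.
Context {R : realType} {m n : nat}.
Local Notation C := R[i].
Local Notation i := ('i%C : C).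
Local Notation QP := (@Defs.QP R m n).

Definition level_eqs (Q : 'M[C]_(n, m)) (P : 'M[C]_(m, n)) :=
  Q ^t* *m Q = 1%:M + 1%:M + P *m P ^t* /\ P *m Q = 0.

Lemma level_pdef Q P : level_eqs Q P -> pdef (1 + 1) (Q ^t* *m Q).
Proof.
move=> [-> _]; have := pdefD pdef1 (pdefD pdef1 (psd_pdef (psd_gram (P ^t*)))).
by rewrite !trCK addr0 addrA.
Qed.

Lemma level_unit Q P : level_eqs Q P -> Q ^t* *m Q \in unitmx.
Proof. by move=> /level_pdef; apply: pdef_unitmx; exact: (addr_gt0 ltr01 ltr01). Qed.

(** P Q vanishes when its skew-Hermitian and Hermitian parts do. In the converse direction the rank
    of Q is read from the invertibility of Q^* Q, which is at least 2. *)
Lemma levelP (a : QP) : level a <-> level_eqs a.1 a.2.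
Proof.
case: a => Q P; rewrite /level /mu1 /mu2 /mu3 /=; split=> [[_ h1 h2 h3]|h].
  split.
    apply/eqP; rewrite -subr_eq; apply/eqP.
    have := congr1 (fun X => (2 / i) *: X) h1; rewrite scalerA.
    have -> : 2 / i * (i / 2) = 1 :> C.
      by rewrite mulrA divfK ?i_neq0 // divff // pnatr_eq0.
    rewrite scale1r => ->; rewrite scale_scalar_mx divfK ?i_neq0 //.
    by rewrite -raddfD.
  have e1 : P *m Q - (P *m Q) ^t* = 0.
    by move/eqP: h2; rewrite scaler_eq0 invr_eq0 pnatr_eq0 /= => /eqP.
  have e2 : P *m Q + (P *m Q) ^t* = 0.
    by move/eqP: h3; rewrite scaler_eq0 invr_eq0 mulf_eq0 pnatr_eq0 (negbTE i_neq0) /= => /eqP.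
  rewrite -[LHS]half_twice; have -> : P *m Q + P *m Q = 0; last by rewrite scaler0.
  by rewrite -[X in X + _](subrK ((P *m Q) ^t*)) e1 add0r addrC.
have [GE PQ] := h; split.
- apply/eqP; rewrite eqn_leq rank_leq_col /= -{1}(mxrank_unit (level_unit h)).
  exact: mxrankM_maxr.
- by rewrite GE addrK -raddfD scale_scalar_mx mulrDr mulr1 -splitr.
- by rewrite PQ trC0 subrr scaler0.
- by rewrite PQ trC0 addr0 scaler0.
Qed.

Lemma toOrbE (a : QP) :
  toOrb a = i *: (2^-1 *: ((a.1 - a.2 ^t*) *m (a.1 ^t* + a.2))).
Proof.
rewrite /toOrb -scalemxAl -scalemxAr !scalerA; congr (_ *: _).
rewrite mulrA mulrC; congr (_ * _).
rewrite -rmorphM -invfM -expr2 sqr_sqrtr ?ler0n // fmorphV rmorph_nat //.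
Qed.

Section Point.
Variables (Q : 'M[C]_(n, m)) (P : 'M[C]_(m, n)).
Hypothesis h : level_eqs Q P.

Let G := Q ^t* *m Q.
Definition levelProj := Q *m invmx (Q ^t* *m Q) *m Q ^t*.
Definition levelE := 2^-1 *: ((Q - P ^t*) *m (Q ^t* + P)).
Let eta := Q *m P.

Let Gu : G \in unitmx. Proof. exact: level_unit h. Qed.
Let PQ : P *m Q = 0. Proof. by case: h. Qed.
Let QP0 : Q ^t* *m P ^t* = 0. Proof. by rewrite -trCM PQ trC0. Qed.

Lemma levelVU : (Q ^t* + P) *m (Q - P ^t*) = 1%:M + 1%:M.
Proof.
by rewrite mulmxBr !mulmxDl PQ QP0 h.1 addr0 add0r addrK.
Qed.

Lemma levelE_idem : idem m levelE.
Proof.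
rewrite /levelE scalemxAr; apply: factor_idem.
by rewrite -scalemxAl levelVU half_twice.
Qed.

Lemma levelProj_l : levelProj *m Q = Q.
Proof. by rewrite /levelProj -mulmxA mulmxKV. Qed.

Lemma levelProj_herm : levelProj ^t* = levelProj.
Proof.
have Gh : G ^t* = G by rewrite trCM trCK.
by rewrite /levelProj !trCM trCK invmx_trC // mulmxA.
Qed.

Lemma levelProj_idem : levelProj *m levelProj = levelProj.
Proof. by rewrite {2}/levelProj !mulmxA levelProj_l. Qed.

Lemma levelProj_r : P *m levelProj = 0.
Proof. by rewrite /levelProj !mulmxA PQ !mul0mx. Qed.

Lemma levelProj_im : im levelProj = im Q.
Proof.
apply/eqP; rewrite eqEsubv; apply/andP; split; apply/im_subP.
  by exists (invmx (Q ^t* *m Q) *m Q ^t*); rewrite mulmxA.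
by exists Q; rewrite levelProj_l.
Qed.

Lemma levelProj_proj : orthoproj (im Q) = levelProj.
Proof. by rewrite -levelProj_im; apply: orthoproj_im; [exact: levelProj_idem|exact: levelProj_herm]. Qed.

Lemma level_TGr : proj_covect m levelProj eta.
Proof.
split; [exact: levelProj_idem|exact: levelProj_herm| | |].
- by rewrite mulmxA levelProj_l.
- by rewrite -mulmxA levelProj_r mulmx0.
- rewrite levelProj_im; apply: (@dim_im_linv _ _ _ _ (invmx G *m Q ^t*)).
  by rewrite -mulmxA mulVmx.
Qed.

(** Closed form of D on the level set, for Z = eta - eta^*. With A = Q Q^* and B = P^* P the level
    equations give A A = 2 A + eta eta^* and B B = eta^* eta - 2 B, so A - Pi on the image of Q and
    B + 1 on its complement square to the blocks of 1 + Z Z^*. *)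
Definition levelD := Q *m Q ^t* - levelProj + (P ^t* *m P + (1%:M - levelProj)).

Let A := Q *m Q ^t*.
Let B := P ^t* *m P.

Let AA : A *m A = A + A + eta *m eta ^t*.
Proof.
rewrite /A !mulmxA -(mulmxA Q) h.1 !(mulmxDl, mulmxDr) mulmx1 trCM.
by rewrite !mulmxA.
Qed.

Let BB : B *m B = eta ^t* *m eta - B - B.
Proof.
have PE : P *m P ^t* = Q ^t* *m Q - 1%:M - 1%:M by rewrite h.1; move: (P *m _) => W; mx_ring.
rewrite /B !mulmxA -(mulmxA _ P) PE !(mulmxBl, mulmxBr) mulmx1 trCM.
by rewrite !mulmxA.
Qed.

Let AB : A *m B = 0.
Proof. by rewrite /A /B !mulmxA -(mulmxA Q) QP0 mulmx0 mul0mx. Qed.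

Let BA : B *m A = 0.
Proof. by rewrite /A /B !mulmxA -(mulmxA _ P) PQ mulmx0 mul0mx. Qed.

Let PA : levelProj *m A = A.
Proof. by rewrite mulmxA levelProj_l. Qed.

Let AP : A *m levelProj = A.
Proof. by rewrite /A /levelProj !mulmxA -(mulmxA Q (Q ^t*) Q) mulmxK. Qed.

Let PB : levelProj *m B = 0.
Proof. by rewrite /levelProj /B !mulmxA -(mulmxA _ (Q ^t*) (P ^t*)) QP0 mulmx0 mul0mx. Qed.

Let BP : B *m levelProj = 0.
Proof. by rewrite -mulmxA levelProj_r mulmx0. Qed.

Let ee : eta *m eta = 0.
Proof. by rewrite /eta mulmxA -(mulmxA Q) PQ mulmx0 mul0mx. Qed.

Let ee' : eta ^t* *m eta ^t* = 0.
Proof. by rewrite -trCM ee trC0. Qed.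

Lemma levelD_sqr : levelD *m levelD = 1%:M + (eta - eta ^t*) *m (eta - eta ^t*) ^t*.
Proof.
have PP := levelProj_idem.
have -> : (eta - eta ^t*) *m (eta - eta ^t*) ^t* = eta *m eta ^t* + eta ^t* *m eta.
  exact: gram_anti ee ee'.
rewrite /levelD -/A -/B.
move: levelProj AA BB AB BA PA AP PB BP PP => Pi aa bb ab ba pa ap pb bp pp.
move: (eta *m eta ^t*) (eta ^t* *m eta) aa bb => N1 N2 aa bb.
rewrite !(mulmxDl, mulmxDr, mulmxN, mulNmx, mul1mx, mulmx1) aa bb ab ba pa ap pb bp pp.
by mx_ring.
Qed.

Lemma psdD k (X Y : 'M[C]_k) : psd X -> psd Y -> psd (X + Y).
Proof.
move=> /psd_pdef pX /psd_pdef pY; apply: (@pdef_psd _ _ (0 + 0)); first by rewrite addr0.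
exact: pdefD.
Qed.

(** With G = Q^* Q = 2 + W and W = P P^*, the block Q Q^* - Pi is congruent to G^2 - G = 2 + 3 W +
    W^2. *)
Lemma levelD_psd : psd levelD.
Proof.
apply: psdD; last apply: psdD.
- have W0 : psd (P *m P ^t*) by have := psd_gram (P ^t*); rewrite trCK.
  have Wh : (P *m P ^t*) ^t* = P *m P ^t* by case: W0.
  have p1 := pdef_psd ler01 (@pdef1 R m).
  have GG : G *m G - G = 1%:M + 1%:M + (P *m P ^t* + P *m P ^t* + P *m P ^t*) +
      (P *m P ^t*) ^t* *m (P *m P ^t*).
    rewrite Wh /G h.1; move: (P *m P ^t*) => W.
    rewrite !(mulmxDl, mulmxDr, mul1mx, mulmx1); mx_ring.
  have pG : psd (G *m G - G).
    rewrite GG; exact: (psdD (psdD (psdD p1 p1) (psdD (psdD W0 W0) W0)) (psd_gram _)).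
  have Gh : (invmx G) ^t* = invmx G by apply: invmx_trC; rewrite trCM trCK.
  have -> : Q *m Q ^t* - levelProj = (invmx G *m Q ^t*) ^t* *m (G *m G - G) *m (invmx G *m Q ^t*).
    by rewrite trCM trCK Gh unit_sandwich.
  exact: psd_conj.
- exact: psd_gram.
have -> : 1%:M - levelProj = (1%:M - levelProj) ^t* *m (1%:M - levelProj).
  rewrite trCB trC1 levelProj_herm mulmxBr mulmx1 mulmxBl mul1mx levelProj_idem.
  by rewrite subrr subr0.
exact: psd_gram.
Qed.

Lemma levelD_Dmx : Dmx (eta - eta ^t*) = levelD.
Proof. by rewrite /Dmx herm_one_gram; apply: sqrtmx_unique; [exact: levelD_psd|exact: levelD_sqr]. Qed.

(** For A and B as above, (Q - P^* ) (Q^* + P) = A - B + Z, while (2 Pi - 1) D = A - B - 1. *)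
Lemma levelE_Eof : levelE = Eof levelProj eta.
Proof.
rewrite /levelE /Eof levelD_Dmx; congr (_ *: _).
have PP := levelProj_idem.
have -> : (Q - P ^t*) *m (Q ^t* + P) = A - B + (eta - eta ^t*).
  by rewrite mulmxBl !mulmxDr -trCM -/A -/B -/eta; mx_ring.
have -> : (levelProj + levelProj - 1%:M) *m levelD = A - B - 1%:M.
  rewrite /levelD -/A -/B; move: levelProj PA PB PP => Pi pa pb pp.
  rewrite !(mulmxDl, mulmxDr, mulmxN, mulNmx, mul1mx, mulmx1) pa pb pp.
  by mx_ring.
by rewrite (addrC 1%:M) subrK.
Qed.

End Point.

Lemma level_toTGr (a : QP) : level a -> TGr m n (toTGr a).
Proof. by move=> /levelP h; apply/TGrP; rewrite /= (levelProj_proj h); exact: level_TGr. Qed.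

Lemma toOrb_levelE (a : QP) : toOrb a = i *: levelE a.1 a.2.
Proof. exact: toOrbE. Qed.

Lemma toOrb_Orb (a : QP) : level a -> Orb m n (toOrb a).
Proof.
move=> /levelP h; apply/OrbP; exists (levelE a.1 a.2); first exact: toOrb_levelE.
exact: levelE_idem.
Qed.

Lemma toOrb_PhiInv (a : QP) : level a -> toOrb a = PhiInv (toTGr a).
Proof.
move=> /levelP h; rewrite toOrb_levelE /PhiInv /= (levelProj_proj h).
by rewrite (levelE_Eof h).
Qed.

Lemma Phi_toOrb (a : QP) : level a -> Phi (toOrb a) = toTGr a.
Proof. by move=> la; rewrite toOrb_PhiInv //; apply: PhiInvK (level_toTGr la). Qed.

End LevelSet.

(** * Trace identities behind the comparison of forms *)

Section TraceIdentities.
Variable K : comNzRingType.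

Lemma kks_product n m (U u2 : 'M[K]_(n, m)) (V v1 : 'M[K]_(m, n)) (u1 : 'M[K]_(n, m)) (v2 : 'M[K]_(m, n)) :
  V *m U = 1%:M + 1%:M -> v1 *m U = - (V *m u1) -> v2 *m U = - (V *m u2) ->
  (V *m (u1 *m V + U *m v1)) *m ((u2 *m V + U *m v2) *m U) =
  v1 *m u2 + v1 *m u2 + (v1 *m u2 + v1 *m u2) + (V *m u1 *m (V *m u2) + V *m u1 *m (V *m u2)).
Proof.
move=> VU vU1 vU2.
have -> : V *m (u1 *m V + U *m v1) = V *m u1 *m V + (v1 + v1).
  by rewrite mulmxDr !mulmxA VU mulmxDl mul1mx.
have -> : (u2 *m V + U *m v2) *m U = u2 + u2 - U *m (V *m u2).
  by rewrite mulmxDl -!mulmxA VU vU2 mulmxDr mulmx1 mulmxN.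
rewrite mulmxDl !mulmxBr !mulmxDr !mulmxDl (mulmxA _ U) -(mulmxA _ V U) VU.
rewrite (mulmxA v1 U) vU1 !mulNmx mulmxDr !mulmxDl !mulmx1 -!(mulmxA (V *m u1) V u2).
move: (V *m u1 *m (V *m u2)) (v1 *m u2) => a c; mx_ring.
Qed.

(** Using V U = 2 and its derivative, each product reduces to four copies of v1 u2 and two of (V u1)
    (V u2). The trace of the latter is symmetric in the two vectors and cancels. *)
Lemma kks_trace n m (U u1 u2 : 'M[K]_(n, m)) (V v1 v2 : 'M[K]_(m, n)) :
  V *m U = 1%:M + 1%:M -> v1 *m U = - (V *m u1) -> v2 *m U = - (V *m u2) ->
  \tr (U *m V *m ((u1 *m V + U *m v1) *m (u2 *m V + U *m v2) -
    (u2 *m V + U *m v2) *m (u1 *m V + U *m v1))) =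
  (\tr (v1 *m u2) - \tr (v2 *m u1)) *+ 4.
Proof.
move=> VU h1 h2.
have key (X Y : 'M[K]_n) : \tr (U *m V *m (X *m Y)) = \tr ((V *m X) *m (Y *m U)).
  by rewrite -mulmxA mxtrace_mulC !mulmxA.
rewrite mulmxBr raddfB /= !key (kks_product VU h1 h2) (kks_product VU h2 h1).
rewrite !mxtraceD (mxtrace_mulC (V *m u1)).
move: (\tr _) (\tr _) (\tr _) => x y z; ring.
Qed.

Lemma cot_trace1 n m (Q q1 q2 : 'M[K]_(n, m)) (P p1 : 'M[K]_(m, n)) (Pi Pi1 Pi2 : 'M[K]_n) :
  Pi2 *m Q + Pi *m q2 = q2 -> p1 *m Pi + P *m Pi1 = 0 ->
  \tr ((q1 *m P + Q *m p1) *m Pi2) =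
  \tr (p1 *m q2) + (\tr (P *m Pi1 *m q2) + \tr (P *m Pi2 *m q1)).
Proof.
move=> e1 e2; rewrite mulmxDl raddfD /= -!mulmxA mxtrace_mulC addrC -(mxtrace_mulC _ Q).
have -> : p1 *m Pi2 *m Q = p1 *m q2 + P *m Pi1 *m q2.
  rewrite -{1}e1 mulmxDr -[RHS]addrA.
  have -> : p1 *m (Pi *m q2) + P *m Pi1 *m q2 = 0 by rewrite mulmxA -mulmxDl e2 mul0mx.
  by rewrite addr0 mulmxA.
by rewrite raddfD /= -addrA -!mulmxA.
Qed.

(** The hypotheses are the derivatives of Pi Q = Q and P Pi = 0. They replace tr (d eta dPi) by tr
    (dP dQ) plus a symmetric expression, which cancels on antisymmetrizing. *)
Lemma cot_trace n m (Q q1 q2 : 'M[K]_(n, m)) (P p1 p2 : 'M[K]_(m, n)) (Pi Pi1 Pi2 : 'M[K]_n) :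
  Pi1 *m Q + Pi *m q1 = q1 -> p1 *m Pi + P *m Pi1 = 0 ->
  Pi2 *m Q + Pi *m q2 = q2 -> p2 *m Pi + P *m Pi2 = 0 ->
  \tr ((q1 *m P + Q *m p1) *m Pi2 - (q2 *m P + Q *m p2) *m Pi1) =
  \tr (p1 *m q2) - \tr (p2 *m q1).
Proof.
move=> a1 b1 a2 b2; rewrite raddfB /= (cot_trace1 q1 a2 b1) (cot_trace1 q2 a1 b2).
by rewrite [X in _ - (_ + X)]addrC opprD addrACA subrr addr0.
Qed.

End TraceIdentities.

(** * The quaternionic metric in complex components *)

Section QuaternionForms.
Context {R : realType} {m n : nat}.
Local Notation C := R[i].
Local Notation i := ('i%C : C).
Local Notation hmx := (@Defs.hmx R).

Lemma Re_conj (z : C) : complex.Re (z^*)%C = complex.Re z.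
Proof. by case: z. Qed.

Lemma tr_conj p (A : 'M[C]_p) : \tr (conjmx A) = ((\tr A)^*)%C.
Proof. by rewrite /mxtrace rmorph_sum; apply: eq_bigr => j _; rewrite !mxE. Qed.

Lemma hmetricE p q (A B : hmx p q) :
  hmetric A B = complex.Re (\tr (A.1 *m B.1 ^t*)) + complex.Re (\tr (A.2 *m B.2 ^t*)).
Proof.
have E (X Y : hmx p q) : complex.Re (\tr (hmul X (hadj Y)).1) =
    complex.Re (\tr (X.1 *m Y.1 ^t*)) + complex.Re (\tr (X.2 *m Y.2 ^t*)).
  rewrite /hmul /hadj /= mulmxN opprK mxtraceD ReD; congr (_ + _).
  rewrite -[RHS]Re_conj -tr_conj; congr (complex.Re (\tr _)).
  by rewrite /conjmx map_mxM /=; congr (_ *m _); apply/matrixP => j k; rewrite !mxE conjCK.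
have S (X Y : 'M[C]_(p, q)) : complex.Re (\tr (X *m Y ^t*)) = complex.Re (\tr (Y *m X ^t*)).
  by rewrite -Re_conj -mxtraceC trCM trCK.
have D (x : R) : (x + x) / 2 = x by field.
by rewrite /hmetric ReD (E A B) (E B A) (S B.1 A.1) (S B.2 A.2) D.
Qed.

Lemma hmul_hi p q (B : hmx p q) : hmul hi B = (i *: B.1, - i *: B.2).
Proof.
rewrite /hmul /hi /= /conjmx map_mx0 !mul0mx subr0 add0r map_scalar_mx /= !mul_scalar_mx.
by rewrite (conji : Num.conj i = - i).
Qed.

Lemma hmul_hk p q (B : hmx p q) : hmul hk B = (- i *: B.2, - i *: B.1).
Proof.
have -> : (hk : hmx p p) = (0, (- i)%:M).
  rewrite /hk hmul_hi /hj /= scaler0; congr (_, _).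
  by rewrite scalemx1.
rewrite /hmul /= /conjmx map_mx0 !mul0mx sub0r addr0 map_scalar_mx /= !mul_scalar_mx.
by rewrite rmorphN /= (conji : Num.conj i = - i) opprK !scaleNr.
Qed.

Lemma tr_vu_expand (a b : 'M[C]_(n, m)) (c d : 'M[C]_(m, n)) :
  \tr ((a ^t* + c) *m (b - d ^t*)) =
  ((\tr (a *m b ^t*))^*)%C - ((\tr (d *m a))^*)%C + (\tr (c *m b) - ((\tr (c ^t* *m d))^*)%C).
Proof.
have c1 (X Y : 'M[C]_(n, m)) : \tr (X ^t* *m Y) = ((\tr (X *m Y ^t*))^*)%C.
  by rewrite -mxtraceC trCM trCK mxtrace_mulC.
have c2 (X Y : 'M[C]_(m, n)) : \tr (X *m Y ^t*) = ((\tr (X ^t* *m Y))^*)%C.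
  by rewrite -mxtraceC trCM trCK mxtrace_mulC.
have c3 (X : 'M[C]_(n, m)) (Y : 'M[C]_(m, n)) : \tr (X ^t* *m Y ^t*) = ((\tr (Y *m X))^*)%C.
  by rewrite -trCM mxtraceC.
by rewrite mulmxDl !mulmxBr !raddfD !raddfN /= (c3 a d) (c1 a b) (c2 c d).
Qed.

Section Values.
Variables (q1 q2 : 'M[C]_(n, m)) (p1 p2 : 'M[C]_(m, n)).

Lemma hk_value : hmetric (hmul hk (toH (q1, p1))) (toH (q2, p2)) =
  - complex.Re (- i * (\tr (p1 *m q2) - \tr (p2 *m q1))).
Proof.
rewrite hmul_hk hmetricE /= trCK -!scalemxAl !mxtraceZ.
have -> : \tr (p1 ^t* *m q2 ^t*) = ((\tr (p1 *m q2))^*)%C.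
  by rewrite -trCM mxtraceC mxtrace_mulC.
rewrite (mxtrace_mulC q1); move: (\tr _) (\tr _) => [a b] [c d] /=; ring.
Qed.

Lemma hi_value : hmetric (hmul hi (toH (q1, p1))) (toH (q2, p2)) =
  complex.Re (- i * (2^-1 * (\tr ((q1 ^t* + p1) *m (q2 - p2 ^t*)) - \tr ((q2 ^t* + p2) *m (q1 - p1 ^t*))))).
Proof.
rewrite hmul_hi hmetricE /= trCK -!scalemxAl !mxtraceZ.
rewrite !tr_vu_expand.
have -> : \tr (q2 *m q1 ^t*) = ((\tr (q1 *m q2 ^t*))^*)%C.
  by rewrite -mxtraceC trCM trCK.
have -> : \tr (p2 ^t* *m p1) = ((\tr (p1 ^t* *m p2))^*)%C.
  by rewrite -mxtraceC trCM trCK.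
have hh : (2^-1 : R)%:C%C = 2^-1 :> C by rewrite fmorphV rmorph_nat.
rewrite mulrCA -hh Re_realM.
move: (\tr _) (\tr _) (\tr _) (\tr _) => [a b] [c d] [e f] [g h].
rewrite /=; lra.
Qed.

End Values.
End QuaternionForms.

(** * Curves in the level set and values of the forms on their velocities *)

Section LevelCurves.
Context {R : realType} {m n : nat}.
Local Notation C := R[i].
Local Notation i := ('i%C : C).
Local Notation rmx := (@Defs.rmx R).
Local Notation rcovect := (@Defs.rcovect R).
Local Notation QP := (@Defs.QP R m n).
Local Notation level := (@Defs.level R m n).
Implicit Types V W X : normedModType R.

Lemma is_derive_pr1 V W X (f : V -> (W * X)%type) x d df : findim W -> findim X ->
  is_derive x d f df -> is_derive x d (fun y => (f y).1) df.1.
Proof.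
move=> fW fX H; have l : linear (fun p : (W * X)%type => p.1) by [].
exact: (is_derive_linear (findim_prod fW fX) l H).
Qed.

Lemma is_derive_pr2 V W X (f : V -> (W * X)%type) x d df : findim W -> findim X ->
  is_derive x d f df -> is_derive x d (fun y => (f y).2) df.2.
Proof.
move=> fW fX H; have l : linear (fun p : (W * X)%type => p.2) by [].
exact: (is_derive_linear (findim_prod fW fX) l H).
Qed.

Lemma is_derive_pd W (Y : Type) (e : Y -> W) k (s : 'rV[R]_k -> Y) (U : set 'rV[R]_k) u (j : 'I_k) :
  smooth_on U (e \o s) -> U u -> is_derive u (dirv j) (e \o s) (pd e j s u).
Proof.
move=> sU Uu; have [_ /(_ (dirv j)) [d1 _]] := sU 1%N.
by apply: derivableP; apply: d1.
Qed.

(** [uvec] and [vvec] are the two factors of [toOrb] without their scalar constants. Being real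
    linear, they apply to points and to tangent vectors alike. *)
Definition uvec (b : QP) : 'M[C]_(n, m) := b.1 - b.2 ^t*.
Definition vvec (b : QP) : 'M[C]_(m, n) := b.1 ^t* + b.2.

(** All that is retained of a curve in the level set: the linearized equations, the velocities of
    its two images, and the derivative Pi' of the projector. *)
Record level_tangent (a b : QP) (xi' : rmx n n) (z' : rcovect n) (Pi' : 'M[C]_n) : Prop := LevelTangent {
  lt_VU : vvec b *m uvec a = - (vvec a *m uvec b);
  lt_xi : xi' = reim (i *: (2^-1 *: (uvec b *m vvec a + uvec a *m vvec b)));
  lt_z : z' = (reim Pi', reim (b.1 *m a.2 + a.1 *m b.2));
  lt_PiQ : Pi' *m a.1 + levelProj a.1 *m b.1 = b.1;
  lt_PPi : b.2 *m levelProj a.1 + a.2 *m Pi' = 0 }.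

Lemma level_curve_tangent a c b : curve_through level embQP a c -> velocity embQP c = embQP b ->
  exists Pi', level_tangent a b (velocity reim (@toOrb R m n \o c)) (velocity embT (@toTGr R m n \o c)) Pi'.
Proof.
move=> [[U [[oU U0] sU US]] c0] cb.
have dc := is_derive_pd 0 sU U0; rewrite -/(velocity embQP c) cb in dc.
have fnm := findim_rmx (R := R) n m; have fmn := findim_rmx (R := R) m n.
have d1 : cderive 0 (dirv 0) (fun u => (c u).1) b.1 := is_derive_pr1 fnm fmn dc.
have d2 : cderive 0 (dirv 0) (fun u => (c u).2) b.2 := is_derive_pr2 fnm fmn dc.
have dU := cderiveB d1 (cderive_trC d2); have dV := cderiveD (cderive_trC d1) d2.
have dE := cderiveZ i (cderiveZ 2^-1 (cderiveM dU dV)).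
have near_level : \forall u \near (0 : 'rV[R]_1), level_eqs (c u).1 (c u).2.
  by apply: filterS (open_near oU U0) => u /US /levelP.
pose s := @toOrb R m n \o c.
have dO : is_derive 0 (dirv 0) ((fun x => reim x : rmx n n) \o s)
    (reim (i *: (2^-1 *: (uvec b *m vvec a + uvec a *m vvec b)))).
  have := dE; rewrite /cderive c0 [_ *m _ + _]addrC; congr (is_derive _ _ _ _).
  by apply/funext => u; rewrite /s /= toOrbE.
have sO : smooth_on U ((fun x => reim x : rmx n n) \o s).
  have oT := @openT (rmx n m * rmx m n)%type.
  have s1 := csmooth_lin (smooth_fst (rmx n m) (rmx m n)).
  have s2 := csmooth_lin (smooth_snd (rmx n m) (rmx m n)).
  have sG := csmoothZ i oT (csmoothZ 2^-1 oT
    (csmoothM oT (csmoothB oT s1 (csmooth_trC oT s2)) (csmoothD oT (csmooth_trC oT s1) s2))).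
  have H := smooth_on_comp oU oT (fun x _ => I) sG sU.
  by move=> k; apply: Ck_ext (H k) => // u _; rewrite /s /= !reimK toOrbE.
have UO u : U u -> Orb m n (s u) by move=> /US; apply: toOrb_Orb.
(* On the level set [toTGr] is [Phi] after [toOrb], and [Phi] has a smooth ambient extension; this
   yields differentiability of the projector onto the image of Q. *)
have dZ := push_pd smooth_GPhi (@GPhi_embT R n m) 0 oU sO UO U0.
set z' := 'd _ _ _ in dZ.
exists (ofreim z'.1).
have vz : velocity embT (@toTGr R m n \o c) = z'.
  have [_ <-] := dZ; apply: near_eq_derive; apply: filterS (open_near oU U0) => u /US lu /=.
  by rewrite /s /= Phi_toOrb.
have [_ vO] := dO.
have dPi : cderive 0 (dirv 0) (fun u => levelProj (c u).1) (ofreim z'.1).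
  rewrite /cderive ofreimK; apply: near_eq_is_derive (is_derive_cov1 dZ).
  apply: filterS (open_near oU U0) => u Uu.
  apply: (etrans (congr1 (fun z => (embT z).1) (Phi_toOrb (US u Uu)))).
  have hp := levelProj_proj ((levelP (c u)).1 (US u Uu)).
  by rewrite /= hp.
have dEta : cderive 0 (dirv 0) (fun u => (c u).1 *m (c u).2) (ofreim z'.2).
  rewrite /cderive ofreimK; apply: near_eq_is_derive (is_derive_cov2 dZ).
  apply: filterS (open_near oU U0) => u Uu.
  exact: (congr1 (fun z => (embT z).2) (Phi_toOrb (US u Uu))).
split.
- have e := cderive_unique (cderiveM dV dU) (cderive_near _ (cderive_cst 0 (dirv 0) (1%:M + 1%:M))).
  rewrite c0 in e; apply/eqP; rewrite -addr_eq0 addrC; apply/eqP; apply: e.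
  by apply: filterS near_level => u hu; rewrite (levelVU hu).
- exact: vO.
- have e := cderive_unique (cderiveM d1 d2) dEta; rewrite c0 in e.
  by rewrite vz [b.1 *m _ + _]addrC e !ofreimK; case: (z').
- have e := cderive_unique (cderiveM dPi d1) (cderive_near _ d1); rewrite c0 in e.
  rewrite addrC; apply: e.
  by apply: filterS near_level => u hu; rewrite (levelProj_l hu).
have e := cderive_unique (cderiveM d2 dPi) (cderive_near _ (cderive_cst 0 (dirv 0) 0)).
rewrite c0 in e; rewrite addrC; apply: e.
by apply: filterS near_level => u hu; rewrite (levelProj_r hu).
Qed.

(** The three halves come from the point and the two vectors, the 4 from [kks_trace]. *)
Lemma kks_scale (t : C) : - (i * (2^-1 * (2^-1 * (2^-1 * (t *+ 4))))) = - i * (2^-1 * t).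
Proof.
rewrite mulNr; congr (- (_ * _)).
by field; rewrite ?pnatr_eq0.
Qed.

Lemma tr_half3 (T A B : 'M[C]_n) :
  \tr ((i *: (2^-1 *: T)) *m bracket (i *: (2^-1 *: A)) (i *: (2^-1 *: B))) =
  - (i * (2^-1 * (2^-1 * (2^-1 * \tr (T *m (A *m B - B *m A)))))).
Proof.
rewrite bracket_ii mulmxN -!scalemxAl raddfN /= !mxtraceZ.
have -> : bracket (2^-1 *: A) (2^-1 *: B) = 2^-1 *: (2^-1 *: (A *m B - B *m A)).
  by rewrite /bracket -!scalemxAl -!scalemxAr -!scalerBr.
by rewrite -!scalemxAr !mxtraceZ.
Qed.

Lemma Re_iN_iN (t : C) : complex.Re (- i * (- i * (2^-1 * t))) = - (2^-1 * complex.Re t).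
Proof.
have hh : (2^-1 : R)%:C%C = 2^-1 :> C by rewrite fmorphV rmorph_nat.
by rewrite mulrA mulrNN mulii mulN1r -hh raddfN /= -[in RHS](Re_realM 2^-1 t).
Qed.

Lemma im_value (b b' : QP) :
  complex.Re (- i * (- i * (2^-1 * (\tr (vvec b *m uvec b') - \tr (vvec b' *m uvec b))))) =
  - complex.Re (\tr (b.2 *m b'.1) - \tr (b'.2 *m b.1)).
Proof.
rewrite Re_iN_iN; congr (- _).
case: b b' => [q1 p1] [q2 p2]; rewrite /uvec /vvec /= tr_vu_expand tr_vu_expand.
have -> : \tr (q2 *m q1 ^t*) = ((\tr (q1 *m q2 ^t*))^*)%C by rewrite -mxtraceC trCM trCK.
have -> : \tr (p2 ^t* *m p1) = ((\tr (p1 ^t* *m p2))^*)%C by rewrite -mxtraceC trCM trCK.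
move: (\tr _) (\tr _) (\tr _) (\tr _) => [? ?] [? ?] [? ?] [? ?]; rewrite /=; lra.
Qed.

Section TwoVectors.
Variables (a b b' : QP) (x x' : rmx n n) (z z' : rcovect n) (Pi1 Pi2 : 'M[C]_n).
Hypotheses (la : level a) (tb : level_tangent a b x z Pi1) (tb' : level_tangent a b' x' z' Pi2).

Lemma level_cot : \tr (cot_form z z') = \tr (b.2 *m b'.1) - \tr (b'.2 *m b.1).
Proof.
rewrite (lt_z tb) (lt_z tb') /cot_form /= !reimK.
exact: (cot_trace (lt_PiQ tb) (lt_PPi tb) (lt_PiQ tb') (lt_PPi tb')).
Qed.

Lemma level_kks : \tr (toOrb a *m bracket (ofreim x) (ofreim x')) =
  - i * (2^-1 * (\tr (vvec b *m uvec b') - \tr (vvec b' *m uvec b))).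
Proof.
have VU := levelVU ((levelP a).1 la).
have ex := etrans (congr1 (@ofreim R n n) (lt_xi tb)) (reimK _).
have ex' := etrans (congr1 (@ofreim R n n) (lt_xi tb')) (reimK _).
rewrite ex ex' toOrbE; apply: (etrans (tr_half3 _ _ _)).
rewrite (kks_trace VU (lt_VU tb) (lt_VU tb')); exact: kks_scale.
Qed.

Lemma level_kks_re : retr 1 (toOrb a *m bracket (ofreim x) (ofreim x')) =
  hmetric (hmul hi (toH b)) (toH b').
Proof.
rewrite /retr mul1r level_kks; case: b b' => [q1 p1] [q2 p2].
by rewrite hi_value.
Qed.

Lemma level_kks_im : retr (- i) (toOrb a *m bracket (ofreim x) (ofreim x')) =
  - retr 1 (cot_form z z').
Proof. by rewrite /retr mul1r level_kks level_cot; exact: im_value. Qed.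

Lemma level_hk : hmetric (hmul hk (toH b)) (toH b') = - retr (- i) (cot_form z z').
Proof.
rewrite /retr level_cot; case: b b' => [q1 p1] [q2 p2].
by rewrite hk_value.
Qed.

End TwoVectors.
End LevelCurves.

(** * Lifting curves of the orbit to the level set *)

Lemma sandwich_inv (A : comUnitRingType) n m (L F : 'M[A]_(n, m)) (T G : 'M[A]_(m, n)) (K N : 'M[A]_m) :
  N \in unitmx -> N = (G *m L) *m (K *m (T *m F)) ->
  L *m K *m T *m F *m invmx N *m G *m (L *m K *m T) = L *m K *m T.
Proof.
move=> Nu NE; have h : (G *m L) *m (K *m (T *m F) *m invmx N) = 1%:M.
  by rewrite mulmxA -NE mulmxV.
have {}h := mulmx1C h.
have -> : L *m K *m T *m F *m invmx N *m G *m (L *m K *m T) =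
    L *m ((K *m (T *m F) *m invmx N) *m (G *m L)) *m (K *m T) by rewrite !mulmxA.
by rewrite h mulmx1 mulmxA.
Qed.

Lemma near_preim (R : realType) (V W : normedModType R) (f : V -> W) (x : V) (D : set W) :
  {for x, continuous f} -> open D -> D (f x) -> interior [set y | D (f y)] x.
Proof. by move=> cf oD Dx; exact: (cf _ (open_near oD Dx)). Qed.

Section Lift.
Context {R : realType} {m n : nat}.
Local Notation C := R[i].
Local Notation i := ('i%C : C).
Local Notation M := 'M[C]_n.
Local Notation rmx := (@Defs.rmx R).
Local Notation QP := (@Defs.QP R m n).
Local Notation level := (@Defs.level R m n).

Section Point.
Variables (P e D H : M) (F : 'M[C]_(n, m)) (N S : 'M[C]_m).
Hypotheses (iP : idem m P) (Ph : P ^t* = P) (Pe : P *m e = e) (eP : e *m P = 0)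
  (PD : P *m D = D *m P) (Dh : D ^t* = D) (Du : 1%:M + D \in unitmx)
  (DD : P *m (D *m D) = P + e *m e ^t*)
  (HE : H = P *m (1%:M + D)) (NE : N = F ^t* *m H *m F)
  (Sh : S ^t* = S) (SS : S *m S = N) (Nu : N \in unitmx).

Let Q := H *m F *m invmx S.
Let p := invmx S *m F ^t* *m e.

Let Su : S \in unitmx.
Proof. by move: Nu; rewrite -SS unitmx_mul => /andP []. Qed.

Let PP : P *m P = P. Proof. by case: iP. Qed.

Lemma lift_H_herm : H ^t* = H.
Proof. by rewrite HE trCM trCD trC1 Dh Ph mulmxDl mulmxDr mul1mx mulmx1 PD. Qed.

Lemma lift_PH : P *m H = H.
Proof. by rewrite HE mulmxA PP. Qed.

Let HE' : H = P + P *m D.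
Proof. by rewrite HE mulmxDr mulmx1. Qed.

Let wP : P *m D *m P = P *m D.
Proof. by rewrite {1}PD -mulmxA PP PD. Qed.

Let ww : P *m D *m (P *m D) = P + e *m e ^t*.
Proof. by rewrite mulmxA wP -mulmxA DD. Qed.

Lemma lift_HP : H *m P = H.
Proof. by rewrite HE' mulmxDl PP wP. Qed.

(** P (1 + D)^2 = 2 P (1 + D) + P (D^2 - 1), where P (D^2 - 1) = e e^*. This is the relation that Q
    Q^* satisfies on the level set. *)
Lemma lift_HH : H *m H = H + H + e *m e ^t*.
Proof.
have Pw : P *m (P *m D) = P *m D by rewrite mulmxA PP.
rewrite HE'; move: (P *m D) wP ww Pw => w wP' ww' Pw.
by rewrite mulmxDl !mulmxDr PP wP' ww' Pw; mx_ring.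
Qed.

Lemma lift_HX : H *m invmx (1%:M + D) = P.
Proof. by rewrite HE mulmxK. Qed.

(** H factors through a space of dimension m, on which invertibility of the m by m compression N
    loses nothing. *)
Lemma lift_HNH : H *m F *m invmx N *m F ^t* *m H = H.
Proof.
have [L [T [PLT TL]]] := idem_factor iP.
have HK : H = L *m (T *m H *m L) *m T.
  by rewrite -{1}lift_HP -{1}lift_PH PLT !mulmxA.
move: (T *m H *m L) HK => K HK.
have NK : N = (F ^t* *m L) *m (K *m (T *m F)) by rewrite NE HK !mulmxA.
rewrite HK; apply: sandwich_inv (Nu) NK.
Qed.

Lemma lift_inv : invmx S *m F ^t* *m Q = 1%:M.
Proof.
have -> : invmx S *m F ^t* *m Q = invmx S *m N *m invmx S by rewrite NE !mulmxA.
by rewrite -SS mulKmx // mulmxV.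
Qed.

Lemma lift_QX : Q *m (invmx S *m F ^t*) *m H = H.
Proof.
have -> : Q *m (invmx S *m F ^t*) = H *m F *m invmx N *m F ^t*.
  have -> : invmx N = invmx S *m invmx S.
    by apply: (can_inj (mulKmx Nu)); rewrite mulmxV // -SS -!mulmxA mulKVmx // mulmxV.
  by rewrite /Q !mulmxA.
exact: lift_HNH.
Qed.

(** e = H (1 + D)^{-1} e lies in the image of H, where Q S^{-1} F^* acts as the identity. *)
Lemma lift_Qp : Q *m p = e.
Proof.
have eE : e = H *m (invmx (1%:M + D) *m e) by rewrite mulmxA lift_HX Pe.
have -> : Q *m p = Q *m (invmx S *m F ^t*) *m e by rewrite /p !mulmxA.
by rewrite {1}eE (mulmxA _ H) lift_QX -eE.
Qed.

Lemma lift_Qtr : Q ^t* = invmx S *m F ^t* *m H.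
Proof. by rewrite /Q !trCM lift_H_herm invmx_trC // mulmxA. Qed.

(** Q^* Q = S^{-1} F^* H^2 F S^{-1}, and [lift_HH] splits it into two copies of S^{-1} N S^{-1} = 1
    and p p^*. *)
Lemma lift_level : level_eqs Q p.
Proof.
have eH : e *m H = 0 by rewrite -lift_PH mulmxA eP mul0mx.
split; last by rewrite /p /Q -!mulmxA (mulmxA e) eH mul0mx !mulmx0.
have pp : p *m p ^t* = invmx S *m F ^t* *m (e *m e ^t*) *m (F *m invmx S).
  by rewrite /p !trCM trCK invmx_trC // !mulmxA.
rewrite lift_Qtr pp /Q.
have -> : invmx S *m F ^t* *m H *m (H *m F *m invmx S) =
    invmx S *m F ^t* *m (H *m H) *m (F *m invmx S) by rewrite !mulmxA.
rewrite lift_HH !(mulmxDl, mulmxDr).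
have -> : invmx S *m F ^t* *m H *m (F *m invmx S) = 1%:M by rewrite -lift_inv /Q !mulmxA.
by [].
Qed.

Lemma lift_im : im Q = im P.
Proof.
apply/eqP; rewrite eqEsubv; apply/andP; split; apply/im_subP.
  by exists (H *m F *m invmx S); rewrite /Q !mulmxA lift_PH.
exists (invmx S *m F ^t* *m H *m invmx (1%:M + D)).
by rewrite (mulmxA Q) (mulmxA Q) lift_QX lift_HX.
Qed.

End Point.

Lemma gram_frame (P : M) : idem m P -> exists F : 'M[C]_(n, m), F ^t* *m F = 1%:M /\ P *m F = F.
Proof.
move=> iP; have [L [T [PLT TL]]] := idem_factor iP.
have Gu : L ^t* *m L \in unitmx.
  by apply: gram_unit => X LX; rewrite -[X]mul1mx -TL -mulmxA LX mulmx0.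
have [B [[Bh _] BB]] := pdef_sqrt (lexx 0) (psd_pdef (psd_gram L)).
have Bu : B \in unitmx by move: Gu; rewrite -BB unitmx_mul => /andP [].
exists (L *m invmx B); split; last by rewrite mulmxA PLT -(mulmxA L) TL mulmx1.
rewrite trCM invmx_trC // -mulmxA (mulmxA (L ^t*)) -BB mulmxK //.
by rewrite mulVmx.
Qed.

(** By the formula for [levelD], points of the level set satisfy Q Q^* = Pi (1 + D). Thus [liftH] is
    Q Q^* as a function on the orbit, and lifting means factoring it smoothly. *)
Definition liftH (v : rmx n n) : M := PiE (numE v) *m (1%:M + Dmx (etaE (numE v) - (etaE (numE v)) ^t*)).

Definition liftN (F : 'M[C]_(n, m)) v : 'M[C]_m := F ^t* *m liftH v *m F.

Definition liftQ F v : 'M[C]_(n, m) := liftH v *m F *m invmx (sqrtmx (herm (liftN F v))).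

Definition liftP F v : 'M[C]_(m, n) := invmx (sqrtmx (herm (liftN F v))) *m F ^t* *m etaE (numE v).

Definition lift_dom F : set (rmx n n) := [set v | pdset (reim (liftN F v))].

Lemma lift_domP F v : lift_dom F v -> exists2 c : R, 0 < c & pdef c%:C%C (herm (liftN F v)).
Proof. by move=> [c c0]; rewrite reimK; exists c. Qed.

Lemma csmooth_liftH : csmooth setT liftH.
Proof.
have oT := @openT (rmx n n); have sE := csmooth_numE (n := n) oT.
have se := csmooth_etaE oT sE.
exact: (csmoothM oT (csmooth_PiE oT sE)
  (csmoothD oT (csmooth_cst _ 1%:M) (csmooth_Dmx oT (csmoothB oT se (csmooth_trC oT se))))).
Qed.

Lemma csmooth_liftN F : csmooth setT (liftN F).
Proof.
have oT := @openT (rmx n n).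
exact: (csmoothM oT (csmoothM oT (csmooth_cst _ (F ^t*)) csmooth_liftH) (csmooth_cst _ F)).
Qed.

Lemma open_lift_dom F : open (lift_dom F).
Proof.
apply: open_comp; last exact: open_pdset.
by move=> v _; exact: (Sm_cont (csmooth_liftN F 0%N) I).
Qed.

Lemma lift_sqrt_unit F v : lift_dom F v -> sqrtmx (herm (liftN F v)) \in unitmx.
Proof.
move=> /lift_domP [c c0 pc]; have c0' : 0 <= c%:C%C :> C by rewrite ltW // ltr0c.
have [_ SS] := sqrtmx_pdef c0' pc.
have hu : herm (liftN F v) \in unitmx by apply: pdef_unitmx pc; rewrite ltr0c.
by move: hu; move: (sqrtmx _) SS => S <-; rewrite unitmx_mul => /andP [].
Qed.

Lemma csmooth_liftQ F : csmooth (lift_dom F) (liftQ F) /\ csmooth (lift_dom F) (liftP F).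
Proof.
have oW := @open_lift_dom F; have sub := @subsetT _ (lift_dom F).
have sN := csmooth_sub sub (csmooth_liftN F).
have sS := csmooth_sqrt oW (@lift_domP F) sN.
have sI := csmooth_inv oW (@lift_sqrt_unit F) sS.
have sH := csmooth_sub sub csmooth_liftH.
have se := csmooth_etaE oW (csmooth_numE (n := n) oW).
split; first exact: (csmoothM oW (csmoothM oW sH (csmooth_cst _ F)) sI).
exact: (csmoothM oW (csmoothM oW sI (csmooth_cst _ (F ^t*))) se).
Qed.

Lemma lift_sqrt F v : lift_dom F v -> (liftN F v) ^t* = liftN F v ->
  [/\ (sqrtmx (liftN F v)) ^t* = sqrtmx (liftN F v),
      sqrtmx (liftN F v) *m sqrtmx (liftN F v) = liftN F v & liftN F v \in unitmx].
Proof.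
move=> /lift_domP [c c0 pN] Nh; rewrite (herm_id Nh) in pN.
have c1 : 0 < c%:C%C :> C := etrans (ltr0c c) c0.
have [pS SS] := sqrtmx_pdef (ltW c1) pN.
split; [exact: pS.1|exact: SS|exact: pdef_unitmx c1 pN].
Qed.

(** For an orthonormal frame F of the image of Pi, F^* H F = 1 + F^* D F, which is at least 1. *)
Lemma lift_dom_base E F : idem m E -> F ^t* *m F = 1%:M -> PiE E *m F = F ->
  lift_dom F (reim (i *: E)).
Proof.
move=> hE FF PF; exists 1; first exact: ltr01.
have [_ Ph _ _ _] := (TGrP _ _).1 (Phi_TGr hE).
rewrite (orthoproj_Phi hE.1) in Ph.
have FP : F ^t* *m PiE E = F ^t* by rewrite -{2}PF trCM Ph.
rewrite reimK /liftN /liftH numE_reim (mulmxA (F ^t*)) FP.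
move: (Dmx _) (Dmx_pdef (etaE E - (etaE E) ^t*)) => D pD.
have -> : F ^t* *m (1%:M + D) *m F = 1%:M + F ^t* *m D *m F.
  by rewrite mulmxDr mulmx1 mulmxDl FF.
have pN := pdefD (@pdef1 R m) (psd_pdef (psd_conj F (pdef_psd ler01 pD))).
rewrite addr0 in pN; have [Nh _] := pN; rewrite herm_id //.
Qed.

(** As e has square zero, Z Z^* = e e^* + e^* e is block diagonal for P, and D inherits this. *)
Lemma lift_Dmx (P e : M) : P ^t* = P -> P *m e = e -> e *m P = 0 ->
  [/\ P *m Dmx (e - e ^t*) = Dmx (e - e ^t*) *m P,
      P *m (Dmx (e - e ^t*) *m Dmx (e - e ^t*)) = P + e *m e ^t*,
      1%:M + Dmx (e - e ^t*) \in unitmx & (Dmx (e - e ^t*)) ^t* = Dmx (e - e ^t*)].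
Proof.
move=> Ph Pe eP.
have ee : e *m e = 0 by rewrite -{2}Pe mulmxA eP mul0mx.
have Pe' : P *m e ^t* = 0 by rewrite -{1}Ph -trCM eP trC0.
have ZZ := gram_anti ee; rewrite -trCM ee trC0 in ZZ; have {}ZZ := ZZ erefl.
have PZ : P *m (e *m e ^t* + e ^t* *m e) = e *m e ^t*.
  by rewrite mulmxDr !mulmxA Pe Pe' mul0mx addr0.
have ZP : (e *m e ^t* + e ^t* *m e) *m P = e *m e ^t*.
  have Pe'' : e ^t* *m P = e ^t* by rewrite -{2}Pe trCM Ph.
  by rewrite mulmxDl -!mulmxA eP Pe'' mulmx0 addr0.
have PD : P *m Dmx (e - e ^t*) = Dmx (e - e ^t*) *m P.
  by apply: Dmx_comm; rewrite ZZ PZ ZP.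
have DD : P *m (Dmx (e - e ^t*) *m Dmx (e - e ^t*)) =
    P + e *m e ^t*.
  by rewrite Dmx_sqr ZZ mulmxDr mulmx1 PZ.
have Du : 1%:M + Dmx (e - e ^t*) \in unitmx.
  exact: (pdef_unitmx (addr_gt0 ltr01 ltr01) (pdefD (@pdef1 R n) (Dmx_pdef _))).
by have Dh := Dmx_herm (e - e ^t*).
Qed.

Lemma lift_point E F : idem m E -> lift_dom F (reim (i *: E)) ->
  level (liftQ F (reim (i *: E)), liftP F (reim (i *: E))) /\
  toOrb (liftQ F (reim (i *: E)), liftP F (reim (i *: E))) = i *: E.
Proof.
move=> hE; set v := reim (i *: E) => dv.
have [PP Ph Pe eP dP] := (TGrP _ _).1 (Phi_TGr hE).
rewrite (orthoproj_Phi hE.1) (eta_Phi hE.1) in PP Ph Pe eP dP.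
have nE : numE v = E by exact: numE_reim.
have [PD DD Du Dh] := lift_Dmx Ph Pe eP.
have HE : liftH v = PiE E *m (1%:M + Dmx (etaE E - (etaE E) ^t*)) by rewrite /liftH nE.
have Hh := lift_H_herm Ph PD Dh HE.
have Nh : (liftN F v) ^t* = liftN F v := herm_conj F Hh.
have [Sh SS Nu] := lift_sqrt dv Nh.
have iP : idem m (PiE E) by split.
have HL := lift_level iP Ph eP PD Dh DD HE (erefl (liftN F v)) Sh SS Nu.
have HQ := lift_Qp iP Pe PD Du HE (erefl (liftN F v)) SS Nu.
have HI := lift_im iP PD Du HE (erefl (liftN F v)) SS Nu.
have QE : liftQ F v = liftH v *m F *m invmx (sqrtmx (liftN F v)) by rewrite /liftQ (herm_id Nh).
have PE : liftP F v = invmx (sqrtmx (liftN F v)) *m F ^t* *m etaE E.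
  by rewrite /liftP (herm_id Nh) nE.
have l0 : level_eqs (liftQ F v) (liftP F v) by rewrite QE PE; exact: HL.
have lv := (levelP (liftQ F v, liftP F v)).2 l0.
have e1 : im (liftQ F v) = im (PiE E) by rewrite QE; exact: HI.
have e2 : liftQ F v *m liftP F v = etaE E by rewrite QE PE; exact: HQ.
split; first exact: lv.
apply: (etrans (toOrb_PhiInv lv)); apply: (etrans (congr1 (@PhiInv R n) (congr2 pair e1 e2))).
by rewrite -(Phi_scale hE.1); exact: PhiK hE.1.
Qed.

Lemma level_lift (x : M) : Orb m n x -> exists2 a, level a & toOrb a = x /\
  forall c, curve_through (Orb m n) reim x c -> exists2 c', curve_through level embQP a c' &
    \forall u \near (0 : 'rV[R]_1), toOrb (c' u) = c u.
Proof.
move=> /OrbP [E -> hE].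
have [PP _ _ _ dP] := (TGrP _ _).1 (Phi_TGr hE).
rewrite (orthoproj_Phi hE.1) in PP dP; have iP : idem m (PiE E) by split.
have [F [FF PF]] := gram_frame iP.
have d0 := lift_dom_base hE FF PF; have [la ta] := lift_point hE d0.
pose L (y : M) : QP := (liftQ F (reim y), liftP F (reim y)).
exists (L (i *: E)) => //; split=> // c [[U [[oU U0] sU US]] c0].
(* The curve is controlled only on U, so the preimage of [lift_dom] need not be open; its interior
   is taken. *)
pose U1 := [set u | U u] `&` interior [set u | lift_dom F (reim (c u))].
have oU1 : open U1 by apply: openI => //; apply: open_interior.
have U10 : U1 0.
  have d1 : lift_dom F (reim (c 0)) by rewrite c0; exact: d0.
  split; first exact: U0.
  exact: (near_preim (Ck_cont (sU 0%N) U0) (@open_lift_dom F) d1).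
have LE u : U1 u -> level (L (c u)) /\ toOrb (L (c u)) = c u.
  move=> [Uu du']; have du := interior_subset du'; have /OrbP [G GE hG] := US u Uu.
  by move: du; rewrite /= GE => du; exact: lift_point hG du.
exists (L \o c); last by apply: filterS (open_near oU1 U10) => u /LE [].
split; last by rewrite /= c0.
have [sQ sP] := csmooth_liftQ F; have oW := @open_lift_dom F.
have sU1 : smooth_on U1 (reim \o c) by apply: smooth_on_sub sU => u [].
have sL : smooth (lift_dom F) (fun v => (reim (liftQ F v), reim (liftP F v))).
  by move=> k; exact: (Sm_pair oW (sQ k) (sP k)).
have sub u : U1 u -> lift_dom F ((reim \o c) u).
  by move=> [_ du']; exact: (interior_subset du').
exists U1; split; [exact: (conj oU1 U10)|exact: (smooth_on_comp oU1 oW sub sL sU1)|].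
by move=> u /LE [].
Qed.

End Lift.

(** * The unitary action and horizontal lifts *)

Section Horizontal.
Context {R : realType} {m n : nat}.
Local Notation C := R[i].
Local Notation i := ('i%C : C).
Local Notation rmx := (@Defs.rmx R).
Local Notation rcovect := (@Defs.rcovect R).
Local Notation QP := (@Defs.QP R m n).
Local Notation level := (@Defs.level R m n).
Local Notation toOrb := (@Defs.toOrb R m n).
Local Notation toTGr := (@Defs.toTGr R m n).

Definition act (h : 'M[C]_m) (a : QP) : QP := (a.1 *m h ^t*, h *m a.2).

Section Action.
Variables (h : 'M[C]_m) (a : QP).
Hypothesis hh : h ^t* *m h = 1%:M.

Lemma act_level : level a -> level (act h a).
Proof.
move=> /levelP [e1 e2]; apply/levelP; split; rewrite /act /=.
  rewrite !trCM trCK -mulmxA (mulmxA (a.1 ^t*)) e1 !(mulmxDl, mulmxDr) mul1mx (mulmx1C hh).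
  by rewrite !mulmxA.
by rewrite -mulmxA (mulmxA a.2) e2 mul0mx mulmx0.
Qed.

Lemma act_toOrb : toOrb (act h a) = toOrb a.
Proof.
rewrite !toOrbE /act /=; congr (_ *: (_ *: _)).
rewrite !trCM trCK -mulmxBl -mulmxDr -mulmxA (mulmxA (h ^t*)) hh.
by rewrite mul1mx.
Qed.

Lemma act_toTGr : toTGr (act h a) = toTGr a.
Proof.
rewrite /toTGr /act /=; congr pair; last by rewrite -mulmxA (mulmxA (h ^t*)) hh mul1mx.
apply/eqP; rewrite eqEsubv; apply/andP; split; apply/im_subP; first by exists (h ^t*).
by exists h; rewrite -mulmxA hh mulmx1.
Qed.

End Action.

(** A rational curve in U(m) that replaces the exponential; its velocity at 0 is 2 X. *)
Definition cayU (X : 'M[C]_m) (u : 'rV[R]_1) : 'M[C]_m :=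
  (1%:M + ofreim (u 0 0 *: reim X)) *m invmx (1%:M - ofreim (u 0 0 *: reim X)).

Lemma cayU_unitary X (u : 'rV[R]_1) : X ^t* = - X -> 1%:M - ofreim (u 0 0 *: reim X) \in unitmx ->
  (cayU X u) ^t* *m cayU X u = 1%:M.
Proof.
rewrite /cayU ofreimZ reimK => Xs; set Y := _ *: X.
have Ys : Y ^t* = - Y by rewrite trCZ Xs scalerN; congr (- (_ *: _)); exact: conjc_real.
move: Y Ys => Y Ys Yu.
have Yu' : 1%:M + Y \in unitmx.
  have : (1%:M - Y) ^t* \in unitmx by rewrite map_unitmx unitmx_tr.
  by rewrite trCB trC1 Ys opprK.
have cm : (1%:M + Y) *m (1%:M - Y) = (1%:M - Y) *m (1%:M + Y).
  by rewrite !(mulmxDl, mulmxDr, mulmxN, mulNmx, mulmx1, mul1mx); mx_ring.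
have -> : ((1%:M + Y) *m invmx (1%:M - Y)) ^t* = invmx (1%:M + Y) *m (1%:M - Y).
  rewrite trCM trCD trC1 Ys; congr (_ *m _).
  by rewrite trmx_inv map_invmx trCB trC1 Ys opprK.
by rewrite mulmxA -(mulmxA (invmx (1%:M + Y))) -cm mulKmx // mulmxV.
Qed.

Definition lin1 (A : rmx m m) (u : 'rV[R]_1) : rmx m m := u 0 0 *: A.

Lemma lin1_linear A : linear (lin1 A).
Proof. by move=> a u v; rewrite /lin1 !mxE scalerDl scalerA. Qed.

Lemma cderive_lin1 A u v : cderive u v (fun x => ofreim (lin1 A x)) (ofreim (lin1 A v)).
Proof.
apply: cderive_ofreim.
exact: (@is_derive_linear R _ _ _ _ id u v v (findim_mx 1 1) (@lin1_linear A) (is_derive_id u v)).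
Qed.

Definition cayU_dom X : set 'rV[R]_1 := [set u | 1%:M - ofreim (lin1 (reim X) u) \in unitmx].

Lemma csmooth_lin1 A U : csmooth U (fun u => ofreim (lin1 A u)).
Proof. by apply: csmooth_lin; apply: smooth_linear; [exact: findim_mx|exact: lin1_linear]. Qed.

Lemma open_cayU_dom X : open (cayU_dom X).
Proof.
by apply: open_unit_preim; exact: (csmoothB (@openT _) (csmooth_cst _ 1%:M) (csmooth_lin1 _ _)).
Qed.

Lemma lin1_0 A : ofreim (lin1 A 0) = 0.
Proof. by rewrite /lin1 mxE scale0r ofreim0. Qed.

Lemma cayU_dom0 X : cayU_dom X 0.
Proof. by rewrite /cayU_dom /= lin1_0 subr0 unitmx1. Qed.

Lemma cayU_0 X : cayU X 0 = 1%:M.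
Proof. by rewrite /cayU -/(lin1 (reim X) 0) lin1_0 addr0 subr0 invmx1 mulmx1. Qed.

Lemma csmooth_cayU X : csmooth (cayU_dom X) (cayU X).
Proof.
have oD := @open_cayU_dom X; have s1 := csmooth_cst (cayU_dom X) (1%:M : 'M[C]_m).
have sY := csmooth_lin1 (reim X) (cayU_dom X).
exact: (csmoothM oD (csmoothD oD s1 sY) (csmooth_inv oD (fun x hx => hx) (csmoothB oD s1 sY))).
Qed.

Lemma cderive_cayU X : cderive 0 (dirv 0) (cayU X) (X + X).
Proof.
have oD := @open_cayU_dom X; have D0 := cayU_dom0 X.
have [c1 dc] := smooth_smooth_on oD (csmooth_cayU X) 1%N.
have [d1 _] := dc (dirv 0).
have dh : cderive 0 (dirv 0) (cayU X) (ofreim ('D_(dirv 0) (fun x => reim (cayU X x) : rmx m m) 0)).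
  by rewrite /cderive ofreimK; apply: derivableP; exact: d1.
move: (ofreim _) dh => D dh.
have dY : cderive 0 (dirv 0) (fun u => ofreim (lin1 (reim X) u)) X.
  by apply: cderive_eq (cderive_lin1 _ _ _) _; rewrite /lin1 mxE eqxx scale1r reimK.
have k1 := cderive_cst (0 : 'rV[R]_1) (dirv 0) (1%:M : 'M[C]_m).
have nr : \forall u \near (0 : 'rV[R]_1),
    cayU X u *m (1%:M - ofreim (lin1 (reim X) u)) = 1%:M + ofreim (lin1 (reim X) u).
  by apply: filterS (open_near oD D0) => u Du; exact: mulmxKV Du _.
have e := cderive_unique (cderive_near nr (cderiveM dh (cderiveB k1 dY))) (cderiveD k1 dY).
rewrite cayU_0 lin1_0 subr0 mulmx1 mul1mx sub0r add0r in e.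
by apply: cderive_eq dh _; rewrite -{2}e addNKr.
Qed.

End Horizontal.

Lemma addr_regroup (V : zmodType) (x y z t : V) : x - y + (- z + t) = x + t - (y + z).
Proof. by rewrite opprD [- z + t]addrC addrACA. Qed.

Lemma subr_swap (V : zmodType) (g x b c : V) : g + x = b - c -> b - g = c + x.
Proof. by move=> e; apply/eqP; rewrite subr_eq -addrA [x + g]addrC e addrC subrK. Qed.

Section HorizontalLift.
Context {R : realType} {m n : nat}.
Local Notation C := R[i].
Local Notation i := ('i%C : C).
Local Notation rmx := (@Defs.rmx R).
Local Notation rcovect := (@Defs.rcovect R).
Local Notation QP := (@Defs.QP R m n).
Local Notation level := (@Defs.level R m n).
Local Notation toOrb := (@Defs.toOrb R m n).
Local Notation toTGr := (@Defs.toTGr R m n).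
Implicit Types V W X : normedModType R.

Lemma Re_tr_skew k (X W : 'M[C]_k) : X ^t* = - X -> W ^t* = W -> complex.Re (\tr (X *m W)) = 0.
Proof.
move=> Xs Wh; have : \tr (X *m W) = - ((\tr (X *m W))^*)%C.
  by rewrite -mxtraceC trCM Xs Wh mulmxN raddfN /= opprK mxtrace_mulC.
move: (\tr _) => [a c] [] aE _ /=; lra.
Qed.

(** The pairing of b with the vertical vector of X is Re tr (X W) with W = Q^* q + P p^*, and a
    skew-Hermitian X is orthogonal to every Hermitian W. *)
Lemma horizontal_cond (a b : QP) : a.1 ^t* *m b.1 + a.2 *m b.2 ^t* = (a.1 ^t* *m b.1 + a.2 *m b.2 ^t*) ^t* ->
  forall X : 'M[C]_m, X ^t* = - X -> hmetric (toH b) (toH (vertical a X)) = 0.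
Proof.
move=> Wh X Xs; rewrite hmetricE /= trCK trCM trCN Xs mulNmx !mulmxN !opprK.
rewrite -[RHS](Re_tr_skew Xs (esym Wh)) mulmxDr raddfD /= ReD; congr (complex.Re _ + complex.Re _).
  by rewrite mxtrace_mulC -mulmxA.
by rewrite mxtrace_mulC -mulmxA.
Qed.

(** The Sylvester operator of G is invertible. X + X^* solves the homogeneous equation, so the
    solution is skew-Hermitian. *)
Lemma skew_sylvester (G W : 'M[C]_m) : pdef (1 + 1) G -> W ^t* = - W ->
  exists2 X : 'M[C]_m, X ^t* = - X & G *m X + X *m G = W.
Proof.
move=> pG Ws.
have two : (1 + 1 : C) = (1 + 1 : R)%:C%C by rewrite rmorphD.
have pG' := pG; rewrite two in pG'.
have u := sylv_unit (addr_gt0 ltr01 ltr01) pG' (pdef_psd (ltW (addr_gt0 ltr01 ltr01)) pG).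
have e := sylv_invK W u; move: (sylv_inv G G W) e => X e.
exists X => //; have Gh := pG.1.
have e' := congr1 (fun Y : 'M[C]_m => Y ^t*) e.
rewrite trCD !trCM Gh Ws -e in e'.
apply/eqP; rewrite -addr_eq0; apply/eqP.
apply: (sylvester_inj (addr_gt0 ltr01 ltr01) pG (pdef_psd (ltW (addr_gt0 ltr01 ltr01)) pG)).
rewrite mulmxDr mulmxDl addrACA [G *m X ^t* + _]addrC e' addNr //.
Qed.

Lemma smooth_21 V W X : smooth setT (fun p : (V * (W * X))%type => p.2.1).
Proof.
have oT := @openT (V * (W * X))%type; have oT' := @openT (W * X)%type.
move=> k; exact: (Sm_comp oT oT' (fun x _ => I) (Sm_fst k setT) (Sm_snd k setT)).
Qed.

Lemma smooth_22 V W X : smooth setT (fun p : (V * (W * X))%type => p.2.2).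
Proof.
have oT := @openT (V * (W * X))%type; have oT' := @openT (W * X)%type.
move=> k; exact: (Sm_comp oT oT' (fun x _ => I) (Sm_snd k setT) (Sm_snd k setT)).
Qed.

Lemma smooth_act (X : 'M[C]_m) :
  smooth [set p : ('rV[R]_1 * (rmx n m * rmx m n))%type | cayU_dom X p.1]
    (fun p => (reim (ofreim p.2.1 *m (cayU X p.1) ^t*), reim (cayU X p.1 *m ofreim p.2.2))).
Proof.
set D := [set p | _].
have oD : open D := open_fst (@open_cayU_dom R m X).
have sf : smooth D (fun p : ('rV[R]_1 * (rmx n m * rmx m n))%type => p.1) by move=> k; apply: Sm_fst.
have sh := csmooth_comp oD (@open_cayU_dom R m X) (fun x hx => hx) (csmooth_cayU X) sf.
have s1 := csmooth_sub (@subsetT _ D) (csmooth_lin (smooth_21 'rV[R]_1 (rmx n m) (rmx m n))).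
have s2 := csmooth_sub (@subsetT _ D) (csmooth_lin (smooth_22 'rV[R]_1 (rmx n m) (rmx m n))).
by move=> k; exact: (Sm_pair oD (csmoothM oD s1 (csmooth_trC oD sh) k) (csmoothM oD sh s2 k)).
Qed.

(** Moving along the unitary group with velocity X changes B into B - G X. This is Hermitian exactly
    when G X + X G = B - B^*, an equation with a skew-Hermitian solution. *)
Lemma horizontal_exists a c b0 : level a -> curve_through level embQP a c ->
  velocity embQP c = embQP b0 -> exists b c', [/\ curve_through level embQP a c',
    velocity embQP c' = embQP b,
    \forall u \near (0 : 'rV[R]_1), exists2 h, h ^t* *m h = 1%:M & c' u = act h (c u) &
    forall X : 'M[C]_m, X ^t* = - X -> hmetric (toH b) (toH (vertical a X)) = 0].
Proof.
move=> /levelP la [[U [[oU U0] sU US]] c0] cb.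
pose G := a.1 ^t* *m a.1 + a.2 *m a.2 ^t*.
have pG : pdef (1 + 1) G.
  have := pdefD (level_pdef la) (psd_pdef (psd_gram (a.2 ^t*))).
  by rewrite trCK addr0.
pose B := a.1 ^t* *m b0.1 + a.2 *m b0.2 ^t*.
have [X Xs GX] : exists2 X : 'M[C]_m, X ^t* = - X & G *m X + X *m G = B - B ^t*.
  by apply: skew_sylvester pG _; rewrite trCB trCK opprB.
(* Halved because the Cayley curve has velocity twice its parameter. *)
pose Y := 2^-1 *: X.
have Ys : Y ^t* = - Y by rewrite /Y trCZ half_real Xs scalerN.
have YY : Y + Y = X by rewrite /Y -scalerDr half_twice.
pose b : QP := (b0.1 + a.1 *m X ^t*, X *m a.2 + b0.2).
pose c' u := act (cayU Y u) (c u).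
have oD := @open_cayU_dom R m Y; have D0 := cayU_dom0 (R := R) Y.
pose U1 := U `&` cayU_dom Y.
have oU1 : open U1 by exact: openI.
exists b, c'; split.
- split; last by rewrite /c' cayU_0 c0 /act trC1 mulmx1 mul1mx; case: (a).
  exists U1; split; first by split=> //; split.
    have sU1 : smooth_on U1 (embQP \o c) by apply: smooth_on_sub sU => u [].
    have sp : smooth_on U1 (fun u => (u, (embQP \o c) u)).
      move=> k; apply: (Ck_pair oU1 _ (sU1 k)); apply: (Sm_Ck oU1); apply: Sm_lin => // z.
      exact: cvg_id.
    have oF := open_fst (F := (rmx n m * rmx m n)%type) oD.
    have sub u : U1 u -> [set p : ('rV[R]_1 * (rmx n m * rmx m n))%type | cayU_dom Y p.1] (u, (embQP \o c) u).
      by move=> [].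
    have H := smooth_on_comp oU1 oF sub (smooth_act Y) sp.
    by move=> k; apply: Ck_ext (H k) => // u _; rewrite /= !reimK.
  move=> u [Uu Du]; apply: act_level; last exact: US.
  exact: cayU_unitary Ys Du.
- have dc := is_derive_pd 0 sU U0; rewrite -/(velocity embQP c) cb in dc.
  have fnm := findim_rmx (R := R) n m; have fmn := findim_rmx (R := R) m n.
  have d1 : cderive 0 (dirv 0) (fun u => (c u).1) b0.1 := is_derive_pr1 fnm fmn dc.
  have d2 : cderive 0 (dirv 0) (fun u => (c u).2) b0.2 := is_derive_pr2 fnm fmn dc.
  have dh := cderive_cayU Y; rewrite YY in dh.
  have e1 := cderiveM d1 (cderive_trC dh); have e2 := cderiveM dh d2.
  rewrite cayU_0 trC1 c0 mulmx1 [_ + b0.1]addrC in e1.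
  rewrite cayU_0 c0 mul1mx [b0.2 + _]addrC in e2.
  by have [_ ] := is_derive_pair e1 e2.
- apply: filterS (open_near oU1 (conj U0 D0)) => u [Uu Du].
  by exists (cayU Y u) => //; exact: cayU_unitary Ys Du.
apply: horizontal_cond; rewrite /b /=.
have -> : a.1 ^t* *m (b0.1 + a.1 *m X ^t*) + a.2 *m (X *m a.2 + b0.2) ^t* = B - G *m X.
  rewrite trCD trCM Xs !(mulmxDr, mulmxN, mulNmx) !mulmxA /B /G mulmxDl.
  exact: addr_regroup.
have Gh : G ^t* = G by case: pG.
rewrite trCB trCM Gh Xs mulNmx opprK.
exact: subr_swap GX.
Qed.

End HorizontalLift.

(** * Comparison of the forms on the orbit and on the cotangent bundle *)

Section Comparison.
Context {R : realType} {m n : nat}.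
Local Notation C := R[i].
Local Notation i := ('i%C : C).
Local Notation M := 'M[C]_n.
Local Notation rmx := (@Defs.rmx R).
Local Notation rcovect := (@Defs.rcovect R).
Local Notation QP := (@Defs.QP R m n).
Local Notation level := (@Defs.level R m n).
Local Notation toOrb := (@Defs.toOrb R m n).
Local Notation toTGr := (@Defs.toTGr R m n).
Local Notation Orb := (@Defs.Orb R m n).
Local Notation TGr := (@Defs.TGr R m n).
Local Notation Phi := (@Defs.Phi R n).

Definition GOrb (w : (rmx n m * rmx m n)%type) : rmx n n :=
  reim (i *: (2^-1 *: ((ofreim w.1 - (ofreim w.2) ^t*) *m ((ofreim w.1) ^t* + ofreim w.2)))).

Lemma smooth_GOrb : smooth setT GOrb.
Proof.
have oT := @openT (rmx n m * rmx m n)%type.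
have s1 := csmooth_lin (smooth_fst (rmx n m) (rmx m n)).
have s2 := csmooth_lin (smooth_snd (rmx n m) (rmx m n)).
exact: (csmoothZ i oT (csmoothZ 2^-1 oT
  (csmoothM oT (csmoothB oT s1 (csmooth_trC oT s2)) (csmoothD oT (csmooth_trC oT s1) s2)))).
Qed.

Lemma GOrb_reim (a : QP) : reim (toOrb a) = GOrb (embQP a).
Proof. by rewrite /GOrb /embQP /= (reimK a.1) (reimK a.2) toOrbE. Qed.

Lemma toOrb_curve a c : curve_through level embQP a c -> curve_through Orb reim (toOrb a) (toOrb \o c).
Proof. exact: (push_curve (@toOrb_Orb R m n) smooth_GOrb (fun a _ => GOrb_reim a)). Qed.

Lemma Orb_TGr x : Orb x -> TGr (Phi x).
Proof. by move=> /OrbP [E -> hE]; exact: Phi_TGr hE. Qed.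

Lemma Phi_curve x c : curve_through Orb reim x c -> curve_through TGr embT (Phi x) (Phi \o c).
Proof. exact: (push_curve Orb_TGr smooth_GPhi (@GPhi_embT R n m)). Qed.

Lemma Phi_velocity x c : curve_through Orb reim x c ->
  velocity embT (Phi \o c) = 'd (@GPhi R n) (reim x) (velocity reim c).
Proof. exact: (push_velocity smooth_GPhi (@GPhi_embT R n m)). Qed.

Lemma curve_near X (E : normedModType R) (S : set X) (e : X -> E) x c :
  curve_through S e x c -> \forall u \near (0 : 'rV[R]_1), S (c u).
Proof. by move=> [[U [[oU U0] _ US]] _]; apply: filterS (open_near oU U0). Qed.

Lemma toTGr_velocity a c : curve_through level embQP a c ->
  velocity embT (toTGr \o c) = velocity embT (Phi \o (toOrb \o c)).
Proof.
move=> cc; apply: velocity_near; apply: filterS (curve_near cc) => u lu.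
exact: (esym (Phi_toOrb lu)).
Qed.

(** Stated for an arbitrary horizontal lift, with both velocities expressed through v: this gives
    independence from the lift. *)
Lemma hl_Orb a v b : level a -> horizontal_lift toOrb reim a v b ->
  exists Pi', level_tangent a b v ('d (@GPhi R n) (reim (toOrb a)) v) Pi'.
Proof.
move=> la [[c [cc cb cv]] _]; have [Pi' t] := level_curve_tangent cc cb.
have co := toOrb_curve cc.
by exists Pi'; move: t; rewrite (toTGr_velocity cc) (Phi_velocity co) cv.
Qed.

Lemma hl_TGr a v b : level a -> horizontal_lift toTGr embT a v b ->
  exists Pi', level_tangent a b ('d (@GPhiInv R n) (embT (toTGr a)) v) v Pi'.
Proof.
move=> la [[c [cc cb cv]] _]; have [Pi' t] := level_curve_tangent cc cb.
have co := toOrb_curve cc; have ct := Phi_curve co; rewrite (Phi_toOrb la) in ct.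
have vI := push_velocity (@smooth_GPhiInv R n) (fun z (_ : TGr z) => GPhiInv_reim z) ct.
rewrite -(toTGr_velocity cc) cv in vI.
have vO : velocity reim (@PhiInv R n \o (Phi \o (toOrb \o c))) = velocity reim (toOrb \o c).
  apply: velocity_near; apply: filterS (curve_near co) => u ou; exact: Orb_PhiK ou.
by exists Pi'; move: t; rewrite cv -vO vI.
Qed.

(** One lift serves both quotient maps, since both are invariant under the unitary action and differ
    by [Phi]. *)
Lemma lift_data x : Orb x -> exists a, [/\ level a, toOrb a = x &
  forall c, curve_through Orb reim x c -> exists b Pi',
    [/\ level_tangent a b (velocity reim c) (velocity embT (Phi \o c)) Pi',
        horizontal_lift toOrb reim a (velocity reim c) b &
        horizontal_lift toTGr embT a (velocity embT (Phi \o c)) b]].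
Proof.
move=> /level_lift [a la [ta H]]; exists a; split=> // c cc.
have [c1 cc1 e1] := H c cc.
pose v := velocity embQP c1; pose b0 : QP := (ofreim v.1, ofreim v.2).
have vb : velocity embQP c1 = embQP b0.
  by rewrite /embQP /b0 /= (ofreimK v.1) (ofreimK v.2) /v; case: (velocity _ _).
have [b [c2 [cc2 cb nr hz]]] := horizontal_exists la cc1 vb.
have vO : velocity reim (toOrb \o c2) = velocity reim c.
  apply: velocity_near; apply: filterS (filterI e1 nr) => u [eu [h hh hu]].
  by rewrite /= hu (act_toOrb _ hh).
have vT : velocity embT (toTGr \o c2) = velocity embT (Phi \o c).
  apply: velocity_near; apply: filterS (filterI (filterI e1 nr) (curve_near cc1)) => u [[eu [h hh hu]] lu].
  by rewrite /= hu (act_toTGr _ hh) -(Phi_toOrb lu) eu.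
have [Pi' t] := level_curve_tangent cc2 cb; rewrite vO vT in t.
exists b, Pi'; split; first exact: t.
  exact: (conj (ex_intro _ c2 (And3 cc2 cb vO)) hz).
exact: (conj (ex_intro _ c2 (And3 cc2 cb vT)) hz).
Qed.

Section TwoCurves.
Variables (x : M) (c c' : 'rV[R]_1 -> M).
Hypotheses (cc : curve_through Orb reim x c) (cc' : curve_through Orb reim x c').

Let Ox : Orb x.
Proof. by case: cc => -[U [[_ U0] _ US]] <-; exact: US. Qed.

Lemma compare_Im :
  retr (- i) (x *m bracket (ofreim (velocity reim c)) (ofreim (velocity reim c'))) =
  - retr 1 (cot_form (velocity embT (Phi \o c)) (velocity embT (Phi \o c'))).
Proof.
have [a [la ta H]] := lift_data Ox.
have [b [P1 [t _ _]]] := H c cc; have [b' [P2 [t' _ _]]] := H c' cc'.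
by rewrite -(level_kks_im la t t') ta.
Qed.

(** The set from which [quotient_form] chooses is a singleton: [lift_data] provides an element, and
    [level_hk] evaluates every other choice to the same number. *)
Lemma compare_K : omega_K R m n x (velocity reim c) (velocity reim c') =
  - retr (- i) (cot_form (velocity embT (Phi \o c)) (velocity embT (Phi \o c'))).
Proof.
have [a [la ta H]] := lift_data Ox.
have [b [P1 [t h _]]] := H c cc; have [b' [P2 [t' h' _]]] := H c' cc'.
rewrite /omega_K /quotient_form; apply: xget_unique.
  by exists a, b, b'; split; [exact: la|exact: ta|exact: h|exact: h'|exact: (esym (level_hk t t'))].
move=> r [a1 [b1 [b2 [la1 ta1 h1 h2 ->]]]].
have [Q1 t1] := hl_Orb la1 h1; have [Q2 t2] := hl_Orb la1 h2.
have e1 := etrans (congr1 (fun y => 'd (@GPhi R n) (reim y) (velocity reim c)) ta1) (esym (Phi_velocity cc)).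
have e2 := etrans (congr1 (fun y => 'd (@GPhi R n) (reim y) (velocity reim c')) ta1) (esym (Phi_velocity cc')).
have e := congr1 (retr (- i)) (congr2 (fun v w : rcovect n => cot_form v w) e1 e2).
exact: (etrans (level_hk t1 t2) (congr1 (fun r : R => - r) e)).
Qed.

Lemma compare_C : omega_C R m n (Phi x) (velocity embT (Phi \o c)) (velocity embT (Phi \o c')) =
  retr 1 (x *m bracket (ofreim (velocity reim c)) (ofreim (velocity reim c'))).
Proof.
have [a [la ta H]] := lift_data Ox.
have [b [P1 [t _ h]]] := H c cc; have [b' [P2 [t' _ h']]] := H c' cc'.
have tg : toTGr a = Phi x by rewrite -(Phi_toOrb la) ta.
have vI d : curve_through Orb reim x d ->
    'd (@GPhiInv R n) (embT (Phi x)) (velocity embT (Phi \o d)) = velocity reim d.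
  move=> cd; have ct := Phi_curve cd.
  rewrite -(push_velocity (@smooth_GPhiInv R n) (fun z (_ : TGr z) => GPhiInv_reim z) ct).
  apply: velocity_near; apply: filterS (curve_near cd) => u ou; exact: Orb_PhiK ou.
rewrite /omega_C /quotient_form; apply: xget_unique.
  exists a, b, b'; split; [exact: la|exact: tg|exact: h|exact: h'|].
  by rewrite -(level_kks_re la t t') ta.
move=> r [a1 [b1 [b2 [la1 ta1 h1 h2 ->]]]].
have [Q1 t1] := hl_TGr la1 h1; have [Q2 t2] := hl_TGr la1 h2.
have x1 : toOrb a1 = x := etrans (toOrb_PhiInv la1) (etrans (congr1 (@PhiInv R n) ta1) (Orb_PhiK Ox)).
have e1 := etrans (congr1 (fun z => 'd (@GPhiInv R n) (embT z) (velocity embT (Phi \o c))) ta1) (vI _ cc).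
have e2 := etrans (congr1 (fun z => 'd (@GPhiInv R n) (embT z) (velocity embT (Phi \o c'))) ta1) (vI _ cc').
have key (X X' : M) (A A' B B' : rmx n n) : X = X' -> A = A' -> B = B' ->
    retr 1 (X *m bracket (ofreim A) (ofreim B)) = retr 1 (X' *m bracket (ofreim A') (ofreim B')).
  by move=> -> -> ->.
exact: (etrans (esym (level_kks_re la1 t1 t2)) (key _ _ _ _ _ _ x1 e1 e2)).
Qed.

End TwoCurves.
End Comparison.

(** * Assembly of the symplectomorphisms *)

Section Symplectic.
Context {R : realType} {n : nat}.
Local Notation C := R[i].
Local Notation i := ('i%C : C).
Local Notation M := 'M[C]_n.
Local Notation rmx := (@Defs.rmx R).
Local Notation rcovect := (@Defs.rcovect R).
Local Notation Phi := (@Defs.Phi R n).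
Variable m : nat.

Lemma curve_sub X (E : normedModType R) (S T : set X) (e : X -> E) x c :
  (forall y, S y -> T y) -> curve_through S e x c -> curve_through T e x c.
Proof.
move=> ST [[U [oU sU US]] c0]; split; last exact: c0.
by exists U; split; [exact: oU|exact: sU|move=> u /US /ST].
Qed.

Lemma curve_tangent X (E : normedModType R) (S : set X) (e : X -> E) x c :
  curve_through S e x c -> tangent S e x (velocity e c).
Proof. by move=> cc; exists c. Qed.

Lemma staraut_antisym (tau : M -> M) : staraut tau ->
  (forall A, tau (i *: A) = - (i *: tau A)) -> antisym false tau.
Proof.
by move=> ht ti; split; [exact: tauL ht|exact: ti|exact: tauM ht|exact: tau1 ht|exact: tauC ht|exact: tauK ht].
Qed.

Lemma staraut_antisym_trC (tau : M -> M) : staraut tau ->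
  (forall A, tau (i *: A) = i *: tau A) -> antisym true (fun A => (tau A) ^t*).
Proof.
move=> ht ti; split.
- by move=> k A B; rewrite (tauL ht) (rlinear_trC k).
- by move=> A; rewrite ti trCZ conji scaleNr.
- by move=> A B; rewrite (tauM ht) trCM.
- by rewrite (tau1 ht) trC1.
- by move=> A; rewrite (tauC ht).
- by move=> A; rewrite -(tauC ht) trCK (tauK ht).
Qed.

Lemma Im_Re_iN (z : C) : complex.Im z = complex.Re (- i * z).
Proof. by case: z => a c /=; ring. Qed.

Section Antilinear.
Variable tau : M -> M.
Hypotheses (ht : staraut tau) (ti : forall A, tau (i *: A) = - (i *: tau A)).

Let hs := staraut_antisym ht ti.
Let gF := Phi_gdiffeo_SF m ht.
Let gA := Phi_gdiffeo_SA m ht.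
Let gI := irot_gdiffeo m ht ti.

Lemma ImOmega_tan E u v : idem m E -> tau E = E -> tangD tau E u -> tangD tau E v ->
  ImOmegaKKS (i *: E) (reim (i *: u)) (reim (i *: v)) =
  retr (kappa false) ((i *: E) *m bracket (i *: u) (i *: v)).
Proof.
move=> hE _ [tu _] [tv _].
by rewrite /ImOmegaKKS (reimK (i *: u)) (reimK (i *: v)) (OmegaKKS_tan hE.1 tu tv) Im_Re_iN.
Qed.

Let sS := kks_symp hs ImOmega_tan.

Lemma Im_pres x c c' : SF m tau x ->
  curve_through (SF m tau) reim x c -> curve_through (SF m tau) reim x c' ->
  omega_can (TF m tau) (Phi x) (velocity embT (Phi \o c)) (velocity embT (Phi \o c')) =
  ImOmegaKKS x (velocity reim c) (velocity reim c').
Proof.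
move=> Sx cc cc'.
have co := curve_sub (@SF_Orb R n m tau) cc; have co' := curve_sub (@SF_Orb R n m tau) cc'.
have pc := push_curve (gd_fST gF) (gd_sG gF) (gd_fG gF).
have hT := has2fam_transport gF (sy_fam sS).
rewrite (omega_canE hT (gd_fST gF Sx) (curve_tangent (pc _ _ cc)) (curve_tangent (pc _ _ cc'))).
rewrite (kks_ambientE hs ImOmega_tan Sx (curve_tangent cc) (curve_tangent cc')).
by rewrite /kks_ambient (reimK x) -(compare_Im co co').
Qed.

Lemma fixed_symplectomorphism :
  symplectomorphism (SF m tau) reim ImOmegaKKS (TF m tau) embT (omega_can (TF m tau)) Phi.
Proof. exact: (symp_symplectomorphism gF Im_pres sS). Qed.

Let sT := symp_transport gF Im_pres sS.

Lemma irot_velocity z c : curve_through (TF m tau) embT z c ->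
  velocity embT (irot i \o c) = Girot i (velocity embT c).
Proof.
move=> [[U [[oU U0] sU US]] _].
have l : linear (Girot (R := R) (n := n) i).
  move=> k u v; rewrite /Girot /=; congr (_, _).
  by rewrite (ofreim_linear k u.2 v.2) scalerDr scalerA mulrC -scalerA (reim_linear k).
have [_ e2] := is_derive_linear (findim_rcovect n) l (is_derive_pd 0 sU U0).
have e : embT \o (irot i \o c) = Girot i \o (embT \o c) by apply/funext => u; exact: irot_embT.
exact: (etrans (congr1 (fun g : 'rV[R]_1 -> rcovect n => 'D_(dirv 0) g 0) e) e2).
Qed.

Lemma cot_form_irot (v w : rcovect n) : cot_form (Girot i v) (Girot i w) = i *: cot_form v w.
Proof.
have e (u : rcovect n) : ofreim (Girot i u).2 = i *: ofreim u.2 by exact: reimK.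
have k (A B X Y : M) : (i *: A) *m B - (i *: X) *m Y = i *: (A *m B - X *m Y).
  by rewrite -!scalemxAl scalerBr.
apply: (etrans (congr2 (fun A B : M => A *m ofreim w.1 - B *m ofreim v.1) (e v) (e w))).
exact: k.
Qed.

Lemma retr_iN_i (A : M) : retr (- i) (i *: A) = retr 1 A.
Proof. by rewrite /retr mxtraceZ mulrA mulNr mulii opprK. Qed.

Let hTA := has2fam_transport gI (sy_fam sT).

(** Rotation multiplies [cot_form] by i, which the factor - i of the imaginary one-form undoes. *)
Lemma irot_pres z c c' : TF m tau z ->
  curve_through (TF m tau) embT z c -> curve_through (TF m tau) embT z c' ->
  omega_can_imag (TA m tau) (irot i z) (velocity embT (irot i \o c)) (velocity embT (irot i \o c')) =
  omega_can (TF m tau) z (velocity embT c) (velocity embT c').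
Proof.
move=> Tz cc cc'.
have pc := push_curve (gd_fST gI) (gd_sG gI) (gd_fG gI).
rewrite (omega_can_imagE hTA (gd_fST gI Tz) (curve_tangent (pc _ _ cc)) (curve_tangent (pc _ _ cc'))).
rewrite (omega_canE (sy_fam sT) Tz (curve_tangent cc) (curve_tangent cc')).
by rewrite (irot_velocity cc) (irot_velocity cc') cot_form_irot retr_iN_i.
Qed.

Let sTA := symp_transport gI irot_pres sT.

Lemma K_pres x c c' : SA m tau x ->
  curve_through (SA m tau) reim x c -> curve_through (SA m tau) reim x c' ->
  omega_can_imag (TA m tau) (Phi x) (velocity embT (Phi \o c)) (velocity embT (Phi \o c')) =
  omega_K R m n x (velocity reim c) (velocity reim c').
Proof.
move=> Sx cc cc'.
have co := curve_sub (@SA_Orb R n m tau) cc; have co' := curve_sub (@SA_Orb R n m tau) cc'.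
have pc := push_curve (gd_fST gA) (gd_sG gA) (gd_fG gA).
rewrite (omega_can_imagE hTA (gd_fST gA Sx) (curve_tangent (pc _ _ cc)) (curve_tangent (pc _ _ cc'))).
exact: (esym (compare_K co co')).
Qed.

(** The symplectic structure on the orbit side is obtained from the cotangent side, so preservation
    is also needed for the inverse map. *)
Lemma K_pres_inv z c c' : TA m tau z ->
  curve_through (TA m tau) embT z c -> curve_through (TA m tau) embT z c' ->
  omega_K R m n (PhiInv z) (velocity reim (@PhiInv R n \o c)) (velocity reim (@PhiInv R n \o c')) =
  omega_can_imag (TA m tau) z (velocity embT c) (velocity embT c').
Proof.
move=> Tz cc cc'; have gB := gdiffeo_sym gA.
have pc := push_curve (gd_fST gB) (gd_sG gB) (gd_fG gB).
have back d : curve_through (TA m tau) embT z d ->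
    velocity embT (Phi \o (@PhiInv R n \o d)) = velocity embT d.
  move=> cd; apply: velocity_near; apply: filterS (curve_near cd) => u du; exact: gd_fg gA _ du.
have H := K_pres (gd_gTS gA Tz) (pc _ _ cc) (pc _ _ cc').
have key z1 z2 (v1 v2 w1 w2 : rcovect n) : z1 = z2 -> v1 = v2 -> w1 = w2 ->
    omega_can_imag (TA m tau) z1 v1 w1 = omega_can_imag (TA m tau) z2 v2 w2 by move=> -> -> ->.
exact: (etrans (esym H) (key _ _ _ _ _ _ (gd_fg gA Tz) (back _ cc) (back _ cc'))).
Qed.

Lemma anti_symplectomorphism :
  symplectomorphism (SA m tau) reim (omega_K R m n) (TA m tau) embT (omega_can_imag (TA m tau)) Phi.
Proof.
exact: (symp_symplectomorphism gA K_pres (symp_transport (gdiffeo_sym gA) K_pres_inv sTA)).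
Qed.

End Antilinear.

Section Linear.
Variable tau : M -> M.
Hypotheses (ht : staraut tau) (ti : forall A, tau (i *: A) = i *: tau A).

Let hs := staraut_antisym_trC ht ti.
Let gA := Phi_gdiffeo_SA m ht.
Local Notation sg := (fun A => (tau A) ^t*).

(** The condition tau E = E^* means that E is fixed by tau followed by the adjoint, an antilinear
    involution reversing products. *)
Lemma SA_Dsym : SA m tau = Dsym m sg.
Proof.
apply/seteqP; split=> x [E -> [hE tE]]; exists E => //; split=> //.
  by rewrite tE trCK.
by rewrite -{2}tE trCK.
Qed.

Lemma ReOmega_tan E u v : idem m E -> sg E = E -> tangD sg E u -> tangD sg E v ->
  ReOmegaKKS (i *: E) (reim (i *: u)) (reim (i *: v)) =
  retr (kappa true) ((i *: E) *m bracket (i *: u) (i *: v)).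
Proof.
move=> hE _ [tu _] [tv _].
by rewrite /ReOmegaKKS (reimK (i *: u)) (reimK (i *: v)) (OmegaKKS_tan hE.1 tu tv) /retr mul1r.
Qed.

Let sS := kks_symp hs ReOmega_tan.

Lemma Re_pres x c c' : SA m tau x ->
  curve_through (SA m tau) reim x c -> curve_through (SA m tau) reim x c' ->
  omega_C R m n (Phi x) (velocity embT (Phi \o c)) (velocity embT (Phi \o c')) =
  ReOmegaKKS x (velocity reim c) (velocity reim c').
Proof.
move=> Sx cc cc'.
have co := curve_sub (@SA_Orb R n m tau) cc; have co' := curve_sub (@SA_Orb R n m tau) cc'.
apply: (etrans (compare_C co co')).
rewrite SA_Dsym in Sx cc cc'.
rewrite (kks_ambientE hs ReOmega_tan Sx (curve_tangent cc) (curve_tangent cc')).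
by rewrite /kks_ambient (reimK x).
Qed.

Lemma unitary_symplectomorphism :
  symplectomorphism (SA m tau) reim ReOmegaKKS (TA m tau) embT (omega_C R m n) Phi.
Proof.
have sA : symp (SA m tau) reim ReOmegaKKS by rewrite SA_Dsym; exact: sS.
exact: (symp_symplectomorphism gA Re_pres sA).
Qed.

End Linear.

Lemma conjmx_i (A : M) : conjmx (i *: A) = - (i *: conjmx A).
Proof. by rewrite conjmxZ conji scaleNr. Qed.

Lemma tauJ_i J (A : M) : tauJ J (i *: A) = - (i *: tauJ J A).
Proof. by rewrite /tauJ conjmx_i mulmxN mulNmx -scalemxAr -scalemxAl scalerN. Qed.

Lemma tauT_i Theta (A : M) : tauT Theta (i *: A) = i *: tauT Theta A.
Proof. by rewrite /tauT -scalemxAr -scalemxAl. Qed.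

End Symplectic.

Theorem corollary4p12 (R : realType) (m n : nat) (hm : (1 <= m)%N)
    (hmn : (m <= n)%N) (Theta : 'M[R]_n) (hThetaT : Theta^T = Theta)
    (hTheta2 : Theta *m Theta = 1%:M) :
  [/\ symplectomorphism (D_R R m n) reim ImOmegaKKS
        (TGr_R R m n) embT (omega_can (TGr_R R m n)) Phi,
      symplectomorphism (D_C_ortho R m n) reim (omega_K R m n)
        (iTGr_R R m n) embT (omega_can_imag (iTGr_R R m n)) Phi,
      symplectomorphism (D_C_unit m n Theta) reim ReOmegaKKS
        (X_Theta m n Theta) embT (omega_C R m n) Phi &
      (~~ odd m -> ~~ odd n -> forall J : 'M[R]_n,
        J^T = - J -> J *m J = - 1%:M ->
        symplectomorphism (D_H m n J) reim ImOmegaKKS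
          (TGr_H m n J) embT (omega_can (TGr_H m n J)) Phi /\
        symplectomorphism (D_C_symp m n J) reim (omega_K R m n)
          (iTGr_H m n J) embT (omega_can_imag (iTGr_H m n J)) Phi)].
Proof.
split.
- rewrite D_RE TGr_RE.
  exact: (fixed_symplectomorphism m (staraut_conj (R := R) (n := n)) (@conjmx_i R n)).
- rewrite D_C_orthoE iTGr_RE.
  exact: (anti_symplectomorphism m (staraut_conj (R := R) (n := n)) (@conjmx_i R n)).
- rewrite (D_C_unitE m hThetaT hTheta2) (X_ThetaE hThetaT hTheta2 m).
  exact: (unitary_symplectomorphism m (staraut_T hThetaT hTheta2) (tauT_i Theta)).
move=> _ _ J JT JJ; split.
- rewrite (D_HE m JT JJ) (TGr_HE m JT JJ).
  exact: (fixed_symplectomorphism m (staraut_J JT JJ) (tauJ_i J)).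
rewrite (D_C_sympE m JT JJ) (iTGr_HE m JT JJ).
exact: (anti_symplectomorphism m (staraut_J JT JJ) (tauJ_i J)).
Qed.
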